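(* Let $g$ be a $C^2$ Riemannian metric on $\overline{D}_1$ and let $\bar u\in C^1(\overline{D}_1,\mathbb{R}^3)$ be a short immersion of $(\overline{D}_1,g)$. For every $\delta\in(0,\tfrac15)$ and every $\varepsilon>0$ there is an isometric immersion $u\in C^{1,\frac15-\delta}(\overline{D}_1,\mathbb{R}^3)$ of $(\overline{D}_1,g)$ into $\mathbb{R}^3$ such that $\|\bar u-u\|_{C^0}<\varepsilon$. If in addition $\bar u$ is an embedding, then $u$ can be chosen to be an embedding.
   Context: $\overline{D}_1\subset\mathbb{R}^2$ denotes the closed disk of radius $1$ centered at $0$. A $C^1$ immersion $u:\overline{D}_1\to\mathbb{R}^3$ is isometric with respect to the metric $g$ if $\partial_i u\cdot\partial_j u=g_{ij}$ for all $i,j\in\{1,2\}$ on $\overline{D}_1$. It is short if $0<(\partial_i u\cdot\partial_j u)_{ij}<(g_{ij})_{ij}$ in the sense of quadratic forms at every point. An embedding is an injective immersion of the compact disk. $C^{1,\beta}$ denotes the usual Hölder space of $C^1$ maps with $\beta$-Hölder first derivatives. *)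

(* Defs.v *)
From HB Require Import structures.
From mathcomp Require Import all_boot all_order all_algebra.
From mathcomp Require Import all_classical all_reals all_analysis.
Import Order.TTheory GRing.Theory Num.Theory.
Import numFieldNormedType.Exports.

Set Implicit Arguments.
Unset Strict Implicit.
Unset Printing Implicit Defensive.

Local Open Scope classical_set_scope.
Local Open Scope ring_scope.

Definition dot (R : realType) (n : nat) (u v : 'rV[R]_n) : R :=
  \sum_(k < n) u 0 k * v 0 k.

(* The library norm [`|u|] on ['rV[R]_n] is the sup norm, not the Euclidean one. *)
Definition enorm (R : realType) (n : nat) (u : 'rV[R]_n) : R :=
  Num.sqrt (dot u u).

Definition disk (R : realType) : set 'rV[R]_2 := [set x | enorm x <= 1].

Definition open_disk (R : realType) : set 'rV[R]_2 := [set x | enorm x < 1].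

(* At boundary points difference quotients need not make sense; the partial
   derivative there is the limit of its interior values. *)
Definition partial (R : realType) (V : normedModType R) (i : 'I_2)
    (f : 'rV[R]_2 -> V) (x : 'rV[R]_2) : V :=
  if x \in @open_disk R then 'D_(delta_mx 0 i) f x
  else lim ('D_(delta_mx 0 i) f y @[y --> within (@open_disk R) (nbhs x)]).

(* C^k on the closed disk: the partial derivatives of order at most k exist in
   the open disk and extend continuously to the closed disk. Continuity of
   [partial i f] within the disk forces the limit defining its boundary values
   to exist. *)
Fixpoint Ck (R : realType) (V : normedModType R) (k : nat)
    (f : 'rV[R]_2 -> V) : Prop :=
  {within @disk R, continuous f} /\
  if k is k'.+1 then
    forall i : 'I_2,
      (forall x, @open_disk R x -> derivable f x (delta_mx 0 i)) /\
      Ck k' (partial i f)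
  else True.

Definition C1holder (R : realType) (m : nat) (beta : R)
    (u : 'rV[R]_2 -> 'rV[R]_m) : Prop :=
  Ck 1 u /\
  exists C : R, forall (i : 'I_2) (x y : 'rV[R]_2),
    @disk R x -> @disk R y ->
    enorm (partial i u x - partial i u y) <= C * enorm (x - y) `^ beta.

Definition C0norm (R : realType) (m : nat) (u : 'rV[R]_2 -> 'rV[R]_m) : R :=
  sup [set enorm (u x) | x in @disk R].

Definition posdef (R : realType) (n : nat) (A : 'M[R]_n) : Prop :=
  forall v : 'rV[R]_n, v != 0 -> 0 < (v *m A *m v^T) 0 0.

Definition riemannian_metric (R : realType) (g : 'rV[R]_2 -> 'M[R]_2) : Prop :=
  forall x, @disk R x -> (g x)^T = g x /\ posdef (g x).

Definition immersion (R : realType) (u : 'rV[R]_2 -> 'rV[R]_3) : Prop :=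
  Ck 1 u /\
  forall x, @disk R x -> row_free (\matrix_(i < 2) partial i u x).

Definition embedding (R : realType) (u : 'rV[R]_2 -> 'rV[R]_3) : Prop :=
  immersion u /\ set_inj (@disk R) u.

Definition induced_metric (R : realType) (u : 'rV[R]_2 -> 'rV[R]_3)
    (x : 'rV[R]_2) : 'M[R]_2 :=
  \matrix_(i < 2, j < 2) dot (partial i u x) (partial j u x).

Definition isometric (R : realType) (g : 'rV[R]_2 -> 'M[R]_2)
    (u : 'rV[R]_2 -> 'rV[R]_3) : Prop :=
  forall x, @disk R x -> induced_metric u x = g x.

Definition short (R : realType) (g : 'rV[R]_2 -> 'M[R]_2)
    (u : 'rV[R]_2 -> 'rV[R]_3) : Prop :=
  forall x, @disk R x ->
    posdef (induced_metric u x) /\ posdef (g x - induced_metric u x).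

(* Main.v *)
(* Convex integration of Nash-Kuiper type. A map u is corrugated in a direction e by
   adding (b / mu) sin(mu e.x) n, n the unit normal, together with tangential terms chosen
   so that the induced metric changes by (b^2 / 2) e (x) e up to errors controlled by
   negative powers of mu and by b^4.

   In a stage the metric defect is s^2 (Id + small) with a very small off-diagonal part
   in an orthonormal frame (e, f). After mollification, one corrugation along e and one
   along f remove the diagonal part, up to a smaller multiple of the identity. The
   off-diagonal part is never corrected: the second amplitude is chosen so as to
   equalize the diagonal entries of the defect, including the error of the first
   corrugation, and the error of the second one has, after an integration by parts, a
   much smaller component along e (x) e - f (x) f. At the end of the stage the diagonal
   entries in (e, f) almost agree, that is, the off-diagonal part in the frame rotated
   by 45 degrees is very small. Thus two alternating frames suffice. A stage divides s
   by K and multiplies the frequency by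
   K^5 r^5 with K = r^M; interpolation between first and second derivatives gives
   every Hoelder exponent below M / (5 M + 5), and M is arbitrary.

   To reach such a defect from a short immersion, g minus the induced metric is
   written as a sum of primitive metrics with finitely many constant directions, which
   are added in many small increments of size 1 / N: each costs an error O(1 / N^2).
   Embeddedness persists because corrugations are C^0 small and, in C^1, small compared
   to the local bi-Lipschitz constant. *)
Require Import Defs.
From mathcomp Require Import all_boot all_order all_algebra.
From mathcomp Require Import all_classical all_reals all_analysis.
From mathcomp Require Import ring lra.
Import Order.TTheory GRing.Theory Num.Theory.
Import numFieldNormedType.Exports.
Set Implicit Arguments.
Unset Strict Implicit.
Unset Printing Implicit Defensive.
Local Open Scope classical_set_scope.
Local Open Scope ring_scope.

(** * Partial derivatives and symbol estimates *)

(** The exponent is a count of frequencies. The defect has to drop by K^2, and the first-order error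
    of a corrugation is s^2 times the ratio of the old frequency to the new one, so each corrugation
    costs K^2. One more factor K is lost because the second derivatives of the incoming map stem
    from a corrugation of amplitude K s. Two corrugations give K^5; a third one, for the
    off-diagonal entry, would give K^7 and exponent 1/7. The powers of r pay for constants:
    estimates are uniform over all admissible data, so r is fixed once, at the price of an
    arbitrarily small loss in the exponent. The quartic error of a corrugation and the mollification
    of g stay harmless because s decreases while s^2 lam grows.

    The analysis takes place in the open disk, with uniformly continuous derivatives; boundary
    values are attached at the end, by radial limits. Injectivity is carried in a quantitative form
    whose C^1 tolerance depends on bounds for the map and not on the map itself, so that it survives
    arbitrarily many steps. *)

Section Partial.
Variable R : realType.
Local Notation E := 'rV[R]_2.
Local Notation U := (@open_disk R).
Implicit Types (f g : E -> R) (x y v : E).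

(** The interior counterpart of [partial], without boundary values; the two are compared only when
    the closed disk is reached. *)
Definition pd (i : 'I_2) f : E -> R := fun x => 'D_(delta_mx 0 i) f x.

Lemma enorm_lt1 x : (enorm x < 1) = (dot x x < 1).
Proof.
by rewrite /enorm -[X in _ < X]sqrtr1 ltr_sqrt// ltr01.
Qed.

Lemma enorm_le1 x : (enorm x <= 1) = (dot x x <= 1).
Proof.
by rewrite /enorm -[X in _ <= X]sqrtr1 ler_sqrt// ler01.
Qed.

Lemma dot2E x y : dot x y = x 0 0 * y 0 0 + x 0 1 * y 0 1.
Proof. by rewrite /dot big_ord_recl big_ord1; congr (_ + _ * _); congr (_ _ _); apply/val_inj. Qed.

Lemma continuous_dot : continuous (fun x : E => dot x x).
Proof.
move=> x.
have -> : (fun x : E => dot x x) = (fun x => x 0 0 * x 0 0 + x 0 1 * x 0 1).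
  by apply/funext => y; rewrite dot2E.
have c i : {for x, continuous (fun y : E => y 0 i)} by exact: coord_continuous.
exact: (continuousD (continuousM (c 0) (c 0)) (continuousM (c 1) (c 1))).
Qed.

Lemma open_diskE : U = [set x | dot x x < 1].
Proof. by apply/seteqP; split=> x /=; rewrite /open_disk /= enorm_lt1. Qed.

Lemma open_disk_open : open U.
Proof.
rewrite open_diskE; apply: (@open_comp _ _ (fun x : E => dot x x) [set t | t < 1]).
  by move=> x _; apply: continuous_dot.
exact: open_lt.
Qed.

Lemma near_disk x : U x -> \forall y \near x, U y.
Proof. by move=> Ux; apply: open_nbhs_nbhs; split => //; apply: open_disk_open. Qed.

Lemma pd_ext f g i x : U x -> (forall y, U y -> f y = g y) -> pd i f x = pd i g x.
Proof.
move=> Ux fg; apply: near_eq_derive.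
by apply: filterS (near_disk Ux) => y /fg.
Qed.

Lemma derivable_ext f g i x : U x -> (forall y, U y -> f y = g y) ->
  derivable f x (delta_mx 0 i) -> derivable g x (delta_mx 0 i).
Proof.
move=> Ux fg; apply: near_eq_derivable.
by apply: filterS (near_disk Ux) => y /fg.
Qed.

(** Restriction to the line through [x] turns a directional derivative into an ordinary one at 0,
    which brings in the one-variable chain rule and mean value theorem. *)
Lemma is_derive_line (W : normedModType R) (f : E -> W) x v (l : W) :
  is_derive x v f l <-> is_derive (0 : R) 1 (fun h => f (h *: v + x)) l.
Proof.
have E0 : (fun h : R => h^-1 *: (((fun h => f (h *: v + x)) \o shift 0) (h *: 1) - f (0 *: v + x)))
   = (fun h : R => h^-1 *: ((f \o shift x) (h *: v) - f x)).
  by apply/funext => h /=; rewrite scale0r add0r addr0 /GRing.scale/= mulr1.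
split=> -[d e]; apply: DeriveDef.
- exact/(derivable1P f x v).
- by rewrite -e /derive E0.
- exact/(derivable1P f x v).
- by rewrite -e /derive E0.
Qed.

Lemma is_derive_chain (h : R -> R) f x v (df dh : R) :
  is_derive x v f df -> is_derive (f x) 1 h dh ->
  is_derive x v (h \o f) (dh * df).
Proof.
move=> /is_derive_line fx hx; apply/is_derive_line.
have := @is_derive1_comp R h (fun t => f (t *: v + x)) 0 dh df.
rewrite scale0r add0r; exact.
Qed.

End Partial.

Section DeriveRules.
Variable R : realType.
Local Notation E := 'rV[R]_2.
Local Notation U := (@open_disk R).
Implicit Types (f g : E -> R) (x : E) (i : 'I_2).

Lemma pdD f g i x : derivable f x (delta_mx 0 i) -> derivable g x (delta_mx 0 i) ->
  pd i (fun y => f y + g y) x = pd i f x + pd i g x.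
Proof. by move=> df dg; rewrite /pd -deriveD. Qed.

Lemma pdM f g i x : derivable f x (delta_mx 0 i) -> derivable g x (delta_mx 0 i) ->
  pd i (fun y => f y * g y) x = pd i f x * g x + f x * pd i g x.
Proof.
move=> df dg; rewrite /pd -[fun y => f y * g y]/(f * g) (deriveM df dg) addrC /GRing.scale/= mulrC.
by rewrite [f x * _]mulrC.
Qed.

Lemma pdN f i x : derivable f x (delta_mx 0 i) -> pd i (fun y => - f y) x = - pd i f x.
Proof. by move=> df; rewrite /pd -deriveN. Qed.

Lemma pd_cst (c : R) i x : pd i (fun _ : E => c) x = 0.
Proof. by rewrite /pd derive_cst. Qed.

Lemma is_derive_pd f i x : derivable f x (delta_mx 0 i) -> is_derive x (delta_mx 0 i) f (pd i f x).
Proof. by move=> df; apply: DeriveDef. Qed.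

Lemma is_derive_coord (j : 'I_2) x v : is_derive x v (fun y : E => y 0 j) (v 0 j).
Proof.
apply/is_derive_line.
have -> : (fun h : R => (h *: v + x) 0 j) = (fun h => h * v 0 j + x 0 j).
  by apply/funext => h; rewrite !mxE.
apply: is_derive_eq; rewrite /GRing.scale/= ; ring.
Qed.

Lemma is_derive_phase (mu : R) (e : E) i x :
  is_derive x (delta_mx 0 i) (fun y => mu * dot e y) (mu * e 0 i).
Proof.
have -> : (fun y => mu * dot e y) = (fun y => mu * (e 0 0 * y 0 0 + e 0 1 * y 0 1)).
  by apply/funext => y; rewrite dot2E.
have c0 := is_derive_coord 0 x (delta_mx 0 i).
have c1 := is_derive_coord 1 x (delta_mx 0 i).
apply: is_derive_eq; rewrite /GRing.scale/= !mxE !eqxx /=.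
case: i c0 c1 => -[|[|//]] /= i2 _ _.
  have -> : Ordinal i2 = 0 by apply/val_inj.
  by rewrite /=; ring.
have -> : Ordinal i2 = 1 by apply/val_inj.
by rewrite /=; ring.
Qed.

End DeriveRules.

(** * Symbol estimates, uniform along a filter *)

Section Symbols.
Variables (R : realType) (P : Type) (F : set_system P).
Context {FF : Filter F}.
Local Notation E := 'rV[R]_2.
Local Notation U := (@open_disk R).
Implicit Types (A B w k : P -> R) (f g : P -> E -> R).

(* Up to a constant that is uniform in the parameter [p], the family [f] is bounded
   by [A], its first derivatives cost a factor [w] and each further derivative, up
   to order [n], a factor [k]. *)
Fixpoint symb (n : nat) A w k f : Prop :=
  (exists C : R, \forall p \near F, forall x, U x -> `|f p x| <= C * A p) /\
  (if n is m.+1 then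
     (\forall p \near F, forall i x, U x -> derivable (f p) x (delta_mx 0 i)) /\
     forall i, symb m (fun p => A p * w p) k k (fun p => pd i (f p))
   else True).

Lemma symb_sup n A w k f : symb n A w k f ->
  exists C : R, \forall p \near F, forall x, U x -> `|f p x| <= C * A p.
Proof. by case: n => [|n] []. Qed.

Lemma symb_derivable n A w k f : symb n.+1 A w k f ->
  \forall p \near F, forall i x, U x -> derivable (f p) x (delta_mx 0 i).
Proof. by case=> _ [h _]. Qed.

Lemma symb_pd n A w k f i : symb n.+1 A w k f ->
  symb n (fun p => A p * w p) k k (fun p => pd i (f p)).
Proof. by case=> _ [_ h]; exact: h. Qed.

Lemma symb_pred n A w k f : symb n.+1 A w k f -> symb n A w k f.
Proof.
elim: n A w f => [|n IH] A w f [s [d s']]; first by [].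
by split=> //; split=> // i; apply: IH; apply: s'.
Qed.

Lemma symb_le m n A w k f : (m <= n)%N -> symb n A w k f -> symb m A w k f.
Proof.
move=> /subnK <-; elim: (n - m)%N => [//|q IH].
by rewrite addSn => /symb_pred.
Qed.

Lemma symb_ext n A w k f g :
  (\forall p \near F, forall x, U x -> f p x = g p x) -> symb n A w k f -> symb n A w k g.
Proof.
elim: n A w f g => [|n IH] A w f g fg.
  move=> [[C fC] _]; split=> //; exists C.
  by apply: filterS2 fg fC => p fg fC x Ux; rewrite -fg// fC.
move=> [[C fC] [df sf]]; split; [|split].
- by exists C; apply: filterS2 fg fC => p fg fC x Ux; rewrite -fg// fC.
- by apply: filterS2 fg df => p fg df i x Ux; apply: derivable_ext (df i x Ux).
- move=> i; apply: IH (sf i); apply: filterS fg => p fg x Ux.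
  exact: pd_ext.
Qed.

(** A constant may be lost in the amplitude, where the constant of the symbol absorbs it;
    frequencies are compared without one. The sign condition on [A] is there because the constant of
    the symbol may be negative. *)
Lemma symb_weaken n (c : R) A A' w w' k k' f :
  (\forall p \near F, 0 <= A p <= c * A' p) ->
  (\forall p \near F, 0 <= w p <= w' p) ->
  (\forall p \near F, 0 <= k p <= k' p) ->
  symb n A w k f -> symb n A' w' k' f.
Proof.
elim: n A A' w w' f => [|n IH] A A' w w' f hA hw hk /=.
  move=> [[C fC] _]; split=> //; exists (`|C| * c).
  apply: filterS2 hA fC => p /andP[A0 AA] fC x /fC /le_trans; apply.
  by rewrite -mulrA (le_trans (ler_wpM2r A0 (ler_norm C)))// ler_wpM2l.
move=> [[C fC] [df sf]]; split; [|split] => //.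
- exists (`|C| * c).
  apply: filterS2 hA fC => p /andP[A0 AA] fC x /fC /le_trans; apply.
  by rewrite -mulrA (le_trans (ler_wpM2r A0 (ler_norm C)))// ler_wpM2l.
- move=> i; apply: IH (sf i) => //.
  apply: filterS2 hA hw => p /andP[A0 AA] /andP[w0 ww].
  by rewrite mulr_ge0// mulrA ler_pM.
Qed.

Lemma symb_amp n (c : R) A A' w k f :
  (\forall p \near F, 0 <= w p <= k p) ->
  (\forall p \near F, 0 <= A p <= c * A' p) ->
  symb n A w k f -> symb n A' w k f.
Proof.
move=> hw hA; apply: symb_weaken hA _ _.
- by apply: filterS hw => p /andP[w0 _]; rewrite w0 lexx.
- by apply: filterS hw => p /andP[w0 wk]; rewrite (le_trans w0 wk) lexx.
Qed.

Lemma symb_eqA n A A' w k f : A =1 A' -> symb n A w k f -> symb n A' w k f.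
Proof. by move=> /funext ->. Qed.

Lemma symbD n A w k f g : symb n A w k f -> symb n A w k g ->
  symb n A w k (fun p x => f p x + g p x).
Proof.
have key A' (f' g' : P -> E -> R) :
    (exists C : R, \forall p \near F, forall x, U x -> `|f' p x| <= C * A' p) ->
    (exists C : R, \forall p \near F, forall x, U x -> `|g' p x| <= C * A' p) ->
    exists C : R, \forall p \near F, forall x, U x -> `|f' p x + g' p x| <= C * A' p.
  move=> [C1 h1] [C2 h2]; exists (C1 + C2); apply: filterS2 h1 h2 => p h1 h2 x Ux.
  by rewrite mulrDl (le_trans (ler_normD _ _))// lerD ?h1 ?h2.
elim: n A w f g => [|n IH] A w f g; first by move=> [sf _] [sg _]; split=> //; exact: key.
move=> [sf [df hf]] [sg [dg hg]]; split; [exact: key|split].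
- by apply: filterS2 df dg => p df dg i x Ux; apply: derivableD; [exact: df|exact: dg].
- move=> i; apply: symb_ext (IH _ _ _ _ (hf i) (hg i)).
  by apply: filterS2 df dg => p df dg x Ux; rewrite pdD//; [exact: df|exact: dg].
Qed.

Lemma symbN n A w k f : symb n A w k f -> symb n A w k (fun p x => - f p x).
Proof.
elim: n A w f => [|n IH] A w f.
  by move=> [[C h] _]; split=> //; exists C; apply: filterS h => p h x Ux; rewrite normrN h.
move=> [[C h] [df hf]]; split; [|split].
- by exists C; apply: filterS h => p h x Ux; rewrite normrN h.
- by apply: filterS df => p df i x Ux; apply: derivableN; exact: df.
- move=> i; apply: symb_ext (IH _ _ _ (hf i)).
  by apply: filterS df => p df x Ux; rewrite pdN//; exact: df.
Qed.

Lemma symbB n A w k f g : symb n A w k f -> symb n A w k g ->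
  symb n A w k (fun p x => f p x - g p x).
Proof. by move=> hf hg; apply: symbD => //; apply: symbN. Qed.

Lemma symb0 n A w k : symb n A w k (fun _ _ => 0).
Proof.
have s0 (A' : P -> R) : exists C : R, \forall p \near F, forall x, U x -> `|0 : R| <= C * A' p.
  by exists 0; apply: nearW => p x _; rewrite normr0 mul0r.
elim: n A w => [|n IH] A w; split=> //; split.
  by apply: nearW => p i x Ux; exact: derivable_cst.
by move=> i; apply: symb_ext (IH _ _); apply: nearW => p x Ux; rewrite pd_cst.
Qed.

Lemma symb_scalar n A w k (a : P -> R) (C : R) : (\forall p \near F, `|a p| <= C * A p) ->
  symb n A w k (fun p _ => a p).
Proof.
move=> aC.
have s0 : exists C : R, \forall p \near F, forall x : E, U x -> `|a p| <= C * A p.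
  by exists C; apply: filterS aC.
case: n => [|n]; split=> //; split.
  by apply: nearW => p i x Ux; exact: derivable_cst.
by move=> i; apply: symb_ext (symb0 _ _ _ _); apply: nearW => p x Ux; rewrite pd_cst.
Qed.

Lemma symb_sum n A w k (I : Type) (r : seq I) (f : I -> P -> E -> R) :
  (forall i, symb n A w k (f i)) -> symb n A w k (fun p x => \sum_(i <- r) f i p x).
Proof.
move=> hf; elim: r => [|i r IH].
  by apply: symb_ext (symb0 n A w k); apply: nearW => p x Ux; rewrite big_nil.
apply: symb_ext (symbD (hf i) IH); apply: nearW => p x Ux.
by rewrite big_cons.
Qed.

(** Forgets that the first derivative is cheaper than the later ones, so that an undifferentiated
    factor can be multiplied with a differentiated one. *)
Lemma symb_slow n A w k f : (\forall p \near F, 0 <= A p) ->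
  (\forall p \near F, 0 <= w p <= k p) -> symb n A w k f -> symb n A k k f.
Proof.
move=> hA hw; apply: (@symb_weaken _ 1) => //.
- by apply: filterS hA => p A0; rewrite mul1r A0 lexx.
- by apply: filterS hw => p /andP[w0 wk]; rewrite (le_trans w0 wk) lexx.
Qed.

(** Leibniz rule. After one derivative the differentiated factor has both frequencies [k]; the other
    factor is slowed to [k] as well, and the induction closes with [w = k]. *)
Lemma symbM n A B w k f g : 
  (\forall p \near F, 0 <= w p <= k p) ->
  (\forall p \near F, 0 <= A p) -> (\forall p \near F, 0 <= B p) ->
  symb n A w k f -> symb n B w k g -> symb n (fun p => A p * B p) w k (fun p x => f p x * g p x).
Proof.
have key A' B' (f' g' : P -> E -> R) :
    (exists C : R, \forall p \near F, forall x, U x -> `|f' p x| <= C * A' p) ->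
    (exists C : R, \forall p \near F, forall x, U x -> `|g' p x| <= C * B' p) ->
    exists C : R, \forall p \near F, forall x, U x -> `|f' p x * g' p x| <= C * (A' p * B' p).
  move=> [C1 h1] [C2 h2]; exists (C1 * C2); apply: filterS2 h1 h2 => p h1 h2 x Ux.
  by rewrite mulrACA normrM ler_pM// ?h1 ?h2.
elim: n A B w f g => [|n IH] A B w f g hw hA hB.
  by move=> [sf _] [sg _]; split=> //; exact: key.
have hk : \forall p \near F, 0 <= k p <= k p.
  by apply: filterS hw => p /andP[w0 wk]; rewrite (le_trans w0 wk) lexx.
have hAw : \forall p \near F, 0 <= A p * w p.
  by apply: filterS2 hA hw => p A0 /andP[w0 _]; rewrite mulr_ge0.
have hBw : \forall p \near F, 0 <= B p * w p.
  by apply: filterS2 hB hw => p A0 /andP[w0 _]; rewrite mulr_ge0.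
move=> sf sg; have [sf0 [df hf]] := sf; have [sg0 [dg hg]] := sg.
split; [exact: key|split].
- by apply: filterS2 df dg => p df dg i x Ux; apply: derivableM; [exact: df|exact: dg].
- move=> i.
  have s1 := IH _ _ _ _ _ hk hAw hB (hf i) (symb_slow hB hw (symb_pred sg)).
  have s2 := IH _ _ _ _ _ hk hA hBw (symb_slow hA hw (symb_pred sf)) (hg i).
  have e1 : (fun p => A p * w p * B p) =1 (fun p => A p * B p * w p) by move=> p; ring.
  have e2 : (fun p => A p * (B p * w p)) =1 (fun p => A p * B p * w p) by move=> p; ring.
  apply: symb_ext (symbD (symb_eqA e1 s1) (symb_eqA e2 s2)).
  by apply: filterS2 df dg => p df dg x Ux; rewrite pdM//; [exact: df|exact: dg].
Qed.

Lemma symbZ n A w k f (c : R) : symb n A w k f -> symb n A w k (fun p x => c * f p x).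
Proof.
elim: n A w f => [|n IH] A w f.
  move=> [[C h] _]; split=> //; exists (`|c| * C); apply: filterS h => p h x Ux.
  by rewrite normrM -mulrA ler_wpM2l// h.
move=> [[C h] [df hf]]; split; [|split].
- exists (`|c| * C); apply: filterS h => p h x Ux.
  by rewrite normrM -mulrA ler_wpM2l// h.
- by apply: filterS df => p df i x Ux; apply: derivableZ; exact: df.
- move=> i; apply: symb_ext (IH _ _ _ (hf i)).
  apply: filterS df => p df x Ux; rewrite pdM ?pd_cst ?mul0r ?add0r//; last exact: df.
Qed.

(** Raises the order of a composition by one. The outer derivative is needed with both frequencies
    [k] only, since the inner derivative has already been paid for at rate [w]. *)
Lemma symb_chain n A w k f (h dh : R -> R) (D : R -> Prop) :
  (\forall p \near F, 0 <= w p <= k p) -> (\forall p \near F, 0 <= A p) ->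
  (forall t, D t -> is_derive t 1 h (dh t)) ->
  (\forall p \near F, forall x, U x -> D (f p x)) ->
  symb n.+1 (fun=> 1) w k f ->
  (exists C : R, \forall p \near F, forall x, U x -> `|h (f p x)| <= C * A p) ->
  symb n A k k (fun p x => dh (f p x)) ->
  symb n.+1 A w k (fun p x => h (f p x)).
Proof.
move=> hw hA hh hD sf sh sdh; split=> //.
have hk : \forall p \near F, 0 <= k p <= k p.
  by apply: filterS hw => p /andP[w0 wk]; rewrite (le_trans w0 wk) lexx.
have [_ [df hf]] := sf.
have ch : \forall p \near F, forall i x, U x -> 
    is_derive x (delta_mx 0 i) (fun x => h (f p x)) (dh (f p x) * pd i (f p) x).
  apply: filterS2 df hD => p df hD i x Ux; apply: is_derive_chain.
    exact/is_derive_pd/df.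
  exact/hh/hD.
split; first by apply: filterS ch => p ch i x /(ch i)[].
move=> i; have hw' : \forall p \near F, 0 <= 1 * w p.
  by apply: filterS hw => p /andP[]; rewrite mul1r.
apply: symb_ext (symb_eqA _ (symbM hk hA hw' sdh (hf i))).
  by apply: filterS ch => p ch x /(ch i)[_ <-].
by move=> p; rewrite mul1r.
Qed.

(** Induction on the order: the derivative of the inverse is a polynomial in the inverse itself,
    known one order lower. No formula for higher derivatives of a composition is involved. *)
Lemma symb_inv n w k f (c : R) : 0 < c ->
  (\forall p \near F, 0 <= w p <= k p) ->
  (\forall p \near F, forall x, U x -> c <= f p x) ->
  symb n (fun=> 1) w k f -> symb n (fun=> 1) w k (fun p x => (f p x)^-1).
Proof.
move=> c0 hw hc.
have s0 : exists C : R, \forall p \near F, forall x, U x -> `|(f p x)^-1| <= C * 1.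
  exists c^-1; apply: filterS hc => p hc x /hc cf; have f0 := lt_le_trans c0 cf.
  by rewrite mulr1 ger0_norm ?invr_ge0 ?(ltW f0)// lef_pV2.
have h1 : \forall p \near F, 0 <= (1 : R) by exact: nearW.
have hk : \forall p \near F, 0 <= k p <= k p.
  by apply: filterS hw => p /andP[w0 wk]; rewrite (le_trans w0 wk) lexx.
elim: n => [|n IH] sf; first by split.
have sk := symb_slow h1 hw (IH (symb_pred sf)).
apply: (@symb_chain n (fun=> 1) w k f GRing.inv (fun t => - (t^-1 * t^-1)) (fun t => t != 0)) => //.
- move=> t t0; have := @is_deriveV _ id t 1 1 t0 _.
  by rewrite /= /GRing.scale/= mulr1 => H; rewrite -invfM -expr2; exact: H.
- by apply: filterS hc => p hc x /hc cf; rewrite gt_eqF// (lt_le_trans c0 cf).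
- by apply/symbN/(symb_eqA _ (symbM hk h1 h1 sk sk)) => p; rewrite mulr1.
Qed.

Lemma symb_sqrt n w k f (c : R) : 0 < c ->
  (\forall p \near F, 0 <= w p <= k p) ->
  (\forall p \near F, forall x, U x -> c <= f p x) ->
  symb n (fun=> 1) w k f -> symb n (fun=> 1) w k (fun p x => Num.sqrt (f p x)).
Proof.
move=> c0 hw hc.
have h1 : \forall p \near F, 0 <= (1 : R) by exact: nearW.
have hk : \forall p \near F, 0 <= k p <= k p.
  by apply: filterS hw => p /andP[w0 wk]; rewrite (le_trans w0 wk) lexx.
have hs : \forall p \near F, forall x, U x -> Num.sqrt c <= Num.sqrt (f p x).
  by apply: filterS hc => p hc x /hc; apply: ler_wsqrtr.
have sup n' : symb n' (fun=> 1) w k f ->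
    exists C : R, \forall p \near F, forall x, U x -> `|Num.sqrt (f p x)| <= C * 1.
  move=> /symb_sup[C fC]; exists (Num.sqrt C); apply: filterS fC => p fC x /fC.
  rewrite !mulr1 (ger0_norm (sqrtr_ge0 _)) => h; apply: ler_wsqrtr.
  exact: le_trans (ler_norm _) h.
elim: n => [|n IH] sf; first by split=> //; exact: sup sf.
have sk := symb_slow h1 hw (symb_inv (c := Num.sqrt c) _ hw hs (IH (symb_pred sf))).
apply: (@symb_chain n (fun=> 1) w k f Num.sqrt (fun t => 2^-1 * (Num.sqrt t)^-1) (fun t => 0 < t)) => //.
- by move=> t t0; have := is_derive1_sqrt t0; rewrite invfM.
- by apply: filterS hc => p hc x /hc; apply: lt_le_trans.
- exact: sup sf.
- by apply/symbZ/sk; rewrite sqrtr_gt0.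
Qed.

(** One induction for both functions, each being up to sign the derivative of the other. *)
Lemma symb_sincos n (mu : P -> R) (e : E) : (\forall p \near F, 0 <= mu p) ->
  symb n (fun=> 1) mu mu (fun p x => sin (mu p * dot e x)) /\
  symb n (fun=> 1) mu mu (fun p x => cos (mu p * dot e x)).
Proof.
move=> hmu.
have bnd (h : R -> R) : (forall t, `|h t| <= 1) -> exists C : R,
    \forall p \near F, forall x : E, U x -> `|h (mu p * dot e x)| <= C * 1.
  by move=> h1; exists 1; apply: nearW => p x _; rewrite mulr1.
have bs t : `|sin t : R| <= 1 by rewrite ler_norml sin_geN1 sin_le1.
have bc t : `|cos t : R| <= 1 by rewrite ler_norml cos_geN1 cos_le1.
have h1 : \forall p \near F, 0 <= (1 : R) by exact: nearW.
have hk : \forall p \near F, 0 <= mu p <= mu p by apply: filterS hmu => p ->; rewrite lexx.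
have sm m i : symb m mu mu mu (fun p _ => mu p * e 0 i).
  apply: (@symb_scalar _ _ _ _ _ `|e 0 i|); apply: filterS hmu => p mu0.
  by rewrite normrM mulrC (ger0_norm mu0).
have ch (h dh : R -> R) : (forall t : R, is_derive t 1 h (dh t)) -> forall p i x,
    is_derive x (delta_mx 0 i) (fun x => h (mu p * dot e x)) (dh (mu p * dot e x) * (mu p * e 0 i)).
  move=> hh p i x.
  exact: (is_derive_chain (is_derive_phase (mu p) e i x) (hh _)).
elim: n => [|n [IHs IHc]]; first by split; split=> //; exact: bnd.
have S (t : R) : is_derive t 1 sin (cos t : R) by exact: is_derive_sin.
have C (t : R) : is_derive t 1 cos (- sin t : R) by exact: is_derive_cos.
have sgen (h dh : R -> R) : (forall t, `|h t| <= 1) -> (forall t : R, is_derive t 1 h (dh t)) ->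
   symb n (fun=> 1) mu mu (fun p x => dh (mu p * dot e x)) ->
   symb n.+1 (fun=> 1) mu mu (fun p x => h (mu p * dot e x)).
  move=> hb hh sdh; split; [exact: bnd|split].
    by apply: nearW => p i x Ux; have [] := ch _ _ hh p i x.
  move=> i; apply: symb_ext (symbM hk h1 hmu sdh (sm n i)).
  by apply: nearW => p x Ux; have [_ <-] := ch _ _ hh p i x.
split; first exact: sgen bs S IHc.
by apply: sgen bc C (symbN IHs).
Qed.

End Symbols.

(** * Corrugations *)

Section VectorAlgebra.
Variable R : realType.
Implicit Types (a b c : 'I_3 -> R).

(** Vectors of the target space are functions on ['I_3], so that estimates are made by coordinates
    and vector identities are left to [ring]. *)
Definition vd a b : R := a 0 * b 0 + a 1 * b 1 + a 2 * b 2.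

Definition cross a b (k : 'I_3) : R :=
  match val k with
  | 0%N => a 1 * b 2 - a 2 * b 1
  | 1%N => a 2 * b 0 - a 0 * b 2
  | _ => a 0 * b 1 - a 1 * b 0
  end.

Lemma vdC a b : vd a b = vd b a. Proof. rewrite /vd; ring. Qed.

Lemma vdZl a b (r : R) : vd (fun l => a l * r) b = vd a b * r.
Proof. rewrite /vd; ring. Qed.

Lemma vdZr a b (r : R) : vd a (fun l => b l * r) = vd a b * r.
Proof. rewrite /vd; ring. Qed.

Lemma vd_linl a b c (p q : R) : vd (fun l => p * a l + q * b l) c = p * vd a c + q * vd b c.
Proof. rewrite /vd; ring. Qed.

Lemma vd_linr a b c (p q : R) : vd c (fun l => p * a l + q * b l) = p * vd c a + q * vd c b.
Proof. rewrite /vd; ring. Qed.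

Lemma vd_crossl a b : vd (cross a b) a = 0.
Proof. rewrite /vd /cross /=; ring. Qed.

Lemma vd_crossr a b : vd (cross a b) b = 0.
Proof. rewrite /vd /cross /=; ring. Qed.

Lemma vd_cross a b : vd (cross a b) (cross a b) = vd a a * vd b b - vd a b ^+ 2.
Proof. rewrite /vd /cross /=; ring. Qed.

(* The products of [uu i] with [nn], of [nn] with [TT], and of [TT] with [uu i]
   are the ones prescribed by the corrugation ansatz. *)
Lemma vd_corrugation (uu nn' TT' : 'I_2 -> 'I_3 -> R) (nn TT : 'I_3 -> R)
    (be ta : R) (bb tt ee : 'I_2 -> R) (i j : 'I_2) :
  vd nn nn = 1 -> (forall l, vd nn (uu l) = 0) -> vd nn TT = 0 ->
  (forall l, vd TT (uu l) = ee l) ->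
  let vv l k := uu l k + (bb l * nn k + be * nn' l k) + (tt l * TT k + ta * TT' l k) in
  vd (vv i) (vv j) = vd (uu i) (uu j) + bb i * bb j
    + be * (vd (uu i) (nn' j) + vd (uu j) (nn' i)) + (tt i * ee j + tt j * ee i)
    + (ta * (vd (uu i) (TT' j) + vd (uu j) (TT' i))
       + be * (bb i * vd nn (nn' j) + bb j * vd nn (nn' i))
       + ta * (bb i * vd nn (TT' j) + bb j * vd nn (TT' i))
       + be * be * vd (nn' i) (nn' j)
       + be * (tt j * vd (nn' i) TT + tt i * vd (nn' j) TT)
       + be * ta * (vd (nn' i) (TT' j) + vd (nn' j) (TT' i))
       + tt i * tt j * vd TT TT
       + ta * (tt i * vd TT (TT' j) + tt j * vd TT (TT' i))
       + ta * ta * vd (TT' i) (TT' j)).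
Proof.
move=> n1 nu nT Tu vv.
transitivity (vd (uu i) (uu j) + bb i * bb j * vd nn nn
    + be * (vd (uu i) (nn' j) + vd (uu j) (nn' i))
    + (tt i * vd TT (uu j) + tt j * vd TT (uu i))
    + (ta * (vd (uu i) (TT' j) + vd (uu j) (TT' i))
       + be * (bb i * vd nn (nn' j) + bb j * vd nn (nn' i))
       + ta * (bb i * vd nn (TT' j) + bb j * vd nn (TT' i))
       + be * be * vd (nn' i) (nn' j)
       + be * (tt j * vd (nn' i) TT + tt i * vd (nn' j) TT)
       + be * ta * (vd (nn' i) (TT' j) + vd (nn' j) (TT' i))
       + tt i * tt j * vd TT TT
       + ta * (tt i * vd TT (TT' j) + tt j * vd TT (TT' i))
       + ta * ta * vd (TT' i) (TT' j))
    + (bb i * vd nn (uu j) + bb j * vd nn (uu i)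
       + (bb i * tt j + bb j * tt i) * vd nn TT)).
  by rewrite /vd /vv; ring.
by rewrite n1 !nu nT !Tu; ring.
Qed.

End VectorAlgebra.

(** * Induced metric, unit normal and dual tangential field *)

Section Geometry.
Variable R : realType.
Local Notation E := 'rV[R]_2.
Local Notation U := (@open_disk R).
Implicit Types (u : 'I_3 -> E -> R) (e x : E) (i j : 'I_2).

Definition du u i x : 'I_3 -> R := fun k => pd i (u k) x.
Definition gram u i j x : R := vd (du u i x) (du u j x).
Definition gdet u x : R := gram u 0 0 x * gram u 1 1 x - gram u 0 1 x ^+ 2.
Definition nrm u (k : 'I_3) x : R := cross (du u 0 x) (du u 1 x) k * (Num.sqrt (gdet u x))^-1.
(** The tangential field whose product with [du u i] is [e 0 i], obtained from the inverse of the
    induced metric ([tgt_du]). A displacement [a * tgt] therefore changes the metric at leading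
    order by the symmetrized product of [e] with the gradient of [a]. *)
Definition tgt e u (k : 'I_3) x : R :=
  ((e 0 0 * gram u 1 1 x - e 0 1 * gram u 0 1 x) * pd 0 (u k) x
   + (e 0 1 * gram u 0 0 x - e 0 0 * gram u 0 1 x) * pd 1 (u k) x) * (gdet u x)^-1.

Lemma ord2_case (i : 'I_2) : (i = 0) \/ (i = 1).
Proof. by case: i => -[|[|//]] h; [left|right]; apply/val_inj. Qed.

Lemma gramC u i j x : gram u i j x = gram u j i x.
Proof. exact: vdC. Qed.

Lemma nrm_du u i x : vd (nrm u ^~ x) (du u i x) = 0.
Proof.
rewrite /nrm vdZl.
by case: (ord2_case i) => ->; rewrite ?vd_crossl ?vd_crossr mul0r.
Qed.

Lemma nrm_nrm u x : 0 < gdet u x -> vd (nrm u ^~ x) (nrm u ^~ x) = 1.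
Proof.
move=> g0; rewrite /nrm vdZl vdZr vd_cross -mulrA -invfM -expr2 sqr_sqrtr ?(ltW g0)//.
by rewrite divff// gt_eqF.
Qed.

Lemma nrm_tgt e u x : vd (nrm u ^~ x) (tgt e u ^~ x) = 0.
Proof.
rewrite /tgt vdZr (vd_linr (du u 0 x) (du u 1 x)).
by rewrite !nrm_du !mulr0 addr0 mul0r.
Qed.

Lemma tgt_du e u i x : 0 < gdet u x -> vd (tgt e u ^~ x) (du u i x) = e 0 i.
Proof.
move=> g0; have gn : gdet u x != 0 by rewrite gt_eqF.
rewrite /tgt vdZl (vd_linl (du u 0 x) (du u 1 x)) -!/(gram u _ _ x).
case: (ord2_case i) => ->; rewrite ?[gram u 1 0 x]gramC; move: gn; rewrite /gdet.
  move: (gram u 0 0 x) (gram u 0 1 x) (gram u 1 1 x) (e 0 0) (e 0 1) => a b d e0 e1 gn.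
  by field.
move: (gram u 0 0 x) (gram u 0 1 x) (gram u 1 1 x) (e 0 0) (e 0 1) => a b d e0 e1 gn.
by field.
Qed.

End Geometry.

Section GeometrySymbols.
Variables (R : realType) (P : Type) (F : set_system P).
Context {FF : Filter F}.
Local Notation E := 'rV[R]_2.
Local Notation U := (@open_disk R).
Local Notation symb := (symb F).

Lemma symb_vd n (A B w k : P -> R) (f g : P -> 'I_3 -> E -> R) :
  (\forall p \near F, 0 <= w p <= k p) ->
  (\forall p \near F, 0 <= A p) -> (\forall p \near F, 0 <= B p) ->
  (forall l, symb n A w k (fun p => f p l)) -> (forall l, symb n B w k (fun p => g p l)) ->
  symb n (fun p => A p * B p) w k (fun p x => vd (f p ^~ x) (g p ^~ x)).
Proof.
move=> hw hA hB sf sg; rewrite /vd.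
by apply: symbD; [apply: symbD|]; apply: symbM.
Qed.

Lemma symbM1 n (w k : P -> R) (f g : P -> E -> R) :
  (\forall p \near F, 0 <= w p <= k p) ->
  symb n (fun=> 1) w k f -> symb n (fun=> 1) w k g ->
  symb n (fun=> 1) w k (fun p x => f p x * g p x).
Proof.
move=> hw hf hg.
have h1 : \forall p \near F, 0 <= (1 : R) by exact: nearW.
by apply: symb_eqA (symbM hw h1 h1 hf hg) => p; rewrite mulr1.
Qed.

Variables (n : nat) (w k : P -> R) (u : P -> 'I_3 -> E -> R) (c : R) (e : E).
Hypothesis hw : \forall p \near F, 0 <= w p <= k p.
Hypothesis c0 : 0 < c.
Hypothesis hc : \forall p \near F, forall x, U x -> c <= gdet (u p) x.
Hypothesis hu : forall i l, symb n (fun=> 1) w k (fun p => pd i (u p l)).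

Let h1 : \forall p \near F, 0 <= (1 : R). Proof. exact: nearW. Qed.

Lemma symb_gram i j : symb n (fun=> 1) w k (fun p => gram (u p) i j).
Proof.
have hu' i' l : symb n (fun=> 1) w k (fun p x => du (u p) i' x l) by exact: hu.
apply: symb_eqA (symb_vd hw h1 h1 (hu' i) (hu' j)) => p; exact: mulr1.
Qed.

Lemma symb_gdet : symb n (fun=> 1) w k (fun p => gdet (u p)).
Proof.
apply: symbB; first by apply: symbM1 => //; exact: symb_gram.
by apply: symbM1 => //; exact: symb_gram.
Qed.

Lemma symb_nrm l : symb n (fun=> 1) w k (fun p => nrm (u p) l).
Proof.
apply: symbM1 => //.
  rewrite /cross; case: l => -[|[|m]] hm /=.
  - by apply: symbB; apply: symbM1 => //; apply: hu.
  - by apply: symbB; apply: symbM1 => //; apply: hu.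
  - by apply: symbB; apply: symbM1 => //; apply: hu.
apply: (symb_inv (c := Num.sqrt c)) => //; first by rewrite sqrtr_gt0.
  by apply: filterS hc => p hcp x Ux; apply: ler_wsqrtr; exact: hcp.
by apply: (symb_sqrt (c := c)) => //; exact: symb_gdet.
Qed.

Lemma symb_tgt l : symb n (fun=> 1) w k (fun p => tgt e (u p) l).
Proof.
have sg i j : symb n (fun=> 1) w k (fun p => gram (u p) i j) by exact: symb_gram.
apply: symbM1 => //.
  by apply: symbD; (apply: symbM1 => //; apply: symbB; exact: symbZ).
by apply: (symb_inv (c := c)) => //; exact: symb_gdet.
Qed.

End GeometrySymbols.

(** * The corrugated map and its induced metric *)

Section Corrugation.
Variable R : realType.
Local Notation E := 'rV[R]_2.
Local Notation U := (@open_disk R).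
Implicit Types (u : 'I_3 -> E -> R) (b g : E -> R) (e f x : E) (i j : 'I_2) (mu : R).

Definition dir e g x : R := e 0 0 * pd 0 g x + e 0 1 * pd 1 g x.

(** Minus twice the second fundamental form for maps with symmetric second derivatives: the first
    variation of the metric under a displacement along the normal. *)
Definition sff u i j x : R :=
  vd (du u i x) (du (nrm u) j x) + vd (du u j x) (du (nrm u) i x).

(** The difference of the two diagonal entries in the frame [(e, f)], see [spread_bil]. *)
Definition spread e f (M : 'I_2 -> 'I_2 -> R) : R :=
  \sum_(i < 2) \sum_(j < 2) (e 0 i * e 0 j - f 0 i * f 0 j) * M i j.

Definition wrinkle mu e b x : R := mu^-1 * (b x * sin (mu * dot e x)).

(** The wrinkle contributes [b^2 cos^2] along [e (x) e], that is [b^2 / 2] plus an oscillation at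
    the doubled phase. The gradient of this slide, symmetrized with [e], cancels that oscillation to
    leading order. *)
Definition slide0 mu e b x : R :=
  mu^-1 * (- 4^-1 * (b x * b x * (sin (mu * dot e x) * cos (mu * dot e x)))).

(* The term that integrates by parts the first-order error of the corrugation. *)
Definition slide1 mu e f u b x : R :=
  mu^-1 * mu^-1 *
  (2^-1 * (b x * spread e f (fun i j => sff u i j x) * cos (mu * dot e x))
   + 8^-1 * (b x * dir e b x *
       (cos (mu * dot e x) * cos (mu * dot e x) - sin (mu * dot e x) * sin (mu * dot e x)))).

Definition slide mu e f u b x : R := slide0 mu e b x + slide1 mu e f u b x.

Definition corr mu e f u b (l : 'I_3) x : R :=
  u l x + (wrinkle mu e b x * nrm u l x + slide mu e f u b x * tgt e u l x).

(** The terms that are only estimated, never cancelled: each is of order [s^3 w / mu] or [s^4]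
    ([sy_corr_rem]). *)
Definition corr_rem mu e f u b i j x : R :=
  let be := wrinkle mu e b in let ta := slide mu e f u b in
  let nn := nrm u ^~ x in let TT := tgt e u ^~ x in
  let nn' := fun i => du (nrm u) i x in let TT' := fun i => du (tgt e u) i x in
  ta x * (vd (du u i x) (TT' j) + vd (du u j x) (TT' i))
  + be x * (pd i be x * vd nn (nn' j) + pd j be x * vd nn (nn' i))
  + ta x * (pd i be x * vd nn (TT' j) + pd j be x * vd nn (TT' i))
  + be x * be x * vd (nn' i) (nn' j)
  + be x * (pd j ta x * vd (nn' i) TT + pd i ta x * vd (nn' j) TT)
  + be x * ta x * (vd (nn' i) (TT' j) + vd (nn' j) (TT' i))
  + pd i ta x * pd j ta x * vd TT TT
  + ta x * (pd i ta x * vd TT (TT' j) + pd j ta x * vd TT (TT' i))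
  + ta x * ta x * vd (TT' i) (TT' j).

Lemma gram_corr mu e f u b i j x :
  (forall l i, derivable (u l) x (delta_mx 0 i)) ->
  (forall i, derivable (wrinkle mu e b) x (delta_mx 0 i)) ->
  (forall i, derivable (slide mu e f u b) x (delta_mx 0 i)) ->
  (forall l i, derivable (nrm u l) x (delta_mx 0 i)) ->
  (forall l i, derivable (tgt e u l) x (delta_mx 0 i)) -> 0 < gdet u x ->
  gram (corr mu e f u b) i j x = gram u i j x
    + pd i (wrinkle mu e b) x * pd j (wrinkle mu e b) x
    + wrinkle mu e b x * sff u i j x
    + (pd i (slide mu e f u b) x * e 0 j + pd j (slide mu e f u b) x * e 0 i)
    + corr_rem mu e f u b i j x.
Proof.
move=> hu hw hs hn ht g0.
have E1 i' : du (corr mu e f u b) i' x = (fun l => du u i' x l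
    + (pd i' (wrinkle mu e b) x * nrm u l x + wrinkle mu e b x * du (nrm u) i' x l)
    + (pd i' (slide mu e f u b) x * tgt e u l x + slide mu e f u b x * du (tgt e u) i' x l)).
  apply/funext => l; rewrite /du /corr pdD//; last first.
    by apply: derivableD; apply: derivableM.
  rewrite -addrA; congr (_ + _).
  rewrite (pdD (derivableM (hw _) (hn l _)) (derivableM (hs _) (ht l _))).
  by rewrite (pdM (hw _) (hn l _)) (pdM (hs _) (ht l _)).
rewrite /gram !E1.
rewrite (@vd_corrugation R (fun i => du u i x) (fun i => du (nrm u) i x) (fun i => du (tgt e u) i x)
  (nrm u ^~ x) (tgt e u ^~ x) (wrinkle mu e b x) (slide mu e f u b x)
  (fun i => pd i (wrinkle mu e b) x) (fun i => pd i (slide mu e f u b) x) (fun i => e 0 i) i j) //.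
- exact: nrm_nrm.
- by move=> i'; exact: nrm_du.
- exact: nrm_tgt.
- by move=> i'; exact: tgt_du.
Qed.

Lemma is_derive_sinp mu e i x :
  is_derive x (delta_mx 0 i) (fun y => sin (mu * dot e y)) (cos (mu * dot e x) * (mu * e 0 i)).
Proof. exact: (is_derive_chain (is_derive_phase mu e i x) (is_derive_sin _)). Qed.

Lemma is_derive_cosp mu e i x :
  is_derive x (delta_mx 0 i) (fun y => cos (mu * dot e y)) (- sin (mu * dot e x) * (mu * e 0 i)).
Proof. exact: (is_derive_chain (is_derive_phase mu e i x) (is_derive_cos _)). Qed.

Lemma pdZ (r : R) g i x : derivable g x (delta_mx 0 i) -> pd i (fun y => r * g y) x = r * pd i g x.
Proof.
by move=> dg; rewrite (pdM (derivable_cst r x (delta_mx 0 i)) dg) pd_cst mul0r add0r.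
Qed.

Lemma pd_wrinkle mu e b i x : mu != 0 -> derivable b x (delta_mx 0 i) ->
  pd i (wrinkle mu e b) x =
  b x * cos (mu * dot e x) * e 0 i + mu^-1 * (pd i b x * sin (mu * dot e x)).
Proof.
move=> m0 db; have [ds es] := is_derive_sinp mu e i x.
rewrite /wrinkle (pdZ _ (derivableM db ds)) (pdM db ds) [pd i (fun y => sin _) x]es.
by move: (pd i b x) (b x) (sin _) (cos _) => d y S C; field.
Qed.

Lemma pd_slide0 mu e b i x : mu != 0 -> derivable b x (delta_mx 0 i) ->
  pd i (slide0 mu e b) x =
  - 4^-1 * (b x * b x * (cos (mu * dot e x) ^+ 2 - sin (mu * dot e x) ^+ 2) * e 0 i)
  - mu^-1 * (2^-1 * (b x * pd i b x * (sin (mu * dot e x) * cos (mu * dot e x)))).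
Proof.
move=> m0 db; have [ds es] := is_derive_sinp mu e i x.
have [dc ec] := is_derive_cosp mu e i x.
have dsc := derivableM ds dc; have dbb := derivableM db db.
have dbs := derivableM dbb dsc.
rewrite /slide0 (pdZ _ (derivableM (derivable_cst (- 4^-1 : R) x (delta_mx 0 i)) dbs)).
rewrite (pdZ _ dbs) (pdM dbb dsc) (pdM db db) (pdM ds dc) /pd es ec -/(pd i b x).
rewrite !fctE.
by move: (pd i b x) (b x) (sin _) (cos _) => d y S C; field.
Qed.

Lemma pd_slide1 mu e f u b i x : mu != 0 ->
  let H y := b y * spread e f (fun i j => sff u i j y) in
  let B y := b y * dir e b y in
  derivable H x (delta_mx 0 i) -> derivable B x (delta_mx 0 i) ->
  pd i (slide1 mu e f u b) x =
  mu^-1 * (- (2^-1 * (H x * sin (mu * dot e x))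
              + 2^-1 * (B x * (sin (mu * dot e x) * cos (mu * dot e x)))) * e 0 i)
  + mu^-1 * mu^-1 * (2^-1 * (pd i H x * cos (mu * dot e x))
     + 8^-1 * (pd i B x * (cos (mu * dot e x) ^+ 2 - sin (mu * dot e x) ^+ 2))).
Proof.
move=> m0 H B dH dB; have [ds es] := is_derive_sinp mu e i x.
have [dc ec] := is_derive_cosp mu e i x.
have dcc := derivableM dc dc; have dss := derivableM ds ds.
have d1 := derivableM dH dc.
have d2 := derivableM dB (derivableB dcc dss).
have d3 := derivableM (derivable_cst (8^-1 : R) x (delta_mx 0 i)) d2.
have d4 := derivableM (derivable_cst (2^-1 : R) x (delta_mx 0 i)) d1.
rewrite /slide1 pdZ; last exact: (derivableD d4 d3).
rewrite (pdD d4 d3) (pdZ _ d1) (pdZ _ d2) (pdM dH dc) (pdM dB (derivableB dcc dss)).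
rewrite (pdD dcc (derivableN dss)) (pdN dss) (pdM dc dc) (pdM ds ds) /= !fctE /pd es ec.
rewrite -/(pd i H x) -/(pd i B x) -/(H x) -/(B x).
by move: (pd i H x) (pd i B x) (H x) (B x) (sin _) (cos _) => d y h g S C; field.
Qed.

End Corrugation.

(** * The diagonal difference of the corrugation error *)

Section SpreadAlgebra.
Variable R : realType.
Local Notation E := 'rV[R]_2.
Local Notation U := (@open_disk R).
Implicit Types (e f x : E).

Lemma spreadE e f M : spread e f M =
  (e 0 0 * e 0 0 - f 0 0 * f 0 0) * M 0 0 + (e 0 0 * e 0 1 - f 0 0 * f 0 1) * M 0 1
  + ((e 0 1 * e 0 0 - f 0 1 * f 0 0) * M 1 0 + (e 0 1 * e 0 1 - f 0 1 * f 0 1) * M 1 1).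
Proof.
rewrite /spread !big_ord_recl !big_ord0 !addr0.
by rewrite (_ : lift ord0 ord0 = 1) //; apply/val_inj.
Qed.

Lemma eq_spread e f M M' : (forall i j, M i j = M' i j) -> spread e f M = spread e f M'.
Proof. by move=> MM; rewrite !spreadE !MM. Qed.

Definition orthoframe e f :=
  [/\ e 0 0 * e 0 0 + e 0 1 * e 0 1 = 1, f 0 0 * f 0 0 + f 0 1 * f 0 1 = 1
    & e 0 0 * f 0 0 + e 0 1 * f 0 1 = 0].

(** In an orthonormal frame the symmetrized product of [e] with [t] has diagonal difference [2 e.t]:
    only the derivative of a slide along [e] is seen, and this is what the slide [slide1] is able to
    correct. *)
Lemma spread_ansatz e f (al ga be : R) (d t : 'I_2 -> R) (h r : 'I_2 -> 'I_2 -> R) :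
  orthoframe e f ->
  spread e f (fun i j => al * (e 0 i * d j + e 0 j * d i) + ga * (d i * d j) + be * h i j
      + (t i * e 0 j + t j * e 0 i) + r i j) =
  2 * al * (e 0 0 * d 0 + e 0 1 * d 1)
  + ga * ((e 0 0 * d 0 + e 0 1 * d 1) ^+ 2 - (f 0 0 * d 0 + f 0 1 * d 1) ^+ 2)
  + be * spread e f h + 2 * (e 0 0 * t 0 + e 0 1 * t 1) + spread e f r.
Proof.
move=> [e1 _ ef0]; rewrite !spreadE.
move: (e 0 0) (e 0 1) (f 0 0) (f 0 1) (d 0) (d 1) (t 0) (t 1) e1 ef0.
move: (h 0 0) (h 0 1) (h 1 0) (h 1 1) (r 0 0) (r 0 1) (r 1 0) (r 1 1).
move=> h1 h2 h3 h4 r1 r2 r3 r4 e0 e1 f0 f1 d0 d1 t0 t1 ee ef.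
apply/eqP; rewrite -subr_eq0; apply/eqP.
(* The difference of the two sides written as a combination of the frame relations; what remains is
   a polynomial identity. *)
transitivity (- 2 * (e0 * f0 + e1 * f1) * (al * (f0 * d0 + f1 * d1) + (f0 * t0 + f1 * t1))
   + 2 * (e0 * e0 + e1 * e1 - 1) * (al * (e0 * d0 + e1 * d1) + (e0 * t0 + e1 * t1))).
  by ring.
by rewrite ef ee subrr !mulr0 !mul0r addr0.
Qed.

Section CorrDefect.
Variables (mu : R) (e f : E) (u : 'I_3 -> E -> R) (b : E -> R).
Local Notation H := (fun y => b y * spread e f (fun i j => sff u i j y)).
Local Notation B := (fun y => b y * dir e b y).

Definition corr_defect i j x : R :=
  gram (corr mu e f u b) i j x - gram u i j x - 2^-1 * (b x * b x) * (e 0 i * e 0 j).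

Definition corr_defect_expr i j x : R :=
  mu^-1 * (2^-1 * (b x * (sin (mu * dot e x) * cos (mu * dot e x))))
    * (e 0 i * pd j b x + e 0 j * pd i b x)
  + mu^-1 * mu^-1 * (sin (mu * dot e x) * sin (mu * dot e x)) * (pd i b x * pd j b x)
  + wrinkle mu e b x * sff u i j x
  + (pd i (slide1 mu e f u b) x * e 0 j + pd j (slide1 mu e f u b) x * e 0 i)
  + corr_rem mu e f u b i j x.

(** The terms of order zero cancel by [cos^2 + sin^2 = 1], thanks to [slide0]. Besides [corr_rem],
    everything left carries a factor [mu^-1]. *)
Lemma corr_defectE i j x : mu != 0 ->
  (forall l i, derivable (u l) x (delta_mx 0 i)) ->
  (forall i, derivable b x (delta_mx 0 i)) ->
  (forall i, derivable (wrinkle mu e b) x (delta_mx 0 i)) ->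
  (forall i, derivable (slide0 mu e b) x (delta_mx 0 i)) ->
  (forall i, derivable (slide1 mu e f u b) x (delta_mx 0 i)) ->
  (forall l i, derivable (nrm u l) x (delta_mx 0 i)) ->
  (forall l i, derivable (tgt e u l) x (delta_mx 0 i)) -> 0 < gdet u x ->
  corr_defect i j x = corr_defect_expr i j x.
Proof.
move=> m0 hu hb hw hs0 hs1 hn ht g0.
have hs l : derivable (slide mu e f u b) x (delta_mx 0 l) by exact: (derivableD (hs0 l) (hs1 l)).
rewrite /corr_defect (gram_corr i j hu hw hs hn ht g0).
rewrite /corr_defect_expr; move: (corr_rem _ _ _ _ _ _ _ _) (gram _ _ _ _) => r g.
have E l : pd l (slide mu e f u b) x = pd l (slide0 mu e b) x + pd l (slide1 mu e f u b) x.
  exact: (pdD (hs0 _) (hs1 _)).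
rewrite !E.
rewrite !(pd_slide0 _ m0 (hb _)) !(pd_wrinkle _ m0 (hb _)).
move: (wrinkle _ _ _ _) (pd i (slide1 _ _ _ _ _) x) (pd j (slide1 _ _ _ _ _) x) => a t1 t2.
have := cos2Dsin2 (mu * dot e x).
move: (sff _ _ _ _) (b x) (pd i b x) (pd j b x) (sin _) (cos _) (e 0 i) (e 0 j) => h y d1 d2 S C e1 e2 SC.
apply/eqP; rewrite -subr_eq0; apply/eqP.
transitivity (2^-1 * (y * y) * (e1 * e2) * (C ^+ 2 + S ^+ 2 - 1)).
  by field.
by rewrite SC subrr mulr0.
Qed.

(** The first-order error, normal and tangential, cancels against the derivative of [slide1] along
    [e]. What survives has two factors [mu^-1] or belongs to [corr_rem]. *)
Lemma spread_corr_defect x : mu != 0 -> orthoframe e f ->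
  (forall i, derivable H x (delta_mx 0 i)) -> (forall i, derivable B x (delta_mx 0 i)) ->
  spread e f (fun i j => corr_defect_expr i j x) =
  mu^-1 * mu^-1 * (dir e H x * cos (mu * dot e x)
     + 4^-1 * (dir e B x * (cos (mu * dot e x) ^+ 2 - sin (mu * dot e x) ^+ 2))
     + sin (mu * dot e x) * sin (mu * dot e x) * (dir e b x ^+ 2 - dir f b x ^+ 2))
  + spread e f (fun i j => corr_rem mu e f u b i j x).
Proof.
move=> m0 ef dH dB; rewrite /corr_defect_expr spread_ansatz//.
rewrite !(pd_slide1 m0 (dH _) (dB _)) /dir /wrinkle.
have [ee _ _] := ef.
move: (spread _ _ (fun i j => corr_rem _ _ _ _ _ _ _ _)) => r.
move: (pd 0 (fun y => _ * spread _ _ _) x) (pd 1 (fun y => _ * spread _ _ _) x) => h0 h1.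
move: (pd 0 (fun y => b y * (_ + _)) x) (pd 1 (fun y => b y * (_ + _)) x) => b0 b1.
move: (spread _ _ _) => h.
move: (sin _) (cos _) (pd 0 b x) (pd 1 b x) (b x) (e 0 0) (e 0 1) (f 0 0) (f 0 1) ee.
move=> S C d0 d1 y e0 e1 f0 f1 ee.
apply/eqP; rewrite -subr_eq0; apply/eqP.
transitivity ((y * h * S + y * (e0 * d0 + e1 * d1) * (S * C)) * mu^-1 * (1 - (e0 * e0 + e1 * e1))).
  by field.
by rewrite ee subrr mulr0.
Qed.

End CorrDefect.
End SpreadAlgebra.

(** * Estimates for one corrugation *)

Section StepSymbols.
Variables (R : realType) (P : Type) (F : set_system P).
Context {FF : Filter F}.
Local Notation E := 'rV[R]_2.
Local Notation U := (@open_disk R).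
Local Notation symb := (symb F).
Variables (n : nat) (s w k mu : P -> R) (u : P -> 'I_3 -> E -> R) (b : P -> E -> R).
Variables (e f : E) (c : R).

(** In the hypothesis [hu] below, a derivative of the gradient of the map costs [s w] and not [w],
    because the map oscillates with amplitude [s]. The normal, the field [tgt] and the second
    fundamental form inherit the extra [s], which makes the leading remainder cubic in [s]. *)
Definition scales_ok p := [/\ 0 <= s p <= 1, 0 <= w p <= k p, k p <= mu p & 0 < mu p].

Hypothesis ok : \forall p \near F, scales_ok p.
Hypothesis ef : orthoframe e f.
Hypothesis c0 : 0 < c.
Hypothesis hdet : \forall p \near F, forall x, U x -> c <= gdet (u p) x.
Hypothesis hder : \forall p \near F, forall l i x, U x -> derivable (u p l) x (delta_mx 0 i).
Hypothesis hu : forall i l, symb n.+2 (fun=> 1) (fun p => s p * w p) k (fun p => pd i (u p l)).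
Hypothesis hb : symb n.+2 s w k b.

(** Symbols at the single top frequency [mu], bundled with the sign of the amplitude so that
    products carry no side conditions. *)
Definition sy m (A : P -> R) g := (\forall p \near F, 0 <= A p) /\ symb m A mu mu g.

Let mumu : \forall p \near F, 0 <= mu p <= mu p.
Proof. by apply: filterS ok => p [_ _ _ m0]; rewrite lexx ltW. Qed.

Lemma syM m A B g h : sy m A g -> sy m B h -> sy m (fun p => A p * B p) (fun p x => g p x * h p x).
Proof.
move=> [A0 sg] [B0 sh]; split; last exact: symbM.
by apply: filterS2 A0 B0 => p; apply: mulr_ge0.
Qed.

Lemma syD m A g h : sy m A g -> sy m A h -> sy m A (fun p x => g p x + h p x).
Proof. by move=> [A0 sg] [_ sh]; split=> //; apply: symbD. Qed.

Lemma syN m A g : sy m A g -> sy m A (fun p x => - g p x).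
Proof. by move=> [A0 sg]; split=> //; apply: symbN. Qed.

Lemma syB m A g h : sy m A g -> sy m A h -> sy m A (fun p x => g p x - h p x).
Proof. by move=> sg sh; apply: syD => //; apply: syN. Qed.

Lemma syZ m A g (r : R) : sy m A g -> sy m A (fun p x => r * g p x).
Proof. by move=> [A0 sg]; split=> //; apply: symbZ. Qed.

Lemma syZr m A g (r : R) : sy m A g -> sy m A (fun p x => g p x * r).
Proof.
move=> /(syZ r)[A0 sg]; split=> //; apply: symb_ext sg; apply: nearW => p x _; exact: mulrC.
Qed.

Lemma sy_vd m A B (g h : P -> 'I_3 -> E -> R) :
  (forall l, sy m A (fun p => g p l)) -> (forall l, sy m B (fun p => h p l)) ->
  sy m (fun p => A p * B p) (fun p x => vd (g p ^~ x) (h p ^~ x)).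
Proof. by move=> sg sh; apply: syD; [apply: syD|]; apply: syM. Qed.

Lemma sy_amp m A B g : (forall p, scales_ok p -> 0 <= A p -> A p <= B p) -> sy m A g -> sy m B g.
Proof.
move=> AB [A0 sg].
have A0B : \forall p \near F, 0 <= A p <= 1 * B p.
  by apply: filterS2 ok A0 => p okp A0; rewrite A0 mul1r AB.
split; first by apply: filterS A0B => p /andP[a0 ab]; rewrite (le_trans a0)// -[B p]mul1r.
exact: symb_amp A0B sg.
Qed.

Lemma sy_pd m A i g : sy m.+1 A g -> sy m (fun p => A p * mu p) (fun p => pd i (g p)).
Proof.
move=> [A0 sg]; split; last exact: symb_pd.
by apply: filterS2 A0 ok => p A0 [_ _ _ m0]; rewrite mulr_ge0// ltW.
Qed.

Lemma sy_le m m' A g : (m' <= m)%N -> sy m A g -> sy m' A g.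
Proof. by move=> mm [A0 sg]; split=> //; apply: symb_le sg. Qed.

Lemma sy_ext m A g h : (\forall p \near F, forall x, U x -> g p x = h p x) -> sy m A g -> sy m A h.
Proof. by move=> gh [A0 sg]; split=> //; apply: symb_ext sg. Qed.

Lemma sy_scalar m (a : P -> R) : (\forall p \near F, 0 <= a p) -> sy m a (fun p _ => a p).
Proof.
by move=> a0; split=> //; apply: (@symb_scalar _ _ _ _ _ _ _ _ _ 1); apply: filterS a0 => p a0; rewrite ger0_norm// mul1r.
Qed.

Lemma sy_derivable m A g : sy m.+1 A g ->
  \forall p \near F, forall i x, U x -> derivable (g p) x (delta_mx 0 i).
Proof. by move=> [_ /symb_derivable]. Qed.

Lemma sy_fast m A w' k' g : (\forall p \near F, 0 <= A p) ->
  (\forall p \near F, 0 <= w' p <= mu p) -> (\forall p \near F, 0 <= k' p <= mu p) ->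
  symb m A w' k' g -> sy m A g.
Proof.
move=> A0 hw hk sg; split=> //; apply: (symb_weaken (c := 1)) hw hk sg.
by apply: filterS A0 => p A0; rewrite mul1r A0 lexx.
Qed.

Let m' p := (mu p)^-1.

Let fI (A B : set P) : F A -> F B -> F (A `&` B) := @filterI _ F FF A B.

Let hwk : \forall p \near F, 0 <= s p * w p <= k p.
Proof.
apply: filterS ok => p [/andP[s0 s1] /andP[w0 wk] _ _].
by rewrite mulr_ge0//= (le_trans _ wk)// ler_piMl.
Qed.
Let hwmu : \forall p \near F, 0 <= s p * w p <= mu p.
Proof. by apply: filterS2 ok hwk => p [_ _ km _] /andP[-> /le_trans]; apply. Qed.
Let hkmu : \forall p \near F, 0 <= k p <= mu p.
Proof. by apply: filterS ok => p [_ /andP[w0 wk] -> _]; rewrite (le_trans w0 wk). Qed.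
Let hkk : \forall p \near F, 0 <= k p <= k p.
Proof. by apply: filterS hkmu => p /andP[-> _]; rewrite lexx. Qed.
Let h1 : \forall p \near F, 0 <= (1 : R). Proof. exact: nearW. Qed.
Let hs0 : \forall p \near F, 0 <= s p. Proof. by apply: filterS ok => p [/andP[]]. Qed.
Let hsw0 : \forall p \near F, 0 <= s p * w p. Proof. by apply: filterS hwk => p /andP[]. Qed.
Let hm0 : \forall p \near F, 0 <= m' p.
Proof. by apply: filterS ok => p [_ _ _ m0]; rewrite invr_ge0 ltW. Qed.

Let sS m : sy m (fun=> 1) (fun p x => sin (mu p * dot e x)).
Proof. by split=> //; apply: (symb_sincos _ _ _).1; apply: filterS mumu => p /andP[]. Qed.
Let sC m : sy m (fun=> 1) (fun p x => cos (mu p * dot e x)).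
Proof. by split=> //; apply: (symb_sincos _ _ _).2; apply: filterS mumu => p /andP[]. Qed.

Let su i l : sy n.+2 (fun=> 1) (fun p => pd i (u p l)).
Proof. exact: sy_fast h1 hwmu hkmu (hu i l). Qed.
Let dnrm i l : symb n.+1 (fun p => s p * w p) k k (fun p => pd i (nrm (u p) l)).
Proof. by apply: symb_eqA (symb_pd i (symb_nrm hwk c0 hdet hu l)) => p; rewrite mul1r. Qed.
Let dtgt i l : symb n.+1 (fun p => s p * w p) k k (fun p => pd i (tgt e (u p) l)).
Proof. by apply: symb_eqA (symb_pd i (symb_tgt e hwk c0 hdet hu l)) => p; rewrite mul1r. Qed.
Let sn l : sy n.+2 (fun=> 1) (fun p => nrm (u p) l).
Proof. exact: sy_fast h1 hwmu hkmu (symb_nrm hwk c0 hdet hu l). Qed.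
Let sT l : sy n.+2 (fun=> 1) (fun p => tgt e (u p) l).
Proof. exact: sy_fast h1 hwmu hkmu (symb_tgt e hwk c0 hdet hu l). Qed.
Let sdn i l : sy n.+1 (fun p => s p * w p) (fun p => pd i (nrm (u p) l)).
Proof. exact: sy_fast hsw0 hkmu hkmu (dnrm i l). Qed.
Let sdT i l : sy n.+1 (fun p => s p * w p) (fun p => pd i (tgt e (u p) l)).
Proof. exact: sy_fast hsw0 hkmu hkmu (dtgt i l). Qed.
Let hw0k : \forall p \near F, 0 <= w p <= k p. Proof. by apply: filterS ok => p []. Qed.
Let hw0mu : \forall p \near F, 0 <= w p <= mu p.
Proof. by apply: filterS ok => p [_ /andP[-> /le_trans h] /h ->]. Qed.
Let sb : sy n.+2 s b. Proof. exact: sy_fast hs0 hw0mu hkmu hb. Qed.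
Let sdb i : sy n.+1 (fun p => s p * w p) (fun p => pd i (b p)).
Proof. exact: sy_fast hsw0 hkmu hkmu (symb_pd i hb). Qed.

Let bk : symb n.+1 s k k b.
Proof. exact: symb_slow hs0 hw0k (symb_pred hb). Qed.

Lemma symb_dir m (A w1 k1 : P -> R) g : symb m.+1 A w1 k1 g ->
  symb m (fun p => A p * w1 p) k1 k1 (fun p => dir e (g p)).
Proof. by move=> sg; apply: symbD; apply: symbZ; exact: symb_pd. Qed.

Let dsff i j : symb n.+1 (fun p => s p * w p) k k (fun p => sff (u p) i j).
Proof.
have hui i' l : symb n.+1 (fun=> 1) k k (fun p x => du (u p) i' x l).
  exact: symb_slow h1 hwk (symb_pred (hu i' l)).
have hni i' l : symb n.+1 (fun p => s p * w p) k k (fun p x => du (nrm (u p)) i' x l) by exact: dnrm.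
by apply: symbD; (apply: symb_eqA (symb_vd hkk h1 hsw0 (hui _) (hni _)) => p; rewrite mul1r).
Qed.

Let ssff i j : sy n.+1 (fun p => s p * w p) (fun p => sff (u p) i j).
Proof. exact: sy_fast hsw0 hkmu hkmu (dsff i j). Qed.

Let dspread : symb n.+1 (fun p => s p * w p) k k (fun p x => spread e f (fun i j => sff (u p) i j x)).
Proof. by apply: symb_sum => i; apply: symb_sum => j; exact: symbZ. Qed.

Let kB : symb n.+1 (fun p => s p * (s p * w p)) k k (fun p x => b p x * dir e (b p) x).
Proof. by apply: symbM => //; exact: symb_dir. Qed.
Let kH : symb n.+1 (fun p => s p * (s p * w p)) k k
  (fun p x => b p x * spread e f (fun i j => sff (u p) i j x)).
Proof. exact: symbM. Qed.

Let hssw0 : \forall p \near F, 0 <= s p * (s p * w p).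
Proof. by apply: filterS2 hs0 hsw0 => p; apply: mulr_ge0. Qed.

Let sBb : sy n.+1 (fun p => s p * (s p * w p)) (fun p x => b p x * dir e (b p) x).
Proof. exact: sy_fast hssw0 hkmu hkmu kB. Qed.
Let sHb : sy n.+1 (fun p => s p * (s p * w p)) 
  (fun p x => b p x * spread e f (fun i j => sff (u p) i j x)).
Proof. exact: sy_fast hssw0 hkmu hkmu kH. Qed.

Let sm m : sy m m' (fun p _ => m' p). Proof. exact: sy_scalar. Qed.

Lemma sy_wrinkle : sy n.+2 (fun p => s p * m' p) (fun p => wrinkle (mu p) e (b p)).
Proof. by apply: sy_amp (syM (sm _) (syM sb (sS _))) => p _ _; rewrite mulr1 mulrC. Qed.

Lemma sy_slide0 : sy n.+2 (fun p => s p * s p * m' p) (fun p => slide0 (mu p) e (b p)).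
Proof.
apply: sy_amp (syM (sm _) (syZ (- 4^-1) (syM (syM sb sb) (syM (sS _) (sC _))))) => p _ _.
by rewrite !mulr1 mulrC.
Qed.

(** One order less than for [slide0]: a derivative of [b] or of the normal already occurs in the
    definition. *)
Lemma sy_slide1 : sy n.+1 (fun p => m' p * m' p * (s p * (s p * w p)))
  (fun p => slide1 (mu p) e f (u p) (b p)).
Proof.
apply: syM; first by apply: syM.
apply: syD.
  have := syZ (2^-1) (syM sHb (sC n.+1)).
  move=> h; apply: sy_amp (sy_ext _ h); first by move=> p _ _; rewrite mulr1.
  by apply: nearW => p x _; rewrite !mulrA.
have := syZ (8^-1) (syM sBb (syB (syM (sC n.+1) (sC n.+1)) (syM (sS n.+1) (sS n.+1)))).
by apply: sy_amp => p _ _; rewrite !mulr1.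
Qed.

Lemma scales_inv p : scales_ok p -> [/\ 0 <= m' p, mu p * m' p = 1 & 0 <= w p * m' p <= 1].
Proof.
move=> [_ /andP[w0 wk] km m0]; split; first by rewrite invr_ge0 ltW.
  by rewrite mulfV// gt_eqF.
by rewrite /m' divr_ge0 ?(ltW m0)//= ler_pdivrMr// mul1r (le_trans wk).
Qed.

Lemma sy_slide : sy n.+1 (fun p => s p * s p * m' p) (fun p => slide (mu p) e f (u p) (b p)).
Proof.
apply: syD; first by apply: sy_le sy_slide0.
apply: sy_amp sy_slide1 => p okp _; have [m0 _ /andP[y0 y1]] := scales_inv okp.
have [/andP[s0 _] _ _ _] := okp.
rewrite (_ : m' p * m' p * _ = s p * s p * m' p * (w p * m' p)); last by ring.
by apply: ler_piMr => //; rewrite !mulr_ge0.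
Qed.

Lemma sy_corr l : sy n.+1 (fun p => s p * m' p)
  (fun p x => corr (mu p) e f (u p) (b p) l x - u p l x).
Proof.
apply: (@sy_ext _ _ (fun p x => wrinkle (mu p) e (b p) x * nrm (u p) l x + slide (mu p) e f (u p) (b p) x * tgt e (u p) l x)).
  by apply: nearW => p x _; rewrite /corr addrAC subrr add0r.
apply: syD.
  by apply: sy_amp (syM (sy_le _ sy_wrinkle) (sy_le _ (sn l))) => // p _ _; rewrite mulr1.
apply: sy_amp (syM sy_slide (sy_le _ (sT l))) => // p okp _; rewrite mulr1.
have [m0 _ _] := scales_inv okp; have [/andP[s0 s1] _ _ _] := okp.
by rewrite ler_wpM2r// ler_piMl.
Qed.

Let AR p := s p ^+ 3 * (w p * m' p) + s p ^+ 4.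

(** Surplus factors [s] and [w / mu], all at most 1, are dropped. *)
Lemma AR_bound3 p (B : R) (i j : nat) : scales_ok p ->
  B = s p ^+ 3 * (w p * m' p) * (s p ^+ i * (w p * m' p) ^+ j) -> B <= AR p.
Proof.
move=> okp ->; have [m0 _ /andP[y0 y1]] := scales_inv okp; have [/andP[s0 s1] _ _ _] := okp.
apply: (@le_trans _ _ (s p ^+ 3 * (w p * m' p))); last by rewrite lerDl exprn_ge0.
apply: ler_piMr; first by rewrite mulr_ge0// exprn_ge0.
by rewrite mulr_ile1 ?exprn_ge0// exprn_ile1.
Qed.

Lemma AR_bound4 p (B : R) (i j : nat) : scales_ok p ->
  B = s p ^+ 4 * (s p ^+ i * (w p * m' p) ^+ j) -> B <= AR p.
Proof.
move=> okp ->; have [m0 _ /andP[y0 y1]] := scales_inv okp; have [/andP[s0 s1] _ _ _] := okp.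
apply: (@le_trans _ _ (s p ^+ 4)); last by rewrite lerDr mulr_ge0// exprn_ge0.
apply: ler_piMr; first by rewrite exprn_ge0.
by rewrite mulr_ile1 ?exprn_ge0// exprn_ile1.
Qed.

(** A derivative of the normal or of [tgt] costs [s w]; a derivative of a displacement costs [mu]
    and cancels its prefactor. A quadratic product of displacements with one derivative of these
    fields is thus of order [s^3 w / mu], and the square of the gradient of the slide of order
    [s^4]. *)
Lemma sy_corr_rem i j : sy n AR (fun p => corr_rem (mu p) e f (u p) (b p) i j).
Proof.
have be : sy n (fun p => s p * m' p) (fun p => wrinkle (mu p) e (b p)) by apply: sy_le sy_wrinkle; rewrite leqW.
have ta : sy n (fun p => s p * s p * m' p) (fun p => slide (mu p) e f (u p) (b p)).
  by apply: sy_le sy_slide.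
have pbe l : sy n s (fun p => pd l (wrinkle (mu p) e (b p))).
  apply: sy_amp (sy_pd l (sy_le (leqnSn _) sy_wrinkle)) => // p okp _.
  by have [_ mm _] := scales_inv okp; rewrite -mulrA [m' p * _]mulrC mm mulr1.
have pta l : sy n (fun p => s p * s p) (fun p => pd l (slide (mu p) e f (u p) (b p))).
  apply: sy_amp (sy_pd l sy_slide) => p okp _.
  by have [_ mm _] := scales_inv okp; rewrite -mulrA [m' p * _]mulrC mm mulr1.
have U1 i' l : sy n (fun=> 1) (fun p x => du (u p) i' x l) by apply: sy_le (su i' l); rewrite leqW.
have N1 l : sy n (fun=> 1) (fun p => nrm (u p) l) by apply: sy_le (sn l); rewrite leqW.
have T1 l : sy n (fun=> 1) (fun p => tgt e (u p) l) by apply: sy_le (sT l); rewrite leqW.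
have DN i' l : sy n (fun p => s p * w p) (fun p x => du (nrm (u p)) i' x l) by apply: sy_le (sdn i' l).
have DT i' l : sy n (fun p => s p * w p) (fun p x => du (tgt e (u p)) i' x l) by apply: sy_le (sdT i' l).
have symm (A : P -> R) (g h : P -> E -> R) : sy n A g -> sy n A h -> sy n A (fun p x => g p x + h p x) by apply: syD.
apply: syD; [apply: syD; [apply: syD; [apply: syD; [apply: syD; [apply: syD; [apply: syD; [apply: syD|]|]|]|]|]|]|].
- apply: sy_amp (syM ta (syD (sy_vd (U1 i) (DT j)) (sy_vd (U1 j) (DT i)))) => p okp _.
  apply: (@AR_bound3 _ _ 0 0) => //; ring.
- apply: sy_amp (syM be (syD (syM (pbe i) (sy_vd N1 (DN j))) (syM (pbe j) (sy_vd N1 (DN i))))) => p okp _.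
  apply: (@AR_bound3 _ _ 0 0) => //; ring.
- apply: sy_amp (syM ta (syD (syM (pbe i) (sy_vd N1 (DT j))) (syM (pbe j) (sy_vd N1 (DT i))))) => p okp _.
  apply: (@AR_bound3 _ _ 1 0) => //; ring.
- apply: sy_amp (syM (syM be be) (sy_vd (DN i) (DN j))) => p okp _.
  apply: (@AR_bound4 _ _ 0 2) => //; ring.
- apply: sy_amp (syM be (syD (syM (pta j) (sy_vd (DN i) T1)) (syM (pta i) (sy_vd (DN j) T1)))) => p okp _.
  apply: (@AR_bound4 _ _ 0 1) => //; ring.
- apply: sy_amp (syM (syM be ta) (syD (sy_vd (DN i) (DT j)) (sy_vd (DN j) (DT i)))) => p okp _.
  apply: (@AR_bound4 _ _ 1 2) => //; ring.
- apply: sy_amp (syM (syM (pta i) (pta j)) (sy_vd T1 T1)) => p okp _.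
  apply: (@AR_bound4 _ _ 0 0) => //; ring.
- apply: sy_amp (syM ta (syD (syM (pta i) (sy_vd T1 (DT j))) (syM (pta j) (sy_vd T1 (DT i))))) => p okp _.
  apply: (@AR_bound4 _ _ 1 1) => //; ring.
- apply: sy_amp (syM (syM ta ta) (sy_vd (DT i) (DT j))) => p okp _.
  apply: (@AR_bound4 _ _ 2 2) => //; ring.
Qed.

Let defect_near : \forall p \near F, forall i j x, U x ->
  corr_defect (mu p) e f (u p) (b p) i j x = corr_defect_expr (mu p) e f (u p) (b p) i j x.
Proof.
have hn' : \forall p \near F, forall l i x, U x -> derivable (nrm (u p) l) x (delta_mx 0 i).
  apply: filterS3 (sy_derivable (sn 0)) (sy_derivable (sn 1)) (sy_derivable (sn 2)) => p a0 a1 a2 l i x Ux.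
  case: l => -[|[|[|//]]] hl.
  - by rewrite (_ : Ordinal hl = 0); [exact: a0|apply/val_inj].
  - by rewrite (_ : Ordinal hl = 1); [exact: a1|apply/val_inj].
  - by rewrite (_ : Ordinal hl = 2); [exact: a2|apply/val_inj].
have ht' : \forall p \near F, forall l i x, U x -> derivable (tgt e (u p) l) x (delta_mx 0 i).
  apply: filterS3 (sy_derivable (sT 0)) (sy_derivable (sT 1)) (sy_derivable (sT 2)) => p a0 a1 a2 l i x Ux.
  case: l => -[|[|[|//]]] hl.
  - by rewrite (_ : Ordinal hl = 0); [exact: a0|apply/val_inj].
  - by rewrite (_ : Ordinal hl = 1); [exact: a1|apply/val_inj].
  - by rewrite (_ : Ordinal hl = 2); [exact: a2|apply/val_inj].
have h3 := fI (fI hder (sy_derivable sb)) (fI hn' ht').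
have h4 := fI (fI (sy_derivable sy_wrinkle) (sy_derivable sy_slide0)) (sy_derivable sy_slide1).
have H := fI (fI ok hdet) (fI h3 h4).
apply: (@filterS _ F FF _ _ _ H) => p [[[_ _ _ m0] hd] [[[a1 a2] [a3 a4]] [[a5 a6] a7]]] i j x Ux.
apply: corr_defectE => //.
- by rewrite gt_eqF.
- by move=> l i'; exact: a1.
- by move=> i'; exact: a2.
- by move=> i'; exact: a5.
- by move=> i'; exact: a6.
- by move=> i'; exact: a7.
- by move=> l i'; exact: a3.
- by move=> l i'; exact: a4.
- exact: lt_le_trans c0 (hd x Ux).
Qed.

Lemma sy_corr_defect i j : sy n (fun p => s p ^+ 2 * (w p * m' p) + s p ^+ 4)
  (fun p => corr_defect (mu p) e f (u p) (b p) i j).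
Proof.
pose AD p := s p ^+ 2 * (w p * m' p).
have adA (A : P -> R) g : sy n A g -> (forall p, scales_ok p -> A p <= AD p) ->
    sy n (fun p => s p ^+ 2 * (w p * m' p) + s p ^+ 4) g.
  move=> sg AA; apply: sy_amp sg => p okp _; rewrite (le_trans (AA _ okp))//.
  by rewrite /AD lerDl exprn_ge0//; have [/andP[]] := okp.
apply: (@sy_ext _ _ (fun p => corr_defect_expr (mu p) e f (u p) (b p) i j)).
  by apply: filterS defect_near => p h x Ux; rewrite h.
have db l : sy n (fun p => s p * w p) (fun p => pd l (b p)) by apply: sy_le (sdb l).
have b' : sy n s b by apply: sy_le sb; rewrite leqW.
have ps1 l : sy n (fun p => m' p * (s p * (s p * w p))) (fun p => pd l (slide1 (mu p) e f (u p) (b p))).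
  apply: sy_amp (sy_pd l sy_slide1) => p okp _; have [_ mm _] := scales_inv okp.
  rewrite (_ : m' p * m' p * (s p * (s p * w p)) * mu p = m' p * (s p * (s p * w p)) * (mu p * m' p)); last by ring.
  by rewrite mm mulr1.
apply: syD; [apply: syD; [apply: syD; [apply: syD|]|]|].
- apply: adA (syM (syM (sm _) (syZ (2^-1) (syM b' (syM (sS n) (sC n))))) 
   (syD (syZ (e 0 i) (db j)) (syZ (e 0 j) (db i)))) _ => p okp.
  by rewrite /AD /= le_eqVlt; apply/orP; left; apply/eqP; ring.
- apply: adA (syM (syM (syM (sm _) (sm _)) (syM (sS n) (sS n))) (syM (db i) (db j))) _ => p okp.
  have [m0 _ /andP[y0 y1]] := scales_inv okp; have [/andP[s0 s1] _ _ _] := okp.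
  rewrite (_ : _ * _ = AD p * (w p * m' p)); last by rewrite /AD; ring.
  by apply: ler_piMr => //; rewrite mulr_ge0// exprn_ge0.
- apply: adA (syM (sy_le (leqW (leqnSn n)) sy_wrinkle) (sy_le (leqnSn n) (ssff i j))) _ => // p okp.
  by rewrite /AD /= le_eqVlt; apply/orP; left; apply/eqP; ring.
- apply: adA (syD (syZr (e 0 j) (ps1 i)) (syZr (e 0 i) (ps1 j))) _ => // p okp.
  by rewrite /AD /= le_eqVlt; apply/orP; left; apply/eqP; ring.
- apply: sy_amp (sy_corr_rem i j) => p okp _; rewrite /AR lerD2r.
  have [m0 _ /andP[y0 y1]] := scales_inv okp; have [/andP[s0 s1] _ _ _] := okp.
  by rewrite ler_wpM2r// exprS ler_piMl// exprn_ge0.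
Qed.

(** Compared with [sy_corr_defect], the term [s^2 w / mu] gains a factor [k / mu]: after the
    integration by parts one more derivative falls on the slow coefficients, at their frequency
    [k]. *)
Lemma spread_defect_bound : exists C : R, \forall p \near F, forall x, U x ->
  `|spread e f (fun i j => corr_defect (mu p) e f (u p) (b p) i j x)| <=
  C * (s p ^+ 2 * (w p * m' p) * (k p * m' p) + s p ^+ 3 * (w p * m' p) + s p ^+ 4).
Proof.
pose A2 p := s p ^+ 2 * (w p * m' p) * (k p * m' p) + s p ^+ 3 * (w p * m' p) + s p ^+ 4.
have a2A (A : P -> R) g : sy 0 A g -> (forall p, scales_ok p -> A p <= s p ^+ 2 * (w p * m' p) * (k p * m' p)) -> sy 0 A2 g.
  move=> sg AA; apply: sy_amp sg => p okp _; rewrite (le_trans (AA _ okp))// /A2 -addrA lerDl.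
  have [m0 _ /andP[y0 y1]] := scales_inv okp; have [/andP[s0 s1] _ _ _] := okp.
  by apply: addr_ge0; [apply: mulr_ge0; [exact: exprn_ge0|exact: y0]|exact: exprn_ge0].
have dk g (A : P -> R) : (\forall p \near F, 0 <= A p) -> symb n.+1 A k k g ->
    sy 0 (fun p => A p * k p) (fun p => dir e (g p)).
  move=> A0 sg; apply: sy_fast hkmu hkmu (symb_le (leq0n n) (symb_dir sg)).
  by apply: filterS2 A0 hkk => p A0 /andP[k0 _]; rewrite mulr_ge0.
have db v : sy 0 (fun p => s p * w p) (fun p => dir v (b p)).
  apply: (@sy_le n); first by [].
  by apply: syD; apply: syZ; apply: sy_le (sdb _).
have [_ hE] : sy 0 A2 (fun p x => (m' p * m' p * (dir e (fun y => b p y * spread e f (fun i j => sff (u p) i j y)) x * cos (mu p * dot e x)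
     + 4^-1 * (dir e (fun y => b p y * dir e (b p) y) x * (cos (mu p * dot e x) * cos (mu p * dot e x) - sin (mu p * dot e x) * sin (mu p * dot e x)))
     + sin (mu p * dot e x) * sin (mu p * dot e x) * (dir e (b p) x * dir e (b p) x - dir f (b p) x * dir f (b p) x)))
  + spread e f (fun i j => corr_rem (mu p) e f (u p) (b p) i j x)).
  apply: syD.
    have s1 : sy 0 (fun p => s p * (s p * w p) * k p) (fun p x => dir e (fun y => b p y * spread e f (fun i j => sff (u p) i j y)) x * cos (mu p * dot e x)).
      by apply: sy_amp (syM (dk _ _ hssw0 kH) (sC 0)) => p _ _; rewrite mulr1.
    have s2 : sy 0 (fun p => s p * (s p * w p) * k p) (fun p x => 4^-1 * (dir e (fun y => b p y * dir e (b p) y) x * (cos (mu p * dot e x) * cos (mu p * dot e x) - sin (mu p * dot e x) * sin (mu p * dot e x)))).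
      by apply: sy_amp (syZ (4^-1) (syM (dk _ _ hssw0 kB) (syB (syM (sC 0) (sC 0)) (syM (sS 0) (sS 0))))) => p _ _; rewrite !mulr1.
    have s3 : sy 0 (fun p => s p * (s p * w p) * k p) (fun p x => sin (mu p * dot e x) * sin (mu p * dot e x) * (dir e (b p) x * dir e (b p) x - dir f (b p) x * dir f (b p) x)).
      apply: sy_amp (syM (syM (sS 0) (sS 0)) (syB (syM (db e) (db e)) (syM (db f) (db f)))) => p [/andP[s0 _] /andP[w0 wk] _ _] _.
      rewrite (_ : _ * _ = s p * (s p * w p) * w p); last by ring.
      by apply: ler_wpM2l wk; rewrite !mulr_ge0.
    apply: a2A (syM (syM (sm _) (sm _)) (syD (syD s1 s2) s3)) _ => p okp.
    by rewrite /= le_eqVlt; apply/orP; left; apply/eqP; ring.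
  have rr i j : sy 0 A2 (fun p => corr_rem (mu p) e f (u p) (b p) i j).
    apply: sy_amp (sy_le _ (sy_corr_rem i j)) => // p okp _; rewrite /A2 /AR.
    have [m0 _ /andP[y0 y1]] := scales_inv okp; have [/andP[s0 s1] /andP[w0 wk] _ _] := okp.
    by rewrite -addrA lerDr !mulr_ge0// ?exprn_ge0// (le_trans w0 wk).
  have [A20 _] := rr 0 0; split=> //.
  by apply: symb_sum => i; apply: symb_sum => j; apply: symbZ; case: (rr i j).
have [C hC] := symb_sup hE; exists C.
have h3 := fI (symb_derivable kH) (symb_derivable kB).
have H := fI (fI ok hC) (fI defect_near h3).
apply: (@filterS _ F FF _ _ _ H) => p [[[_ _ _ m0] hC'] [hd [dH dB]]] x Ux.
have := hC' x Ux.
rewrite (eq_spread _ _ (fun i j => hd i j x Ux)) spread_corr_defect ?gt_eqF//.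
- by move=> i; exact: dH.
- by move=> i; exact: dB.
Qed.

End StepSymbols.

(** * Smoothing by averages over the disk *)

Section AxisCalculus.
Variable R : realType.
Local Notation E := 'rV[R]_2.
Local Notation U := (@open_disk R).
Implicit Types (g : E -> R) (x y : E) (i : 'I_2) (M t : R).

Lemma in_disk x : U x <-> x 0 0 ^+ 2 + x 0 1 ^+ 2 < 1.
Proof. by rewrite open_diskE /= dot2E !expr2. Qed.

Lemma is_derive_axis g x i t : derivable g (t *: delta_mx 0 i + x) (delta_mx 0 i) ->
  is_derive t 1 (fun h => g (h *: delta_mx 0 i + x)) (pd i g (t *: delta_mx 0 i + x)).
Proof.
move=> /is_derive_pd/is_derive_line dg.
have ds : is_derive t 1 (fun h : R => h - t) 1.
  have := is_deriveB (is_derive_id t 1) (is_derive_cst t t 1).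
  by rewrite subr0.
have z : t - t = 0 by rewrite subrr.
have := @is_derive1_comp R (fun h => g (h *: delta_mx 0 i + (t *: delta_mx 0 i + x))) (fun h => h - t) t.
rewrite z => /(_ _ _ dg ds); rewrite mulr1.
have -> // : (fun h => g (h *: delta_mx 0 i + (t *: delta_mx 0 i + x))) \o (fun h => h - t) =
  (fun h => g (h *: delta_mx 0 i + x)).
by apply/funext => h /=; rewrite addrA -scalerDl subrK.
Qed.

Lemma disk_axis x i (a b t : R) : U (a *: delta_mx 0 i + x) -> U (b *: delta_mx 0 i + x) ->
  a <= t <= b -> U (t *: delta_mx 0 i + x).
Proof.
have sq (X A B T c : R) : (A + X) ^+ 2 + c < 1 -> (B + X) ^+ 2 + c < 1 ->
    A <= T <= B -> (T + X) ^+ 2 + c < 1.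
  move=> h1 h2 /andP[h3 h4]; have [h5|h5] := leP 0 (T + X).
    have : (T + X) ^+ 2 <= (B + X) ^+ 2 by rewrite ler_sqr ?nnegrE//; lra.
    by lra.
  have : (- (T + X)) ^+ 2 <= (- (A + X)) ^+ 2 by rewrite ler_sqr ?nnegrE//; lra.
  by rewrite !sqrrN; lra.
move=> /in_disk h1 /in_disk h2 ht; apply/in_disk; move: h1 h2; rewrite !mxE.
case: (ord2_case i) => -> /=; rewrite ?(mulr1, mulr0, add0r).
  by move=> h1 h2; exact: sq h1 h2 ht.
rewrite ![x 0 0 ^+ 2 + _]addrC => h1 h2; exact: sq h1 h2 ht.
Qed.

(** The intermediate point is given as a fraction [th] of the displacement, which treats both signs
    of [t] alike. *)
Lemma axis_MVT g x i t : (forall y, U y -> derivable g y (delta_mx 0 i)) ->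
  U x -> U (t *: delta_mx 0 i + x) -> exists th, [/\ 0 <= th <= 1,
  U ((th * t) *: delta_mx 0 i + x) & 
  g (t *: delta_mx 0 i + x) - g x = t * pd i g ((th * t) *: delta_mx 0 i + x)].
Proof.
move=> dg Ux Ut.
have U0 : U (0 *: delta_mx 0 i + x) by rewrite scale0r add0r.
have gen (a b : R) : a < b -> U (a *: delta_mx 0 i + x) -> U (b *: delta_mx 0 i + x) ->
    exists2 c, a <= c <= b & g (b *: delta_mx 0 i + x) - g (a *: delta_mx 0 i + x) =
      pd i g (c *: delta_mx 0 i + x) * (b - a).
  move=> ab Ua Ub.
  have der c : a <= c <= b -> is_derive c 1 (fun h => g (h *: delta_mx 0 i + x)) (pd i g (c *: delta_mx 0 i + x)).
    by move=> cab; apply: is_derive_axis; apply: dg; exact: disk_axis Ua Ub cab.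
  have [| |c] := MVT_segment (ltW ab) (f := fun h => g (h *: delta_mx 0 i + x))
     (df := fun c => pd i g (c *: delta_mx 0 i + x)).
  - by move=> c; rewrite in_itv /= => /andP[ac cb]; apply: der; rewrite !ltW.
  - apply: derivable_within_continuous => c; rewrite in_itv /= => cab.
    by have [] := der _ cab.
  - by rewrite in_itv /= => cab e; exists c.
have [t0|t0|t0] := ltgtP 0 t.
- have [c /andP[c0 ct] e] := gen _ _ t0 U0 Ut; exists (c / t); split.
  + by rewrite divr_ge0 ?(ltW t0)//= ler_pdivrMr// mul1r.
  + rewrite divfK ?gt_eqF//; apply: disk_axis U0 Ut _; by rewrite c0.
  + by move: e; rewrite scale0r add0r subr0 divfK ?gt_eqF// mulrC.
- have [c /andP[c0 ct] e] := gen _ _ t0 Ut U0; exists (c / t); split.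
  + by rewrite -mulrNN -invrN divr_ge0 ?oppr_ge0 ?(ltW t0)//= ler_pdivrMr ?oppr_gt0// mul1r lerN2.
  + rewrite divfK ?lt_eqF//; apply: disk_axis Ut U0 _; by rewrite c0.
  + move: e; rewrite scale0r add0r sub0r divfK ?lt_eqF// => e.
    by rewrite -opprB e mulrN opprK mulrC.
- exists 0; rewrite lexx ler01 mul0r; split=> //.
  by rewrite -t0 !scale0r !add0r mul0r subrr.
Qed.

Lemma axis_lip g x i t M : (forall y, U y -> derivable g y (delta_mx 0 i)) ->
  (forall y, U y -> `|pd i g y| <= M) -> U x -> U (t *: delta_mx 0 i + x) ->
  `|g (t *: delta_mx 0 i + x) - g x| <= M * `|t|.
Proof.
move=> dg bg Ux Ut; have [th [_ Uth ->]] := axis_MVT dg Ux Ut.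
by rewrite normrM mulrC ler_wpM2r// bg.
Qed.

(** The l1 distance, suited to paths that follow the axes. *)
Definition dist1 x y := `|x 0 0 - y 0 0| + `|x 0 1 - y 0 1|.

(* One of the two corners of the axis-parallel rectangle spanned by two points of
   the disk is in the disk: their squared norms add up to those of the points. *)
Lemma disk_lip g M : (forall i y, U y -> derivable g y (delta_mx 0 i)) ->
  (forall i y, U y -> `|pd i g y| <= M) -> forall x y, U x -> U y ->
  `|g x - g y| <= M * dist1 x y.
Proof.
move=> dg bg.
have half x y : U x -> U y -> U ((y 0 0 - x 0 0) *: delta_mx 0 0 + x) -> `|g x - g y| <= M * dist1 x y.
  move=> Ux Uy Uc; set z := (_ *: _ + x) in Uc.
  have ez : y = (y 0 1 - x 0 1) *: delta_mx 0 1 + z.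
    apply/rowP => j; rewrite !mxE; case: (ord2_case j) => -> /=.
      by rewrite mulr0 add0r mulr1 subrK.
    by rewrite mulr1 mulr0 add0r subrK.
  have h1 := axis_lip (dg 0) (bg 0) Ux Uc.
  have h2 : `|g y - g z| <= M * `|y 0 1 - x 0 1|.
    by rewrite {1}ez; apply: axis_lip => //; [exact: dg|exact: bg|rewrite -ez].
  have -> : g x - g y = - ((g y - g z) + (g z - g x)) by rewrite addrA subrK opprB.
  rewrite normrN (le_trans (ler_normD _ _))// /dist1 mulrDr addrC.
  by rewrite [`|x 0 0 - _|]distrC [`|x 0 1 - _|]distrC lerD.
move=> x y Ux Uy.
have [c|c] := ltP (y 0 0 ^+ 2 + x 0 1 ^+ 2) 1.
  apply: half => //; apply/in_disk; rewrite !mxE /= mulr1 mulr0 add0r subrK //.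
rewrite distrC /dist1 [`|x 0 0 - _|]distrC [`|x 0 1 - _|]distrC; apply: half => //.
move/in_disk: Ux; move/in_disk: Uy => hy hx.
by apply/in_disk; rewrite !mxE /= mulr1 mulr0 add0r subrK; lra.
Qed.

End AxisCalculus.

(** * Means through primitives *)

Section Mean.
Variable R : realType.
Implicit Types (phi Phi : R -> R) (M c : R).

Definition prim phi Phi := forall s : R, -1 <= s <= 1 -> is_derive s 1 Phi (phi s).

(** A mean over [[-1, 1]] taken from any primitive. Linearity follows from that of primitives,
    bounds from the mean value theorem, and derivatives of averages from the primitive itself. The
    value is 0 if there is no primitive. *)
Definition mean phi : R :=
  xget 0 [set v | exists2 Phi, prim phi Phi & v = 2^-1 * (Phi 1 - Phi (-1))].

Lemma prim_MVT phi Phi : prim phi Phi ->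
  exists2 c, -1 <= c <= 1 & 2^-1 * (Phi 1 - Phi (-1)) = phi c.
Proof.
move=> h; have m11 : (-1 : R) <= 1 by lra.
have [| |c] := MVT_segment m11 (f := Phi) (df := phi).
- by move=> c; rewrite in_itv /= => /andP[a b]; apply: h; rewrite !ltW.
- by apply: derivable_within_continuous => c; rewrite in_itv /= => /h[].
- rewrite in_itv /= => hc ->; exists c => //.
  by rewrite opprK (_ : 1 + 1 = 2)// mulrCA mulVf ?mulr1.
Qed.

Lemma primD phi psi Phi Psi : prim phi Phi -> prim psi Psi ->
  prim (fun s => phi s + psi s) (fun s => Phi s + Psi s).
Proof. by move=> h1 h2 s hs; apply: is_deriveD; [exact: h1|exact: h2]. Qed.

Lemma primZ c phi Phi : prim phi Phi -> prim (fun s => c * phi s) (fun s => c * Phi s).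
Proof. by move=> h s hs; apply: is_deriveZ; exact: h. Qed.

(** Independence of the primitive: the difference of two primitives is a primitive of 0, and the
    mean value theorem shows that it has equal values at both ends. *)
Lemma meanE phi Phi : prim phi Phi -> mean phi = 2^-1 * (Phi 1 - Phi (-1)).
Proof.
move=> h; rewrite /mean; case: xgetP => [v _ [Psi h2 ->]|/(_ (2^-1 * (Phi 1 - Phi (-1))))]; last first.
  by case; exists Phi.
have [c _ h0] := prim_MVT (primD h2 (primZ (-1) h)).
have {}h0 := etrans h0 (_ : phi c + -1 * phi c = 0).
apply/eqP; rewrite -subr_eq0; apply/eqP; rewrite -h0; ring.
Qed.
Definition hasprim phi := exists Phi, prim phi Phi.

Lemma mean_bound phi M : hasprim phi -> (forall s, -1 <= s <= 1 -> `|phi s| <= M) -> `|mean phi| <= M.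
Proof.
by move=> [Phi h] hM; rewrite (meanE h); have [c hc ->] := prim_MVT h; apply: hM.
Qed.

Lemma hasprimD phi psi : hasprim phi -> hasprim psi -> hasprim (fun s => phi s + psi s).
Proof. by move=> [Phi h1] [Psi h2]; exists (fun s => Phi s + Psi s); exact: primD. Qed.

Lemma hasprimZ c phi : hasprim phi -> hasprim (fun s => c * phi s).
Proof. by move=> [Phi h]; exists (fun s => c * Phi s); exact: primZ. Qed.

Lemma prim_cst c : prim (fun=> c) (fun s => c * s).
Proof. by move=> s _; apply: is_derive_eq; rewrite /GRing.scale/=; ring. Qed.

Lemma meanD phi psi : hasprim phi -> hasprim psi ->
  mean (fun s => phi s + psi s) = mean phi + mean psi.
Proof.
move=> [Phi h1] [Psi h2]; rewrite (meanE (primD h1 h2)) (meanE h1) (meanE h2); ring.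
Qed.

Lemma meanZ c phi : hasprim phi -> mean (fun s => c * phi s) = c * mean phi.
Proof. move=> [Phi h1]; rewrite (meanE (primZ c h1)) (meanE h1); ring. Qed.

Lemma mean_cst c : mean (fun=> c) = c.
Proof. rewrite (meanE (prim_cst c)); lra. Qed.

Lemma mean_sub_bound phi psi M : hasprim phi -> hasprim psi ->
  (forall s, -1 <= s <= 1 -> `|phi s - psi s| <= M) -> `|mean phi - mean psi| <= M.
Proof.
move=> h1 h2 h; rewrite -[- mean psi]mulN1r -(meanZ (-1) h2) -meanD//; last exact: hasprimZ.
apply: mean_bound; first by apply: hasprimD => //; exact: hasprimZ.
by move=> s /h; rewrite mulN1r.
Qed.

Lemma primitive_exists (g : R -> R) (a : R) : continuous g ->
  exists G, forall t, - a < t < a -> is_derive t 1 G (g t).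
Proof.
move=> cg.
pose G x := (\int[lebesgue_measure]_(t in `[(- a)%R, x]) (g t))%R.
exists G => t /andP[ta tb].
have ig : lebesgue_measure.-integrable `[- a, a] (EFin \o g).
  apply: continuous_compact_integrable; first exact: segment_compact.
  by apply: continuous_subspaceT.
have [dG eG] := continuous_FTC1_closed tb ig ta (cg t).
exact: (DeriveDef dG (etrans (esym (derive1E _ _)) eG)).
Qed.

Definition clamp (a t : R) : R := Num.max (- a) (Num.min t a).

Lemma clamp_id (a t : R) : - a <= t <= a -> clamp a t = t.
Proof. by move=> /andP[h1 h2]; rewrite /clamp (min_idPl h2) (max_idPr h1). Qed.

Lemma clamp_itv (a t : R) : 0 <= a -> - a <= clamp a t <= a.
Proof.
move=> a0; rewrite /clamp le_max lexx /= ge_max ge_min lexx orbT andbT.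
lra.
Qed.

Lemma clamp_lip (a s t : R) : `|clamp a s - clamp a t| <= `|s - t|.
Proof.
rewrite /clamp; wlog st : s t / s <= t.
  move=> h; have [/h//|/ltW/h] := leP s t.
  by rewrite distrC [X in _ <= X]distrC.
rewrite [`|s - t|]ler0_norm ?subr_le0//; 
by case: (leP s a) => h1; case: (leP t a) => h2;
  case: (leP (- a) s) => h3; case: (leP (- a) t) => h4; case: (leP (- a) a) => h5;
  rewrite ler_norml; apply/andP; split; lra.
Qed.

(** The function is controlled on a segment only. Composing with [clamp] makes it continuous on the
    whole line and leaves it unchanged on the segment, so the fundamental theorem of calculus
    applies. *)
Lemma uc_primitive (phi : R -> R) (a : R) : 0 < a ->
  (forall e, 0 < e -> exists2 d, 0 < d & forall s t, - a <= s <= a -> - a <= t <= a ->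
     `|s - t| < d -> `|phi s - phi t| < e) ->
  exists G, forall t, - a < t < a -> is_derive t 1 G (phi t).
Proof.
move=> a0 uc; have [] := @primitive_exists (phi \o clamp a) a.
  move=> t; apply/cvgrPdist_lt => e e0; have [d d0 hd] := uc e e0.
  apply/nbhs_ballP; exists d => //= s bs; apply: hd; rewrite ?clamp_itv ?(ltW a0)//.
  exact: le_lt_trans (clamp_lip _ _ _) bs.
move=> G hG; exists G => t ht; have := hG t ht.
by rewrite /= clamp_id//; case/andP: ht => ? ?; rewrite !ltW.
Qed.

End Mean.

(** * Functions of class C^n up to the boundary *)

Section UniformContinuity.
Variable R : realType.
Local Notation E := 'rV[R]_2.
Local Notation U := (@open_disk R).
Implicit Types (f h : E -> R) (x y : E) (i j : 'I_2) (l : R) (n : nat).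

Definition uc f := forall e : R, 0 < e -> exists2 d, 0 < d &
  forall x y, U x -> U y -> dist1 x y < d -> `|f x - f y| < e.

Definition bounded_on_disk f := exists M, forall x, U x -> `|f x| <= M.

(** Class C^n on the closed disk expressed inside the open one: uniform continuity of the
    derivatives stands for their continuous extension. *)
Fixpoint ucn n f : Prop := [/\ uc f, bounded_on_disk f &
  if n is m.+1 then (forall i x, U x -> derivable f x (delta_mx 0 i)) /\
    forall i, ucn m (pd i f) else True].

Lemma ucn_uc n f : ucn n f -> uc f. Proof. by case: n => [|n] []. Qed.
Lemma ucn_bnd n f : ucn n f -> bounded_on_disk f. Proof. by case: n => [|n] []. Qed.
Lemma ucn_der n f i x : ucn n.+1 f -> U x -> derivable f x (delta_mx 0 i).
Proof. by move=> [_ _ [h _]]; exact: h. Qed.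
Lemma ucn_pd n f i : ucn n.+1 f -> ucn n (pd i f).
Proof. by move=> [_ _ [_ h]]; exact: h. Qed.

Lemma ucn_pred n f : ucn n.+1 f -> ucn n f.
Proof.
elim: n f => [|n IH] f [a b [c d]]; split=> //; split=> // i; exact: IH (d i).
Qed.

Lemma ucn_le m n f : (m <= n)%N -> ucn n f -> ucn m f.
Proof. by move=> /subnK <-; elim: (n - m)%N => [//|q IH]; rewrite addSn => /ucn_pred. Qed.

Lemma uc_ext f h : (forall x, U x -> f x = h x) -> uc f -> uc h.
Proof.
move=> fh uf e e0; have [d d0 hd] := uf e e0; exists d => // x y Ux Uy.
by rewrite -!fh//; exact: hd.
Qed.

Lemma ucn_ext n f h : (forall x, U x -> f x = h x) -> ucn n f -> ucn n h.
Proof.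
elim: n f h => [|n IH] f h fh [uf [M bf] r]; (split; first exact: uc_ext fh uf) => //.
- by exists M => x Ux; rewrite -fh// bf.
- by exists M => x Ux; rewrite -fh// bf.
case: r => df hf; split=> i.
  by move=> x Ux; apply: derivable_ext (df i x Ux).
by apply: IH (hf i) => x Ux; apply: pd_ext.
Qed.

Lemma dist1_ge0 x y : 0 <= dist1 x y. Proof. by rewrite addr_ge0. Qed.
Lemma dist1C x y : dist1 x y = dist1 y x.
Proof. by rewrite /dist1 distrC [`|x 0 1 - _|]distrC. Qed.

Lemma lip_uc f M : (forall x y, U x -> U y -> `|f x - f y| <= M * dist1 x y) -> uc f.
Proof.
move=> hM e e0; have M0 : 0 < `|M| + 1 by rewrite ltr_wpDl.
exists (e / (`|M| + 1)); first by rewrite divr_gt0.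
move=> x y Ux Uy; rewrite ltr_pdivlMr// => h.
apply: le_lt_trans (hM _ _ Ux Uy) _; apply: le_lt_trans h.
by rewrite mulrC ler_wpM2l ?dist1_ge0// (le_trans (ler_norm M))// lerDl.
Qed.

Lemma ucD f h : uc f -> uc h -> uc (fun x => f x + h x).
Proof.
move=> uf uh e e0; have e2 : 0 < e / 2 by rewrite divr_gt0.
have [d1 d10 hd1] := uf _ e2; have [d2 d20 hd2] := uh _ e2.
exists (Num.min d1 d2); first by rewrite lt_min d10.
move=> x y Ux Uy; rewrite lt_min => /andP[a b].
have := hd1 _ _ Ux Uy a; have := hd2 _ _ Ux Uy b.
rewrite (_ : _ + _ - _ = (f x - f y) + (h x - h y)); last by ring.
by have := ler_normD (f x - f y) (h x - h y); lra.
Qed.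

Lemma ucM f h : uc f -> bounded_on_disk f -> uc h -> bounded_on_disk h -> uc (fun x => f x * h x).
Proof.
move=> uf [M1 b1] uh [M2 b2] e e0.
pose M := `|M1| + `|M2| + 1.
have M0 : 0 < M by rewrite ltr_wpDl// addr_ge0.
have bf x : U x -> `|f x| <= M.
  by move=> /b1 h1; rewrite /M (le_trans h1)// (le_trans (ler_norm M1))// -addrA lerDl addr_ge0.
have bh x : U x -> `|h x| <= M.
  move=> /b2 h1; rewrite /M (le_trans h1)// (le_trans (ler_norm M2))//.
  by rewrite [`|M1| + _]addrC -addrA lerDl addr_ge0.
have e2 : 0 < e / (2 * M) by rewrite divr_gt0// mulr_gt0.
have [d1 d10 hd1] := uf _ e2; have [d2 d20 hd2] := uh _ e2.
exists (Num.min d1 d2); first by rewrite lt_min d10.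
move=> x y Ux Uy; rewrite lt_min => /andP[a b].
have := hd1 _ _ Ux Uy a; have := hd2 _ _ Ux Uy b.
rewrite !ltr_pdivlMr ?mulr_gt0// => k2 k1.
rewrite (_ : _ * _ - _ = (f x - f y) * h x + f y * (h x - h y)); last by ring.
have := ler_normD ((f x - f y) * h x) (f y * (h x - h y)); rewrite !normrM.
have := ler_wpM2l (normr_ge0 (f x - f y)) (bh x Ux).
have := ler_wpM2r (normr_ge0 (h x - h y)) (bf y Uy).
by lra.
Qed.

Lemma bndD f h : bounded_on_disk f -> bounded_on_disk h -> bounded_on_disk (fun x => f x + h x).
Proof.
move=> [M1 b1] [M2 b2]; exists (M1 + M2) => x Ux.
by rewrite (le_trans (ler_normD _ _))// lerD ?b1 ?b2.
Qed.

Lemma bndM f h : bounded_on_disk f -> bounded_on_disk h -> bounded_on_disk (fun x => f x * h x).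
Proof.
move=> [M1 b1] [M2 b2]; exists (M1 * M2) => x Ux.
by rewrite normrM ler_pM ?b1 ?b2.
Qed.

Lemma ucn_cst n (c : R) : ucn n (fun=> c).
Proof.
have u c' : uc (fun _ : E => c').
  by move=> e e0; exists 1 => // x y _ _ _; rewrite subrr normr0.
have b c' : bounded_on_disk (fun _ : E => c') by exists `|c'|.
elim: n c => [|n IH] c; split=> //; split=> i.
  by move=> x _; exact: derivable_cst.
by apply: ucn_ext (IH 0) => x _; rewrite pd_cst.
Qed.

Lemma ucnD n f h : ucn n f -> ucn n h -> ucn n (fun x => f x + h x).
Proof.
elim: n f h => [|n IH] f h sf sh; (split; [exact: ucD (ucn_uc sf) (ucn_uc sh)|exact: bndD (ucn_bnd sf) (ucn_bnd sh)|]) => //.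
split=> i.
  by move=> x Ux; apply: derivableD; [exact: ucn_der sf Ux|exact: ucn_der sh Ux].
apply: ucn_ext (IH _ _ (ucn_pd i sf) (ucn_pd i sh)) => x Ux.
by rewrite pdD; [| exact: ucn_der sf Ux|exact: ucn_der sh Ux].
Qed.

Lemma ucnM n f h : ucn n f -> ucn n h -> ucn n (fun x => f x * h x).
Proof.
elim: n f h => [|n IH] f h sf sh; (split; [exact: ucM (ucn_uc sf) (ucn_bnd sf) (ucn_uc sh) (ucn_bnd sh)|exact: bndM (ucn_bnd sf) (ucn_bnd sh)|]) => //.
split=> i.
  by move=> x Ux; apply: derivableM; [exact: ucn_der sf Ux|exact: ucn_der sh Ux].
apply: ucn_ext (ucnD (IH _ _ (ucn_pd i sf) (ucn_pred sh)) (IH _ _ (ucn_pred sf) (ucn_pd i sh))) => x Ux.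
by rewrite pdM; [| exact: ucn_der sf Ux|exact: ucn_der sh Ux].
Qed.

Lemma ucnZ n f (c : R) : ucn n f -> ucn n (fun x => c * f x).
Proof. by move=> sf; apply: ucnM => //; exact: ucn_cst. Qed.

Lemma ucnN n f : ucn n f -> ucn n (fun x => - f x).
Proof. by move=> /(ucnZ (-1)); apply: ucn_ext => x _; rewrite mulN1r. Qed.

Lemma ucnB n f h : ucn n f -> ucn n h -> ucn n (fun x => f x - h x).
Proof. by move=> sf /ucnN; exact: ucnD. Qed.

End UniformContinuity.

(** * Averages along one axis *)

Section DiskAverage.
Variable R : realType.
Local Notation E := 'rV[R]_2.
Local Notation U := (@open_disk R).
Implicit Types (f h : E -> R) (x y : E) (i j : 'I_2) (l s t : R) (n : nat).

(* Contracting by [1 - l] keeps the segment of half-length [l] around the point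
   inside the disk, so that no extension of [f] is needed. *)
Definition avpt l i x s : E := (1 - l) *: x + (l * s) *: delta_mx 0 i.

Definition avg l i f x : R := mean (fun s => f (avpt l i x s)).

Lemma avptE l i x s j : avpt l i x s 0 j = (1 - l) * x 0 j + (if j == i then l * s else 0).
Proof.
rewrite !mxE; case: (ord2_case i) => ->; case: (ord2_case j) => -> /=;
  by rewrite ?mulr1 ?mulr0.
Qed.

(** The point is the convex combination, with weights [1 - l] and [l], of [x] and of a point of the
    axis in the closed disk; the square is convex. *)
Lemma avpt_disk l i x s : 0 < l < 1 -> -1 <= s <= 1 -> U x -> U (avpt l i x s).
Proof.
have sq (X Y : R) : X ^+ 2 + Y ^+ 2 < 1 -> 0 < l < 1 -> -1 <= s <= 1 ->
    ((1 - l) * X + l * s) ^+ 2 + ((1 - l) * Y) ^+ 2 < 1.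
  move=> h /andP[l0 l1] /andP[s0 s1].
  have s2 : s ^+ 2 <= 1 by nra.
  have : ((1 - l) * X + l * s) ^+ 2 + ((1 - l) * Y) ^+ 2
     = (1 - l) * (X ^+ 2 + Y ^+ 2) + l * s ^+ 2 - l * (1 - l) * ((X - s) ^+ 2 + Y ^+ 2) by ring.
  move=> ->.
  have : 0 <= l * (1 - l) * ((X - s) ^+ 2 + Y ^+ 2).
    by rewrite mulr_ge0 ?addr_ge0 ?sqr_ge0// mulr_ge0//; lra.
  have : (1 - l) * (X ^+ 2 + Y ^+ 2) < (1 - l) * 1 by rewrite ltr_pM2l//; lra.
  have : l * s ^+ 2 <= l * 1 by rewrite ler_wpM2l// ltW.
  lra.
move=> hl hs /in_disk hx; apply/in_disk; rewrite !avptE.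
case: (ord2_case i) => -> /=; rewrite addr0; first exact: sq.
by rewrite addrC; apply: sq => //; rewrite addrC.
Qed.

Lemma dist1_avpt l i x y s : 0 < l < 1 -> dist1 (avpt l i x s) (avpt l i y s) <= dist1 x y.
Proof.
move=> /andP[l0 l1]; rewrite /dist1 !avptE.
have e (X Y c : R) : `|(1 - l) * X + c - ((1 - l) * Y + c)| <= `|X - Y|.
  rewrite (_ : _ - _ = (1 - l) * (X - Y)); last by ring.
  by rewrite normrM ger0_norm ?ler_piMl//; lra.
by apply: lerD; apply: e.
Qed.

Lemma dist1_axis i x (s t : R) : dist1 (s *: delta_mx 0 i + x) (t *: delta_mx 0 i + x) = `|s - t|.
Proof.
rewrite /dist1 !mxE; case: (ord2_case i) => -> /=.
  by rewrite !mulr1 !mulr0 !add0r subrr normr0 addr0 opprD addrACA subrr addr0.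
by rewrite !mulr1 !mulr0 !add0r subrr normr0 add0r opprD addrACA subrr addr0.
Qed.

Lemma dist1_avptl l i x s : 0 < l < 1 -> -1 <= s <= 1 -> U x ->
  dist1 (avpt l i x s) x <= 3 * l.
Proof.
move=> /andP[l0 l1] /andP[s0 s1] /in_disk hx; rewrite /dist1 !avptE.
have x1 (X Y : R) : X ^+ 2 + Y ^+ 2 < 1 -> `|X| <= 1.
  move=> h; rewrite -(@ler_sqr _ `|X| 1) ?nnegrE// real_normK ?num_real// expr1n.
  by have := sqr_ge0 Y; lra.
have h0 := x1 _ _ hx; have h1 : `|x 0 1| <= 1 by apply: (x1 _ (x 0 0)); rewrite addrC.
have e (X c : R) : `|X| <= 1 -> `|(1 - l) * X + c - X| <= l + `|c|.
  move=> hX; rewrite (_ : _ - _ = c - l * X); last by ring.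
  rewrite (le_trans (ler_normB _ _))// addrC lerD2r normrM (ger0_norm (ltW l0)).
  by rewrite ler_piMr// ltW.
have cs : `|l * s| <= l.
  by rewrite normrM (ger0_norm (ltW l0)) ler_piMr ?(ltW l0)// ler_norml s0.
have a0 c := e _ c h0; have a1 c := e _ c h1.
case: (ord2_case i) => -> /=.
  have := a0 (l * s); have := a1 0; rewrite normr0; lra.
have := a1 (l * s); have := a0 0; rewrite normr0; lra.
Qed.

Lemma avpt_axis l i x s : avpt l i x s = (l * s) *: delta_mx 0 i + (1 - l) *: x.
Proof. by rewrite /avpt addrC. Qed.

(* a segment slightly longer than the one averaged over still lies in the disk *)
Lemma avpt_margin l i x : 0 < l < 1 -> U x -> exists2 d, 0 < d &
  forall t, - (l + d) <= t <= l + d -> U (t *: delta_mx 0 i + (1 - l) *: x).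
Proof.
move=> hl Ux.
have [d d0 hd] : exists2 d, 0 < d & forall X Y : R, X ^+ 2 + Y ^+ 2 = dot x x ->
   forall t, - (l + d) <= t <= l + d -> (t + (1 - l) * X) ^+ 2 + ((1 - l) * Y) ^+ 2 < 1.
  move: Ux; rewrite open_diskE /= => Ux; case/andP: hl => l0 l1.
  have q0 : 0 <= dot x x by rewrite dot2E -!expr2 addr_ge0 ?sqr_ge0.
  pose m := (1 - dot x x) / 8.
  have m0 : 0 < m by rewrite /m divr_gt0// subr_gt0.
  have m1 : m <= 8^-1 by rewrite /m ler_pdivrMr// mulVf// lerBlDr lerDl.
  exists ((1 - l) * m * l); first by rewrite !mulr_gt0// subr_gt0.
  move=> X Y XY t ht.
  have e1 : (t + (1 - l) * X) ^+ 2 + ((1 - l) * Y) ^+ 2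
      = (1 - l) * (X ^+ 2 + Y ^+ 2) + t ^+ 2 / l - (1 - l) / l * ((t - l * X) ^+ 2 + (l * Y) ^+ 2).
    by field; rewrite gt_eqF.
  have e2 : 0 <= (1 - l) / l * ((t - l * X) ^+ 2 + (l * Y) ^+ 2).
    by rewrite mulr_ge0 ?addr_ge0 ?sqr_ge0// divr_ge0 ?ltW// subr_gt0.
  have tt : t ^+ 2 <= (l * (1 + (1 - l) * m)) ^+ 2.
    rewrite -real_normK ?num_real// ler_sqr ?nnegrE//.
      rewrite ler_norml; move: ht; rewrite (_ : l + (1 - l) * m * l = l * (1 + (1 - l) * m)) //; ring.
    by rewrite mulr_ge0 ?(ltW l0)// addr_ge0// mulr_ge0 ?(ltW m0)// subr_ge0 ltW.
  have e3 : t ^+ 2 / l <= l * (1 + (1 - l) * m) ^+ 2.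
    by rewrite ler_pdivrMr// (le_trans tt)// le_eqVlt (_ : _ ^+ 2 = l * (1 + (1 - l) * m) ^+ 2 * l) ?eqxx//; ring.
  have em : dot x x = 1 - 8 * m by rewrite /m; field.
  rewrite e1 XY em.
  have e4 : l * (1 + (1 - l) * m) ^+ 2 <= l + (1 - l) * (3 * m).
    have -> : l * (1 + (1 - l) * m) ^+ 2 = l + (1 - l) * (2 * (l * m) + l * m * ((1 - l) * m)) by ring.
    rewrite lerD2l ler_wpM2l ?subr_ge0 ?(ltW l1)//.
    have h1 : l * m <= m by rewrite ler_piMl ?(ltW m0) ?(ltW l1).
    have h2 : (1 - l) * m <= 1 by nra.
    have h3 : 0 <= l * m by rewrite mulr_ge0 ?(ltW m0) ?(ltW l0).
    by have := ler_wpM2l h3 h2; lra.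
  have : 0 < (1 - l) * m by rewrite mulr_gt0// subr_gt0.
  move: e2 e3 e4.
  move: (t ^+ 2 / l) ((1 - l) / l * _) (l * (1 + _) ^+ 2) => A B D; lra.
exists d => // t ht; apply/in_disk; rewrite !mxE; case: (ord2_case i) => -> /=; rewrite ?mulr0 ?mulr1 ?add0r.
  by apply: hd => //; rewrite dot2E !expr2.
by rewrite [X in X < _]addrC; apply: hd => //; rewrite dot2E !expr2 addrC.
Qed.

Lemma avg_uc_line f l i x : 0 < l < 1 -> uc f -> U x -> exists2 d, 0 < d & exists G : R -> R,
  forall t, - (l + d) < t < l + d -> is_derive t 1 G (f (t *: delta_mx 0 i + (1 - l) *: x)).
Proof.
move=> hl uf Ux; have [d d0 hd] := avpt_margin i hl Ux; exists d => //.
apply: (@uc_primitive _ (fun t => f (t *: delta_mx 0 i + (1 - l) *: x))).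
  by rewrite addr_gt0//; case/andP: hl.
move=> e e0; have [r r0 hr] := uf e e0; exists r => // s t hs ht st.
by apply: hr; [exact: hd|exact: hd|rewrite dist1_axis].
Qed.

Lemma is_derive_affine (G : R -> R) (a c t dG : R) : is_derive (a * t + c) 1 G dG ->
  is_derive t 1 (fun s => G (a * s + c)) (a * dG).
Proof.
move=> h.
have ha : is_derive t 1 (fun s : R => a * s + c) a.
  by apply: is_derive_eq; rewrite /GRing.scale/= addr0 mulr1.
by rewrite mulrC; exact: (@is_derive1_comp R G (fun s => a * s + c) t dG a).
Qed.

Lemma avg_hasprim f l i x : 0 < l < 1 -> uc f -> U x -> hasprim (fun s => f (avpt l i x s)).
Proof.
move=> hl uf Ux; have [d d0 [G hG]] := avg_uc_line i hl uf Ux; case/andP: (hl) => l0 l1.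
exists (fun s => l^-1 * G (l * s + 0)) => s hs.
have := is_derive_affine (a := l) (c := 0) (t := s) (G := G) (dG := f (avpt l i x s)).
move=> /(_ _) h; have {}h : is_derive s 1 (fun s0 : R => G (l * s0 + 0)) (l * f (avpt l i x s)).
  apply: h; rewrite addr0 avpt_axis; apply: hG.
  case/andP: hs => s0 s1.
  have a : l * s <= l * 1 by rewrite ler_wpM2l// ltW.
  have b : l * (-1) <= l * s by rewrite ler_wpM2l// ltW.
  by apply/andP; split; lra.
have := is_deriveZ l^-1 h.
by rewrite /GRing.scale /= mulrA mulVf ?mul1r// gt_eqF.
Qed.

(** The derivative in the direction of the average falls on the ends of the segment: it is a
    difference quotient of [f] and asks for no derivative of [f]. The margin around the segment is
    what makes the primitive differentiable at these ends. *)
Lemma avg_gain f l i x : 0 < l < 1 -> uc f -> U x ->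
  is_derive x (delta_mx 0 i) (avg l i f)
    ((1 - l) * (2 * l)^-1 * (f (avpt l i x 1) - f (avpt l i x (-1)))).
Proof.
move=> hl uf Ux; have [d d0 [G hG]] := avg_uc_line i hl uf Ux; case/andP: (hl) => l0 l1.
apply/is_derive_line.
have l1' : 0 < 1 - l by rewrite subr_gt0.
have dom s t : -1 <= s <= 1 -> `|t| < d / (1 - l) -> - (l + d) < l * s + (1 - l) * t < l + d.
  move=> /andP[s0 s1]; rewrite ltr_pdivlMr// => td.
  have a : l * s <= l * 1 by rewrite ler_wpM2l// ltW.
  have b : l * (-1) <= l * s by rewrite ler_wpM2l// ltW.
  have : `|(1 - l) * t| < d by rewrite normrM (ger0_norm (ltW l1')) mulrC.
  by rewrite ltr_norml => /andP[c1 c2]; apply/andP; split; lra.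
have pt s t : avpt l i (t *: delta_mx 0 i + x) s = (l * s + (1 - l) * t) *: delta_mx 0 i + (1 - l) *: x.
  by rewrite /avpt scalerDr scalerA [in RHS]scalerDl addrC addrA.
have e1 t : `|t| < d / (1 - l) -> avg l i f (t *: delta_mx 0 i + x) =
    2^-1 * (l^-1 * G ((1 - l) * t + l) - l^-1 * G ((1 - l) * t + - l)).
  move=> ht; rewrite /avg (@meanE _ _ (fun s => l^-1 * G (l * s + (1 - l) * t))).
    by rewrite mulr1 mulrN1 [l + _]addrC [- l + _]addrC.
  move=> s hs.
  have hd := is_derive_affine (a := l) (c := (1 - l) * t) (t := s) (hG _ (dom s t hs ht)).
  have := is_deriveZ l^-1 hd.
  by rewrite /GRing.scale /= mulrA mulVf ?mul1r ?gt_eqF// pt.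
have dl : 0 < d / (1 - l) by rewrite divr_gt0.
have d1 : is_derive (0 : R) 1 (fun t => 2^-1 * (l^-1 * G ((1 - l) * t + l) - l^-1 * G ((1 - l) * t + - l)))
    (2^-1 * (l^-1 * ((1 - l) * f (avpt l i x 1)) - l^-1 * ((1 - l) * f (avpt l i x (-1))))).
  have m1 : -1 <= (1 : R) <= 1 by rewrite lexx andbT; lra.
  have m2 : -1 <= (-1 : R) <= 1 by rewrite lexx /=; lra.
  have n0 : `|0 : R| < d / (1 - l) by rewrite normr0.
  have h1 := hG _ (dom 1 0 m1 n0); have h2 := hG _ (dom (-1) 0 m2 n0).
  have q1 : l * 1 + (1 - l) * 0 = (1 - l) * 0 + l by ring.
  have q2 : l * (-1) + (1 - l) * 0 = (1 - l) * 0 + - l by ring.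
  rewrite -!pt scale0r add0r q1 in h1; rewrite -!pt scale0r add0r q2 in h2.
  apply: is_deriveZ; apply: is_deriveB; apply: is_deriveZ; exact: is_derive_affine.
apply: (near_eq_is_derive (f := fun t => 2^-1 * (l^-1 * G ((1 - l) * t + l) - l^-1 * G ((1 - l) * t + - l)))).
  apply/nbhs_ballP; exists (d / (1 - l)) => //= t /=.
  by rewrite /ball /= sub0r normrN => ht; rewrite e1.
have -> // : (1 - l) * (2 * l)^-1 * (f (avpt l i x 1) - f (avpt l i x (-1))) =
   2^-1 * (l^-1 * ((1 - l) * f (avpt l i x 1)) - l^-1 * ((1 - l) * f (avpt l i x (-1)))).
by field; rewrite gt_eqF.
Qed.

Lemma avg_bound f l i x M : 0 < l < 1 -> uc f -> U x ->
  (forall s, -1 <= s <= 1 -> `|f (avpt l i x s)| <= M) -> `|avg l i f x| <= M.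
Proof. by move=> hl uf Ux; apply: mean_bound; exact: avg_hasprim. Qed.

Lemma avg_sub_bound f h l i x y M : 0 < l < 1 -> uc f -> uc h -> U x -> U y ->
  (forall s, -1 <= s <= 1 -> `|f (avpt l i x s) - h (avpt l i y s)| <= M) ->
  `|avg l i f x - avg l i h y| <= M.
Proof. by move=> hl uf uh Ux Uy; apply: mean_sub_bound; exact: avg_hasprim. Qed.

Lemma avgD f h l i x : 0 < l < 1 -> uc f -> uc h -> U x ->
  avg l i (fun y => f y + h y) x = avg l i f x + avg l i h x.
Proof. by move=> hl uf uh Ux; apply: meanD; exact: avg_hasprim. Qed.

Lemma avgZ (c : R) f l i x : 0 < l < 1 -> uc f -> U x ->
  avg l i (fun y => c * f y) x = c * avg l i f x.
Proof. by move=> hl uf Ux; apply: meanZ; exact: avg_hasprim. Qed.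

Lemma avg_cst (c : R) l i x : avg l i (fun=> c) x = c.
Proof. exact: mean_cst. Qed.

Lemma avg_uc f l i : 0 < l < 1 -> uc f -> uc (avg l i f).
Proof.
move=> hl uf e e0; have e2 : 0 < e / 2 by rewrite divr_gt0.
have [d d0 hd] := uf _ e2; exists d => // x y Ux Uy xy.
apply: (@le_lt_trans _ _ (e / 2)); last by lra.
apply: avg_sub_bound => // s hs; apply/ltW/hd; try exact: avpt_disk.
exact: le_lt_trans (dist1_avpt _ _ _ _ hl) xy.
Qed.

Lemma avg_bnd f l i : 0 < l < 1 -> uc f -> bounded_on_disk f -> bounded_on_disk (avg l i f).
Proof.
move=> hl uf [M hM]; exists M => x Ux; apply: avg_bound => // s hs.
by apply: hM; exact: avpt_disk.
Qed.

Lemma is_derive_quotient (G : R -> R) (L : R) :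
  (forall e, 0 < e -> exists2 d, 0 < d & forall t, t != 0 -> `|t| < d ->
     `|G t - (G 0 + t * L)| <= `|t| * e) -> is_derive (0 : R) 1 G L.
Proof.
move=> hG.
have cv : h^-1 *: ((G \o shift 0) (h *: 1) - G 0) @[h --> (0 : R)^'] --> L.
  apply/cvgrPdist_le => e e0; have [d d0 hd] := hG e e0.
  apply/nbhs_ballP; exists d => //= t; rewrite /ball /= sub0r normrN => td t0.
  rewrite addr0 /GRing.scale /= mulr1.
  rewrite (_ : L - _ = - (t^-1 * (G t - (G 0 + t * L)))); last by field.
  rewrite normrN normrM normfV ler_pdivrMl ?normr_gt0//.
  exact: hd.
apply: DeriveDef; first by apply/cvg_ex; exists L.
exact: cvg_lim cv.
Qed.

(** Differentiation under the mean; [1 - l] comes from the contraction. Uniform continuity of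
    [pd j f] makes the difference quotients converge uniformly over the segment. *)
Lemma avg_pd f l i j x : 0 < l < 1 -> uc f -> uc (pd j f) ->
  (forall y, U y -> derivable f y (delta_mx 0 j)) -> U x ->
  is_derive x (delta_mx 0 j) (avg l i f) ((1 - l) * avg l i (pd j f) x).
Proof.
move=> hl uf up df Ux; apply/is_derive_line; case/andP: (hl) => l0 l1.
have l1' : 0 < 1 - l by rewrite subr_gt0.
apply: is_derive_quotient => e e0; have [r r0 hr] := up e e0.
have [d d0 hd] : exists2 d : R, 0 < d & forall t, `|t| < d -> U (t *: delta_mx 0 j + x).
  have Ut : \forall t \near (0 : R), U (t *: delta_mx 0 j + x).
    have c : (fun t : R => t *: (delta_mx 0 j : E) + x) @ (0 : R) --> 0 *: (delta_mx 0 j : E) + x.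
      by apply: cvgD; [apply: cvgZr_tmp; exact: cvg_id|exact: cvg_cst].
    apply: c; rewrite scale0r add0r; exact: near_disk.
  have /nbhs_ballP[d /= d0 hd] := Ut; exists d => // t td.
  by apply: hd; rewrite /ball /= sub0r normrN.
exists (Num.min d r); first by rewrite lt_min d0.
move=> t t0; rewrite lt_min => /andP[td tr].
have Ut := hd t td.
have pt s : avpt l i (t *: delta_mx 0 j + x) s = ((1 - l) * t) *: delta_mx 0 j + avpt l i x s.
  by rewrite /avpt scalerDr scalerA addrA.
rewrite scale0r add0r mulrA -avgZ//.
rewrite -meanD; [|exact: avg_hasprim|exact: (hasprimZ _ (avg_hasprim i hl up Ux))].
apply: mean_sub_bound; first exact: avg_hasprim.
  by apply: hasprimD; [exact: avg_hasprim|exact: (hasprimZ _ (avg_hasprim i hl up Ux))].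
move=> s hs; rewrite pt.
have Uxs := avpt_disk i hl hs Ux.
have Uts : U (((1 - l) * t) *: delta_mx 0 j + avpt l i x s) by rewrite -pt; exact: avpt_disk.
have [th [/andP[th0 th1] Uth eth]] := axis_MVT df Uxs Uts.
rewrite opprD addrA eth.
set A := pd j f _; set B := pd j f _.
have -> : (1 - l) * t * A - t * (1 - l) * B = t * ((1 - l) * (A - B)) by ring.
rewrite normrM ler_wpM2l//.
rewrite normrM (ger0_norm (ltW l1')).
have h1 : `|A - B| <= e.
  apply/ltW/hr => //.
  have := dist1_axis j (avpt l i x s) (th * ((1 - l) * t)) 0; rewrite scale0r add0r => ->.
  rewrite subr0 !normrM (ger0_norm th0) (ger0_norm (ltW l1')); apply: le_lt_trans tr.
  by rewrite mulrA ler_piMl// mulr_ile1 ?(ltW l1')//; lra.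
by apply: le_trans h1; rewrite ler_piMl//; lra.
Qed.

End DiskAverage.

(** * Mollification by two successive averages *)

Section Smoothing.
Variable R : realType.
Local Notation E := 'rV[R]_2.
Local Notation U := (@open_disk R).
Implicit Types (f h : E -> R) (x y : E) (i j : 'I_2) (l s t : R) (n m : nat).

Lemma ucn_avg n f l i : 0 < l < 1 -> ucn n f -> ucn n (avg l i f).
Proof.
move=> hl; elim: n f => [|n IH] f sf.
  split=> //; [exact: avg_uc (ucn_uc sf)|exact: avg_bnd (ucn_uc sf) (ucn_bnd sf)].
split; [exact: avg_uc (ucn_uc sf)|exact: avg_bnd (ucn_uc sf) (ucn_bnd sf)|].
have d j x : U x -> is_derive x (delta_mx 0 j) (avg l i f) ((1 - l) * avg l i (pd j f) x).
  move=> Ux; apply: avg_pd => //; first exact: ucn_uc sf.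
    exact: ucn_uc (ucn_pd j sf).
  by move=> y Uy; exact: ucn_der sf Uy.
split=> j; first by move=> x /(d j)[].
apply: ucn_ext (ucnZ (1 - l) (IH _ (ucn_pd j sf))) => x /(d j)[_ ed].
by rewrite /pd ed.
Qed.

Lemma is_derive_avpt f l i j s x : derivable f (avpt l i x s) (delta_mx 0 j) ->
  is_derive x (delta_mx 0 j) (fun y => f (avpt l i y s)) ((1 - l) * pd j f (avpt l i x s)).
Proof.
move=> df; apply/is_derive_line.
have e : (fun r : R => f (avpt l i (r *: delta_mx 0 j + x) s)) =
   (fun r => (fun t => f (t *: delta_mx 0 j + avpt l i x s)) ((1 - l) * r + 0)).
  by apply/funext => r; rewrite addr0 /avpt scalerDr scalerA addrA.
rewrite e; apply: (is_derive_affine (G := fun t => f (t *: delta_mx 0 j + avpt l i x s))).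
rewrite mulr0 addr0; apply/is_derive_line; exact: is_derive_pd.
Qed.

Lemma ucn_avpt n f l i s : 0 < l < 1 -> -1 <= s <= 1 -> ucn n f -> ucn n (fun x => f (avpt l i x s)).
Proof.
move=> hl hs; elim: n f => [|n IH] f sf.
  have [uf [M bf] _] := sf; split=> //.
    move=> e e0; have [d d0 hd] := uf e e0; exists d => // x y Ux Uy xy.
    apply: hd; try exact: avpt_disk.
    exact: le_lt_trans (dist1_avpt _ _ _ _ hl) xy.
  by exists M => x Ux; apply: bf; exact: avpt_disk.
have [uf [M bf] [df hf]] := sf; split.
- move=> e e0; have [d d0 hd] := uf e e0; exists d => // x y Ux Uy xy.
  apply: hd; try exact: avpt_disk.
  exact: le_lt_trans (dist1_avpt _ _ _ _ hl) xy.
- by exists M => x Ux; apply: bf; exact: avpt_disk.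
have d j x : U x -> is_derive x (delta_mx 0 j) (fun y => f (avpt l i y s)) ((1 - l) * pd j f (avpt l i x s)).
  by move=> Ux; apply: is_derive_avpt; apply: df; exact: avpt_disk.
split=> j; first by move=> x /(d j)[].
apply: ucn_ext (ucnZ (1 - l) (IH _ (hf j))) => x /(d j)[_ ed].
by rewrite /pd ed.
Qed.

Let m1 : -1 <= (1 : R) <= 1. Proof. by rewrite lexx andbT; lra. Qed.
Let m2 : -1 <= (-1 : R) <= 1. Proof. by rewrite lexx /=; lra. Qed.

Lemma pd_avg_gain f l i x : 0 < l < 1 -> uc f -> U x ->
  pd i (avg l i f) x = (1 - l) * (2 * l)^-1 * (f (avpt l i x 1) - f (avpt l i x (-1))).
Proof. by move=> hl uf Ux; rewrite /pd; have [_ ->] := avg_gain i hl uf Ux. Qed.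

Lemma pd_avg f l i j x n : 0 < l < 1 -> ucn n.+1 f -> U x ->
  pd j (avg l i f) x = (1 - l) * avg l i (pd j f) x.
Proof.
move=> hl sf Ux; rewrite /pd.
have [|_ ->//] := @avg_pd _ f l i j x hl (ucn_uc sf) (ucn_uc (ucn_pd j sf)) _ Ux.
by move=> y Uy; exact: ucn_der sf Uy.
Qed.

(** One derivative is gained in each direction: the inner average gains the direction 1, and the
    outer average passes it on while gaining the direction 0. *)
Definition smooth l f : E -> R := avg l 0 (avg l 1 f).

Lemma ucn_gain n f l i : 0 < l < 1 -> ucn n f -> ucn n (pd i (avg l i f)).
Proof.
move=> hl sf.
apply: ucn_ext (ucnZ ((1 - l) * (2 * l)^-1) (ucnB (ucn_avpt i hl m1 sf) (ucn_avpt i hl m2 sf))) => x Ux.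
by rewrite pd_avg_gain//; exact: ucn_uc sf.
Qed.

Lemma uc_smooth f l : 0 < l < 1 -> uc f -> uc (smooth l f).
Proof. by move=> hl uf; apply: avg_uc => //; exact: avg_uc. Qed.

Lemma derivable_smooth f l i x : 0 < l < 1 -> uc f -> bounded_on_disk f -> U x -> derivable (smooth l f) x (delta_mx 0 i).
Proof.
move=> hl uf bf Ux; case: (ord2_case i) => ->.
  by have [] := avg_gain 0 hl (avg_uc 1 hl uf) Ux.
have [||//] := @avg_pd _ (avg l 1 f) l 0 1 x hl (avg_uc 1 hl uf) _ _ Ux.
  exact: ucn_uc (@ucn_gain 0 _ _ _ hl _).
by move=> y Uy; have [] := avg_gain 1 hl uf Uy.
Qed.

Lemma pd_smooth0 f l x : 0 < l < 1 -> uc f -> U x -> pd 0 (smooth l f) x =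
  (1 - l) * (2 * l)^-1 * (avg l 1 f (avpt l 0 x 1) - avg l 1 f (avpt l 0 x (-1))).
Proof. by move=> hl uf Ux; rewrite pd_avg_gain//; exact: avg_uc. Qed.

Lemma pd_smooth1 f l x : 0 < l < 1 -> ucn 0 f -> U x -> pd 1 (smooth l f) x =
  (1 - l) * avg l 0 (pd 1 (avg l 1 f)) x.
Proof.
move=> hl sf Ux; rewrite /pd.
have [||_ ->//] := @avg_pd _ (avg l 1 f) l 0 1 x hl (avg_uc 1 hl (ucn_uc sf)) _ _ Ux.
  exact: ucn_uc (@ucn_gain 0 _ _ _ hl _).
by move=> y Uy; have [] := avg_gain 1 hl (ucn_uc sf) Uy.
Qed.

Lemma eq_avg f h l i x : 0 < l < 1 -> uc f -> uc h -> U x -> (forall y, U y -> f y = h y) ->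
  avg l i f x = avg l i h x.
Proof.
move=> hl uf uh Ux fh; apply/eqP; rewrite -subr_eq0 -normr_eq0 eq_le normr_ge0 andbT.
by apply: avg_sub_bound => // s hs; rewrite fh ?subrr ?normr0//; exact: avpt_disk.
Qed.

Lemma pd_smooth f l i x n : 0 < l < 1 -> ucn n.+1 f -> U x ->
  pd i (smooth l f) x = (1 - l) ^+ 2 * smooth l (pd i f) x.
Proof.
move=> hl sf Ux; rewrite (pd_avg _ _ hl (ucn_avg 1 hl sf))//.
rewrite expr2 -mulrA; congr (_ * _); rewrite /smooth -avgZ//; last first.
  exact: avg_uc (ucn_uc (ucn_pd i sf)).
have sp := ucn_pd i sf.
apply: eq_avg => //.
- exact: ucn_uc (ucn_pd i (ucn_avg 1 hl sf)).
- exact: ucn_uc (ucnZ _ (ucn_avg 1 hl sp)).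
- by move=> y Uy; exact: pd_avg sf Uy.
Qed.

Lemma smoothD f h l x : 0 < l < 1 -> uc f -> uc h -> U x ->
  smooth l (fun y => f y + h y) x = smooth l f x + smooth l h x.
Proof.
move=> hl uf uh Ux; rewrite /smooth -avgD//; try exact: avg_uc.
apply: eq_avg => //; first exact: avg_uc (ucD uf uh).
  by apply: ucD; exact: avg_uc.
by move=> y Uy; exact: avgD.
Qed.

Lemma smoothZ (c : R) f l x : 0 < l < 1 -> uc f -> U x ->
  smooth l (fun y => c * f y) x = c * smooth l f x.
Proof.
move=> hl uf Ux; have uz g : uc g -> uc (fun y => c * g y).
  move=> ug e e0; have c1 : 0 < `|c| + 1 by rewrite ltr_wpDl.
  have [d d0 hd] := ug (e / (`|c| + 1)) (divr_gt0 e0 c1); exists d => // a b Ua Ub ab.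
  rewrite -mulrBr normrM; have := hd _ _ Ua Ub ab; rewrite ltr_pdivlMr// => /(le_lt_trans _); apply.
  by rewrite mulrC ler_wpM2l// lerDl.
rewrite /smooth -avgZ//; last exact: avg_uc.
apply: eq_avg => //; [exact: avg_uc (uz _ uf)|exact: uz (avg_uc _ hl uf)|].
by move=> y Uy; exact: avgZ.
Qed.

Lemma smooth_cst (c : R) l x : 0 < l < 1 -> U x -> smooth l (fun=> c) x = c.
Proof.
move=> hl Ux; rewrite /smooth -[RHS](avg_cst c l 0 x); apply: eq_avg => //.
- exact: avg_uc (ucn_uc (ucn_cst 0 c)).
- exact: ucn_uc (ucn_cst 0 c).
- by move=> y _; rewrite avg_cst.
Qed.

Lemma eq_smooth f h l x : 0 < l < 1 -> uc f -> uc h -> U x -> (forall y, U y -> f y = h y) ->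
  smooth l f x = smooth l h x.
Proof.
move=> hl uf uh Ux fh; apply: eq_avg => //; [exact: avg_uc|exact: avg_uc|].
by move=> y Uy; exact: eq_avg.
Qed.

Lemma dist1_triangle x y z : dist1 x z <= dist1 x y + dist1 y z.
Proof. by rewrite /dist1 addrACA lerD// ler_distD. Qed.

(** Each of the two averages moves a point by at most [3 l] ([dist1_avptl]), whence the radius
    [6 l]. *)
Lemma smooth_bound f l x M : 0 < l < 1 -> uc f -> U x ->
  (forall y, U y -> dist1 y x <= 6 * l -> `|f y| <= M) -> `|smooth l f x| <= M.
Proof.
move=> hl uf Ux hM; apply: avg_bound => //; first exact: avg_uc.
move=> s hs; have Us := avpt_disk 0 hl hs Ux; apply: avg_bound => // t ht.
apply: hM; first exact: avpt_disk.
apply: le_trans (dist1_triangle _ (avpt l 0 x s) _) _.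
by have := dist1_avptl 1 hl ht Us; have := dist1_avptl 0 hl hs Ux; lra.
Qed.

Lemma ucn_smooth n f l : 0 < l < 1 -> ucn n f -> ucn n (smooth l f).
Proof. by move=> hl sf; apply: ucn_avg => //; exact: ucn_avg. Qed.

Lemma ucn_smooth_gain n f l : 0 < l < 1 -> ucn n f -> ucn n.+1 (smooth l f).
Proof.
move=> hl sf; have s0 := ucn_le (leq0n n) sf.
have [ua ba _] := ucn_smooth hl s0; split=> //; split=> i.
  by move=> x Ux; exact: derivable_smooth (ucn_uc sf) (ucn_bnd sf) Ux.
case: (ord2_case i) => ->.
  exact: ucn_gain (ucn_avg 1 hl sf).
apply: ucn_ext (ucnZ (1 - l) (ucn_avg 0 hl (ucn_gain 1 hl sf))) => x Ux.
by rewrite pd_smooth1.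
Qed.

(* Vanishes when one factor is constant, so only oscillations at scale [l] enter:
   this is the quadratic commutator estimate for mollified products. *)
Definition scov l f h x : R := smooth l (fun y => f y * h y) x - smooth l f x * smooth l h x.

(** [scov] is unchanged when constants are subtracted from its arguments. With the values at [x]
    subtracted, each of its two terms is bounded by the product of the oscillations. *)
Lemma scov_bound f h l x M N : 0 < l < 1 -> ucn 0 f -> ucn 0 h -> U x ->
  (forall y, U y -> dist1 y x <= 6 * l -> `|f y - f x| <= M) ->
  (forall y, U y -> dist1 y x <= 6 * l -> `|h y - h x| <= N) ->
  `|scov l f h x| <= 2 * (M * N).
Proof.
move=> hl sf sh Ux hM hN; set a := f x; set b := h x.
have sfa : ucn 0 (fun y => f y - a) by apply: ucnB => //; exact: ucn_cst.
have shb : ucn 0 (fun y => h y - b) by apply: ucnB => //; exact: ucn_cst.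
have sa : smooth l (fun y => f y - a) x = smooth l f x - a.
  by rewrite smoothD ?smooth_cst//; [exact: ucn_uc sf|exact: ucn_uc (ucn_cst 0 _)].
have sb : smooth l (fun y => h y - b) x = smooth l h x - b.
  by rewrite smoothD ?smooth_cst//; [exact: ucn_uc sh|exact: ucn_uc (ucn_cst 0 _)].
have -> : scov l f h x = smooth l (fun y => (f y - a) * (h y - b)) x
   - smooth l (fun y => f y - a) x * smooth l (fun y => h y - b) x.
  have ufh := ucnM sf sh.
  have e : smooth l (fun y => f y * h y) x =
    smooth l (fun y => (f y - a) * (h y - b) + (a * h y + (b * f y + - (a * b)))) x.
    apply: eq_smooth => //; first exact: ucn_uc ufh.
      apply: (@ucn_uc _ 0); apply: ucnD; first exact: ucnM.
      by apply: ucnD; [exact: ucnZ|apply: ucnD; [exact: ucnZ|exact: ucn_cst]].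
    by move=> y _; ring.
  have u1 := ucnM sfa shb.
  have u2 := ucnZ a sh; have u3 := ucnZ b sf; have u4 := ucn_cst 0 (- (a * b)).
  rewrite /scov e (smoothD hl (ucn_uc u1) (ucn_uc (ucnD u2 (ucnD u3 u4))) Ux).
  rewrite (smoothD hl (ucn_uc u2) (ucn_uc (ucnD u3 u4)) Ux) (smoothD hl (ucn_uc u3) (ucn_uc u4) Ux).
  rewrite (smoothZ a hl (ucn_uc sh) Ux) (smoothZ b hl (ucn_uc sf) Ux) (smooth_cst _ hl Ux) sa sb.
  by move: (smooth l _ x) (smooth l f x) (smooth l h x) => A B C; ring.
have b1 : `|smooth l (fun y => (f y - a) * (h y - b)) x| <= M * N.
  apply: smooth_bound => //; first exact: ucn_uc (ucnM sfa shb).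
  by move=> y Uy yx; rewrite normrM ler_pM ?hM ?hN.
have b2 : `|smooth l (fun y => f y - a) x| <= M by apply: smooth_bound => //; exact: ucn_uc sfa.
have b3 : `|smooth l (fun y => h y - b) x| <= N by apply: smooth_bound => //; exact: ucn_uc shb.
apply: le_trans (ler_normB _ _) _; rewrite normrM.
have : `|smooth l (fun y => f y - a) x| * `|smooth l (fun y => h y - b) x| <= M * N by rewrite ler_pM.
lra.
Qed.

Lemma ucn_scov n f h l : 0 < l < 1 -> ucn n f -> ucn n h -> ucn n (scov l f h).
Proof.
by move=> hl sf sh; apply: ucnB; [apply: ucn_smooth => //; exact: ucnM|apply: ucnM; exact: ucn_smooth].
Qed.

(** All the smoothings produce the same factor [(1 - l)^2], so the product rule holds up to this
    factor and the commutator estimate passes to derivatives. *)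
Lemma pd_scov f h l i x n : 0 < l < 1 -> ucn n.+1 f -> ucn n.+1 h -> U x ->
  pd i (scov l f h) x = (1 - l) ^+ 2 * (scov l (pd i f) h x + scov l f (pd i h) x).
Proof.
move=> hl sf sh Ux; have sfh := ucnM sf sh.
have s1 := ucn_smooth hl sf; have s2 := ucn_smooth hl sh; have s3 := ucn_smooth hl sfh.
rewrite /scov pdD; last 2 first.
- exact: ucn_der s3 Ux.
- by apply: derivableN; apply: derivableM; [exact: ucn_der s1 Ux|exact: ucn_der s2 Ux].
rewrite pdN; last by apply: derivableM; [exact: ucn_der s1 Ux|exact: ucn_der s2 Ux].
rewrite pdM; [|exact: ucn_der s1 Ux|exact: ucn_der s2 Ux].
rewrite (pd_smooth _ hl sf Ux) (pd_smooth _ hl sh Ux) (pd_smooth _ hl sfh Ux).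
have -> : smooth l (pd i (fun y => f y * h y)) x =
   smooth l (fun y => pd i f y * h y) x + smooth l (fun y => f y * pd i h y) x.
  rewrite -smoothD//; last 2 first.
  - exact: ucn_uc (ucnM (ucn_pd i sf) (ucn_pred sh)).
  - exact: ucn_uc (ucnM (ucn_pred sf) (ucn_pd i sh)).
  apply: eq_smooth => //; first exact: ucn_uc (ucn_pd i sfh).
    exact: ucn_uc (ucnD (ucnM (ucn_pd i sf) (ucn_pred sh)) (ucnM (ucn_pred sf) (ucn_pd i sh))).
  by move=> y Uy; rewrite pdM//; [exact: ucn_der sf Uy|exact: ucn_der sh Uy].
move: (smooth l (fun y => pd i f y * h y) x) (smooth l (fun y => f y * pd i h y) x).
move: (smooth l (pd i f) x) (smooth l h x) (smooth l f x) (smooth l (pd i h) x) => A B C D G H; ring.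
Qed.

End Smoothing.

(** * Symbol estimates for mollification *)

Section SmoothingSymbols.
Variables (R : realType) (P : Type) (F : set_system P).
Context {FF : Filter F}.
Local Notation E := 'rV[R]_2.
Local Notation U := (@open_disk R).
Local Notation symb := (symb F).
Implicit Types (f h : P -> E -> R) (A w : P -> R) (i : 'I_2) (n m : nat).
Variable l : P -> R.
Hypothesis hl : \forall p \near F, 0 < l p < 1.
Local Notation k := (fun p => (l p)^-1).

Let m1 : -1 <= (1 : R) <= 1. Proof. by rewrite lexx andbT; lra. Qed.
Let m2 : -1 <= (-1 : R) <= 1. Proof. by rewrite lexx /=; lra. Qed.

Let hkk : \forall p \near F, 0 <= k p <= k p.
Proof. by apply: filterS hl => p /andP[l0 _]; rewrite lexx invr_ge0 ltW. Qed.

Lemma symb_avpt n A w k1 f i s : -1 <= s <= 1 -> (\forall p \near F, 0 <= A p) ->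
  (\forall p \near F, 0 <= w p <= k1 p) ->
  symb n A w k1 f -> symb n A w k1 (fun p x => f p (avpt (l p) i x s)).
Proof.
move=> hs; elim: n A w f => [|n IH] A w f hA hw sf.
  have [[C hC] _] := sf; split=> //; exists C.
  by apply: filterS2 hl hC => p lp hC x Ux; apply: hC; exact: avpt_disk.
have [[C hC] [df hf]] := sf; split; last split.
- by exists C; apply: filterS2 hl hC => p lp hC x Ux; apply: hC; exact: avpt_disk.
- apply: filterS2 hl df => p lp df j x Ux.
  by have [] := @is_derive_avpt _ (f p) (l p) i j s x (df j _ (avpt_disk i lp hs Ux)).
move=> j.
have hAw : \forall p \near F, 0 <= A p * w p.
  by apply: filterS2 hA hw => p A0 /andP[w0 _]; rewrite mulr_ge0.
have hk1 : \forall p \near F, 0 <= k1 p <= k1 p.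
  by apply: filterS hw => p /andP[w0 wk]; rewrite lexx (le_trans w0 wk).
have sl : symb n (fun=> 1) k1 k1 (fun p _ => 1 - l p).
  apply: (@symb_scalar _ _ _ _ _ _ _ _ _ 1); apply: filterS hl => p /andP[l0 l1].
  by rewrite mulr1 ger0_norm; lra.
have h1 : \forall p \near F, 0 <= (1 : R) by exact: nearW.
apply: symb_ext (symb_eqA _ (symbM hk1 h1 hAw sl (IH _ _ _ hAw hk1 (hf j)))).
  apply: filterS2 hl df => p lp df x Ux.
  by rewrite /pd; have [_ ->] := @is_derive_avpt _ (f p) (l p) i j s x (df j _ (avpt_disk i lp hs Ux)).
by move=> p; rewrite mul1r.
Qed.

Lemma symb_avg n A w k1 f i : (\forall p \near F, 0 <= A p) ->
  (\forall p \near F, 0 <= w p <= k1 p) -> (\forall p \near F, ucn n (f p)) ->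
  symb n A w k1 f -> symb n A w k1 (fun p => avg (l p) i (f p)).
Proof.
elim: n A w f => [|n IH] A w f hA hw uf sf.
  have [[C hC] _] := sf; split=> //; exists C.
  apply: filterS3 hl hC uf => p lp hC uf x Ux; apply: avg_bound => //; first exact: ucn_uc uf.
  by move=> s hs; apply: hC; exact: avpt_disk.
have [[C hC] [df hf]] := sf; split; last split.
- exists C; apply: filterS3 hl hC uf => p lp hC uf x Ux; apply: avg_bound => //; first exact: ucn_uc uf.
  by move=> s hs; apply: hC; exact: avpt_disk.
- by apply: filterS2 hl uf => p lp uf j x Ux; exact: ucn_der (ucn_avg i lp uf) Ux.
move=> j.
have hAw : \forall p \near F, 0 <= A p * w p.
  by apply: filterS2 hA hw => p A0 /andP[w0 _]; rewrite mulr_ge0.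
have hk1 : \forall p \near F, 0 <= k1 p <= k1 p.
  by apply: filterS hw => p /andP[w0 wk]; rewrite lexx (le_trans w0 wk).
have sl : symb n (fun=> 1) k1 k1 (fun p _ => 1 - l p).
  apply: (@symb_scalar _ _ _ _ _ _ _ _ _ 1); apply: filterS hl => p /andP[l0 l1].
  by rewrite mulr1 ger0_norm; lra.
have h1 : \forall p \near F, 0 <= (1 : R) by exact: nearW.
have upd : \forall p \near F, ucn n (pd j (f p)) by apply: filterS uf => p; exact: ucn_pd.
apply: symb_ext (symb_eqA _ (symbM hk1 h1 hAw sl (IH _ _ _ hAw hk1 upd (hf j)))).
  by apply: filterS2 hl uf => p lp uf x Ux; rewrite (pd_avg i j lp uf Ux).
by move=> p; rewrite mul1r.
Qed.

Lemma symb_smooth n A w k1 f : (\forall p \near F, 0 <= A p) ->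
  (\forall p \near F, 0 <= w p <= k1 p) -> (\forall p \near F, ucn n (f p)) ->
  symb n A w k1 f -> symb n A w k1 (fun p => smooth (l p) (f p)).
Proof.
move=> hA hw uf sf; apply: symb_avg => //; last exact: symb_avg.
by apply: filterS2 hl uf => p lp; exact: ucn_avg.
Qed.

Lemma symb_gain n A f : (\forall p \near F, 0 <= A p) ->
  (\forall p \near F, ucn n (f p)) ->
  symb n A k k f -> symb n.+1 A k k (fun p => smooth (l p) (f p)).
Proof.
move=> hA uf sf.
have ua : \forall p \near F, ucn n (avg (l p) 1 (f p)).
  by apply: filterS2 hl uf => p lp; exact: ucn_avg.
have sa : symb n A k k (fun p => avg (l p) 1 (f p)) by exact: symb_avg.
have sl : symb n k k k (fun p _ => (1 - l p) * (2 * l p)^-1).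
  apply: (@symb_scalar _ _ _ _ _ _ _ _ _ 1); apply: filterS hl => p /andP[l0 l1].
  rewrite mul1r ger0_norm; last by rewrite mulr_ge0 ?invr_ge0 ?mulr_ge0 ?subr_ge0 ?ltW.
  by rewrite invfM mulrA ler_piMl ?invr_ge0 ?(ltW l0)//; lra.
have hk0 : \forall p \near F, 0 <= k p by apply: filterS hkk => p /andP[].
have gain f' : symb n A k k f' -> symb n (fun p => A p * k p) k k
    (fun p x => (1 - l p) * (2 * l p)^-1 * f' p x).
  by move=> sf'; apply: symb_eqA (symbM hkk hk0 hA sl sf') => p; rewrite mulrC.
split; last split.
- by have := symb_sup (symb_smooth hA hkk uf sf).
- apply: filterS2 hl uf => p lp uf i x Ux.
  by apply: derivable_smooth => //; [exact: ucn_uc uf|exact: ucn_bnd uf].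
move=> i; case: (ord2_case i) => ->.
  apply: symb_ext (gain _ (symbB (symb_avpt 0 m1 hA hkk sa) (symb_avpt 0 m2 hA hkk sa))).
  by apply: filterS2 hl uf => p lp uf x Ux; rewrite pd_smooth0//; exact: ucn_uc uf.
have ud : \forall p \near F, ucn n (pd 1 (avg (l p) 1 (f p))).
  by apply: filterS2 hl uf => p lp; exact: ucn_gain.
have sd : symb n (fun p => A p * k p) k k (fun p => pd 1 (avg (l p) 1 (f p))).
  apply: symb_ext (gain _ (symbB (symb_avpt 1 m1 hA hkk sf) (symb_avpt 1 m2 hA hkk sf))).
  by apply: filterS2 hl uf => p lp uf x Ux; rewrite pd_avg_gain//; exact: ucn_uc uf.
have hAk : \forall p \near F, 0 <= A p * k p.
  by apply: filterS2 hA hk0 => p; exact: mulr_ge0.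
have sl1 : symb n (fun=> 1) k k (fun p _ => 1 - l p).
  apply: (@symb_scalar _ _ _ _ _ _ _ _ _ 1); apply: filterS hl => p /andP[l0 l1].
  by rewrite mulr1 ger0_norm; lra.
have h1 : \forall p \near F, 0 <= (1 : R) by exact: nearW.
apply: symb_ext (symb_eqA _ (symbM hkk h1 hAk sl1 (symb_avg 0 hAk hkk ud sd))).
  by apply: filterS2 hl uf => p lp uf x Ux; rewrite (pd_smooth1 lp (ucn_le (leq0n n) uf) Ux).
by move=> p; rewrite mul1r.
Qed.

Let symb_c2 n : symb n (fun=> 1) k k (fun p _ => (1 - l p) ^+ 2).
Proof.
apply: (@symb_scalar _ _ _ _ _ _ _ _ _ 1); apply: filterS hl => p /andP[l0 l1].
by rewrite mulr1 ger0_norm ?sqr_ge0// expr_le1//; lra.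
Qed.

(** Unlike in [symb_gain], the cheap first derivative is kept: differentiation commutes with
    [smooth] up to [(1 - l)^2], and the gain is applied to the gradient. *)
Lemma symb_gain1 n A w f : (\forall p \near F, 0 <= A p) ->
  (\forall p \near F, 0 <= w p <= k p) -> (\forall p \near F, ucn n.+1 (f p)) ->
  symb n.+1 A w k f -> symb n.+2 A w k (fun p => smooth (l p) (f p)).
Proof.
move=> hA hw uf sf; have [_ [_ hf]] := sf; split; last split.
- by have := symb_sup (symb_smooth hA hw uf sf).
- apply: filterS2 hl uf => p lp uf i x Ux.
  by apply: derivable_smooth => //; [exact: ucn_uc uf|exact: ucn_bnd uf].
move=> i; have hAw : \forall p \near F, 0 <= A p * w p.
  by apply: filterS2 hA hw => p A0 /andP[w0 _]; rewrite mulr_ge0.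
have h1 : \forall p \near F, 0 <= (1 : R) by exact: nearW.
have ud : \forall p \near F, ucn n (pd i (f p)) by apply: filterS uf => p; exact: ucn_pd.
apply: symb_ext (symb_eqA _ (symbM hkk h1 hAw (symb_c2 _) (symb_gain hAw ud (hf i)))).
  by apply: filterS2 hl uf => p lp uf x Ux; rewrite (pd_smooth _ lp uf Ux).
by move=> p; rewrite mul1r.
Qed.

(** Each argument oscillates by [l] times its gradient at scale [l], which gives the factor [l^2].
    Derivatives follow from [pd_scov] by moving the derivative onto one argument. *)
Lemma symb_scov n (A B : P -> R) f h : 
  (\forall p \near F, 0 <= A p) -> (\forall p \near F, 0 <= B p) ->
  (\forall p \near F, ucn n.+1 (f p)) -> (\forall p \near F, ucn n.+1 (h p)) ->
  (forall i, symb n A k k (fun p => pd i (f p))) ->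
  (forall i, symb n B k k (fun p => pd i (h p))) ->
  symb n (fun p => l p ^+ 2 * (A p * B p)) k k (fun p => scov (l p) (f p) (h p)).
Proof.
have h1 : \forall p \near F, 0 <= (1 : R) by exact: nearW.
have key A' f' : (\forall p \near F, 0 <= A' p) -> (\forall p \near F, ucn 1 (f' p)) ->
    (forall i, exists C : R, \forall p \near F, forall x, U x -> `|pd i (f' p) x| <= C * A' p) ->
    exists C : R, \forall p \near F, forall x y, U x -> U y -> dist1 y x <= 6 * l p ->
      `|f' p y - f' p x| <= C * A' p * (6 * l p).
  move=> hA' uf hf; have [C0 hC0] := hf 0; have [C1 hC1] := hf 1.
  exists (Num.max C0 C1); apply: filterS (filterI (filterI hA' uf) (filterI hC0 hC1)) => p [[a0 [_ _ [df _]]] [h0 h1']] x y Ux Uy xy.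
  have bd i z : U z -> `|pd i (f' p) z| <= Num.max C0 C1 * A' p.
    move=> Uz; case: (ord2_case i) => ->.
      by apply: le_trans (h0 z Uz) _; rewrite ler_wpM2r// le_max lexx.
    by apply: le_trans (h1' z Uz) _; rewrite ler_wpM2r// le_max lexx orbT.
  apply: le_trans (disk_lip df bd Uy Ux) _; apply: ler_wpM2l xy.
  by apply: le_trans (bd 0 x Ux).
have sup n' (A' B' : P -> R) f' h' : (\forall p \near F, 0 <= A' p) -> (\forall p \near F, 0 <= B' p) ->
  (\forall p \near F, ucn n'.+1 (f' p)) -> (\forall p \near F, ucn n'.+1 (h' p)) ->
  (forall i, symb n' A' k k (fun p => pd i (f' p))) ->
  (forall i, symb n' B' k k (fun p => pd i (h' p))) ->
  exists C : R, \forall p \near F, forall x, U x ->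
    `|scov (l p) (f' p) (h' p) x| <= C * (l p ^+ 2 * (A' p * B' p)).
  move=> hA hB uf uh sf sh.
  have uf1 : \forall p \near F, ucn 1 (f' p) by apply: filterS uf => p; apply: ucn_le.
  have uh1 : \forall p \near F, ucn 1 (h' p) by apply: filterS uh => p; apply: ucn_le.
  have [C1 hC1] := key _ _ hA uf1 (fun i => symb_sup (sf i)).
  have [C2 hC2] := key _ _ hB uh1 (fun i => symb_sup (sh i)).
  (* The factor 2 of [scov_bound] times the square of the radius constant 6. *)
  exists (72 * (C1 * C2)).
  apply: filterS (filterI hl (filterI (filterI uf1 uh1) (filterI hC1 hC2))) => p [lp [[u1 u2] [c1 c2]]] x Ux.
  apply: le_trans (scov_bound lp (ucn_pred u1) (ucn_pred u2) Ux _ _) _.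
  - by move=> y Uy yx; exact: c1 x y Ux Uy yx.
  - by move=> y Uy yx; exact: c2 x y Ux Uy yx.
  by rewrite le_eqVlt; apply/orP; left; apply/eqP; ring.
elim: n A B f h => [|n IH] A B f h hA hB uf uh sf sh.
  by split=> //; exact: sup uf uh sf sh.
split; [exact: sup uf uh sf sh|split].
  by apply: filterS3 hl uf uh => p lp uf uh i x Ux; exact: ucn_der (ucn_scov lp uf uh) Ux.
move=> i.
have hk0 : \forall p \near F, 0 <= k p by apply: filterS hkk => p /andP[].
have hAk : \forall p \near F, 0 <= A p * k p by apply: filterS2 hA hk0 => p; exact: mulr_ge0.
have hBk : \forall p \near F, 0 <= B p * k p by apply: filterS2 hB hk0 => p; exact: mulr_ge0.
have ufp : \forall p \near F, ucn n.+1 (pd i (f p)) by apply: filterS uf => p; exact: ucn_pd.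
have uhp : \forall p \near F, ucn n.+1 (pd i (h p)) by apply: filterS uh => p; exact: ucn_pd.
have uf' : \forall p \near F, ucn n.+1 (f p) by apply: filterS uf => p; exact: ucn_pred.
have uh' : \forall p \near F, ucn n.+1 (h p) by apply: filterS uh => p; exact: ucn_pred.
have s1 := IH _ _ _ _ hAk hB ufp uh' (fun j => symb_pd j (sf i)) (fun j => symb_pred (sh j)).
have s2 := IH _ _ _ _ hA hBk uf' uhp (fun j => symb_pred (sf j)) (fun j => symb_pd j (sh i)).
have e1 : (fun p => l p ^+ 2 * (A p * k p * B p)) =1 (fun p => l p ^+ 2 * (A p * B p) * k p) by move=> p /=; ring.
have e2 : (fun p => l p ^+ 2 * (A p * (B p * k p))) =1 (fun p => l p ^+ 2 * (A p * B p) * k p) by move=> p /=; ring.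
have hc : \forall p \near F, 0 <= l p ^+ 2 * (A p * B p) * k p.
  by apply: filterS3 hA hB hk0 => p a b c; rewrite mulr_ge0// mulr_ge0 ?sqr_ge0// mulr_ge0.
apply: symb_ext (symb_eqA _ (symbM hkk h1 hc (symb_c2 _) (symbD (symb_eqA e1 s1) (symb_eqA e2 s2)))).
  by apply: filterS3 hl uf uh => p lp uf uh x Ux; rewrite (pd_scov _ lp uf uh Ux).
by move=> p /=; rewrite mul1r.
Qed.

End SmoothingSymbols.

(** * Iterated mollification *)

Section IteratedSmoothing.
Variable R : realType.
Local Notation E := 'rV[R]_2.
Local Notation U := (@open_disk R).
Implicit Types (f h : E -> R) (x y : E) (i j : 'I_2) (l : R) (n m : nat).

(** One averaging gains a single derivative; iterating at the same scale gains as many as the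
    corrugations will consume. *)
Definition sm m l f : E -> R := iter m (smooth l) f.

Lemma ucn_sm n m f l : 0 < l < 1 -> ucn n f -> ucn n (sm m l f).
Proof. by move=> hl sf; elim: m => [//|m IH]; apply: ucn_smooth. Qed.

Lemma eq_sm m f h l x : 0 < l < 1 -> uc f -> uc h -> U x -> (forall y, U y -> f y = h y) ->
  sm m l f x = sm m l h x.
Proof.
move=> hl uf uh Ux fh; have u g q : uc g -> uc (sm q l g).
  by move=> ug; elim: q => [//|q IH]; exact: uc_smooth.
by elim: m x Ux => [|m IH] x Ux; [exact: fh|apply: eq_smooth; [|exact: u|exact: u| |]].
Qed.

Lemma pd_sm m f l i x n : 0 < l < 1 -> ucn n.+1 f -> U x ->
  pd i (sm m l f) x = (1 - l) ^+ (2 * m) * sm m l (pd i f) x.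
Proof.
move=> hl sf; have sp := ucn_pd i sf.
elim: m x => [|m IH] x Ux; first by rewrite muln0 expr0 mul1r.
have sm' := ucn_sm m hl sf.
rewrite /= (pd_smooth i hl sm' Ux).
have -> : smooth l (pd i (sm m l f)) x = smooth l (fun y => (1 - l) ^+ (2 * m) * sm m l (pd i f) y) x.
  apply: eq_smooth => //; first exact: ucn_uc (ucn_pd i sm').
  exact: ucn_uc (ucnZ _ (ucn_sm m hl sp)).
rewrite smoothZ//; last exact: ucn_uc (ucn_sm m hl sp).
by rewrite mulrA -exprD mulnS addnC addnC.
Qed.

Lemma smD m f h l x : 0 < l < 1 -> uc f -> uc h -> U x ->
  sm m l (fun y => f y + h y) x = sm m l f x + sm m l h x.
Proof.
move=> hl uf uh; have u g q : uc g -> uc (sm q l g).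
  by move=> ug; elim: q => [//|q IH]; exact: uc_smooth.
elim: m x => [//|m IH] x Ux /=; rewrite -(smoothD hl (u _ m uf) (u _ m uh) Ux).
apply: (eq_smooth hl (u _ m (ucD uf uh)) (ucD (u _ m uf) (u _ m uh)) Ux) => y Uy.
exact: IH.
Qed.

Lemma smZ m (c : R) f l x : 0 < l < 1 -> ucn 0 f -> U x ->
  sm m l (fun y => c * f y) x = c * sm m l f x.
Proof.
move=> hl uf; elim: m x => [//|m IH] x Ux /=; rewrite -smoothZ//; last exact: ucn_uc (ucn_sm m hl uf).
apply: eq_smooth => //; first exact: ucn_uc (ucn_sm m hl (ucnZ c uf)).
exact: ucn_uc (ucnZ c (ucn_sm m hl uf)).
Qed.

Lemma sm_cst m (c : R) l x : 0 < l < 1 -> U x -> sm m l (fun=> c) x = c.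
Proof.
move=> hl; elim: m x => [//|m IH] x Ux /=; rewrite -[RHS](smooth_cst c hl Ux).
apply: eq_smooth => //; first exact: ucn_uc (ucn_sm m hl (ucn_cst 0 c)).
exact: ucn_uc (ucn_cst 0 c).
Qed.

Definition cov m l f h x : R := sm m l (fun y => f y * h y) x - sm m l f x * sm m l h x.

(** The commutator of the iterated smoothing telescopes into smoothed one-step commutators, so its
    estimate remains quadratic in [l]. *)
Lemma covS m l f h x : 0 < l < 1 -> ucn 0 f -> ucn 0 h -> U x ->
  cov m.+1 l f h x = smooth l (cov m l f h) x + scov l (sm m l f) (sm m l h) x.
Proof.
move=> hl sf sh Ux.
have s1 := ucn_sm m hl sf; have s2 := ucn_sm m hl sh; have s3 := ucn_sm m hl (ucnM sf sh).
have e : smooth l (cov m l f h) x = smooth l (sm m l (fun y => f y * h y)) x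
   + -1 * smooth l (fun y => sm m l f y * sm m l h y) x.
  rewrite -smoothZ//; last exact: ucn_uc (ucnM s1 s2).
  rewrite -smoothD//; last 2 first.
  - exact: ucn_uc s3.
  - exact: ucn_uc (ucnZ _ (ucnM s1 s2)).
  apply: eq_smooth => //; first exact: ucn_uc (ucnB s3 (ucnM s1 s2)).
    exact: ucn_uc (ucnD s3 (ucnZ _ (ucnM s1 s2))).
  by move=> y _; rewrite mulN1r.
rewrite e /cov /scov /=; ring.
Qed.

End IteratedSmoothing.

Section IteratedSymbols.
Variables (R : realType) (P : Type) (F : set_system P).
Context {FF : Filter F}.
Local Notation E := 'rV[R]_2.
Local Notation U := (@open_disk R).
Local Notation symb := (symb F).
Implicit Types (f h : P -> E -> R) (A B w : P -> R) (i : 'I_2) (n m : nat).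

(** Only the size [A] of the function and the size [A w] of its gradient occur, so a smaller
    amplitude can be traded against a larger first frequency. *)
Lemma symb_conv n (c : R) A A' w w' k f :
  (\forall p \near F, 0 <= A p <= c * A' p) ->
  (\forall p \near F, 0 <= A p * w p <= c * (A' p * w' p)) ->
  (\forall p \near F, 0 <= k p) ->
  symb n A w k f -> symb n A' w' k f.
Proof.
move=> hA hAw hk; have sup : (exists C : R, \forall p \near F, forall x, U x -> `|f p x| <= C * A p) ->
    exists C : R, \forall p \near F, forall x, U x -> `|f p x| <= C * A' p.
  move=> [C fC]; exists (`|C| * c).
  apply: filterS2 hA fC => p /andP[A0 AA] fC x /fC /le_trans; apply.
  by rewrite -mulrA (le_trans (ler_wpM2r A0 (ler_norm C)))// ler_wpM2l.
case: n => [|n] [sf r]; split=> //; try exact: sup.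
case: r => df hf; split=> // i.
have hk2 : \forall p \near F, 0 <= k p <= k p by apply: filterS hk => p ->; rewrite lexx.
exact: symb_amp hk2 hAw (hf i).
Qed.

(** The derivative of order [n + 1] provides the Lipschitz bounds behind the uniform continuity of
    the previous ones; hence the loss of one order. *)
Lemma symb_ucn n A w k f : symb n.+1 A w k f -> \forall p \near F, ucn n (f p).
Proof.
elim: n A w f => [|n IH] A w f sf.
  have [[C hC] [df hf]] := sf; have [[C0 h0] _] := hf 0; have [[C1 h1] _] := hf 1.
  have H := @filterI _ F FF _ _ (@filterI _ F FF _ _ hC df) (@filterI _ F FF _ _ h0 h1).
  apply: (@filterS _ F FF _ _ _ H) => p [[b d] [b0 b1]]; split=> //; last by exists (C * A p).
  apply: (lip_uc (M := Num.max (C0 * (A p * w p)) (C1 * (A p * w p)))) => x y Ux Uy.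
  apply: disk_lip => // i z Uz; case: (ord2_case i) => ->.
    by rewrite le_max b0.
  by rewrite le_max b1// orbT.
have [_ [df hf]] := sf.
have H := @filterI _ F FF _ _ (@filterI _ F FF _ _ (IH _ _ _ (symb_pred sf)) df) (@filterI _ F FF _ _ (IH _ _ _ (hf 0)) (IH _ _ _ (hf 1))).
apply: (@filterS _ F FF _ _ _ H) => p [[u d] [u0 u1]].
split; [exact: ucn_uc u|exact: ucn_bnd u|split; first exact: d].
by move=> i; case: (ord2_case i) => ->; [exact: u0|exact: u1].
Qed.

Variable l : P -> R.
Hypothesis hl : \forall p \near F, 0 < l p < 1.
Local Notation k := (fun p => (l p)^-1).

Let hkk : \forall p \near F, 0 <= k p <= k p.
Proof. by apply: filterS hl => p /andP[l0 _]; rewrite lexx invr_ge0 ltW. Qed.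

Lemma symb_smk n m A f : (\forall p \near F, 0 <= A p) -> (\forall p \near F, ucn n (f p)) ->
  symb n A k k f -> symb (m + n) A k k (fun p => sm m (l p) (f p)) /\
  (\forall p \near F, ucn (m + n) (sm m (l p) (f p))).
Proof.
move=> hA uf sf; elim: m => [//|m [IH1 IH2]]; split.
  by rewrite addSn; apply: symb_gain.
by apply: filterS2 hl IH2 => p lp u; rewrite addSn; exact: ucn_smooth_gain.
Qed.

Lemma symb_sm1 n m A w f : (\forall p \near F, 0 <= A p) -> (\forall p \near F, 0 <= w p <= k p) ->
  (\forall p \near F, ucn n.+1 (f p)) ->
  symb n.+1 A w k f -> symb (m + n.+1) A w k (fun p => sm m (l p) (f p)) /\
  (\forall p \near F, ucn (m + n.+1) (sm m (l p) (f p))).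
Proof.
move=> hA hw uf sf; elim: m => [//|m [IH1 IH2]]; split.
  by rewrite addSn; move: IH1 IH2; rewrite addnS => IH1 IH2; exact: symb_gain1.
by apply: filterS2 hl IH2 => p lp u; rewrite addSn; exact: ucn_smooth_gain.
Qed.

Lemma symb_sm0 m A w k1 f : (\forall p \near F, 0 <= A p) -> (\forall p \near F, 0 <= w p <= k1 p) ->
  (\forall p \near F, ucn 0 (f p)) ->
  symb 0 A w k1 f -> symb 0 A w k1 (fun p => sm m (l p) (f p)).
Proof.
move=> hA hw uf sf; elim: m => [//|m IH].
apply: symb_smooth => //.
by apply: filterS2 hl uf => p lp u; exact: ucn_sm.
Qed.

Lemma symb_pd_sm m A f i : (\forall p \near F, 0 <= A p) -> (\forall p \near F, ucn 1 (f p)) ->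
  symb 0 A k k (fun p => pd i (f p)) ->
  symb m A k k (fun p => pd i (sm m (l p) (f p))).
Proof.
move=> hA uf sf.
have up : \forall p \near F, ucn 0 (pd i (f p)) by apply: filterS uf => p; exact: ucn_pd.
have [s1 _] := symb_smk m hA up sf; rewrite addn0 in s1.
have h1 : \forall p \near F, 0 <= (1 : R) by exact: nearW.
have sc : symb m (fun=> 1) k k (fun p _ => (1 - l p) ^+ (2 * m)).
  apply: (@symb_scalar _ _ _ _ _ _ _ _ _ 1); apply: filterS hl => p /andP[l0 l1].
  rewrite mulr1 ger0_norm ?exprn_ge0 ?subr_ge0 ?(ltW l1)//.
  by rewrite exprn_ile1 ?subr_ge0 ?(ltW l1)//; lra.
apply: symb_ext (symb_eqA _ (symbM hkk h1 hA sc s1)).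
  by apply: filterS2 hl uf => p lp u x Ux; rewrite (pd_sm m i lp u Ux).
by move=> p; rewrite mul1r.
Qed.

(** Each further smoothing adds one order to the accumulated commutator, and the new one-step
    commutator is taken between arguments that have already been smoothed [m] times. *)
Lemma symb_cov m A B f h : 
  (\forall p \near F, 0 <= A p) -> (\forall p \near F, 0 <= B p) ->
  (\forall p \near F, ucn 1 (f p)) -> (\forall p \near F, ucn 1 (h p)) ->
  (forall i, symb 0 A k k (fun p => pd i (f p))) ->
  (forall i, symb 0 B k k (fun p => pd i (h p))) ->
  symb m (fun p => l p ^+ 2 * (A p * B p)) k k (fun p => cov m.+1 (l p) (f p) (h p)).
Proof.
move=> hA hB uf uh sf sh.
have hc : \forall p \near F, 0 <= l p ^+ 2 * (A p * B p).
  by apply: filterS2 hA hB => p a b; rewrite mulr_ge0 ?sqr_ge0// mulr_ge0.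
have usm q (f' : P -> E -> R) : (\forall p \near F, ucn 1 (f' p)) -> \forall p \near F, ucn q.+1 (sm q (l p) (f' p)).
  move=> uf'; elim: q => [//|q IH]; apply: filterS2 hl IH => p lp u; exact: ucn_smooth_gain.
have sc q : symb q (fun p => l p ^+ 2 * (A p * B p)) k k (fun p => scov (l p) (sm q (l p) (f p)) (sm q (l p) (h p))).
  apply: symb_scov => //; try exact: usm.
    by move=> i; exact: symb_pd_sm.
  by move=> i; exact: symb_pd_sm.
have exts q : symb q (fun p => l p ^+ 2 * (A p * B p)) k k (fun p => smooth (l p) (cov q (l p) (f p) (h p))) ->
    symb q (fun p => l p ^+ 2 * (A p * B p)) k k (fun p => cov q.+1 (l p) (f p) (h p)).
  move=> s1; apply: symb_ext (symbD s1 (sc q)).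
  apply: filterS3 hl uf uh => p lp u1 u2 x Ux.
  by rewrite covS//; exact: ucn_pred.
elim: m => [|m IH]; apply: exts => //.
  apply: symb_ext (symb0 _ _ _ _); apply: filterS3 hl uf uh => p lp u1 u2 x Ux.
  rewrite -[LHS](smooth_cst 0 lp Ux); apply: eq_smooth => //.
  - exact: ucn_uc (ucn_cst 0 0).
  - exact: ucn_uc (ucnB (ucnM u1 u2) (ucnM u1 u2)).
  - by move=> y _; rewrite /cov /= subrr.
apply: symb_gain => //.
have u1 := usm m.+1 _ uf; have u2 := usm m.+1 _ uh.
have u3 : \forall p \near F, ucn m.+2 (sm m.+1 (l p) (fun y => f p y * h p y)).
  by apply: usm; apply: filterS2 uf uh => p; exact: ucnM.
apply: filterS3 u1 u2 u3 => p u1 u2 u3.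
by apply: (@ucn_le _ m m.+2); [rewrite leqW|apply: ucnB u3 (ucnM u1 u2)].
Qed.

Lemma symb_sm_diff m A f : (\forall p \near F, 0 <= A p) -> (\forall p \near F, ucn 1 (f p)) ->
  (forall i, symb 0 A k k (fun p => pd i (f p))) ->
  symb 0 (fun p => l p * A p) k k (fun p x => sm m (l p) (f p) x - f p x).
Proof.
move=> hA uf sf; elim: m => [|m IH].
  by apply: symb_ext (symb0 _ _ _ _); apply: nearW => p x _; rewrite subrr.
suff s : symb 0 (fun p => l p * A p) k k (fun p x => smooth (l p) (sm m (l p) (f p)) x - sm m (l p) (f p) x).
  by apply: symb_ext (symbD s IH); apply: nearW => p x _; rewrite /= addrA subrK.
split=> //.
have [C0 h0] := symb_sup (symb_le (leq0n m) (symb_pd_sm m hA uf (sf 0))).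
have [C1 h1] := symb_sup (symb_le (leq0n m) (symb_pd_sm m hA uf (sf 1))).
exists (6 * Num.max C0 C1).
have H := @filterI _ F FF _ _ (@filterI _ F FF _ _ hl (@filterI _ F FF _ _ hA uf)) (@filterI _ F FF _ _ h0 h1).
apply: (@filterS _ F FF _ _ _ H) => p [[lp [a0 u]] [b0 b1]] x Ux.
have su := ucn_sm m lp u.
have bd i z : U z -> `|pd i (sm m (l p) (f p)) z| <= Num.max C0 C1 * A p.
  move=> Uz; case: (ord2_case i) => ->.
    by apply: le_trans (b0 z Uz) _; rewrite ler_wpM2r// le_max lexx.
  by apply: le_trans (b1 z Uz) _; rewrite ler_wpM2r// le_max lexx orbT.
set c := sm m (l p) (f p) x.
have -> : smooth (l p) (sm m (l p) (f p)) x - c = smooth (l p) (fun y => sm m (l p) (f p) y - c) x.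
  by rewrite smoothD ?smooth_cst//; [exact: ucn_uc su|exact: ucn_uc (ucn_cst 0 _)].
apply: smooth_bound => //; first exact: ucn_uc (ucnB su (ucn_cst 1 c)).
move=> y Uy yx; have dd i z : U z -> derivable (sm m (l p) (f p)) z (delta_mx 0 i) by exact: ucn_der su.
rewrite /c; apply: le_trans (disk_lip dd bd Uy Ux) _.
apply: le_trans (ler_wpM2l _ yx) _; first by apply: le_trans (bd 0 x Ux).
by rewrite le_eqVlt; apply/orP; left; apply/eqP; ring.
Qed.

End IteratedSymbols.

(** * One stage of the iteration *)

Section StageNumbers.
Variable R : realType.
Variables (s lam r K : R).
(** With [r^2 <= K], the condition [s K^3 <= 1] gives [s <= hh], which makes the quartic error
    negligible ([sn_shh]). The condition [K^4 <= s^2 lam] makes the mollification error of [g]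
    negligible ([sn_lhh]). Both persist, since a stage divides [s] by [K] and multiplies [s^2 lam]
    by [K^3 r^5]. The frequencies below are those of the mollification, [k], and of the two
    corrugations; [hh] is both [w1 / mu1] and [mu1 / mu2]. *)
Definition stage_num := [/\ 2 <= r, r ^+ 2 <= K, 0 < s, s * K ^+ 3 <= 1 & 0 < lam /\ K ^+ 4 <= s ^+ 2 * lam].
Hypothesis num : stage_num.
Local Notation k := (K ^+ 2 * r * lam).
Local Notation w1 := (K * lam).
Local Notation mu1 := (K ^+ 3 * r ^+ 2 * lam).
Local Notation mu2 := (K ^+ 2 * r ^+ 2 * mu1).
Local Notation hh := (K ^+ 2 * r ^+ 2)^-1.

Lemma sn_pos : [/\ 0 < r, 0 < s, 0 < lam & 4 <= K].
Proof. by case: num => r2 rK s0 _ [l0 _]; split=> //; [lra|nra]. Qed.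

Lemma sn_s1 : s <= 1.
Proof.
have [r0 s0 l0 K4] := sn_pos; have [_ _ _ sK _] := num.
have K3 : 1 <= K ^+ 3 by rewrite exprn_ege1//; lra.
by apply: le_trans sK; rewrite ler_peMr// ltW.
Qed.

Lemma sn_lam : K ^+ 4 <= lam.
Proof.
have [r0 s0 l0 K4] := sn_pos; have [_ _ _ _ [_]] := num; have s1 := sn_s1.
move=> /le_trans; apply; rewrite ler_piMl ?(ltW l0)//.
by rewrite expr_le1// ltW.
Qed.

Lemma sn_k : 2 <= k.
Proof.
have [r0 s0 l0 K4] := sn_pos; have lK := sn_lam; have [r2 _ _ _ _] := num.
have K1 : 1 <= K ^+ 2 by rewrite exprn_ege1//; lra.
have l1 : 1 <= lam by apply: le_trans lK; rewrite exprn_ege1//; lra.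
have : 1 * 2 <= K ^+ 2 * r by rewrite ler_pM.
have : 1 * 2 * 1 <= K ^+ 2 * r * lam by rewrite ler_pM// ler_pM.
by rewrite !mul1r mulr1.
Qed.

Lemma sn_l : 0 < k^-1 < 1.
Proof.
have k2 := sn_k; have k0 : 0 < k by lra.
by rewrite invr_gt0 k0/= invf_lt1//; lra.
Qed.

Lemma sn_w1 : 0 <= w1 <= k.
Proof.
have [r0 s0 l0 K4] := sn_pos; have [r2 _ _ _ _] := num.
have K0 : 0 < K by lra.
rewrite mulr_ge0 ?(ltW l0) ?(ltW K0)//= ler_wpM2r ?(ltW l0)//; nra.
Qed.

Lemma sn_kmu1 : k <= mu1.
Proof.
have [r0 s0 l0 K4] := sn_pos; have [r2 _ _ _ _] := num.
rewrite ler_wpM2r ?(ltW l0)//.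
have -> : K ^+ 3 * r ^+ 2 = K ^+ 2 * r * (K * r) by ring.
have : 0 <= K ^+ 2 * r by rewrite mulr_ge0 ?sqr_ge0 ?ltW.
by move=> h; rewrite ler_peMr//; nra.
Qed.

Lemma sn_mu1 : 0 < mu1.
Proof. have := sn_kmu1; have := sn_k; lra. Qed.

Lemma sn_mu12 : mu1 <= mu2.
Proof.
have [r0 s0 l0 K4] := sn_pos; have [r2 _ _ _ _] := num; have m0 := sn_mu1.
by rewrite ler_peMl ?(ltW m0)// mulr_ege1// exprn_ege1//; lra.
Qed.

Lemma sn_mu2 : 0 < mu2. Proof. have := sn_mu12; have := sn_mu1; lra. Qed.

Let nz : [/\ r != 0, s != 0, lam != 0 & K != 0].
Proof. by have [r0 s0 l0 K4] := sn_pos; split; rewrite gt_eqF//; lra. Qed.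

Lemma sn_w1mu1 : w1 * mu1^-1 = hh.
Proof. by have [a b c d] := nz; field; rewrite a c d. Qed.

Lemma sn_mu1mu2 : mu1 * mu2^-1 = hh.
Proof. by have [a b c d] := nz; field; rewrite a c d. Qed.

Lemma sn_cov : k^-1 ^+ 2 * (s * w1 * (s * w1)) = s ^+ 2 * hh.
Proof. by have [a b c d] := nz; field; rewrite a c d. Qed.

Lemma sn_hh0 : 0 < hh.
Proof. by have [r0 s0 l0 K4] := sn_pos; rewrite invr_gt0 mulr_gt0 ?exprn_gt0//; lra. Qed.

Lemma sn_hhk : hh * k <= w1.
Proof.
have [r0 s0 l0 K4] := sn_pos; have [a b c d] := nz; have [r2 _ _ _ _] := num.
rewrite (_ : hh * k = lam / r); last by field; rewrite a d.
rewrite ler_pdivrMr//; have lr : 0 < lam * r by rewrite mulr_gt0.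
nra.
Qed.

Lemma sn_hhr : hh <= r^-1.
Proof.
have [r0 s0 l0 K4] := sn_pos; have [r2 _ _ _ _] := num.
rewrite lef_pV2 ?posrE//; last by rewrite mulr_gt0 ?exprn_gt0//; lra.
have -> : K ^+ 2 * r ^+ 2 = r * (K ^+ 2 * r) by ring.
have r1 : 1 <= r by lra.
have K1 : 1 <= K by lra.
by rewrite ler_peMr ?(ltW r0)// mulr_ege1 ?exprn_ege1.
Qed.

Lemma sn_shh : s <= hh.
Proof.
have [r0 s0 l0 K4] := sn_pos; have [r2 rK _ sK _] := num.
have K0 : 0 < K by lra.
rewrite -[hh]mul1r ler_pdivlMr; last by rewrite mulr_gt0 ?exprn_gt0.
apply: le_trans sK; rewrite ler_pM2l// (_ : K ^+ 3 = K ^+ 2 * K); last by ring.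
by rewrite ler_pM2l ?exprn_gt0.
Qed.

Lemma sn_lhh : k^-1 <= s ^+ 2 * hh ^+ 2.
Proof.
have [r0 s0 l0 K4] := sn_pos; have [r2 rK _ sK [_ lK]] := num.
have K0 : 0 < K by lra.
have k0 : 0 < k by have := sn_k; lra.
rewrite exprVn ler_pdivlMr ?exprn_gt0 ?mulr_gt0 ?exprn_gt0// mulrC ler_pdivrMr//.
have -> : (K ^+ 2 * r ^+ 2) ^+ 2 = K ^+ 4 * (r ^+ 2 * (r ^+ 2)) by ring.
have -> : s ^+ 2 * (K ^+ 2 * r * lam) = s ^+ 2 * lam * (K * (K * r)) by ring.
rewrite ler_pM ?exprn_ge0 ?mulr_ge0 ?exprn_ge0 ?(ltW r0) ?(ltW K0)//.
rewrite ler_pM ?exprn_ge0 ?(ltW r0)//.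
apply: le_trans rK _; rewrite ler_peMr ?(ltW K0)//; lra.
Qed.

Lemma sn_hh1 : hh <= 1.
Proof.
apply: le_trans sn_hhr _; have [r0 _ _ _] := sn_pos; have [r2 _ _ _ _] := num.
by rewrite invf_le1//; lra.
Qed.

Lemma sn_s2r : s ^+ 2 <= r^-1.
Proof.
apply: le_trans sn_hhr; apply: le_trans sn_shh; have [_ s0 _ _] := sn_pos.
by rewrite expr2 ler_piMl ?(ltW s0)// sn_s1.
Qed.

End StageNumbers.

(** * The invariant of a stage *)

Section StageInvariant.
Variable R : realType.
Local Notation E := 'rV[R]_2.
Local Notation U := (@open_disk R).
Implicit Types (e f x : E) (i j q : 'I_2).

Definition bil e f (M : 'I_2 -> 'I_2 -> R) : R := \sum_(i < 2) \sum_(j < 2) e 0 i * f 0 j * M i j.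

Lemma bilE e f M : bil e f M =
  e 0 0 * f 0 0 * M 0 0 + e 0 0 * f 0 1 * M 0 1 + (e 0 1 * f 0 0 * M 1 0 + e 0 1 * f 0 1 * M 1 1).
Proof.
rewrite /bil !big_ord_recl !big_ord0 !addr0.
by rewrite (_ : lift ord0 ord0 = 1) //; apply/val_inj.
Qed.

Variables (g : 'I_2 -> 'I_2 -> E -> R) (M : nat).

Definition defect (u : 'I_3 -> E -> R) i j x : R := g i j x - gram u i j x.

(* [st_s ^ 2] is the size of the isotropic part of the metric defect, [st_l] the
   frequency of the map and [st_r] the factor separating consecutive scales. *)
Record stage := Stage { st_s : R; st_l : R; st_r : R; st_u : 'I_3 -> E -> R }.

Definition st_K p : R := st_r p ^+ M.
Definition st_h p : R := (st_K p ^+ 2 * st_r p ^+ 2)^-1.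

(** The factor [K] in the second derivatives is there because the preceding corrugation had
    amplitude [K s]. The entry between [e] and [f] already has the size allowed for the whole
    deviation after the stage: [s^2 h] is below [(s / K)^2 / r]. That is why it may be left
    alone. *)
Definition stage_inv e f p :=
  [/\ stage_num (st_s p) (st_l p) (st_r p) (st_K p),
      forall l, ucn 2 (st_u p l),
      forall i j l x, U x -> `|pd j (pd i (st_u p l)) x| <= st_s p * (st_K p * st_l p),
      (forall i j x, U x -> `|defect (st_u p) i j x - st_s p ^+ 2 * (i == j)%:R| <= st_s p ^+ 2 / st_r p) /\
      (forall i j q x, U x -> `|pd q (defect (st_u p) i j) x| <= st_s p ^+ 2 * st_l p)
    & forall x, U x -> `|bil e f (fun i j => defect (st_u p) i j x)| <= st_s p ^+ 2 * st_h p].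

(** Along this filter, eventually means for [r] large, uniformly in [s], in the frequency and in the
    map. A symbol constant is then absorbed by a spare power of [r]. *)
Definition stageF e f : set_system stage :=
  [set Q | exists r0, forall p, stage_inv e f p -> r0 <= st_r p -> Q p].

Global Instance stageF_filter e f : Filter (stageF e f).
Proof.
constructor.
- by exists 0.
- move=> A B [a hA] [b hB]; exists (Num.max a b) => p ip; rewrite ge_max => /andP[h1 h2].
  by split; [exact: hA|exact: hB].
- by move=> A B AB [a hA]; exists a => p ip h; apply: AB; exact: hA.
Qed.

End StageInvariant.

Lemma ord3_case (l : 'I_3) : [\/ l = 0, l = 1 | l = 2].
Proof.
by case: l => -[|[|[|//]]] h; [apply: Or31|apply: Or32|apply: Or33]; apply/val_inj.
Qed.

Lemma sum3 (V : nmodType) (h : 'I_3 -> V) : \sum_(i < 3) h i = h 0 + h 1 + h 2.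
Proof.
rewrite !big_ord_recl big_ord0 addr0 addrA.
by congr (_ + _ + _); congr h; apply/val_inj.
Qed.

Lemma sm_lin4 (R : realType) m (c1 c2 c3 c4 l : R) (D1 D2 D3 D4 : 'rV[R]_2 -> R) x :
  0 < l < 1 -> ucn 0 D1 -> ucn 0 D2 -> ucn 0 D3 -> ucn 0 D4 -> @open_disk R x ->
  sm m l (fun y => (c1 * D1 y + c2 * D2 y) + (c3 * D3 y + c4 * D4 y)) x =
  (c1 * sm m l D1 x + c2 * sm m l D2 x) + (c3 * sm m l D3 x + c4 * sm m l D4 x).
Proof.
move=> lp h1 h2 h3 h4 Ux.
have z1 := ucn_uc (ucnZ c1 h1); have z2 := ucn_uc (ucnZ c2 h2).
have z3 := ucn_uc (ucnZ c3 h3); have z4 := ucn_uc (ucnZ c4 h4).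
rewrite (smD m lp (ucD z1 z2) (ucD z3 z4) Ux) (smD m lp z1 z2 Ux) (smD m lp z3 z4 Ux).
by rewrite (smZ m _ lp h1 Ux) (smZ m _ lp h2 Ux) (smZ m _ lp h3 Ux) (smZ m _ lp h4 Ux).
Qed.

(** * Mollified map and metric of a stage *)

Section StageMollify.
Variable R : realType.
Local Notation E := 'rV[R]_2.
Local Notation U := (@open_disk R).
Implicit Types (x : E) (i j q : 'I_2).
Variables (g : 'I_2 -> 'I_2 -> E -> R) (M : nat) (e f : E).
Hypothesis gucn : forall i j, ucn 2 (g i j).
Local Notation F := (stageF g M e f).
Local Notation symb := (symb F).
Local Notation K := (@st_K R M).
Local Notation hh := (@st_h R M).

Definition st_len p : R := (K p ^+ 2 * st_r p * st_l p)^-1.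
Local Notation l := st_len.
Local Notation k := (fun p => (l p)^-1).
Definition st_w p : R := K p * st_l p.
Definition st_mu1 p : R := K p ^+ 3 * st_r p ^+ 2 * st_l p.
Definition st_mu2 p : R := K p ^+ 2 * st_r p ^+ 2 * st_mu1 p.

Lemma st_near (Q : stage R -> Prop) : (forall p, stage_inv g M e f p -> Q p) -> \forall p \near F, Q p.
Proof. by move=> h; exists 0 => p ip _; exact: h. Qed.

Lemma stI (A B : set (stage R)) : F A -> F B -> F (A `&` B).
Proof. exact: filterI. Qed.

Lemma st_large (c : R) : \forall p \near F, c <= st_r p.
Proof. by exists c. Qed.

Definition st_num p := stage_num (st_s p) (st_l p) (st_r p) (K p).

Lemma near_st_num : \forall p \near F, st_num p.
Proof. by apply: st_near => p []. Qed.

Lemma st_kE p : (l p)^-1 = K p ^+ 2 * st_r p * st_l p.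
Proof. by rewrite /l invrK. Qed.

Lemma near_st_len : \forall p \near F, 0 < l p < 1.
Proof. by apply: filterS near_st_num => p /sn_l. Qed.

Lemma near_st_freq_ge0 : \forall p \near F, 0 <= k p.
Proof. by apply: filterS near_st_len => p /andP[l0 _]; rewrite invr_ge0 ltW. Qed.

Lemma near_st_freq : \forall p \near F, 0 <= k p <= k p.
Proof. by apply: filterS near_st_freq_ge0 => p ->; rewrite lexx. Qed.

Lemma near_st_w : \forall p \near F, 0 <= st_w p <= k p.
Proof. by apply: filterS near_st_num => p /sn_w1; rewrite st_kE. Qed.

Lemma near_st_sw : \forall p \near F, 0 <= st_s p * st_w p <= k p.
Proof.
apply: filterS2 near_st_num near_st_w => p num /andP[w0 wk]; have [_ s0 _ _] := sn_pos num.
rewrite mulr_ge0 ?(ltW s0)//=; apply: le_trans wk; rewrite ler_piMl//.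
exact: sn_s1 num.
Qed.

Lemma near_st_s2_ge0 : \forall p \near F, 0 <= st_s p ^+ 2. Proof. by apply: nearW => p; exact: sqr_ge0. Qed.

Lemma near_st_h_ge0 : \forall p \near F, 0 <= hh p.
Proof. by apply: filterS near_st_num => p num; exact: ltW (sn_hh0 num). Qed.

Lemma near_st_s2h_ge0 : \forall p \near F, 0 <= st_s p ^+ 2 * hh p.
Proof. by apply: filterS near_st_h_ge0 => p h; rewrite mulr_ge0 ?sqr_ge0. Qed.

Lemma near_one_ge0 : \forall p \near F, 0 <= (1 : R). Proof. exact: nearW. Qed.

Lemma stu_ucn l' : \forall p \near F, ucn 2 (st_u p l').
Proof. by apply: st_near => p []. Qed.

Lemma stdu_ucn i l' : \forall p \near F, ucn 1 (pd i (st_u p l')).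
Proof. by apply: filterS (stu_ucn l') => p; exact: ucn_pd. Qed.

Lemma gram_ucn n (u : 'I_3 -> E -> R) i j : (forall i l, ucn n (pd i (u l))) -> ucn n (gram u i j).
Proof.
by move=> h; rewrite /gram /vd /du; apply: ucnD; [apply: ucnD|]; exact: ucnM.
Qed.

Lemma defect_ucn i j : \forall p \near F, ucn 1 (defect g (st_u p) i j).
Proof.
apply: st_near => p [_ hu _ _ _]; apply: ucnB; first exact: ucn_pred (gucn i j).
by apply: gram_ucn => i' l'; exact: ucn_pd.
Qed.

Lemma symb_g i j : symb 1 (fun=> 1) (fun=> 1) k (fun _ => g i j).
Proof.
have [_ [C hC] [dg hg]] := gucn i j; split; last split.
- by exists C; apply: nearW => p x Ux; rewrite mulr1; exact: hC.
- by apply: nearW => p i' x Ux; exact: dg.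
- move=> q; have [_ [C' hC'] _] := hg q; split=> //.
  by exists C'; apply: nearW => p x Ux; rewrite !mulr1; exact: hC'.
Qed.

Lemma symb_defect i j : symb 1 (fun p => st_s p ^+ 2) st_w k (fun p => defect g (st_u p) i j).
Proof.
split; last split.
- exists 2; apply: st_near => p [num _ _ [h _] _] x Ux.
  have [r0 s0 _ _] := sn_pos num; have [r2 _ _ _ _] := num.
  have := h i j x Ux; set d := defect _ _ _ _ _ => hd.
  have s2 : 0 <= st_s p ^+ 2 by exact: sqr_ge0.
  have sr : st_s p ^+ 2 / st_r p <= st_s p ^+ 2.
    by rewrite ler_pdivrMr// ler_peMr//; lra.
  have b : `|st_s p ^+ 2 * (i == j)%:R| <= st_s p ^+ 2.
    by rewrite normrM ger0_norm// ler_piMr//; case: (i == j); rewrite ?normr1 ?normr0 ?ler01.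
  rewrite -[d](subrK (st_s p ^+ 2 * (i == j)%:R)).
  by apply: le_trans (ler_normD _ _) _; lra.
- by apply: filterS (defect_ucn i j) => p u q x Ux; exact: ucn_der u Ux.
- move=> q; split=> //; exists 1; apply: st_near => p [num _ _ [_ h] _] x Ux; rewrite mul1r.
  apply: le_trans (h i j q x Ux) _; rewrite /st_w mulrCA ler_peMl//.
    by rewrite mulr_ge0 ?sqr_ge0//; have [_ _ l0 _] := sn_pos num; exact: ltW.
  by have [_ _ _ K4] := sn_pos num; lra.
Qed.

(** The invariant contains no bound for the gradient. It follows from the diagonal of the induced
    metric, which differs from [g] by the small defect. *)
Lemma symb_du0 i l' : symb 1 (fun=> 1) (fun p => st_s p * st_w p) k (fun p => pd i (st_u p l')).
Proof.
split; last split.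
- have [[C hC] _] := symb_g i i; have [[C' hC'] _] := symb_defect i i.
  exists (1 + (C + `|C'|)); apply: filterS (stI (stI hC hC') near_st_num) => p [[b1 b2] num] x Ux.
  rewrite mulr1.
  have sq : (pd i (st_u p l') x) ^+ 2 <= gram (st_u p) i i x.
    rewrite /gram /vd /du -!expr2.
    case: l' => -[|[|[|//]]] h3.
    + by rewrite (_ : Ordinal h3 = 0); [rewrite -addrA lerDl addr_ge0 ?sqr_ge0|apply/val_inj].
    + by rewrite (_ : Ordinal h3 = 1); [rewrite addrAC lerDr addr_ge0 ?sqr_ge0|apply/val_inj].
    + by rewrite (_ : Ordinal h3 = 2); [rewrite lerDr addr_ge0 ?sqr_ge0|apply/val_inj].
  have gE : gram (st_u p) i i x = g i i x - defect g (st_u p) i i x by rewrite /defect opprB addrCA subrr addr0.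
  have c1 := b1 x Ux; have c2 := b2 x Ux; rewrite mulr1 in c1.
  have c3 : C' * st_s p ^+ 2 <= `|C'|.
    apply: le_trans (ler_wpM2r (sqr_ge0 _) (ler_norm C')) _.
    by rewrite ler_piMr// expr_le1 ?(sn_s1 num)//; have [_ s0 _ _] := sn_pos num; exact: ltW.
  have c4 := ler_norm (g i i x); have c5 := ler_norm (- defect g (st_u p) i i x).
  rewrite normrN in c5.
  have t1 : `|pd i (st_u p l') x| <= 1 + pd i (st_u p l') x ^+ 2.
    by rewrite -[_ ^+ 2]real_normK ?num_real//; nra.
  lra.
- by apply: filterS (stdu_ucn i l') => p u q x Ux; exact: ucn_der u Ux.
- move=> q; split=> //; exists 1; apply: st_near => p [num _ h _ _] x Ux; rewrite !mul1r.
  exact: h.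
Qed.

(** The prefactor undoes the contraction, so that the gradient is exactly the mollified gradient
    ([pd_ul]). The value at 0 is set aside because this dilation would move a map with large values
    too far. Seven iterations leave enough derivatives for two corrugations and a final map of class
    C^2. *)
Definition st_ul (p : stage R) (l' : 'I_3) x : R :=
  (1 - l p) ^- (2 * 7) * sm 7 (l p) (fun y => st_u p l' y - st_u p l' 0) x + st_u p l' 0.

Lemma pdB_cst (h : E -> R) (c : R) i x : derivable h x (delta_mx 0 i) ->
  pd i (fun y => h y - c) x = pd i h x.
Proof. by move=> dh; rewrite (pdD dh (derivable_cst (- c) x (delta_mx 0 i))) pd_cst addr0. Qed.

Lemma pd_ul i l' : \forall p \near F, forall x, U x -> 
  derivable (st_ul p l') x (delta_mx 0 i) /\ pd i (st_ul p l') x = sm 7 (l p) (pd i (st_u p l')) x.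
Proof.
apply: filterS2 near_st_len (stu_ucn l') => p lp u x Ux.
have uc0 := ucnB u (ucn_cst 2 (st_u p l' 0)).
have u7 := ucn_sm 7 lp uc0.
have d7 : derivable _ x (delta_mx 0 i) := ucn_der u7 Ux.
have dz := derivableM (derivable_cst ((1 - l p) ^- (2 * 7)) x (delta_mx 0 i)) d7.
have dc := derivable_cst (st_u p l' 0) x (delta_mx 0 i).
split; first exact: (derivableD dz dc).
rewrite /st_ul (pdD dz dc) pd_cst addr0 (pdZ _ d7) (pd_sm 7 i lp uc0 Ux) mulrA mulVf ?mul1r; last first.
  by rewrite expf_neq0// subr_eq0 gt_eqF//; case/andP: lp.
apply: (eq_sm _ lp) => //; first exact: ucn_uc (ucn_pd i uc0).
  exact: ucn_uc (ucn_pd i u).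
by move=> y Uy; exact: pdB_cst _ (ucn_der u Uy).
Qed.

Lemma symb_dul i l' : symb 8 (fun=> 1) (fun p => st_s p * st_w p) k (fun p => pd i (st_ul p l')).
Proof.
have [s8 _] := symb_sm1 near_st_len 7 near_one_ge0 near_st_sw (stdu_ucn i l') (symb_du0 i l').
by apply: symb_ext s8; apply: filterS (pd_ul i l') => p h x /h[].
Qed.

Definition st_cv p i j x : R := \sum_(l' < 3) cov 7 (l p) (pd i (st_u p l')) (pd j (st_u p l')) x.

Lemma symb_cv i j : symb 6 (fun p => st_s p ^+ 2 * hh p) k k (fun p => st_cv p i j).
Proof.
apply: symb_sum => l'.
have hsw : \forall p \near F, 0 <= st_s p * st_w p by apply: filterS near_st_sw => p /andP[].
have d2 i' q : symb 0 (fun p => st_s p * st_w p) k k (fun p => pd q (pd i' (st_u p l'))).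
  by apply: symb_eqA (symb_pd q (symb_du0 i' l')) => p; rewrite mul1r.
apply: (symb_amp (c := 1) near_st_freq _ (symb_cov near_st_len 6 hsw hsw (stdu_ucn i l') (stdu_ucn j l') (d2 i) (d2 j))).
apply: filterS near_st_num => p num; rewrite mul1r /st_h -(sn_cov num) lexx andbT.
by rewrite mulr_ge0 ?sqr_ge0//= -expr2 sqr_ge0.
Qed.

Definition st_D0 p i j x : R := sm 7 (l p) (g i j) x - gram (st_ul p) i j x.

(** As the gradient of [st_ul] is the mollified gradient, the induced metric differs from the
    mollified one by a commutator of products only. *)
Lemma st_D0E i j : \forall p \near F, forall x, U x ->
  st_D0 p i j x = sm 7 (l p) (defect g (st_u p) i j) x + st_cv p i j x.
Proof.
have H := stI (stI near_st_len (defect_ucn i j))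
  (stI (stI (stu_ucn 0) (stu_ucn 1)) (stu_ucn 2)).
have H2 q := stI (stI (pd_ul q 0) (pd_ul q 1)) (pd_ul q 2).
have H3 := stI (H2 i) (H2 j).
apply: filterS2 H H3 => p [[lp ud] [[u0 u1] u2]] [[[a0 a1] a2] [[b0 b1] b2]] x Ux.
rewrite /st_D0 /gram /vd /du; have [_ ->] := a0 x Ux; have [_ ->] := a1 x Ux; have [_ ->] := a2 x Ux.
have [_ ->] := b0 x Ux; have [_ ->] := b1 x Ux; have [_ ->] := b2 x Ux.
have up l' : ucn 2 (st_u p l').
  by case: (ord3_case l') => ->; [exact: u0|exact: u1|exact: u2].
have upm l' : ucn 1 (fun y => pd i (st_u p l') y * pd j (st_u p l') y).
  exact: (ucnM (ucn_pd i (up l')) (ucn_pd j (up l'))).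
have -> : sm 7 (l p) (g i j) x = sm 7 (l p) (fun y => defect g (st_u p) i j y +
   ((pd i (st_u p 0) y * pd j (st_u p 0) y + pd i (st_u p 1) y * pd j (st_u p 1) y) + pd i (st_u p 2) y * pd j (st_u p 2) y)) x.
  apply: (eq_sm _ lp) => //; first exact: ucn_uc (gucn i j).
    exact: ucn_uc (ucnD ud (ucnD (ucnD (upm 0) (upm 1)) (upm 2))).
  by move=> y _; rewrite /defect /gram /vd /du subrK.
rewrite (smD 7 lp (ucn_uc ud) (ucn_uc (ucnD (ucnD (upm 0) (upm 1)) (upm 2))) Ux).
rewrite (smD 7 lp (ucn_uc (ucnD (upm 0) (upm 1))) (ucn_uc (upm 2)) Ux).
rewrite (smD 7 lp (ucn_uc (upm 0)) (ucn_uc (upm 1)) Ux).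
rewrite /st_cv sum3 /cov.
have alg (D A B C a b c a' b' c' : R) : D + (A + B + C) - (a * a' + b * b' + c * c') =
  D + ((A - a * a') + (B - b * b') + (C - c * c')) by ring.
exact: alg.
Qed.

(** The commutator, of size [s^2 h] at frequency [k], fits below the first frequency [w] because
    [h k <= w]. *)
Lemma symb_D0 i j : symb 6 (fun p => st_s p ^+ 2) st_w k (fun p => st_D0 p i j).
Proof.
have [s8 _] := symb_sm1 near_st_len 7 near_st_s2_ge0 near_st_w (defect_ucn i j) (symb_defect i j).
have s6 := symb_le (isT : (6 <= 8)%N) s8.
have c6 : symb 6 (fun p => st_s p ^+ 2) st_w k (fun p => st_cv p i j).
  apply: (symb_conv (c := 1)) near_st_freq_ge0 (symb_cv i j).
    apply: filterS near_st_num => p num; rewrite mul1r mulr_ge0 ?sqr_ge0 ?ler_piMr ?sqr_ge0 ?(sn_hh1 num)//.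
    exact: ltW (sn_hh0 num).
  apply: filterS2 near_st_num near_st_freq_ge0 => p num k0; rewrite mul1r -mulrA ler_wpM2l ?sqr_ge0//.
    rewrite mulr_ge0 ?sqr_ge0// mulr_ge0//; exact: ltW (sn_hh0 num).
  by rewrite st_kE; exact: sn_hhk num.
apply: symb_ext (symbD s6 c6).
by apply: filterS (st_D0E i j) => p h x Ux; rewrite h.
Qed.

Lemma symb_D0_delta i j :
  symb 0 (fun p => st_s p ^+ 2 / st_r p) k k (fun p x => st_D0 p i j x - st_s p ^+ 2 * (i == j)%:R).
Proof.
have hA : \forall p \near F, 0 <= st_s p ^+ 2 / st_r p.
  by apply: filterS near_st_num => p num; have [r0 _ _ _] := sn_pos num; rewrite divr_ge0 ?sqr_ge0 ?ltW.
have sd : symb 0 (fun p => st_s p ^+ 2 / st_r p) k k (fun p x => defect g (st_u p) i j x - st_s p ^+ 2 * (i == j)%:R).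
  by split=> //; exists 1; apply: st_near => p [_ _ _ [h _] _] x Ux; rewrite mul1r; exact: h.
have ud : \forall p \near F, ucn 0 (fun x => defect g (st_u p) i j x - st_s p ^+ 2 * (i == j)%:R).
  by apply: filterS (defect_ucn i j) => p u; apply: ucnB; [exact: ucn_pred|exact: ucn_cst].
have s1 := symb_sm0 (FF := stageF_filter g M e f) near_st_len 7 hA near_st_freq ud sd.
have s2 : symb 0 (fun p => st_s p ^+ 2 / st_r p) k k (fun p => st_cv p i j).
  apply: (symb_amp (c := 1) near_st_freq _ (symb_le (leq0n 6) (symb_cv i j))).
  apply: filterS2 near_st_s2h_ge0 near_st_num => p -> num /=; rewrite mul1r ler_wpM2l ?sqr_ge0//; exact: sn_hhr num.
apply: symb_ext (symbD s1 s2).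
apply: filterS3 near_st_len (st_D0E i j) (defect_ucn i j) => p lp h ud' x Ux; rewrite (h x Ux) addrAC; congr (_ + _).
have := smD 7 lp (ucn_uc ud') (ucn_uc (ucn_cst 0 (- (st_s p ^+ 2 * (i == j)%:R)))) Ux.
by rewrite (sm_cst _ _ lp Ux).
Qed.

Lemma symb_D0_off : symb 0 (fun p => st_s p ^+ 2 * hh p) k k (fun p x => bil e f (fun i j => st_D0 p i j x)).
Proof.
have sd : symb 0 (fun p => st_s p ^+ 2 * hh p) k k (fun p x => bil e f (fun i j => defect g (st_u p) i j x)).
  by split=> //; exists 1; apply: st_near => p [_ _ _ _ h] x Ux; rewrite mul1r; exact: h.
have ubil (D : 'I_2 -> 'I_2 -> E -> R) : (forall i j, ucn 1 (D i j)) -> ucn 1 (fun x => bil e f (fun i j => D i j x)).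
  move=> hD; apply: ucn_ext (ucnD (ucnD (ucnZ (e 0 0 * f 0 0) (hD 0 0)) (ucnZ (e 0 0 * f 0 1) (hD 0 1)))
    (ucnD (ucnZ (e 0 1 * f 0 0) (hD 1 0)) (ucnZ (e 0 1 * f 0 1) (hD 1 1)))) => x _.
  by rewrite bilE.
have H := stI (stI (defect_ucn 0 0) (defect_ucn 0 1))
  (stI (defect_ucn 1 0) (defect_ucn 1 1)).
have uall : \forall p \near F, forall i j, ucn 1 (defect g (st_u p) i j).
  by apply: filterS H => p [[a b] [c d]] i j; case: (ord2_case i) => ->; case: (ord2_case j) => ->.
have ub : \forall p \near F, ucn 0 (fun x => bil e f (fun i j => defect g (st_u p) i j x)).
  by apply: filterS uall => p h; apply: ucn_pred; exact: ubil.
have s1 := symb_sm0 (FF := stageF_filter g M e f) near_st_len 7 near_st_s2h_ge0 near_st_freq ub sd.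
have s2 : symb 0 (fun p => st_s p ^+ 2 * hh p) k k (fun p x => bil e f (fun i j => st_cv p i j x)).
  by apply: symb_sum => i; apply: symb_sum => j; apply: symbZ; exact: symb_le (leq0n 6) (symb_cv i j).
apply: symb_ext (symbD s1 s2).
have H2 := stI (stI (st_D0E 0 0) (st_D0E 0 1))
  (stI (st_D0E 1 0) (st_D0E 1 1)).
apply: filterS3 near_st_len uall H2 => p lp ua [[a00 a01] [a10 a11]] x Ux.
rewrite !bilE (a00 x Ux) (a01 x Ux) (a10 x Ux) (a11 x Ux).
have fe : (fun x0 => bil e f (fun i j => defect g (st_u p) i j x0)) =
   (fun y => (e 0 0 * f 0 0 * defect g (st_u p) 0 0 y + e 0 0 * f 0 1 * defect g (st_u p) 0 1 y)
    + (e 0 1 * f 0 0 * defect g (st_u p) 1 0 y + e 0 1 * f 0 1 * defect g (st_u p) 1 1 y)).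
  by apply/funext => y; exact: bilE.
rewrite fe.
have z0 i j := ucn_pred (ua i j).
rewrite (sm_lin4 7 _ _ _ _ lp (z0 0 0) (z0 0 1) (z0 1 0) (z0 1 1) Ux).
have alg (c1 c2 c3 c4 A1 A2 A3 A4 B1 B2 B3 B4 : R) :
  c1 * A1 + c2 * A2 + (c3 * A3 + c4 * A4) + (c1 * B1 + c2 * B2 + (c3 * B3 + c4 * B4)) =
  c1 * (A1 + B1) + c2 * (A2 + B2) + (c3 * (A3 + B3) + c4 * (A4 + B4)) by ring.
exact: alg.
Qed.

Lemma symb_g_diff i j : symb 0 (fun p => l p) k k (fun p x => sm 7 (l p) (g i j) x - g i j x).
Proof.
have hp q : symb 0 (fun=> 1) k k (fun _ : stage R => pd q (g i j)).
  by apply: symb_eqA (symb_pd q (symb_g i j)) => p; rewrite mulr1.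
have ug : \forall p \near F, ucn 1 (g i j) by apply: nearW => p; exact: ucn_pred.
by apply: symb_eqA (symb_sm_diff near_st_len 7 near_one_ge0 ug hp) => p; rewrite mulr1.
Qed.

End StageMollify.

(** * Linear algebra in orthonormal frames *)

Section FrameAlgebra.
Variable R : realType.
Local Notation E := 'rV[R]_2.
Implicit Types (e f : E) (M : 'I_2 -> 'I_2 -> R).

Lemma orthoframeC e f : orthoframe e f -> orthoframe f e.
Proof. by case=> a b c; split=> //; rewrite mulrC [f 0 1 * _]mulrC. Qed.

(** The determinant [e0 f1 - e1 f0] has square 1 and expresses [f] as plus or minus the rotated
    [e]. *)
Lemma frame_complete_num (e0 e1 f0 f1 : R) : e0 * e0 + e1 * e1 = 1 -> f0 * f0 + f1 * f1 = 1 ->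
  e0 * f0 + e1 * f1 = 0 -> [/\ e0 * e0 + f0 * f0 = 1, e0 * e1 + f0 * f1 = 0 & e1 * e1 + f1 * f1 = 1].
Proof.
move=> ee ff ef.
have s2 : (e0 * f1 - e1 * f0) ^+ 2 = 1.
  rewrite (_ : _ ^+ 2 = (e0 * e0 + e1 * e1) * (f0 * f0 + f1 * f1) - (e0 * f0 + e1 * f1) ^+ 2); last by ring.
  by rewrite ee ff ef; ring.
have h0 : f0 = - (e0 * f1 - e1 * f0) * e1.
  rewrite (_ : - _ * e1 = f0 * (e0 * e0 + e1 * e1) - e0 * (e0 * f0 + e1 * f1)); last by ring.
  by rewrite ee ef; ring.
have h1 : f1 = (e0 * f1 - e1 * f0) * e0.
  rewrite (_ : _ * e0 = f1 * (e0 * e0 + e1 * e1) - e1 * (e0 * f0 + e1 * f1)); last by ring.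
  by rewrite ee ef; ring.
move: (e0 * f1 - e1 * f0) s2 h0 h1 => t t2 -> ->; split.
- rewrite (_ : _ + _ = e0 * e0 + t ^+ 2 * (e1 * e1)); last by ring.
  by rewrite t2 mul1r ee.
- rewrite (_ : _ + _ = e0 * e1 * (1 - t ^+ 2)); last by ring.
  by rewrite t2 subrr mulr0.
- rewrite (_ : _ + _ = e1 * e1 + t ^+ 2 * (e0 * e0)); last by ring.
  by rewrite t2 mul1r addrC ee.
Qed.

Lemma frame_complete e f : orthoframe e f ->
  forall i j : 'I_2, e 0 i * e 0 j + f 0 i * f 0 j = (i == j)%:R.
Proof.
case=> ee ff eof; have [h00 h01 h11] := frame_complete_num ee ff eof.
move=> i j; case: (ord2_case i) => ->; case: (ord2_case j) => -> //=.
by rewrite mulrC [f 0 1 * _]mulrC.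
Qed.

Lemma frame_expand e f M i j : orthoframe e f ->
  M i j = bil e e M * (e 0 i * e 0 j) + bil e f M * (e 0 i * f 0 j)
     + bil f e M * (f 0 i * e 0 j) + bil f f M * (f 0 i * f 0 j).
Proof.
move=> /frame_complete c; rewrite !bilE.
have c00 := c i 0; have c01 := c i 1; have d00 := c 0 j; have d01 := c 1 j.
rewrite [RHS](_ : _ = (e 0 i * e 0 0 + f 0 i * f 0 0) * M 0 0 * (e 0 0 * e 0 j + f 0 0 * f 0 j)
  + (e 0 i * e 0 0 + f 0 i * f 0 0) * M 0 1 * (e 0 1 * e 0 j + f 0 1 * f 0 j)
  + (e 0 i * e 0 1 + f 0 i * f 0 1) * M 1 0 * (e 0 0 * e 0 j + f 0 0 * f 0 j)
  + (e 0 i * e 0 1 + f 0 i * f 0 1) * M 1 1 * (e 0 1 * e 0 j + f 0 1 * f 0 j)).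
  by rewrite c00 c01 d00 d01; case: (ord2_case i) => ->; case: (ord2_case j) => -> /=; ring.
move: (e 0 0) (e 0 1) (f 0 0) (f 0 1) (e 0 i) (e 0 j) (f 0 i) (f 0 j) => e0 e1 f0 f1 ei ej fi fj.
move: (M 0 0) (M 0 1) (M 1 0) (M 1 1) => a b c' d; ring.
Qed.

Lemma spread_bil e f M : spread e f M = bil e e M - bil f f M.
Proof.
rewrite spreadE !bilE.
move: (e 0 0) (e 0 1) (f 0 0) (f 0 1) (M 0 0) (M 0 1) (M 1 0) (M 1 1) => *; ring.
Qed.

Lemma bilC e f M : (forall i j, M i j = M j i) -> bil e f M = bil f e M.
Proof.
move=> s; rewrite !bilE (s 1 0).
move: (e 0 0) (e 0 1) (f 0 0) (f 0 1) (M 0 0) (M 0 1) (M 1 1) => *; ring.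
Qed.

Lemma bilB v w M N : bil v w (fun i j => M i j - N i j) = bil v w M - bil v w N.
Proof.
rewrite !bilE; move: (v 0 0) (v 0 1) (w 0 0) (w 0 1).
move: (M 0 0) (M 0 1) (M 1 0) (M 1 1) (N 0 0) (N 0 1) (N 1 0) (N 1 1) => *; ring.
Qed.

Lemma bil_tensor e v w (a : R) : bil v w (fun i j => a * (e 0 i * e 0 j)) =
  a * ((v 0 0 * e 0 0 + v 0 1 * e 0 1) * (w 0 0 * e 0 0 + w 0 1 * e 0 1)).
Proof.
rewrite !bilE; move: (e 0 0) (e 0 1) (v 0 0) (v 0 1) (w 0 0) (w 0 1) => *; ring.
Qed.

(** Multiples of the identity and off-diagonal terms have equal diagonal entries. The part of [N]
    that would unbalance the diagonal is compensated along [f (x) f]. With [N] the error of the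
    first corrugation, this is the effect of the second amplitude. *)
Lemma spread_cancel e f (c d : R) M N P : orthoframe e f ->
  spread f e (fun i j => c * (i == j)%:R + (M i j + d * (e 0 i * f 0 j + f 0 i * e 0 j)
    - N i j - spread f e N * - (f 0 i * f 0 j) - P i j)) = spread f e M - spread f e P.
Proof.
case; rewrite !spreadE /=.
move: (e 0 0) (e 0 1) (f 0 0) (f 0 1) => e0 e1 f0 f1 ee ff eof.
move: (M 0 0) (M 0 1) (M 1 0) (M 1 1) => g1 g2 g3 g4.
move: (N 0 0) (N 0 1) (N 1 0) (N 1 1) => p1 p2 p3 p4.
move: (P 0 0) (P 0 1) (P 1 0) (P 1 1) => q1 q2 q3 q4.
set SF := (f0 * f0 - e0 * e0) * p1 + _ + _.
apply/eqP; rewrite -subr_eq0; apply/eqP.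
transitivity (c * ((f0 * f0 + f1 * f1) - (e0 * e0 + e1 * e1))
    + 2 * d * (e0 * f0 + e1 * f1) * ((f0 * f0 + f1 * f1) - (e0 * e0 + e1 * e1))
    + SF * ((f0 * f0 + f1 * f1) ^+ 2 - (e0 * f0 + e1 * f1) ^+ 2 - 1)).
  by rewrite /SF; ring.
by rewrite ee ff eof; ring.
Qed.

End FrameAlgebra.

Section DeterminantPerturbation.
Variable R : realType.

Lemma det_close (a b d a' b' d' T t : R) : 0 <= t <= 1 -> `|a| <= T -> `|b| <= T -> `|d| <= T ->
  `|a' - a| <= t -> `|b' - b| <= t -> `|d' - d| <= t -> a * d - b ^+ 2 - (4 * T + 2) * t <= a' * d' - b' ^+ 2.
Proof.
move=> /andP[t0 t1] aT bT dT ha hb hd.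
have pr (y z Y Z : R) : `|y| <= Y -> `|z| <= Z -> - (Y * Z) <= y * z <= Y * Z.
  by move=> hy hz; rewrite -ler_norml normrM ler_pM.
have id : a' * d' - b' ^+ 2 = a * d - b ^+ 2 + ((a' - a) * (d' - d) + (a' - a) * d + a * (d' - d)
   - (b' - b) * (b' - b) - 2 * ((b' - b) * b)) by ring.
rewrite id.
have /andP[p1 p1'] := pr _ _ _ _ ha hd; have /andP[p2 p2'] := pr _ _ _ _ ha dT.
have /andP[p3 p3'] := pr _ _ _ _ aT hd; have /andP[p4 p4'] := pr _ _ _ _ hb hb.
have /andP[p5 p5'] := pr _ _ _ _ hb bT.
have tt : t * t <= t by rewrite ler_piMr.
lra.
Qed.

End DeterminantPerturbation.

(** * The two corrugations of a stage *)

Section StageSteps.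
Variable R : realType.
Local Notation E := 'rV[R]_2.
Local Notation U := (@open_disk R).
Implicit Types (x : E) (i j q : 'I_2).
Variables (g : 'I_2 -> 'I_2 -> E -> R) (M : nat) (e f : E) (ga : R).
Hypothesis gucn : forall i j, ucn 2 (g i j).
Hypothesis gsym : forall i j, g i j = g j i.
Hypothesis ga0 : 0 < ga.
Hypothesis gdet_ga : forall x, U x -> ga <= g 0 0 x * g 1 1 x - g 0 1 x ^+ 2.
Hypothesis ef : orthoframe e f.
Local Notation F := (stageF g M e f).
Local Notation symb := (symb F).
Local Notation K := (@st_K R M).
Local Notation hh := (@st_h R M).
Local Notation l := (@st_len R M).
Local Notation k := (fun p => (l p)^-1).
Local Notation wf := (@st_w R M).
Local Notation mu1 := (@st_mu1 R M).
Local Notation mu2 := (@st_mu2 R M).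
Local Notation s := (@st_s R).
Local Notation D0 := (st_D0 g M).
Let num := near_st_num g M e f.
Let stI := @stI R g M e f.
Let hkk : \forall p \near F, 0 <= k p <= k p := near_st_freq g M e f.
Let hw1 : \forall p \near F, 0 <= wf p <= k p := near_st_w g M e f.
Let h1 : \forall p \near F, 0 <= (1 : R) := near_one_ge0 g M e f.

(** A deviation of order [1 / r] from [g] costs at most half of the determinant bound when [r] is
    large. It is applied to both maps that are going to be corrugated. *)
Lemma gdet_near (v : stage R -> 'I_3 -> E -> R) (w' k' : stage R -> R) :
  (forall i j, symb 0 (fun p => (st_r p)^-1) w' k' (fun p x => gram (v p) i j x - g i j x)) ->
  \forall p \near F, forall x, U x -> ga / 2 <= gdet (v p) x.
Proof.
move=> hv.
have [[C00 h00] _] := hv 0 0; have [[C01 h01] _] := hv 0 1; have [[C11 h11] _] := hv 1 1.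
have [G00 b00] := ucn_bnd (gucn 0 0); have [G01 b01] := ucn_bnd (gucn 0 1); have [G11 b11] := ucn_bnd (gucn 1 1).
pose C := 1 + `|C00| + `|C01| + `|C11|; pose G := `|G00| + `|G01| + `|G11|.
have C1 : 1 <= C by rewrite /C -!addrA lerDl !addr_ge0.
have G0 : 0 <= G by rewrite /G !addr_ge0.
have T0 : 0 <= 2 * (C * (4 * G + 2)) / ga.
  by rewrite divr_ge0 ?(ltW ga0)// !mulr_ge0//; lra.
apply: filterS2 (stI (stI h00 h01) h11) (stI num (st_large g M e f (C + 2 * (C * (4 * G + 2)) / ga))) => p [[a00 a01] a11] [nump rl] x Ux.
have [r0 _ _ _] := sn_pos nump.
set t := C / st_r p.
have tpos : 0 <= t by rewrite /t divr_ge0; lra.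
have t1 : t <= 1 by rewrite /t ler_pdivrMr// mul1r; lra.
have tga : t * (4 * G + 2) <= ga / 2.
  rewrite /t mulrAC ler_pdivrMr//.
  have rT : 2 * (C * (4 * G + 2)) / ga <= st_r p.
    by apply: le_trans rl; rewrite lerDr (le_trans ler01 C1).
  have : ga / 2 * (2 * (C * (4 * G + 2)) / ga) <= ga / 2 * st_r p.
    by apply: ler_wpM2l rT; rewrite divr_ge0 ?(ltW ga0).
  have -> : ga / 2 * (2 * (C * (4 * G + 2)) / ga) = C * (4 * G + 2) by field; rewrite gt_eqF.
  by [].
have bnd (C' : R) z : `|C'| <= C -> `|z| <= C' * (st_r p)^-1 -> `|z| <= t.
  move=> cc /le_trans; apply; rewrite /t ler_wpM2r ?invr_ge0 ?(ltW r0)//.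
  exact: le_trans (ler_norm _) cc.
have n00 := normr_ge0 C00; have n01 := normr_ge0 C01; have n11 := normr_ge0 C11.
have m00 := normr_ge0 G00; have m01 := normr_ge0 G01; have m11 := normr_ge0 G11.
have d00 : `|gram (v p) 0 0 x - g 0 0 x| <= t by apply: bnd (a00 x Ux); rewrite /C; lra.
have d01 : `|gram (v p) 0 1 x - g 0 1 x| <= t by apply: bnd (a01 x Ux); rewrite /C; lra.
have d11 : `|gram (v p) 1 1 x - g 1 1 x| <= t by apply: bnd (a11 x Ux); rewrite /C; lra.
have e00 : `|g 0 0 x| <= G by apply: le_trans (b00 x Ux) _; apply: le_trans (ler_norm _) _; rewrite /G; lra.
have e01 : `|g 0 1 x| <= G by apply: le_trans (b01 x Ux) _; apply: le_trans (ler_norm _) _; rewrite /G; lra.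
have e11 : `|g 1 1 x| <= G by apply: le_trans (b11 x Ux) _; apply: le_trans (ler_norm _) _; rewrite /G; lra.
have t01 : 0 <= t <= 1 by rewrite tpos.
have := det_close t01 e00 e01 e11 d00 d01 d11; apply: le_trans.
have := gdet_ga Ux; move: (_ - _ ^+ 2) => z; move: tga; rewrite mulrC.
by move: (_ * t) => y; lra.
Qed.

Lemma gram_ul_g i j : symb 0 (fun p => (st_r p)^-1) k k (fun p x => gram (st_ul M p) i j x - g i j x).
Proof.
have s1 : symb 0 (fun p => (st_r p)^-1) k k (fun p x => sm 7 (l p) (g i j) x - g i j x).
  apply: (symb_amp (c := 1) hkk _ (symb_g_diff M e f gucn i j)).
  apply: filterS2 num (near_st_len g M e f) => p n /andP[l0 _]; rewrite (ltW l0) mul1r.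
  apply: le_trans (sn_lhh n) _; apply: le_trans (sn_s2r n).
  rewrite ler_piMr ?sqr_ge0// expr_le1 ?(sn_hh1 n)//; exact: ltW (sn_hh0 n).
have s2 : symb 0 (fun p => (st_r p)^-1) k k (fun p => D0 p i j).
  apply: (symb_weaken (c := 1) _ _ hkk (symb_le (leq0n 6) (symb_D0 M e f gucn i j))) => //.
  by apply: filterS num => p n; rewrite sqr_ge0 mul1r (sn_s2r n).
have alg (a b c : R) : a - b - (a - c) = c - b by ring.
by apply: symb_ext (symbB s1 s2); apply: nearW => p x _; exact: alg.
Qed.

Lemma symb_bil n (A w' k' : stage R -> R) (v w : E) (D : stage R -> 'I_2 -> 'I_2 -> E -> R) :
  (forall i j, symb n A w' k' (fun p => D p i j)) ->
  symb n A w' k' (fun p x => bil v w (fun i j => D p i j x)).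
Proof. by move=> h; apply: symb_sum => i; apply: symb_sum => j; exact: symbZ. Qed.

Lemma bil_delta (v : E) (c : R) : v 0 0 * v 0 0 + v 0 1 * v 0 1 = 1 ->
  bil v v (fun i j => c * (i == j)%:R) = c.
Proof.
move=> vv; rewrite bilE /=; transitivity (c * (v 0 0 * v 0 0 + v 0 1 * v 0 1)); last by rewrite vv mulr1.
by ring.
Qed.

(* the amplitude [sqrt (2 a)] of a primitive metric whose coefficient [a] is
   comparable to [s^2] *)
Definition amp (p : stage R) (a : E -> R) x : R := s p * Num.sqrt (2 * ((s p ^+ 2)^-1 * a x)).

(** Dividing by [s^2] puts the radicand between positive constants, as the estimate of the square
    root requires. *)
Lemma symb_amplitude n (w' k' : stage R -> R) (a : stage R -> E -> R) :
  (\forall p \near F, 0 <= w' p <= k' p) ->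
  symb n (fun p => s p ^+ 2) w' k' a ->
  (\forall p \near F, forall x, U x -> s p ^+ 2 / 4 <= a p x) ->
  symb n s w' k' (fun p => amp p (a p)) /\
  (\forall p \near F, forall x, U x -> 2^-1 * (amp p (a p) x * amp p (a p) x) = a p x).
Proof.
move=> hw sa ha.
have hs : \forall p \near F, 0 <= s p by apply: filterS num => p n'; have [_ s0 _ _] := sn_pos n'; exact: ltW.
have low : \forall p \near F, forall x, U x -> 2^-1 <= 2 * ((s p ^+ 2)^-1 * a p x).
  apply: filterS2 num ha => p n' h x /h; have [_ s0 _ _] := sn_pos n'.
  have s2 : 0 < s p ^+ 2 by rewrite exprn_gt0.
  move=> hx; have : (s p ^+ 2)^-1 * (s p ^+ 2 / 4) <= (s p ^+ 2)^-1 * a p x by rewrite ler_wpM2l// invr_ge0 ltW.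
  have -> : (s p ^+ 2)^-1 * (s p ^+ 2 / 4) = 4^-1 by field; rewrite gt_eqF.
  by lra.
have sc : symb n (fun p => (s p ^+ 2)^-1) w' k' (fun p _ => (s p ^+ 2)^-1).
  apply: (@symb_scalar _ _ _ _ _ _ _ _ _ 1); apply: nearW => p.
  by rewrite mul1r ger0_norm// invr_ge0 sqr_ge0.
have h2 : \forall p \near F, 0 <= s p ^+ 2 by apply: nearW => p; exact: sqr_ge0.
have hi : \forall p \near F, 0 <= (s p ^+ 2)^-1 by apply: nearW => p; rewrite invr_ge0 sqr_ge0.
split.
  have s1 : symb n (fun=> 1) w' k' (fun p x => 2 * ((s p ^+ 2)^-1 * a p x)).
    apply: symbZ; apply: (symb_amp (c := 1) hw _ (symbM hw hi h2 sc sa)).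
    apply: filterS num => p n'; have [_ s0 _ _] := sn_pos n'.
    by rewrite mulVf ?mulr1 ?ler01 ?lexx// gt_eqF// exprn_gt0.
  have half0 : (0 : R) < 2^-1 by rewrite invr_gt0.
  have s2 := symb_sqrt (FF := stageF_filter g M e f) half0 hw low s1.
  have ss : symb n s w' k' (fun p _ => s p).
    apply: (@symb_scalar _ _ _ _ _ _ _ _ _ 1); apply: filterS hs => p s0.
    by rewrite mul1r ger0_norm.
  have s3 : symb n s w' k' (fun p x => s p * Num.sqrt (2 * ((s p ^+ 2)^-1 * a p x))).
    by apply: symb_eqA (symbM hw hs h1 ss s2) => p; rewrite mulr1.
  exact: s3.
apply: filterS2 num low => p n' h x /h hx; have [_ s0 _ _] := sn_pos n'.
have q0 : 0 <= 2 * ((s p ^+ 2)^-1 * a p x) by apply: le_trans hx; rewrite invr_ge0.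
have alg (y z : R) : 2^-1 * (y * z * (y * z)) = 2^-1 * (y ^+ 2 * z ^+ 2) by ring.
rewrite /amp alg sqr_sqrtr//.
by move: (a p x) => y; field; rewrite gt_eqF.
Qed.

(** The amount [(s / K)^2] is held back: it becomes the isotropic defect of the next stage. *)
Definition st_a1 p x : R := bil e e (fun i j => D0 p i j x) - s p ^+ 2 * (K p ^+ 2)^-1.

Let smallK : \forall p \near F, (K p ^+ 2)^-1 <= 16^-1.
Proof.
apply: filterS num => p n; have [_ _ _ K4] := sn_pos n.
have K2 : 16 <= K p ^+ 2 by nra.
by rewrite lef_pV2 ?posrE//; apply: lt_le_trans K2.
Qed.

Lemma D0_unit_low (v : E) : v 0 0 * v 0 0 + v 0 1 * v 0 1 = 1 ->
  \forall p \near F, forall x, U x -> s p ^+ 2 * (3 / 4) <= bil v v (fun i j => D0 p i j x).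
Proof.
move=> vv.
have [[C hC] _] := symb_bil v v (fun i j => symb_D0_delta M e f gucn i j).
apply: filterS2 (stI hC num) (st_large g M e f (4 * `|C|)) => p [h n] rC x Ux.
have [r0 s0 _ _] := sn_pos n.
have := h x Ux.
rewrite (_ : bil v v _ = bil v v (fun i j => D0 p i j x) - s p ^+ 2); last first.
  by rewrite bilB (bil_delta _ vv).
have : C * (s p ^+ 2 / st_r p) <= s p ^+ 2 / 4.
  rewrite mulrA ler_pdivrMr//.
  have s2 : 0 <= s p ^+ 2 by exact: sqr_ge0.
  have := ler_wpM2l s2 rC; have := ler_wpM2l s2 (ler_norm C); lra.
move=> h2 h3; have := le_trans h3 h2.
by rewrite ler_norml => /andP[]; lra.
Qed.

Lemma symb_scalar_s n (w' k' : stage R -> R) : symb n (fun p => s p ^+ 2) w' k' (fun p _ => s p ^+ 2 * (K p ^+ 2)^-1).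
Proof.
apply: (@symb_scalar _ _ _ _ _ _ _ _ _ 1); apply: filterS smallK => p h.
have s2 : 0 <= s p ^+ 2 by exact: sqr_ge0.
have k2 : 0 <= (K p ^+ 2)^-1 by rewrite invr_ge0 sqr_ge0.
have k1 : (K p ^+ 2)^-1 <= 1 by apply: le_trans h _; lra.
by rewrite mul1r (ger0_norm (mulr_ge0 s2 k2)) ler_piMr.
Qed.

Lemma symb_a1 : symb 6 (fun p => s p ^+ 2) wf k st_a1.
Proof. by apply: symbB; [apply: symb_bil => i j; exact: symb_D0|exact: symb_scalar_s]. Qed.

Lemma a1_low : \forall p \near F, forall x, U x -> s p ^+ 2 / 4 <= st_a1 p x.
Proof.
have [ee _ _] := ef.
apply: filterS2 (D0_unit_low ee) smallK => p h sk x Ux; have := h x Ux; rewrite /st_a1.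
have := ler_wpM2l (sqr_ge0 (s p)) sk; have := sqr_ge0 (s p); lra.
Qed.

Definition st_b1 p := amp p (st_a1 p).
Definition st_v1 p := corr (mu1 p) e f (st_ul M p) (st_b1 p).

Lemma scales1 : \forall p \near F, scales_ok s wf k mu1 p.
Proof.
apply: filterS2 num hw1 => p n hw; have [_ s0 _ _] := sn_pos n; split=> //.
- by rewrite (ltW s0) (sn_s1 n).
- by rewrite st_kE; exact: sn_kmu1 n.
- exact: sn_mu1 n.
Qed.

Let ga20 : 0 < ga / 2. Proof. by rewrite divr_gt0. Qed.

Lemma derul : \forall p \near F, forall l' i x, U x -> derivable (st_ul M p l') x (delta_mx 0 i).
Proof.
have H i := stI (stI (pd_ul g M e f i 0) (pd_ul g M e f i 1)) (pd_ul g M e f i 2).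
apply: filterS2 (H 0) (H 1) => p [[a0 a1] a2] [[b0 b1] b2] l' i x Ux.
case: l' => -[|[|[|//]]] h3; case: (ord2_case i) => ->.
- by rewrite (_ : Ordinal h3 = 0); [have [] := a0 x Ux|apply/val_inj].
- by rewrite (_ : Ordinal h3 = 0); [have [] := b0 x Ux|apply/val_inj].
- by rewrite (_ : Ordinal h3 = 1); [have [] := a1 x Ux|apply/val_inj].
- by rewrite (_ : Ordinal h3 = 1); [have [] := b1 x Ux|apply/val_inj].
- by rewrite (_ : Ordinal h3 = 2); [have [] := a2 x Ux|apply/val_inj].
- by rewrite (_ : Ordinal h3 = 2); [have [] := b2 x Ux|apply/val_inj].
Qed.

Let sb1 := symb_amplitude hw1 symb_a1 a1_low.
Let hu1 i l' : symb 6 (fun=> 1) (fun p => s p * wf p) k (fun p => pd i (st_ul M p l')) :=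
  symb_le (isT : (6 <= 8)%N) (symb_dul M e f gucn i l').
Let det1 := gdet_near gram_ul_g.

Definition st_F1 p := corr_defect (mu1 p) e f (st_ul M p) (st_b1 p).

Lemma symb_corr1 l' : symb 5 (fun p => s p * (mu1 p)^-1) mu1 mu1 (fun p x => st_v1 p l' x - st_ul M p l' x).
Proof. by have [_ h] := sy_corr e f scales1 ga20 det1 hu1 sb1.1 l'; exact: h. Qed.

Lemma mu1mu1 : \forall p \near F, 0 <= mu1 p <= mu1 p.
Proof. by apply: filterS num => p n; rewrite lexx andbT; exact: ltW (sn_mu1 n). Qed.

(** [mu1] is chosen so that [w / mu1 = h], and [s <= h] brings the quartic term below [s^2 h]. *)
Lemma symb_F1 i j : symb 4 (fun p => s p ^+ 2 * hh p) mu1 mu1 (fun p => st_F1 p i j).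
Proof.
have [_ h] := sy_corr_defect e f scales1 ga20 det1 derul hu1 sb1.1 i j.
apply: (symb_amp (c := 2) mu1mu1 _ h).
apply: filterS num => p n; rewrite (sn_w1mu1 n).
have := sn_shh n; have h0 := ltW (sn_hh0 n); have [_ s0 _ _] := sn_pos n; have s1 := sn_s1 n.
rewrite -!/(hh p) => sh; rewrite -/(hh p) in h0.
have s2 : 0 <= s p ^+ 2 by exact: sqr_ge0.
have s4 : s p ^+ 4 <= s p ^+ 2 * hh p.
  rewrite (_ : s p ^+ 4 = s p ^+ 2 * (s p ^+ 2)); last by ring.
  by apply: ler_wpM2l => //; apply: le_trans sh; rewrite expr2 ler_piMl ?(ltW s0).
by rewrite addr_ge0 ?mulr_ge0 ?exprn_ge0 ?(ltW s0)//=; lra.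
Qed.

Lemma gram_v1 i j p x : gram (st_v1 p) i j x =
  gram (st_ul M p) i j x + 2^-1 * (st_b1 p x * st_b1 p x) * (e 0 i * e 0 j) + st_F1 p i j x.
Proof. rewrite /st_F1 /corr_defect -/(st_v1 p); ring. Qed.

Definition st_D1 p i j x : R := D0 p i j x - st_a1 p x * (e 0 i * e 0 j) - st_F1 p i j x.

Lemma st_D1E i j : \forall p \near F, forall x, U x ->
  sm 7 (l p) (g i j) x - gram (st_v1 p) i j x = st_D1 p i j x.
Proof.
apply: filterS sb1.2 => p h x Ux; rewrite gram_v1 -/(st_b1 p) in h *; rewrite (h x Ux) /st_D1 /st_D0; ring.
Qed.

Let hs2 : \forall p \near F, 0 <= s p ^+ 2. Proof. by apply: nearW => p; exact: sqr_ge0. Qed.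

Let kmu1 : \forall p \near F, 0 <= k p <= mu1 p.
Proof. by apply: filterS2 num hkk => p n /andP[-> _]; rewrite st_kE; exact: sn_kmu1 n. Qed.
Let wmu1 : \forall p \near F, 0 <= wf p <= mu1 p.
Proof. by apply: filterS2 hw1 kmu1 => p /andP[-> wk] /andP[_]; exact: le_trans. Qed.

Lemma symb_up n (A w' k' m : stage R -> R) h : (\forall p \near F, 0 <= A p) ->
  (\forall p \near F, 0 <= w' p <= m p) -> (\forall p \near F, 0 <= k' p <= m p) ->
  symb n A w' k' h -> symb n A m m h.
Proof.
move=> A0 hw hk; apply: (symb_weaken (c := 1)) hw hk.
by apply: filterS A0 => p A0; rewrite mul1r A0 lexx.
Qed.

Lemma symb_D1 i j : symb 4 (fun p => s p ^+ 2) mu1 mu1 (fun p => st_D1 p i j).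
Proof.
have s1 := symb_up hs2 wmu1 kmu1 (symb_le (isT : (4 <= 6)%N) (symb_D0 M e f gucn i j)).
have s2 := symb_up hs2 wmu1 kmu1 (symb_le (isT : (4 <= 6)%N) symb_a1).
have s3 : symb 4 (fun p => s p ^+ 2) mu1 mu1 (fun p => st_F1 p i j).
  apply: (symb_amp (c := 1) mu1mu1 _ (symb_F1 i j)); apply: filterS num => p n.
  rewrite mul1r mulr_ge0 ?sqr_ge0 ?(ltW (sn_hh0 n))//= ler_piMr ?sqr_ge0//; exact: sn_hh1 n.
have alg (a b c d : R) : a - c * b - d = a - b * c - d by ring.
by apply: symb_ext (symbB (symbB s1 (symbZ (e 0 i * e 0 j) s2)) s3); apply: nearW => p x _; exact: alg.
Qed.

(** Removing this multiple of [f (x) f] equalizes the entries along [e] and [f]. Their common value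
    is the reserved [(s / K)^2], up to the error of the first corrugation ([bil_D1]). *)
Definition st_a2 p x : R := bil f f (fun i j => st_D1 p i j x) - bil e e (fun i j => st_D1 p i j x).

Lemma bil_D1 p x :
  bil e e (fun i j => st_D1 p i j x) = s p ^+ 2 * (K p ^+ 2)^-1 - bil e e (fun i j => st_F1 p i j x) /\
  bil f f (fun i j => st_D1 p i j x) = bil f f (fun i j => D0 p i j x) - bil f f (fun i j => st_F1 p i j x).
Proof.
have [ee ff eof] := ef; have [_ _ foe] := orthoframeC ef.
have D1E v w : bil v w (fun i j => st_D1 p i j x) = bil v w (fun i j => D0 p i j x)
    - st_a1 p x * ((v 0 0 * e 0 0 + v 0 1 * e 0 1) * (w 0 0 * e 0 0 + w 0 1 * e 0 1))
    - bil v w (fun i j => st_F1 p i j x).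
  rewrite -(bil_tensor e v w (st_a1 p x)).
  rewrite -(bilB v w (fun i j => D0 p i j x) (fun i j => st_a1 p x * (e 0 i * e 0 j))).
  by rewrite -(bilB v w _ (fun i j => st_F1 p i j x)).
rewrite !D1E ee foe mulr1 mulr1 !mulr0 subr0; split=> //.
by rewrite {1}/st_a1 subKr.
Qed.

Lemma symb_a2 : symb 4 (fun p => s p ^+ 2) mu1 mu1 st_a2.
Proof. by apply: symbB; apply: symb_bil => i j; exact: symb_D1. Qed.

Lemma a2_low : \forall p \near F, forall x, U x -> s p ^+ 2 / 4 <= st_a2 p x.
Proof.
have [_ ff _] := ef.
have [[C1 hC1] _] := symb_bil e e symb_F1; have [[C2 hC2] _] := symb_bil f f symb_F1.
apply: filterS2 (stI (stI (D0_unit_low ff) smallK) (stI hC1 hC2)) (stI num (st_large g M e f (16 * (`|C1| + `|C2|)))).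
move=> p [[h sk] [b1 b2]] [n rC] x Ux; have := h x Ux; have c1 := b1 x Ux; have c2 := b2 x Ux.
have [E1 E2] := bil_D1 p x; rewrite /st_a2 E1 E2.
have s2 : 0 <= s p ^+ 2 by exact: sqr_ge0.
have [r0 _ _ _] := sn_pos n.
have hr : hh p <= (st_r p)^-1 by exact: sn_hhr n.
have h0 : 0 <= hh p by exact: ltW (sn_hh0 n).
have small : (`|C1| + `|C2|) * (s p ^+ 2 * hh p) <= s p ^+ 2 / 16.
  rewrite mulrCA ler_wpM2l//.
  apply: le_trans (ler_wpM2l (addr_ge0 (normr_ge0 _) (normr_ge0 _)) hr) _.
  by rewrite ler_pdivrMr//; lra.
have := ler_wpM2l s2 sk.
have k1 : C1 * (s p ^+ 2 * hh p) <= `|C1| * (s p ^+ 2 * hh p) by exact: ler_wpM2r (mulr_ge0 s2 h0) _ _ (ler_norm _).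
have k2 : C2 * (s p ^+ 2 * hh p) <= `|C2| * (s p ^+ 2 * hh p) by exact: ler_wpM2r (mulr_ge0 s2 h0) _ _ (ler_norm _).
move: c1 c2; rewrite !ler_norml => /andP[c1 c1'] /andP[c2 c2'].
rewrite mulrDl in small; lra.
Qed.

Definition st_b2 p := amp p (st_a2 p).
Definition st_v2 p := corr (mu2 p) f e (st_v1 p) (st_b2 p).
Definition st_F2 p := corr_defect (mu2 p) f e (st_v1 p) (st_b2 p).

Let fe : orthoframe f e := orthoframeC ef.
Let sb2 := symb_amplitude mu1mu1 symb_a2 a2_low.

(** The amplitude and the map now oscillate at [mu1], which takes the place of both slow
    frequencies. *)
Lemma scales2 : \forall p \near F, scales_ok s mu1 mu1 mu2 p.
Proof.
apply: filterS2 num mu1mu1 => p n hw; have [_ s0 _ _] := sn_pos n; split=> //.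
- by rewrite (ltW s0) (sn_s1 n).
- exact: sn_mu12 n.
- exact: sn_mu2 n.
Qed.

Let hs : \forall p \near F, 0 <= s p.
Proof. by apply: filterS num => p n; have [_ s0 _ _] := sn_pos n; exact: ltW. Qed.

Lemma symb_dcorr1 i l' : symb 4 s mu1 mu1 (fun p => pd i (fun x => st_v1 p l' x - st_ul M p l' x)).
Proof.
apply: (symb_amp (c := 1) mu1mu1 _ (symb_pd i (symb_corr1 l'))).
apply: filterS2 num hs => p n s0; rewrite -mulrA mulVf ?gt_eqF ?(sn_mu1 n)// mulr1 mul1r s0 lexx.
by [].
Qed.

Lemma der_v1 i l' : \forall p \near F, forall x, U x -> derivable (st_v1 p l') x (delta_mx 0 i) /\
  pd i (st_v1 p l') x = pd i (st_ul M p l') x + pd i (fun y => st_v1 p l' y - st_ul M p l' y) x.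
Proof.
apply: filterS2 (symb_derivable (symb_corr1 l')) derul => p d1 d2 x Ux.
have e1 : st_v1 p l' = (fun y => st_ul M p l' y + (st_v1 p l' y - st_ul M p l' y)).
  by apply/funext => y; rewrite addrC subrK.
have da := d2 l' i x Ux; have db := d1 i x Ux.
split; first by rewrite e1; exact: (derivableD da db).
by rewrite [in LHS]e1; exact: (pdD da db).
Qed.

Lemma symb_dv1 i l' : symb 4 (fun=> 1) (fun p => s p * mu1 p) mu1 (fun p => pd i (st_v1 p l')).
Proof.
have hsw : \forall p \near F, 0 <= s p * wf p <= s p * mu1 p.
  apply: filterS3 hs wmu1 num => p s0 /andP[w0 wm] n; rewrite mulr_ge0//=.
  exact: ler_wpM2l.
have s1 : symb 4 (fun=> 1) (fun p => s p * mu1 p) mu1 (fun p => pd i (st_ul M p l')).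
  apply: (symb_weaken (c := 1) _ hsw kmu1 (symb_le (isT : (4 <= 6)%N) (hu1 i l'))).
  by apply: nearW => p; rewrite mul1r ler01 lexx.
have s2 : symb 4 (fun=> 1) (fun p => s p * mu1 p) mu1 (fun p => pd i (fun x => st_v1 p l' x - st_ul M p l' x)).
  apply: (symb_conv (c := 1)) (symb_dcorr1 i l').
  - by apply: filterS2 num hs => p n ->; rewrite mul1r (sn_s1 n).
  - by apply: filterS2 mu1mu1 hs => p /andP[m0 _] s0; rewrite mulr_ge0// !mul1r lexx.
  - by apply: filterS mu1mu1 => p /andP[].
apply: symb_ext (symbD s1 s2).
by apply: filterS (der_v1 i l') => p h x /h[_ ->].
Qed.

Lemma derv1 : \forall p \near F, forall l' i x, U x -> derivable (st_v1 p l') x (delta_mx 0 i).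
Proof.
have H i := stI (stI (der_v1 i 0) (der_v1 i 1)) (der_v1 i 2).
apply: filterS2 (H 0) (H 1) => p [[a0 a1] a2] [[b0 b1] b2] l' i x Ux.
case: (ord3_case l') => ->; case: (ord2_case i) => ->.
- by have [] := a0 x Ux.
- by have [] := b0 x Ux.
- by have [] := a1 x Ux.
- by have [] := b1 x Ux.
- by have [] := a2 x Ux.
- by have [] := b2 x Ux.
Qed.

Lemma gram_v1_g i j : symb 0 (fun p => (st_r p)^-1) mu1 mu1 (fun p x => gram (st_v1 p) i j x - g i j x).
Proof.
have hr : \forall p \near F, 0 <= (st_r p)^-1.
  by apply: filterS num => p n; have [r0 _ _ _] := sn_pos n; rewrite invr_ge0 ltW.
have s1 := symb_up hr kmu1 kmu1 (gram_ul_g i j).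
have hle : \forall p \near F, 0 <= s p ^+ 2 <= 1 * (st_r p)^-1.
  by apply: filterS num => p n; rewrite sqr_ge0 mul1r (sn_s2r n).
have s2 := symb_amp (FF := stageF_filter g M e f) mu1mu1 hle (symb_up hs2 wmu1 kmu1 (symb_le (isT : (0 <= 6)%N) symb_a1)).
have s3 : symb 0 (fun p => (st_r p)^-1) mu1 mu1 (fun p => st_F1 p i j).
  apply: (symb_amp (c := 1) mu1mu1 _ (symb_le (isT : (0 <= 4)%N) (symb_F1 i j))).
  apply: filterS num => p n; rewrite mul1r mulr_ge0 ?sqr_ge0 ?(ltW (sn_hh0 n))//=.
  apply: le_trans (sn_s2r n); rewrite ler_piMr ?sqr_ge0//; exact: sn_hh1 n.
apply: symb_ext (symbD (symbD s1 (symbZ (e 0 i * e 0 j) s2)) s3).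
apply: filterS sb1.2 => p h x Ux; rewrite gram_v1 -(h x Ux).
have alg (a b c d F' : R) : a - b + c * d + F' = a + d * c + F' - b by ring.
exact: alg.
Qed.

Let det2 := gdet_near gram_v1_g.

Lemma symb_corr2 l' : symb 3 (fun p => s p * (mu2 p)^-1) mu2 mu2 (fun p x => st_v2 p l' x - st_v1 p l' x).
Proof. by have [_ h] := sy_corr f e scales2 ga20 det2 symb_dv1 sb2.1 l'; exact: h. Qed.

Lemma mu2mu2 : \forall p \near F, 0 <= mu2 p <= mu2 p.
Proof. by apply: filterS num => p n; rewrite lexx andbT; exact: ltW (sn_mu2 n). Qed.

Let s4h : \forall p \near F, s p ^+ 3 <= s p ^+ 2 * hh p.
Proof.
apply: filterS num => p n; rewrite exprS mulrC ler_wpM2l ?sqr_ge0//; exact: sn_shh n.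
Qed.

Lemma symb_F2 i j : symb 2 (fun p => s p ^+ 2 * hh p) mu2 mu2 (fun p => st_F2 p i j).
Proof.
have [_ h] := sy_corr_defect f e scales2 ga20 det2 derv1 symb_dv1 sb2.1 i j.
apply: (symb_amp (c := 2) mu2mu2 _ h).
apply: filterS2 num s4h => p n s4; rewrite (sn_mu1mu2 n).
have h0 := ltW (sn_hh0 n); have [_ s0 _ _] := sn_pos n; have s1 := sn_s1 n.
rewrite -/(hh p) in h0 *.
have s2 : 0 <= s p ^+ 2 * hh p by rewrite mulr_ge0 ?sqr_ge0.
have s4' : s p ^+ 4 <= s p ^+ 3 by rewrite exprS ler_piMl ?exprn_ge0 ?(ltW s0).
by rewrite addr_ge0 ?exprn_ge0 ?(ltW s0)//=; lra.
Qed.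

(** Both slow frequencies being [mu1], the gain in [spread_defect_bound] is [(mu1 / mu2)^2 = h^2];
    the cubic and quartic terms are brought to this size by [s <= h]. *)
Lemma spread_F2 : symb 0 (fun p => s p ^+ 2 * hh p ^+ 2) mu2 mu2
  (fun p x => spread f e (fun i j => st_F2 p i j x)).
Proof.
have [C hC] := spread_defect_bound scales2 fe ga20 det2 derv1 symb_dv1 sb2.1.
split=> //; exists (3 * `|C|); apply: filterS2 num hC => p n h x Ux.
apply: le_trans (h x Ux) _; rewrite (sn_mu1mu2 n) -/(hh p).
have h0 := ltW (sn_hh0 n); have [_ s0 _ _] := sn_pos n; have s1 := sn_s1 n; have sh := sn_shh n.
rewrite -/(hh p) in h0 sh.
have s2 : 0 <= s p ^+ 2 by exact: sqr_ge0.
have t1 : s p ^+ 3 * hh p <= s p ^+ 2 * hh p ^+ 2.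
  rewrite (_ : s p ^+ 3 * hh p = s p ^+ 2 * (s p * hh p)); last by ring.
  by rewrite ler_wpM2l// expr2 ler_wpM2r.
have t2 : s p ^+ 4 <= s p ^+ 2 * hh p ^+ 2.
  rewrite (_ : s p ^+ 4 = s p ^+ 2 * s p ^+ 2); last by ring.
  by rewrite ler_wpM2l// ler_sqr ?nnegrE// ltW.
have t3 : s p ^+ 2 * hh p * hh p = s p ^+ 2 * hh p ^+ 2 by ring.
rewrite t3; set T := s p ^+ 2 * hh p ^+ 2 in t1 t2 *.
have T0 : 0 <= T by rewrite mulr_ge0 ?sqr_ge0.
apply: (@le_trans _ _ (`|C| * (T + s p ^+ 3 * hh p + s p ^+ 4))).
  apply: ler_wpM2r (ler_norm C); rewrite !addr_ge0 ?mulr_ge0 ?exprn_ge0 ?(ltW s0)//.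
have c0 := normr_ge0 C.
apply: (@le_trans _ _ (`|C| * (3 * T))); last by rewrite mulrCA mulrA.
by apply: ler_wpM2l => //; lra.
Qed.

Lemma gram_v2 i j p x : gram (st_v2 p) i j x =
  gram (st_v1 p) i j x + 2^-1 * (st_b2 p x * st_b2 p x) * (f 0 i * f 0 j) + st_F2 p i j x.
Proof.
have alg (a b c : R) : a = b + c + (a - b - c) by ring.
exact: alg.
Qed.

Definition st_Eg p i j x : R := g i j x - sm 7 (l p) (g i j) x.

(* what remains of the metric defect after the two corrugations, up to a multiple
   of the identity *)
Lemma defect_v2 i j : \forall p \near F, forall x, U x ->
  defect g (st_v2 p) i j x - s p ^+ 2 * (K p ^+ 2)^-1 * (i == j)%:R =
  st_Eg p i j x + bil e f (fun i j => D0 p i j x) * (e 0 i * f 0 j + f 0 i * e 0 j)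
  - st_F1 p i j x - spread f e (fun i j => st_F1 p i j x) * - (f 0 i * f 0 j) - st_F2 p i j x.
Proof.
apply: filterS3 (st_D1E i j) sb2.2 (near_st_len g M e f) => p h1' h2 lp x Ux.
have D0C : forall i j, D0 p i j x = D0 p j i x by move=> i' j'; rewrite /st_D0 gsym gramC.
have bC : bil f e (fun i j => D0 p i j x) = bil e f (fun i j => D0 p i j x) by apply: bilC.
rewrite /defect gram_v2 (h2 x Ux) /st_a2.
have := h1' x Ux; have [E1 E2] := bil_D1 p x; rewrite E1 E2 spread_bil.
have fx := frame_expand (fun i j => D0 p i j x) i j ef; rewrite bC in fx.
rewrite /st_D1 {1}fx -(frame_complete ef) /st_Eg /st_a1.
move: (bil e e (fun i j => D0 p i j x)) (bil e f (fun i j => D0 p i j x)) (bil f f (fun i j => D0 p i j x)).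
move: (bil e e (fun i j => st_F1 p i j x)) (bil f f (fun i j => st_F1 p i j x)).
move: (st_F1 p i j x) (st_F2 p i j x) (sm 7 (l p) (g i j) x) (gram (st_v1 p) i j x) (g i j x) (s p ^+ 2) ((K p ^+ 2)^-1).
move: (e 0 i) (e 0 j) (f 0 i) (f 0 j) => ei ej fi fj f1 f2 sg gv gg ss kk fe' ff' d1 d2 d3 hh1.
have -> : gg - (gv + (d3 - ff' - (ss * kk - fe')) * (fi * fj) + f2) =
   (gg - sg) + (sg - gv) - (d3 - ff' - (ss * kk - fe')) * (fi * fj) - f2 by ring.
rewrite hh1; ring.
Qed.

Let hs2h : \forall p \near F, 0 <= s p ^+ 2 * hh p := near_st_s2h_ge0 g M e f.

Lemma symb1_intro (A w' k' : stage R -> R) (h : stage R -> E -> R) :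
  symb 0 A w' k' h -> (\forall p \near F, forall i x, U x -> derivable (h p) x (delta_mx 0 i)) ->
  (forall i, symb 0 (fun p => A p * w' p) k' k' (fun p => pd i (h p))) -> symb 1 A w' k' h.
Proof. by move=> [s0 _] d sd; split. Qed.

Let mu12 : \forall p \near F, 0 <= mu1 p <= mu2 p.
Proof. by apply: filterS2 num mu1mu1 => p n /andP[-> _]; exact: sn_mu12 n. Qed.
Let kmu2 : \forall p \near F, 0 <= k p <= mu2 p.
Proof. by apply: filterS2 kmu1 mu12 => p /andP[-> h] /andP[_]; exact: le_trans. Qed.

Lemma sn_bound_mu2 p : st_num M p ->
  [/\ s p ^+ 2 * hh p * mu2 p = s p ^+ 2 * st_l p * (K p ^+ 3 * st_r p ^+ 2),
      1 <= s p ^+ 2 * hh p * mu2 p & s p ^+ 2 * wf p <= s p ^+ 2 * hh p * mu2 p].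
Proof.
move=> n; have [r0 s0 l0 K4] := sn_pos n; have [r2 rK _ sK [_ lK]] := n.
have K0 : 0 < K p by lra.
have e1 : s p ^+ 2 * hh p * mu2 p = s p ^+ 2 * st_l p * (K p ^+ 3 * st_r p ^+ 2).
  rewrite /mu2 /mu1 /hh; move: (K p) K0 => Kp K0; field; rewrite !gt_eqF//.
have K1 : 1 <= K p by lra.
have r1 : 1 <= st_r p by lra.
have q1 : 1 <= K p ^+ 3 * st_r p ^+ 2 by rewrite mulr_ege1 ?exprn_ege1.
split=> //; rewrite e1.
  by apply: mulr_ege1 => //; apply: le_trans lK; rewrite exprn_ege1.
have -> : s p ^+ 2 * wf p = s p ^+ 2 * st_l p * K p by rewrite /st_w; ring.
apply: ler_wpM2l; first by rewrite mulr_ge0 ?sqr_ge0 ?(ltW l0).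
rewrite (_ : K p ^+ 3 * st_r p ^+ 2 = K p * (K p ^+ 2 * st_r p ^+ 2)); last by ring.
by rewrite ler_peMr ?(ltW K0)// mulr_ege1 ?exprn_ege1.
Qed.

Lemma ucn_ul l' : \forall p \near F, ucn 2 (st_ul M p l').
Proof.
apply: filterS2 (near_st_len g M e f) (stu_ucn g M e f l') => p lp u.
exact: (ucnD (ucnZ _ (ucn_sm 7 lp (ucnB u (ucn_cst 2 (st_u p l' 0))))) (ucn_cst 2 (st_u p l' 0))).
Qed.

Lemma ucn_v2 l' : \forall p \near F, ucn 2 (st_v2 p l').
Proof.
apply: filterS3 (ucn_ul l') (symb_ucn (symb_corr1 l')) (symb_ucn (symb_corr2 l')) => p u0 u1 u2.
apply: ucn_ext (ucnD (ucnD u0 (ucn_le (isT : (2 <= 4)%N) u1)) u2) => x _.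
by rewrite [st_ul _ _ _ _ + _]addrC subrK addrC subrK.
Qed.

Lemma der_v2 i l' : \forall p \near F, forall x, U x -> 
  pd i (st_v2 p l') x = pd i (st_v1 p l') x + pd i (fun y => st_v2 p l' y - st_v1 p l' y) x.
Proof.
apply: filterS2 (symb_derivable (symb_corr2 l')) derv1 => p d1 d2 x Ux.
have e1 : st_v2 p l' = (fun y => st_v1 p l' y + (st_v2 p l' y - st_v1 p l' y)).
  by apply/funext => y; rewrite addrC subrK.
by rewrite [in LHS]e1; exact: (pdD (d2 l' i x Ux) (d1 i x Ux)).
Qed.

Lemma symb_dcorr2 i l' : symb 2 s mu2 mu2 (fun p => pd i (fun x => st_v2 p l' x - st_v1 p l' x)).
Proof.
apply: (symb_amp (c := 1) mu2mu2 _ (symb_pd i (symb_corr2 l'))).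
apply: filterS2 num hs => p n s0; rewrite -mulrA mulVf ?gt_eqF ?(sn_mu2 n)// mulr1 mul1r s0 lexx.
by [].
Qed.

Lemma symb_dv2 i l' : symb 2 (fun=> 1) (fun p => s p * mu2 p) mu2 (fun p => pd i (st_v2 p l')).
Proof.
have hsw : \forall p \near F, 0 <= s p * mu1 p <= s p * mu2 p.
  apply: filterS2 hs mu12 => p s0 /andP[w0 wm]; rewrite mulr_ge0//=.
  exact: ler_wpM2l.
have s1 : symb 2 (fun=> 1) (fun p => s p * mu2 p) mu2 (fun p => pd i (st_v1 p l')).
  apply: (symb_weaken (c := 1) _ hsw mu12 (symb_le (isT : (2 <= 4)%N) (symb_dv1 i l'))).
  by apply: nearW => p; rewrite mul1r ler01 lexx.
have s2 : symb 2 (fun=> 1) (fun p => s p * mu2 p) mu2 (fun p => pd i (fun x => st_v2 p l' x - st_v1 p l' x)).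
  apply: (symb_conv (c := 1)) (symb_dcorr2 i l').
  - by apply: filterS2 num hs => p n ->; rewrite mul1r (sn_s1 n).
  - by apply: filterS2 mu2mu2 hs => p /andP[m0 _] s0; rewrite mulr_ge0// !mul1r lexx.
  - by apply: filterS mu2mu2 => p /andP[].
apply: symb_ext (symbD s1 s2).
by apply: filterS (der_v2 i l') => p h x Ux; rewrite h.
Qed.

(** [g] has a bounded gradient, so mollifying it costs [l], and [K^4 <= s^2 lam] bounds this by
    [s^2 h^2]. *)
Lemma symb_Eg0 i j : symb 0 (fun p => s p ^+ 2 * hh p ^+ 2) mu2 mu2 (fun p => st_Eg p i j).
Proof.
have h2 : \forall p \near F, 0 <= s p ^+ 2 * hh p ^+ 2 by apply: nearW => p; rewrite mulr_ge0 ?sqr_ge0.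
apply: (symb_up h2 kmu2 kmu2).
have s1 : symb 0 (fun p => s p ^+ 2 * hh p ^+ 2) k k (fun p x => sm 7 (l p) (g i j) x - g i j x).
  apply: (symb_amp (c := 1) hkk _ (symb_g_diff M e f gucn i j)).
  by apply: filterS2 num (near_st_len g M e f) => p n /andP[l0 _]; rewrite (ltW l0) mul1r; exact: sn_lhh n.
apply: symb_ext (symbN s1); apply: nearW => p x _; exact: opprB.
Qed.

Lemma symb_Eg i j : symb 1 (fun p => s p ^+ 2 * hh p) mu2 mu2 (fun p => st_Eg p i j).
Proof.
have hk1 : \forall p \near F, 0 <= (1 : R) <= k p.
  by apply: filterS num => p n; rewrite st_kE ler01 (le_trans _ (sn_k n))//; lra.
have ug : \forall p \near F, ucn 1 (g i j) by apply: nearW => p; exact: ucn_pred.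
have [s8 _] := symb_sm1 (near_st_len g M e f) 7 h1 hk1 ug (symb_g M e f gucn i j).
have sg : symb 1 (fun=> 1) (fun=> 1) k (fun p => st_Eg p i j).
  exact: (symbB (symb_g M e f gucn i j) (symb_le (isT : (1 <= 8)%N) s8)).
apply: symb1_intro.
- apply: (symb_amp (c := 1) mu2mu2 _ (symb_Eg0 i j)); apply: filterS num => p n.
  rewrite mul1r mulr_ge0 ?sqr_ge0//= ler_wpM2l ?sqr_ge0// expr2 ler_piMr ?(ltW (sn_hh0 n))//.
  exact: sn_hh1 n.
- exact: symb_derivable sg.
- move=> q; have s0 := symb_pd q sg.
  have h11 : \forall p \near F, 0 <= (1 * 1 : R) <= 1 * (s p ^+ 2 * hh p * mu2 p).
    by apply: filterS num => p n; rewrite !mul1r ler01; have [_ -> _] := sn_bound_mu2 n.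
  exact: symb_weaken h11 kmu2 kmu2 s0.
Qed.

Lemma symb_D0ef : symb 1 (fun p => s p ^+ 2 * hh p) mu2 mu2 (fun p x => bil e f (fun i j => D0 p i j x)).
Proof.
have sb := symb_bil e f (fun i j => symb_le (isT : (1 <= 6)%N) (symb_D0 M e f gucn i j)).
apply: symb1_intro.
- exact: (symb_up hs2h kmu2 kmu2 (symb_D0_off M e f gucn)).
- exact: symb_derivable sb.
- move=> q; have s0 := symb_pd q sb.
  have h11 : \forall p \near F, 0 <= s p ^+ 2 * wf p <= 1 * (s p ^+ 2 * hh p * mu2 p).
    apply: filterS2 num hw1 => p n /andP[w0 _]; rewrite mul1r mulr_ge0 ?sqr_ge0//=.
    by have [_ _ ->] := sn_bound_mu2 n.
  exact: symb_weaken h11 kmu2 kmu2 s0.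
Qed.

Lemma symb_defect_v2 i j : symb 1 (fun p => s p ^+ 2 * hh p) mu2 mu2
  (fun p x => defect g (st_v2 p) i j x - s p ^+ 2 * (K p ^+ 2)^-1 * (i == j)%:R).
Proof.
have sF1 i' j' : symb 1 (fun p => s p ^+ 2 * hh p) mu2 mu2 (fun p => st_F1 p i' j').
  apply: (symb_weaken (c := 1) _ mu12 mu12 (symb_le (isT : (1 <= 4)%N) (symb_F1 i' j'))).
  by apply: filterS hs2h => p ->; rewrite mul1r lexx.
have sF2 i' j' := symb_le (isT : (1 <= 2)%N) (symb_F2 i' j').
have sS : symb 1 (fun p => s p ^+ 2 * hh p) mu2 mu2 (fun p x => spread f e (fun i j => st_F1 p i j x)).
  by apply: symb_sum => i'; apply: symb_sum => j'; exact: symbZ.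
have t1 := symbZ (FF := stageF_filter g M e f) (e 0 i * f 0 j + f 0 i * e 0 j) symb_D0ef.
have t2 := symbZ (FF := stageF_filter g M e f) (- (f 0 i * f 0 j)) sS.
apply: symb_ext (symbB (symbB (symbB (symbD (symb_Eg i j) t1) (sF1 i j)) t2) (sF2 i j)).
apply: filterS (defect_v2 i j) => p h x Ux; rewrite (h x Ux).
by rewrite [(e 0 i * f 0 j + _) * _]mulrC [- _ * spread _ _ _]mulrC.
Qed.

(** By [spread_cancel] only the mollification error of [g] and the error of the second corrugation
    remain. Both are of order [s^2 h^2], whereas the full defect is only known to order [s^2 h]. *)
Lemma spread_defect_v2 : symb 0 (fun p => s p ^+ 2 * hh p ^+ 2) mu2 mu2
  (fun p x => spread f e (fun i j => defect g (st_v2 p) i j x)).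
Proof.
have sE : symb 0 (fun p => s p ^+ 2 * hh p ^+ 2) mu2 mu2 (fun p x => spread f e (fun i j => st_Eg p i j x)).
  by apply: symb_sum => i'; apply: symb_sum => j'; apply: symbZ; exact: symb_Eg0.
apply: symb_ext (symbB sE spread_F2).
have H := stI (stI (defect_v2 0 0) (defect_v2 0 1)) (stI (defect_v2 1 0) (defect_v2 1 1)).
apply: filterS H => p [[a00 a01] [a10 a11]] x Ux.
have [ee ff eof] := ef.
have E1 i j : defect g (st_v2 p) i j x =
   s p ^+ 2 * (K p ^+ 2)^-1 * (i == j)%:R + (st_Eg p i j x + bil e f (fun i j => D0 p i j x) * (e 0 i * f 0 j + f 0 i * e 0 j)
  - st_F1 p i j x - spread f e (fun i j => st_F1 p i j x) * - (f 0 i * f 0 j) - st_F2 p i j x).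
  apply/eqP; rewrite addrC -subr_eq; apply/eqP.
  by case: (ord2_case i) => ->; case: (ord2_case j) => ->; [exact: a00|exact: a01|exact: a10|exact: a11].
by rewrite (eq_spread f e E1) (spread_cancel _ _ _ _ _ ef).
Qed.

(** The dilation factor differs from 1 by a multiple of [l], and it acts on [u - u(0)], which the
    gradient bounds. *)
Lemma ul_close l' : symb 0 (fun p => (st_l p)^-1) k k (fun p x => st_ul M p l' x - st_u p l' x).
Proof.
pose ut (p : stage R) := fun y => st_u p l' y - st_u p l' 0.
have hut : \forall p \near F, ucn 1 (ut p).
  by apply: filterS (stu_ucn g M e f l') => p u; exact: ucn_pred (ucnB u (ucn_cst 2 _)).
have sut q : symb 0 (fun=> 1) k k (fun p => pd q (ut p)).
  apply: symb_ext (symb_slow h1 (near_st_sw g M e f) (symb_le (isT : (0 <= 1)%N) (symb_du0 M e f gucn q l'))).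
  apply: filterS (stu_ucn g M e f l') => p u x Ux; apply: esym; exact: pdB_cst _ (ucn_der u Ux).
have [[C1 hC1] _] := symb_sm_diff (near_st_len g M e f) 7 h1 hut sut.
have [[D0' hD0] _] := sut 0; have [[D1' hD1] _] := sut 1.
pose C := Num.max D0' D1'.
(* As [l <= 1/2], the dilation factor is at most [2^14], and its distance to 1 at most [2^14 * 14 l]
   by Bernoulli; 28 is 14 times the factor 2 in [|ut| <= 2 C]. *)
split=> //; exists (2 ^+ 14 * (`|C1| + 28 * `|C|)).
apply: filterS3 (stI num (near_st_len g M e f)) (stI hC1 hut) (stI hD0 hD1) => p [n lp] [c1 u] [d0 d1] x Ux.
have [r0 s0 l0 K4] := sn_pos n; case/andP: (lp) => lp0 lp1.
have lh : l p <= 2^-1.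
  have k2 : 2 <= (l p)^-1 by rewrite st_kE; exact: sn_k n.
  have := ler_wpM2l (ltW lp0) k2; rewrite mulfV ?gt_eqF// => h; lra.
have llam : l p <= (st_l p)^-1.
  have kl : st_l p <= (l p)^-1.
    have [r2 _ _ _ _] := n; rewrite st_kE ler_peMl ?(ltW l0)// mulr_ege1 ?exprn_ege1//; lra.
  have := ler_wpM2l (ltW lp0) kl; rewrite mulfV ?gt_eqF// => h.
  by rewrite -[leRHS]mul1r ler_pdivlMr.
have bdu q z : U z -> `|pd q (ut p) z| <= C.
  move=> Uz; case: (ord2_case q) => ->.
    by have := d0 z Uz; rewrite mulr1 => /le_trans; apply; rewrite /C le_max lexx.
  by have := d1 z Uz; rewrite mulr1 => /le_trans; apply; rewrite /C le_max lexx orbT.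
have U0 : U 0 by apply/in_disk; rewrite !mxE expr0n /= addr0.
have C0 : 0 <= C by apply: le_trans (bdu 0 0 U0).
have but : `|ut p x| <= 2 * C.
  have ut0 : ut p 0 = 0 by rewrite /ut subrr.
  have := @disk_lip _ (ut p) C (fun q z Uz => ucn_der u Uz) bdu x 0 Ux U0.
  rewrite ut0 subr0 => /le_trans; apply; rewrite mulrC ler_wpM2r//.
  have [x0 x1] : `|x 0 0| <= 1 /\ `|x 0 1| <= 1.
    move/in_disk: Ux => hx; have a := sqr_ge0 (x 0 0); have b := sqr_ge0 (x 0 1).
    by split; rewrite -(@ler_sqr _ _ 1) ?nnegrE// real_normK ?num_real// expr1n; lra.
  by rewrite /dist1 !mxE !subr0; lra.
set a := (1 - l p) ^- (2 * 7).
have q0 : 0 < (1 - l p) ^+ (2 * 7) by rewrite exprn_gt0// subr_gt0.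
have ale : 0 <= a <= 2 ^+ 14.
  rewrite /a invr_ge0 (ltW q0)/= -[leRHS]invrK lef_pV2 ?posrE// ?invr_gt0 ?exprn_gt0//.
  rewrite -exprVn; apply: lerXn2r; rewrite ?nnegrE ?invr_ge0 ?subr_ge0 ?(ltW lp1)//; lra.
have bern m : 1 - m%:R * l p <= (1 - l p) ^+ m.
  elim: m => [|m IH]; first by rewrite mul0r subr0 expr0.
  rewrite exprS; have := ler_wpM2l (_ : 0 <= 1 - l p) IH.
  have m0 : 0 <= m%:R * l p * l p by rewrite !mulr_ge0 ?(ltW lp0).
  rewrite subr_ge0 (ltW lp1) => /(_ isT); rewrite -natr1; lra.
have a1 : 0 <= a - 1 <= 2 ^+ 14 * (14 * l p).
  have e1 : a - 1 = a * (1 - (1 - l p) ^+ (2 * 7)) by rewrite mulrBr mulr1 /a mulVf ?gt_eqF.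
  case/andP: ale => a0 aM.
  have b14 := bern (2 * 7)%N; have b1 : (1 - l p) ^+ (2 * 7) <= 1 by rewrite exprn_ile1 ?subr_ge0 ?(ltW lp1)//; lra.
  by rewrite e1 mulr_ge0 ?subr_ge0//= ler_pM ?subr_ge0//; lra.
have -> : st_ul M p l' x - st_u p l' x = a * (sm 7 (l p) (ut p) x - ut p x) + (a - 1) * ut p x.
  by rewrite /st_ul -/a -/(ut p) /ut; move: (sm _ _ _ _) => y; ring.
apply: le_trans (ler_normD _ _) _; rewrite !normrM.
case/andP: ale => a0 aM; case/andP: a1 => a10 a1M.
rewrite (ger0_norm a0) (ger0_norm a10).
have c1x : `|sm 7 (l p) (ut p) x - ut p x| <= `|C1| * (st_l p)^-1.
  apply: le_trans (c1 x Ux) _; rewrite mulr1.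
  by apply: le_trans (ler_wpM2r (ltW lp0) (ler_norm C1)) _; rewrite ler_wpM2l.
have t1 := ler_pM a0 (normr_ge0 _) aM c1x.
have t2 := ler_pM a10 (normr_ge0 _) a1M but.
apply: le_trans (lerD t1 t2) _; rewrite (ger0_norm C0).
have t3 : 2 ^+ 14 * (28 * C) * l p <= 2 ^+ 14 * (28 * C) * (st_l p)^-1.
  by apply: ler_wpM2l llam; rewrite !mulr_ge0 ?exprn_ge0.
move: t3; move: (l p) (st_l p)^-1 `|C1| (2 ^+ 14 : R) => a' b' c' d' t3; lra.
Qed.

Lemma v2_close l' : exists C, \forall p \near F, forall x, U x -> `|st_v2 p l' x - st_u p l' x| <= C * (st_l p)^-1.
Proof.
have [[C0 h0] _] := ul_close l'.
have [C1 hC1] := symb_sup (symb_corr1 l'); have [C2 hC2] := symb_sup (symb_corr2 l').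
exists (C0 + `|C1| + `|C2|); apply: filterS3 num h0 (stI hC1 hC2) => p n a0 [a1 a2] x Ux.
have [r0 s0 l0 K4] := sn_pos n; have [r2 _ _ _ _] := n; have s1 := sn_s1 n.
have m1 : s p * (mu1 p)^-1 <= (st_l p)^-1.
  rewrite -[leRHS]mul1r; apply: ler_pM; rewrite ?(ltW s0) ?invr_ge0 ?(ltW (sn_mu1 n))//.
  rewrite lef_pV2 ?posrE ?(sn_mu1 n)//.
  by rewrite ler_peMl ?(ltW l0)// mulr_ege1 ?exprn_ege1//; lra.
have m2 : s p * (mu2 p)^-1 <= (st_l p)^-1.
  apply: le_trans m1; rewrite ler_wpM2l ?(ltW s0)// lef_pV2 ?posrE ?(sn_mu1 n) ?(sn_mu2 n)//.
  exact: sn_mu12 n.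
have b C D : D <= (st_l p)^-1 -> 0 <= D -> C * D <= `|C| * (st_l p)^-1.
  move=> dl d0; apply: le_trans (ler_wpM2r d0 (ler_norm C)) _; exact: ler_wpM2l.
have p1 : 0 <= s p * (mu1 p)^-1 by rewrite mulr_ge0 ?(ltW s0) ?invr_ge0 ?(ltW (sn_mu1 n)).
have p2 : 0 <= s p * (mu2 p)^-1 by rewrite mulr_ge0 ?(ltW s0) ?invr_ge0 ?(ltW (sn_mu2 n)).
have e1 : st_v2 p l' x - st_u p l' x = (st_ul M p l' x - st_u p l' x)
   + (st_v1 p l' x - st_ul M p l' x) + (st_v2 p l' x - st_v1 p l' x) by ring.
rewrite e1; apply: le_trans (ler_normD _ _) _; rewrite !mulrDl; apply: lerD.
  apply: le_trans (ler_normD _ _) _; apply: lerD; first exact: a0.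
  exact: le_trans (a1 x Ux) (b _ _ m1 p1).
exact: le_trans (a2 x Ux) (b _ _ m2 p2).
Qed.

Lemma dv2_close i l' : exists C, \forall p \near F, forall x, U x -> `|pd i (st_v2 p l') x - pd i (st_u p l') x| <= C * s p.
Proof.
have hsw : \forall p \near F, 0 <= s p * wf p by apply: filterS (near_st_sw g M e f) => p /andP[].
have sd q : symb 0 (fun p => s p * wf p) k k (fun p => pd q (pd i (st_u p l'))).
  by apply: symb_eqA (symb_pd q (symb_du0 M e f gucn i l')) => p; rewrite mul1r.
have s0 : symb 0 s k k (fun p x => sm 7 (l p) (pd i (st_u p l')) x - pd i (st_u p l') x).
  apply: (symb_amp (c := 1) hkk _ (symb_sm_diff (near_st_len g M e f) 7 hsw (stdu_ucn g M e f i l') sd)).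
  apply: filterS3 num hw1 (near_st_len g M e f) => p n /andP[w0 wk] /andP[l0 l1].
  have [_ s0 _ _] := sn_pos n; rewrite mul1r mulrCA (mulr_ge0 (ltW s0) (mulr_ge0 (ltW l0) w0)) /=.
  rewrite ler_piMr ?(ltW s0)//; apply: le_trans (ler_wpM2l (ltW l0) wk) _.
  by rewrite mulfV// gt_eqF.
have [[C0 h0] _] := s0.
have [C1 hC1] := symb_sup (symb_dcorr1 i l'); have [C2 hC2] := symb_sup (symb_dcorr2 i l').
exists (C0 + C1 + C2).
have H := stI (stI (stI h0 hC1) hC2) (stI (stI (der_v1 i l') (der_v2 i l')) (pd_ul g M e f i l')).
apply: filterS H => p [[[a0 a1] a2] [[d1 d2] d0]] x Ux.
rewrite (d2 x Ux) (proj2 (d1 x Ux)) (proj2 (d0 x Ux)).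
have alg (a b c d : R) : a + b + c - d = (a - d) + b + c by ring.
rewrite alg !mulrDl; apply: le_trans (ler_normD _ _) _; apply: lerD; last exact: a2.
by apply: le_trans (ler_normD _ _) _; apply: lerD; [exact: a0|exact: a1].
Qed.

Lemma stage_num_next p : st_num M p ->
  stage_num (s p / K p) (K p ^+ 5 * st_r p ^+ 5 * st_l p) (st_r p) (K p).
Proof.
move=> n; have [r0 s0 l0 K4] := sn_pos n; have [r2 rK _ sK [_ lK]] := n.
have K0 : 0 < K p by lra.
split=> //; first by rewrite divr_gt0.
  apply: le_trans sK; apply: ler_wpM2r; first by rewrite exprn_ge0 ?(ltW K0).
  by rewrite ler_pdivrMr// ler_peMr ?(ltW s0)//; lra.
split; first by rewrite !mulr_gt0 ?exprn_gt0.
apply: le_trans lK _.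
have -> : (s p / K p) ^+ 2 * (K p ^+ 5 * st_r p ^+ 5 * st_l p) = s p ^+ 2 * st_l p * (K p ^+ 3 * st_r p ^+ 5).
  by move: (K p) K0 => Kp K0; field; rewrite gt_eqF.
have K1 : 1 <= K p by lra.
have r1 : 1 <= st_r p by lra.
by rewrite ler_peMr ?mulr_ge0 ?(ltW s0) ?(ltW l0)//; apply: mulr_ege1; exact: exprn_ege1.
Qed.

(** The hypothesis turns the diagonal difference in the old frame into the off-diagonal entry of the
    new one. Every bound of the new invariant exceeds the proved one by at least a factor [r], which
    absorbs the constant; [C] survives only in the displacement. *)
Theorem stage_step (e' f' : E) :
  (forall D : 'I_2 -> 'I_2 -> R, (forall i j, D i j = D j i) -> `|bil e' f' D| = 2^-1 * `|spread f e D|) ->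
  exists C r0, forall p, stage_inv g M e f p -> r0 <= st_r p -> exists v : 'I_3 -> E -> R,
    [/\ stage_inv g M e' f' (Stage (s p / K p) (K p ^+ 5 * st_r p ^+ 5 * st_l p) (st_r p) v),
        forall l' x, U x -> `|v l' x - st_u p l' x| <= C / st_l p
      & forall i l' x, U x -> `|pd i (v l') x - pd i (st_u p l') x| <= C * s p].
Proof.
move=> hef.
have q3 (T : 'I_3 -> stage R -> Prop) : (forall l', \forall p \near F, T l' p) -> \forall p \near F, forall l', T l' p.
  by move=> hT; apply: filterS3 (hT 0) (hT 1) (hT 2) => p a b c l'; case: (ord3_case l') => ->.
have q2 (T : 'I_2 -> stage R -> Prop) : (forall l', \forall p \near F, T l' p) -> \forall p \near F, forall l', T l' p.
  by move=> hT; apply: filterS2 (hT 0) (hT 1) => p a b l'; case: (ord2_case l') => ->.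
have N2 : \forall p \near F, forall i j l' x, U x -> `|pd j (pd i (st_v2 p l')) x| <= s p / K p * (K p * (K p ^+ 5 * st_r p ^+ 5 * st_l p)).
  apply: (q2) => i; apply: (q2) => j; apply: (q3) => l'.
  have [C hC] := symb_sup (symb_pd j (symb_dv2 i l')).
  apply: filterS3 num hC (st_large g M e f C) => p n h rC x Ux; apply: le_trans (h x Ux) _.
  have [r0 s0 l0 K4] := sn_pos n; have K0 : 0 < K p by lra.
  (* As [mu2 = K^5 r^4 lam], the fifth factor [r] of the new frequency is the reserve for [C]. *)
  have -> : s p / K p * (K p * (K p ^+ 5 * st_r p ^+ 5 * st_l p)) = st_r p * (1 * (s p * mu2 p)).
    by rewrite /mu2 /mu1; move: (K p) K0 => Kp K0; field; rewrite gt_eqF.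
  by apply: ler_wpM2r rC; rewrite mul1r mulr_ge0 ?(ltW s0) ?(ltW (sn_mu2 n)).
have N3 : \forall p \near F, forall i j x, U x -> `|defect g (st_v2 p) i j x - (s p / K p) ^+ 2 * (i == j)%:R| <= (s p / K p) ^+ 2 / st_r p.
  apply: (q2) => i; apply: (q2) => j.
  have [C hC] := symb_sup (symb_defect_v2 i j).
  apply: filterS3 num hC (st_large g M e f C) => p n h rC x Ux.
  have [r0 s0 l0 K4] := sn_pos n; have K0 : 0 < K p by lra.
  rewrite expr_div_n; apply: le_trans (h x Ux) _.
  have -> : s p ^+ 2 / K p ^+ 2 / st_r p = st_r p * (s p ^+ 2 * hh p).
    by rewrite /hh; move: (K p) K0 => Kp K0; field; rewrite !gt_eqF.
  by apply: ler_wpM2r rC; rewrite mulr_ge0 ?sqr_ge0 ?(ltW (sn_hh0 n)).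
have N4 : \forall p \near F, forall i j q x, U x -> `|pd q (defect g (st_v2 p) i j) x| <= (s p / K p) ^+ 2 * (K p ^+ 5 * st_r p ^+ 5 * st_l p).
  apply: (q2) => i; apply: (q2) => j; apply: (q2) => q.
  have [C hC] := symb_sup (symb_pd q (symb_defect_v2 i j)).
  apply: filterS3 (stI num (symb_derivable (symb_defect_v2 i j))) hC (st_large g M e f C) => p [n d] h rC x Ux.
  have [r0 s0 l0 K4] := sn_pos n; have [r2 _ _ _ _] := n; have K0 : 0 < K p by lra.
  have dd := d q x Ux; set c := s p ^+ 2 * _ * _ in dd.
  have -> : pd q (defect g (st_v2 p) i j) x = pd q (fun y => defect g (st_v2 p) i j y - c) x.
    have e1 : defect g (st_v2 p) i j = (fun y => (defect g (st_v2 p) i j y - c) + c) by apply/funext => y; rewrite subrK.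
    by rewrite [in LHS]e1 (pdD dd (derivable_cst c x (delta_mx 0 q))) pd_cst addr0.
  apply: le_trans (h x Ux) _; have [-> _ _] := sn_bound_mu2 n.
  have -> : (s p / K p) ^+ 2 * (K p ^+ 5 * st_r p ^+ 5 * st_l p) = st_r p * (s p ^+ 2 * st_l p * (K p ^+ 3 * st_r p ^+ 2)) * st_r p ^+ 2.
    by move: (K p) K0 => Kp K0; field; rewrite gt_eqF.
  have T0 : 0 <= s p ^+ 2 * st_l p * (K p ^+ 3 * st_r p ^+ 2) by rewrite !mulr_ge0 ?exprn_ge0 ?(ltW l0) ?(ltW s0) ?(ltW K0) ?(ltW r0).
  apply: le_trans (ler_wpM2r T0 rC) _; rewrite ler_peMr ?(mulr_ge0 (ltW r0) T0)// exprn_ege1//; exact: le_trans (ler1n R 2) r2.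
have N5 : \forall p \near F, forall x, U x -> `|bil e' f' (fun i j => defect g (st_v2 p) i j x)| <= (s p / K p) ^+ 2 * hh p.
  have [C hC] := symb_sup spread_defect_v2.
  apply: filterS3 num hC (st_large g M e f C) => p n h rC x Ux.
  have [r0 s0 l0 K4] := sn_pos n; have [r2 _ _ _ _] := n; have K0 : 0 < K p by lra.
  rewrite hef; last by move=> i j; rewrite /defect gsym gramC.
  have := h x Ux; set Z := `|_| => hZ.
  have Z0 : 0 <= Z by exact: normr_ge0.
  have -> : (s p / K p) ^+ 2 * hh p = st_r p * (s p ^+ 2 * hh p ^+ 2) * st_r p.
    by rewrite /hh; move: (K p) K0 => Kp K0; field; rewrite !gt_eqF.
  have T0 : 0 <= s p ^+ 2 * hh p ^+ 2 by rewrite mulr_ge0 ?sqr_ge0.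
  have T1 := le_trans hZ (ler_wpM2r T0 rC).
  apply: (@le_trans _ _ Z); first by lra.
  apply: le_trans T1 _; rewrite ler_peMr ?(mulr_ge0 (ltW r0) T0)//; lra.
have [C0 hc0] := v2_close 0; have [C1 hc1] := v2_close 1; have [C2 hc2] := v2_close 2.
have [D00 k00] := dv2_close 0 0; have [D01 k01] := dv2_close 0 1; have [D02 k02] := dv2_close 0 2.
have [D10 k10] := dv2_close 1 0; have [D11 k11] := dv2_close 1 1; have [D12 k12] := dv2_close 1 2.
pose C := `|C0| + `|C1| + `|C2| + (`|D00| + `|D01| + `|D02| + (`|D10| + `|D11| + `|D12|)).
have N6 : \forall p \near F, forall l' x, U x -> `|st_v2 p l' x - st_u p l' x| <= C / st_l p.
  apply: (q3) => l'.
  have [C' CC hc] : exists2 C', C' <= C & \forall p \near F, forall x, U x -> `|st_v2 p l' x - st_u p l' x| <= C' * (st_l p)^-1.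
    have n0 := normr_ge0; case: (ord3_case l') => ->.
    - by exists C0 => //; apply: le_trans (ler_norm C0) _; rewrite /C -!addrA lerDl !addr_ge0.
    - by exists C1 => //; apply: le_trans (ler_norm C1) _; rewrite /C [`|C0| + _]addrC -!addrA lerDl !addr_ge0.
    - by exists C2 => //; apply: le_trans (ler_norm C2) _; rewrite /C [`|C0| + _ + _]addrC -!addrA lerDl !addr_ge0.
  apply: filterS2 num hc => p n h x Ux; have [r0 s0 l0 K4] := sn_pos n.
  by apply: le_trans (h x Ux) _; rewrite ler_wpM2r// invr_ge0 ltW.
have N7 : \forall p \near F, forall i l' x, U x -> `|pd i (st_v2 p l') x - pd i (st_u p l') x| <= C * s p.
  apply: (q2) => i; apply: (q3) => l'.
  have [C' CC hc] : exists2 C', C' <= C & \forall p \near F, forall x, U x -> `|pd i (st_v2 p l') x - pd i (st_u p l') x| <= C' * s p.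
    have := normr_ge0 C0; have := normr_ge0 C1; have := normr_ge0 C2.
    have := normr_ge0 D00; have := normr_ge0 D01; have := normr_ge0 D02.
    have := normr_ge0 D10; have := normr_ge0 D11; have := normr_ge0 D12 => a1 a2 a3 a4 a5 a6 a7 a8 a9.
    case: (ord2_case i) => ->; case: (ord3_case l') => ->.
    - by exists D00 => //; have := ler_norm D00; rewrite /C; lra.
    - by exists D01 => //; have := ler_norm D01; rewrite /C; lra.
    - by exists D02 => //; have := ler_norm D02; rewrite /C; lra.
    - by exists D10 => //; have := ler_norm D10; rewrite /C; lra.
    - by exists D11 => //; have := ler_norm D11; rewrite /C; lra.
    - by exists D12 => //; have := ler_norm D12; rewrite /C; lra.
  apply: filterS2 num hc => p n h x Ux; have [r0 s0 l0 K4] := sn_pos n.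
  by apply: le_trans (h x Ux) _; rewrite ler_wpM2r// ltW.
have H := stI (stI (stI (q3 _ ucn_v2) N2) (stI N3 N4)) (stI N5 (stI N6 N7)).
have [r0 hr0] := H; exists C, r0 => p ip rp.
have [[[a1 a2] [a3 a4]] [a5 [a6 a7]]] := hr0 p ip rp.
exists (st_v2 p); split=> //.
by have [n _ _ _ _] := ip; split=> //; exact: stage_num_next.
Qed.

End StageSteps.

(** * Convergence of the iteration *)

Section GeometricLimits.
Variable R : realType.
Implicit Types (a : nat -> R) (c t : R).

Lemma geo_small c t e : 0 <= t <= 2^-1 -> 0 < e -> exists m, forall n, (m <= n)%N -> c * t ^+ n <= e.
Proof.
move=> /andP[t0 t1] e0.
have ce : 0 <= `|c| / e by rewrite divr_ge0// ltW.
exists (Num.bound (`|c| / e)) => n mn.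
have h1 : `|c| / e <= 2 ^+ n.
  apply: ltW; apply: lt_le_trans (archi_boundP ce) _.
  by rewrite -natrX ler_nat (leq_trans mn)// ltnW// ltn_expl.
have h2 : t ^+ n <= (2 ^+ n)^-1.
  by rewrite -exprVn lerXn2r ?nnegrE// invr_ge0.
have p2 : (0 : R) < 2 ^+ n by rewrite exprn_gt0.
apply: le_trans (ler_wpM2r (exprn_ge0 n t0) (ler_norm c)) _.
apply: le_trans (ler_wpM2l (normr_ge0 c) h2) _.
by rewrite ler_pdivrMr// mulrC -ler_pdivrMr.
Qed.

(** The intervals of radius [2 c t^q] around [a q] are nested because [t <= 1/2]; the limit is the
    supremum of their left ends. *)
Lemma geo_limit a c t : 0 <= c -> 0 <= t <= 2^-1 ->
  (forall q, `|a q.+1 - a q| <= c * t ^+ q) -> exists A, forall q, `|a q - A| <= 2 * c * t ^+ q.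
Proof.
move=> c0 /andP[t0 t1] h.
pose b q := a q - 2 * c * t ^+ q; pose d q := a q + 2 * c * t ^+ q.
have st q : b q <= b q.+1 /\ d q.+1 <= d q.
  have p : 0 <= c * t ^+ q by rewrite mulr_ge0 ?exprn_ge0.
  have p' : c * t ^+ q * t <= c * t ^+ q * 2^-1 by rewrite ler_wpM2l.
  have := h q; rewrite ler_norml => /andP[h1 h2].
  by rewrite /b /d exprSr -!mulrA !(mulrA c); split; lra.
have mb m n : (m <= n)%N -> b m <= b n.
  by move=> /subnK <-; elim: (n - m)%N => [//|k IH]; rewrite addSn (le_trans IH)//; case: (st (k + m)%N).
have md m n : (m <= n)%N -> d n <= d m.
  by move=> /subnK <-; elim: (n - m)%N => [//|k IH]; rewrite addSn (le_trans _ IH)//; case: (st (k + m)%N).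
have bd m n : b m <= d n.
  have bdn k : b k <= d k.
    have p : 0 <= c * t ^+ k by rewrite mulr_ge0 ?exprn_ge0.
    by rewrite /b /d -mulrA; lra.
  by case: (leqP m n) => [/mb/le_trans|/ltnW/md h2]; [apply|apply: le_trans h2].
have sb : has_sup (range b).
  by split; [exists (b 0%N), 0%N|exists (d 0%N) => _ [q _ <-]].
exists (sup (range b)) => q.
have h1 : b q <= sup (range b) by apply: sup_upper_bound => //; exists q.
have h2 : sup (range b) <= d q by apply: ge_sup => [|_ [k _ <-]//]; exists (b 0%N), 0%N.
by rewrite ler_norml; move: h1 h2; rewrite /b /d => h1 h2; apply/andP; split; lra.
Qed.

End GeometricLimits.

Section LimitDerivative.
Variable R : realType.
Local Notation E := 'rV[R]_2.
Local Notation U := (@open_disk R).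

Lemma pdB (f h : E -> R) i x : derivable f x (delta_mx 0 i) -> derivable h x (delta_mx 0 i) ->
  pd i (fun y => f y - h y) x = pd i f x - pd i h x.
Proof. by move=> df dh; rewrite (pdD df (derivableN dh)) (pdN dh). Qed.

(** By the mean value theorem along the axis, the increments of [f n - f m] are controlled by the
    difference of the derivatives. Letting [n] grow with [m] fixed compares the limit with [f m],
    whose difference quotient converges. *)
Lemma is_derive_limit (f : nat -> E -> R) (h d : E -> R) (i : 'I_2) (c t : R) :
  0 <= t <= 2^-1 ->
  (forall q x, U x -> derivable (f q) x (delta_mx 0 i)) ->
  (forall q x, U x -> `|f q x - h x| <= c * t ^+ q) ->
  (forall q x, U x -> `|pd i (f q) x - d x| <= c * t ^+ q) ->
  forall x, U x -> is_derive x (delta_mx 0 i) h (d x).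
Proof.
move=> ht df fh pf x Ux.
suff cv : (fun s : R => s^-1 *: ((h \o shift x) (s *: delta_mx 0 i) - h x)) @ 0^' --> d x.
  by split; [apply/cvg_ex; exists (d x)|exact: cvg_lim cv].
apply/cvgrPdist_le => e e0; have e4 : 0 < e / 4 by rewrite divr_gt0.
have [m hm] := geo_small c ht e4.
have dm := df m x Ux.
have : (fun s : R => s^-1 *: ((f m \o shift x) (s *: delta_mx 0 i) - f m x)) @ 0^' --> pd i (f m) x.
  by exact: dm.
move=> /cvgrPdist_le /(_ _ e4) near1.
have near2 : \forall s \near (0 : R)^', U (s *: delta_mx 0 i + x).
  suff near0 : \forall s \near (0 : R), U (s *: delta_mx 0 i + x).
    by rewrite /dnbhs /within /=; near_simpl; apply: filterS near0 => s Us _.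
  have : (fun s : R => s *: delta_mx 0 i + x) @ (0 : R) --> (0 : R) *: (delta_mx 0 i : E) + x.
    by apply: cvgD; [apply: cvgZr_tmp; exact: cvg_id|exact: cvg_cst].
  by apply; rewrite scale0r add0r; exact: near_disk.
have near3 : \forall s \near (0 : R)^', s != 0 by exact: withinT.
apply: filterS3 near1 near2 near3 => s h1 h2 s0.
have ns : 0 < `|s| by rewrite normr_gt0.
pose w y := h y - f m y.
have key : `|w (s *: delta_mx 0 i + x) - w x| <= e / 2 * `|s|.
  apply/ler_addgt0Pr => e' e'0; have e'2 : 0 < e' / 2 by rewrite divr_gt0.
  have [n0 hn0] := geo_small c ht e'2.
  pose n := maxn m n0.
  pose k y := f n y - f m y.
  have dk y : U y -> derivable k y (delta_mx 0 i) by move=> Uy; apply: derivableB; exact: df.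
  have bk y : U y -> `|pd i k y| <= e / 2.
    move=> Uy; rewrite (pdB (df n y Uy) (df m y Uy)).
    have a1 := le_trans (pf n y Uy) (hm n (leq_maxl _ _)).
    have a2 := le_trans (pf m y Uy) (hm m (leqnn _)).
    have -> : pd i (f n) y - pd i (f m) y = (pd i (f n) y - d y) - (pd i (f m) y - d y) by ring.
    by apply: le_trans (ler_normB _ _) _; lra.
  have lk := axis_lip dk bk Ux h2.
  have b1 := le_trans (fh n _ h2) (hn0 n (leq_maxr _ _)).
  have b2 := le_trans (fh n _ Ux) (hn0 n (leq_maxr _ _)).
  have -> : w (s *: delta_mx 0 i + x) - w x = (k (s *: delta_mx 0 i + x) - k x)
     - (f n (s *: delta_mx 0 i + x) - h (s *: delta_mx 0 i + x)) + (f n x - h x).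
    by rewrite /w /k; ring.
  apply: le_trans (ler_normD _ _) _; apply: (@le_trans _ _ (e / 2 * `|s| + e' / 2 + e' / 2)); last by lra.
  apply: lerD b2; apply: le_trans (ler_normB _ _) _; exact: lerD.
have b3 := le_trans (pf m x Ux) (hm m (leqnn _)).
have -> : d x - s^-1 *: ((h \o shift x) (s *: delta_mx 0 i) - h x)
   = - (pd i (f m) x - d x) + (pd i (f m) x - s^-1 *: ((f m \o shift x) (s *: delta_mx 0 i) - f m x))
     - s^-1 * (w (s *: delta_mx 0 i + x) - w x).
  rewrite /w /= /GRing.scale /=; move: (pd i (f m) x) (h _) (f m _) => *; ring.
apply: le_trans (ler_normB _ _) _; apply: (@le_trans _ _ (e / 4 + e / 4 + e / 2)); last by lra.
apply: lerD.
  by apply: le_trans (ler_normD _ _) _; rewrite normrN; exact: lerD.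
rewrite normrM normfV mulrC ler_pdivrMr//.
Qed.

End LimitDerivative.

(** * Alternating frames and the sequence of stages *)

Section Iteration.
Variable R : realType.
Local Notation E := 'rV[R]_2.
Local Notation U := (@open_disk R).
Implicit Types (x y : E) (i j : 'I_2).

Lemma enorm_ge_coord x i : `|x 0 i| <= enorm x.
Proof.
rewrite /enorm dot2E -sqrtr_sqr ler_sqrt; last by rewrite -!expr2 addr_ge0 ?sqr_ge0.
by have a := sqr_ge0 (x 0 0); have b := sqr_ge0 (x 0 1); case: (ord2_case i) => ->; rewrite -!expr2; lra.
Qed.

Lemma dist1_enorm x y : dist1 x y <= 2 * enorm (x - y).
Proof.
have := enorm_ge_coord (x - y) 0; have := enorm_ge_coord (x - y) 1; rewrite !mxE /dist1; lra.
Qed.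

Lemma enorm_dist1 x y : enorm (x - y) <= dist1 x y.
Proof.
rewrite /enorm dot2E !mxE /dist1 -[leRHS]ger0_norm ?addr_ge0// -sqrtr_sqr ler_sqrt ?sqr_ge0//.
rewrite -!expr2; move: (x 0 0 - y 0 0) (x 0 1 - y 0 1) => a b.
have : 0 <= `|a| * `|b| by rewrite mulr_ge0.
rewrite sqrrD !real_normK ?num_real//; lra.
Qed.

Lemma coord_lt1 x i : U x -> `|x 0 i| <= 1.
Proof. by move=> Ux; apply: le_trans (enorm_ge_coord x i) _; exact: ltW. Qed.

Lemma dist1_le4 x y : U x -> U y -> dist1 x y <= 4.
Proof.
move=> Ux Uy; have a := coord_lt1 0 Ux; have b := coord_lt1 1 Ux; have c := coord_lt1 0 Uy; have d := coord_lt1 1 Uy.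
have := ler_normB (x 0 0) (y 0 0); have := ler_normB (x 0 1) (y 0 1); rewrite /dist1; lra.
Qed.

(** The cosine and sine of 45 degrees. *)
Definition rot_c : R := Num.sqrt 2^-1.

Lemma rot_cc : rot_c * rot_c = 2^-1.
Proof. by rewrite -expr2 sqr_sqrtr// invr_ge0. Qed.

Definition frame1 (b : bool) : E :=
  if b then \row_(i < 2) rot_c else delta_mx 0 0.
Definition frame2 (b : bool) : E :=
  if b then \row_(i < 2) (if i == 0 then - rot_c else rot_c) else delta_mx 0 1.

Lemma frameE b : [/\ frame1 b 0 0 = (if b then rot_c else 1), frame1 b 0 1 = (if b then rot_c else 0),
  frame2 b 0 0 = (if b then - rot_c else 0) & frame2 b 0 1 = (if b then rot_c else 1)].
Proof. by case: b; rewrite !mxE. Qed.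

Lemma frame_ortho b : orthoframe (frame1 b) (frame2 b).
Proof.
have [h1 h2 h3 h4] := frameE b; rewrite /orthoframe h1 h2 h3 h4.
have := rot_cc; case: b {h1 h2 h3 h4} => h; split; lra.
Qed.

(* The diagonal of a matrix in one frame is its off-diagonal part in the frame
   rotated by 45 degrees. *)
Lemma frame_alternate b (D : 'I_2 -> 'I_2 -> R) : (forall i j, D i j = D j i) ->
  `|bil (frame1 (~~ b)) (frame2 (~~ b)) D| = 2^-1 * `|spread (frame2 b) (frame1 b) D|.
Proof.
move=> s; rewrite bilE spreadE (s 1 0).
have := rot_cc; case: b; rewrite /= !mxE /=; move: rot_c (D 0 0) (D 0 1) (D 1 1) => c d00 d01 d11 cc.
  rewrite (_ : _ + _ = d01); last by ring.
  rewrite [X in _ = _ * `|X|](_ : _ = - 2 * (c * c + c * c) * d01); last by ring.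
  by rewrite cc normrM mulrA (_ : `|- 2 * _| = 2) ?mulVf ?mul1r// (_ : _ * _ = - 2) ?normrN ?ger0_norm//; lra.
rewrite (_ : _ + _ = c * c * (d11 - d00)); last by ring.
rewrite [X in _ = _ * `|X|](_ : _ = d11 - d00); last by ring.
by rewrite cc normrM ger0_norm// invr_ge0.
Qed.

Variables (g : 'I_2 -> 'I_2 -> E -> R) (M : nat) (ga : R).
Hypothesis gucn : forall i j, ucn 2 (g i j).
Hypothesis gsym : forall i j, g i j = g j i.
Hypothesis ga0 : 0 < ga.
Hypothesis gdet_ga : forall x, U x -> ga <= g 0 0 x * g 1 1 x - g 0 1 x ^+ 2.
Hypothesis M0 : (0 < M)%N.

Local Notation inv b := (stage_inv g M (frame1 b) (frame2 b)).

Definition next_stage p v : stage R :=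
  Stage (st_s p / st_K M p) (st_K M p ^+ 5 * st_r p ^+ 5 * st_l p) (st_r p) v.

Lemma stage_step_alt : exists C r0, 0 <= C /\ forall b p, inv b p -> r0 <= st_r p ->
  exists v : 'I_3 -> E -> R, [/\ inv (~~ b) (next_stage p v),
    forall l x, U x -> `|v l x - st_u p l x| <= C / st_l p
  & forall i l x, U x -> `|pd i (v l) x - pd i (st_u p l) x| <= C * st_s p].
Proof.
have step b := stage_step M gucn gsym ga0 gdet_ga (frame_ortho b) (@frame_alternate b).
have [Ct [rt ht]] := step true; have [Cf [rf hf]] := step false.
have mx b : exists Cb rb, [/\ Cb <= `|Ct| + `|Cf|, rb <= Num.max rt rf & forall p, inv b p -> rb <= st_r p ->
  exists v : 'I_3 -> E -> R, [/\ inv (~~ b) (next_stage p v),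
    forall l x, U x -> `|v l x - st_u p l x| <= Cb / st_l p
  & forall i l x, U x -> `|pd i (v l) x - pd i (st_u p l) x| <= Cb * st_s p]].
  have a := ler_norm Ct; have a' := ler_norm Cf; have c := normr_ge0 Ct; have c' := normr_ge0 Cf.
  case: b; [exists Ct, rt|exists Cf, rf]; split=> //; rewrite ?le_max ?lexx ?orbT//; lra.
exists (`|Ct| + `|Cf|), (Num.max rt rf); split; first by rewrite addr_ge0.
move=> b p ip rp; have [Cb [rb [Cle rle hb]]] := mx b.
have [v [h1 h2 h3]] := hb p ip (le_trans rle rp).
have [n _ _ _ _] := ip; have [_ s0 l0 _] := sn_pos n.
exists v; split=> //.
  by move=> l x Ux; apply: le_trans (h2 l x Ux) _; rewrite ler_wpM2r// invr_ge0 ltW.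
by move=> i l x Ux; apply: le_trans (h3 i l x Ux) _; rewrite ler_wpM2r// ltW.
Qed.

Lemma stage_sequence : exists C r0, 0 <= C /\ forall p, inv false p -> r0 <= st_r p ->
  exists P : nat -> stage R, P 0%N = p /\ forall q,
   [/\ inv (odd q) (P q),
       [/\ st_r (P q) = st_r p, st_s (P q) = st_s p * (st_K M p)^-1 ^+ q
         & st_l (P q) = st_l p * (st_K M p ^+ 5 * st_r p ^+ 5) ^+ q],
       forall l x, U x -> `|st_u (P q.+1) l x - st_u (P q) l x| <= C / st_l (P q)
     & forall i l x, U x -> `|pd i (st_u (P q.+1) l) x - pd i (st_u (P q) l) x| <= C * st_s (P q)].
Proof.
have [C [r0 [C0 h]]] := stage_step_alt; exists C, r0; split=> // p ip rp.
(* The choice function is total; where the invariant or [r0 <= st_r] fails it returns the zero map.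
   The boolean records which of the two frames is current. *)
have /choice[F hF] (z : bool * stage R) : exists v : 'I_3 -> E -> R, inv z.1 z.2 -> r0 <= st_r z.2 ->
  [/\ inv (~~ z.1) (next_stage z.2 v),
    forall l x, U x -> `|v l x - st_u z.2 l x| <= C / st_l z.2
  & forall i l x, U x -> `|pd i (v l) x - pd i (st_u z.2 l) x| <= C * st_s z.2].
  case: z => b z /=.
  have [iz|] := pselect (inv b z); last by exists (fun _ _ => 0).
  have [rz|nz] := boolP (r0 <= st_r z); last by exists (fun _ _ => 0).
  by have [v hv] := h b z iz rz; exists v.
pose P := fix P q := if q is q'.+1 then next_stage (P q') (F (odd q', P q')) else p.
have iP q : inv (odd q) (P q) /\ st_r (P q) = st_r p.
  elim: q => [//|q [IH1 IH2]]; split=> //=.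
  by have [] := hF (odd q, P q) IH1; rewrite ?IH2.
exists P; split=> // q; have [i1 i2] := iP q; have [_ h2 h3] : [/\ _, _ & _] := hF (odd q, P q) i1 (eq_ind_r (fun z => r0 <= z) rp i2).
split=> //; split=> //.
- elim: q {i1 i2 h2 h3} => [|q IH]; first by rewrite expr0 mulr1.
  by rewrite exprS mulrCA -IH /= /st_K (iP q).2 mulrC.
- elim: q {i1 i2 h2 h3} => [|q IH]; first by rewrite expr0 mulr1.
  by rewrite exprS mulrCA -IH /= /st_K (iP q).2.
Qed.

End Iteration.

Lemma geo_cvg (R : realType) (a : nat -> R) (A c t : R) : 0 <= t <= 2^-1 ->
  (forall q, `|a q - A| <= c * t ^+ q) -> a @ \oo --> A.
Proof.
move=> ht h; apply/cvgrPdist_le => e e0; have [m hm] := geo_small c ht e0.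
by exists m => // q /= mq; rewrite distrC; apply: le_trans (h q) (hm q mq).
Qed.

(** * The limit isometry and its Hölder exponent *)

Section StageLimit.
Variable R : realType.
Local Notation E := 'rV[R]_2.
Local Notation U := (@open_disk R).
Implicit Types (x y : E) (i j : 'I_2).
Variables (g : 'I_2 -> 'I_2 -> E -> R) (M : nat) (ga al : R).
Hypothesis gucn : forall i j, ucn 2 (g i j).
Hypothesis gsym : forall i j, g i j = g j i.
Hypothesis ga0 : 0 < ga.
Hypothesis gdet_ga : forall x, U x -> ga <= g 0 0 x * g 1 1 x - g 0 1 x ^+ 2.
Hypothesis al0 : 0 <= al.
Hypothesis alM : al * (5 * M + 5)%:R <= M%:R.

(** The origin of the exponent: a stage multiplies the frequency by [r^(5 M + 5)] and divides the
    amplitude by [r^M]. *)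
Lemma powR_frequency (r : R) : 1 <= r -> ((r ^+ M) ^+ 5 * r ^+ 5) `^ al <= r ^+ M.
Proof.
move=> r1; have r0 : 0 <= r by lra.
rewrite -exprM -exprD -!powR_mulrn// -powRrM mulrC ler_powR//.
by rewrite (_ : (M * 5 + 5)%N = (5 * M + 5)%N) // mulnC.
Qed.

Theorem stage_limit : exists C r0, 0 <= C /\ forall p, stage_inv g M (delta_mx 0 0) (delta_mx 0 1) p -> r0 <= st_r p ->
  exists u : 'I_3 -> E -> R, [/\
    forall l x, U x -> `|u l x - st_u p l x| <= C / st_l p,
    forall i l x, U x -> derivable (u l) x (delta_mx 0 i) /\ `|pd i (u l) x - pd i (st_u p l) x| <= C * st_s p,
    forall i j x, U x -> gram u i j x = g i j x
  & exists H, forall i l x y, U x -> U y -> `|pd i (u l) x - pd i (u l) y| <= H * enorm (x - y) `^ al].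
Proof.
have [C [r0 [C0 h]]] := stage_sequence M gucn gsym ga0 gdet_ga.
exists (2 * C), r0; split=> [|p ip rp]; first by rewrite mulr_ge0.
have [P [P0 hP]] := h p ip rp.
have [n _ _ _ _] := ip; have [rr0 s0 l0 K4] := sn_pos n; have [r2 _ _ _ _] := n.
set K := st_K M p in hP n K4; pose L := K ^+ 5 * st_r p ^+ 5.
have K0 : 0 < K by lra.
have L2 : 2 <= L.
  have r1 : 1 <= st_r p by lra.
  have K1 : 1 <= K by lra.
  apply: le_trans (_ : K <= _); first by lra.
  rewrite /L exprS -mulrA ler_peMr ?(ltW K0)//; apply: mulr_ege1; exact: exprn_ege1.
have L0 : 0 < L by lra.
have tK : 0 <= K^-1 <= 2^-1 by rewrite invr_ge0 (ltW K0)/= lef_pV2 ?posrE//; lra.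
have tL : 0 <= L^-1 <= 2^-1 by rewrite invr_ge0 (ltW L0)/= lef_pV2 ?posrE.
pose uq q := st_u (P q).
have sq q : st_s (P q) = st_s p * K^-1 ^+ q by have [_ [_ -> _] _ _] := hP q.
have lq q : st_l (P q) = st_l p * L ^+ q by have [_ [_ _ ->] _ _] := hP q.
have rq q : st_r (P q) = st_r p by have [_ [-> _ _] _ _] := hP q.
have cl0 : 0 <= C / st_l p by rewrite divr_ge0 ?(ltW l0).
have cs0 : 0 <= C * st_s p by rewrite mulr_ge0 ?(ltW s0).
have /choice[u0 hu0] (z : 'I_3 * E) : exists A, U z.2 -> forall q, `|uq q z.1 z.2 - A| <= 2 * (C / st_l p) * L^-1 ^+ q.
  have [Uz|] := pselect (U z.2); last by exists 0.
  have [A hA] : exists A, forall q, `|uq q z.1 z.2 - A| <= 2 * (C / st_l p) * L^-1 ^+ q.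
    apply: geo_limit => // q; have [_ _ hq _] := hP q; apply: le_trans (hq z.1 z.2 Uz) _.
    by rewrite lq invfM exprVn mulrA.
  by exists A.
have /choice[d0 hd0] (z : 'I_2 * 'I_3 * E) : exists A, U z.2 -> forall q, `|pd z.1.1 (uq q z.1.2) z.2 - A| <= 2 * (C * st_s p) * K^-1 ^+ q.
  have [Uz|] := pselect (U z.2); last by exists 0.
  have [A hA] : exists A, forall q, `|pd z.1.1 (uq q z.1.2) z.2 - A| <= 2 * (C * st_s p) * K^-1 ^+ q.
    apply: geo_limit => // q; have [_ _ _ hq] := hP q; apply: le_trans (hq z.1.1 z.1.2 z.2 Uz) _.
    by rewrite sq mulrA.
  by exists A.
pose u l x := u0 (l, x); pose d i l x := d0 (i, l, x).
have hu q l x : U x -> `|uq q l x - u l x| <= 2 * (C / st_l p) * L^-1 ^+ q by move=> Ux; exact: hu0 (l, x) Ux q.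
have hd q i l x : U x -> `|pd i (uq q l) x - d i l x| <= 2 * (C * st_s p) * K^-1 ^+ q.
  by move=> Ux; exact: hd0 (i, l, x) Ux q.
have uqu q l : ucn 2 (uq q l) by have [[_ hq _ _ _] _ _ _] := hP q; exact: hq.
have half (c t : R) q : 0 <= c -> 0 <= t <= 2^-1 -> c * t ^+ q <= c * 2^-1 ^+ q.
  by move=> c0 /andP[t0 t1]; rewrite ler_wpM2l// lerXn2r ?nnegrE// invr_ge0.
have dlim i l x : U x -> is_derive x (delta_mx 0 i) (u l) (d i l x).
  apply: (@is_derive_limit _ (fun q => uq q l) _ _ i (2 * (C / st_l p) + 2 * (C * st_s p)) 2^-1).
  - by rewrite lexx andbT invr_ge0.
  - by move=> q y Uy; exact: ucn_der (uqu q l) Uy.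
  - move=> q y Uy; apply: le_trans (hu q l y Uy) _; apply: le_trans (half _ _ q (mulr_ge0 (ler0n _ 2) cl0) tL) _.
    by rewrite ler_wpM2r ?exprn_ge0 ?invr_ge0// lerDl mulr_ge0.
  - move=> q y Uy; apply: le_trans (hd q i l y Uy) _; apply: le_trans (half _ _ q (mulr_ge0 (ler0n _ 2) cs0) tK) _.
    by rewrite ler_wpM2r ?exprn_ge0 ?invr_ge0// lerDr mulr_ge0.
have pdu i l x : U x -> pd i (u l) x = d i l x by move=> Ux; have := dlim i l x Ux => dx; exact: derive_val.
exists u; split.
- by move=> l x Ux; have := hu 0%N l x Ux; rewrite /uq P0 expr0 mulr1 distrC mulrA.
- move=> i l x Ux; split; first by have := dlim i l x Ux => dx; exact: ex_derive.
  by rewrite (pdu i l x Ux); have := hd 0%N i l x Ux; rewrite /uq P0 expr0 mulr1 distrC mulrA.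
- move=> i j x Ux.
  have cd i' l : (fun q => pd i' (uq q l) x) @ \oo --> pd i' (u l) x.
    by rewrite (pdu i' l x Ux); apply: (geo_cvg tK) => q; exact: hd.
  have cg : (fun q => gram (uq q) i j x) @ \oo --> gram u i j x.
    by rewrite /gram /vd /du; apply: cvgD; [apply: cvgD|]; apply: cvgM; exact: cd.
  have cg' : (fun q => gram (uq q) i j x) @ \oo --> g i j x.
    apply: (@geo_cvg _ _ _ (2 * st_s p ^+ 2) K^-1 tK) => q.
    have [[nq _ _ [hq _] _] _ _ _] := hP q.
    have := hq i j x Ux; rewrite rq => h1.
    have s2 : st_s (P q) ^+ 2 <= st_s p ^+ 2 * K^-1 ^+ q.
      case/andP: tK => tK0 tK1.
      rewrite sq exprMn ler_wpM2l ?sqr_ge0// [leLHS]expr2 ler_piMr ?exprn_ge0// exprn_ile1//; lra.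
    have h2 : st_s (P q) ^+ 2 / st_r p <= st_s (P q) ^+ 2.
      by rewrite ler_pdivrMr// ler_peMr ?sqr_ge0//; lra.
    have h3 : 0 <= st_s (P q) ^+ 2 * (i == j)%:R <= st_s (P q) ^+ 2.
      by case: (i == j); rewrite ?mulr1 ?mulr0 sqr_ge0 ?lexx.
    have := h1; rewrite /defect ler_norml -/(uq q); move: (gram (uq q) i j x) (g i j x) h3 => a b /andP[h3 h4] /andP[h5 h6].
    by rewrite ler_norml; apply/andP; split; lra.
  exact: (cvg_unique (@norm_hausdorff _ _) cg cg').
pose Q := st_s p * (4 * C + 2 * K * (L + 4 * st_l p)).
have Q0 : 0 <= Q.
  have a1 := mulr_ge0 (ltW K0) (ltW L0); have a2 := mulr_ge0 (ltW K0) (ltW l0).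
  by rewrite /Q mulr_ge0 ?(ltW s0)// mulrDr; lra.
exists (st_l p `^ al * Q) => i l x y Ux Uy.
have [->|xy] := eqVneq x y.
  by rewrite !subrr normr0; apply: mulr_ge0 (powR_ge0 _ _); exact: mulr_ge0 (powR_ge0 _ _) Q0.
set D := enorm (x - y).
have D0 : 0 < D.
  have c1 := enorm_ge_coord (x - y) 0; have c2 := enorm_ge_coord (x - y) 1.
  rewrite lt_neqAle sqrtr_ge0 andbT eq_sym; apply: contra_neq xy => D0.
  move: c1 c2; rewrite -/D D0 !normr_le0 !mxE !subr_eq0 => /eqP c1 /eqP c2.
  by apply/rowP => k; case: (ord2_case k) => ->.
have D4 : D <= 4 by apply: le_trans (enorm_dist1 x y) (dist1_le4 Ux Uy).
have dist2 : dist1 x y <= 2 * D by exact: dist1_enorm.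
have ex : exists q, 1 <= st_l p * L ^+ q * D.
  have [q hq] := geo_small 1 tL (mulr_gt0 l0 D0); exists q.
  have := hq q (leqnn q); rewrite mul1r exprVn -[leLHS]div1r ler_pdivrMr ?exprn_gt0//.
  by rewrite mulrAC.
(* The first stage whose frequency resolves the distance [D]. The second derivatives of [uq q] bound
   the increment of its gradient, and the distance to the limit bounds the rest; both are of order
   [s K^-q]. *)
case: (ex_minnP ex) => q hq1 hq2.
(* For [q > 0] this is the minimality of [q]; the term [4 * st_l p] covers [q = 0], where the
   diameter bound [D <= 4] is used. *)
have up : st_l p * L ^+ q * D <= L + 4 * st_l p.
  case: q hq1 hq2 => [_ _|q _ hq2].
    by rewrite expr0 mulr1 mulrC; apply: le_trans (ler_wpM2r (ltW l0) D4) _; rewrite lerDr ltW.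
  have : ~~ (1 <= st_l p * L ^+ q * D) by apply/negP => /hq2; rewrite ltnn.
  rewrite -ltNge => lt1; have := ler_wpM2l (ltW L0) (ltW lt1).
  by rewrite exprS mulr1; have := ltW l0; move: (L ^+ q) => z; lra.
have [[_ _ d2 _ _] _ _ _] := hP q.
have b1 := hd q i l x Ux; have b2 := hd q i l y Uy.
have b3 : `|pd i (uq q l) x - pd i (uq q l) y| <= st_s (P q) * (K * st_l (P q)) * dist1 x y.
  apply: (@disk_lip _ (pd i (uq q l))) => //.
    by move=> j z Uz; exact: ucn_der (ucn_pd i (uqu q l)) Uz.
  by move=> j z Uz; have := d2 i j l z Uz; rewrite /st_K rq.
have sq0 : 0 <= st_s p * K^-1 ^+ q by rewrite mulr_ge0 ?exprn_ge0 ?invr_ge0 ?(ltW s0) ?(ltW K0).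
have b4 : st_s (P q) * (K * st_l (P q)) * dist1 x y <= st_s p * K^-1 ^+ q * (2 * K * (L + 4 * st_l p)).
  rewrite sq lq -mulrA ler_wpM2l//.
  have := ler_wpM2l (ltW K0) up.
  have : K * (st_l p * L ^+ q) * dist1 x y <= K * (st_l p * L ^+ q) * (2 * D).
    by apply: ler_wpM2l dist2; exact: (mulr_ge0 (ltW K0) (mulr_ge0 (ltW l0) (exprn_ge0 _ (ltW L0)))).
  move: (L ^+ q) => z; lra.
have tot : `|pd i (u l) x - pd i (u l) y| <= K^-1 ^+ q * Q.
  rewrite (pdu i l x Ux) (pdu i l y Uy).
  have -> : d i l x - d i l y = (pd i (uq q l) x - pd i (uq q l) y) - (pd i (uq q l) x - d i l x) + (pd i (uq q l) y - d i l y) by ring.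
  apply: le_trans (ler_normD _ _) _; apply: le_trans (lerD (ler_normB _ _) (lexx _)) _.
  have b5 := le_trans b3 b4; rewrite /Q.
  move: b1 b2 b5; set a1 := `|_|; set a2 := `|_|; set a3 := `|_|.
  move: (K^-1 ^+ q) => z; lra.
apply: le_trans tot _; rewrite mulrAC; apply: (ler_wpM2r Q0).
rewrite -powRM ?(ltW l0) ?(ltW D0)//.
have r1 : 1 <= st_r p by lra.
have LK : L `^ al <= K by exact: powR_frequency.
have h1 : 1 <= (st_l p * L ^+ q * D) `^ al.
  have -> : (1 : R) = 1 `^ al by rewrite powR1.
  by rewrite ge0_ler_powR ?nnegrE// (le_trans ler01).
have h2 : (st_l p * L ^+ q * D) `^ al = (st_l p * D) `^ al * (L `^ al) ^+ q.
  rewrite mulrAC (powRM _ (mulr_ge0 (ltW l0) (ltW D0)) (exprn_ge0 _ (ltW L0))); congr (_ * _).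
  by elim: (q) => [|k IH]; rewrite ?expr0 ?powR1// !exprS powRM ?exprn_ge0 ?(ltW L0)// IH.
have h3 : (L `^ al) ^+ q <= K ^+ q by rewrite lerXn2r ?nnegrE ?(ltW K0) ?powR_ge0.
rewrite exprVn -[leLHS]div1r ler_pdivrMr ?exprn_gt0//.
by apply: le_trans h1 _; rewrite h2; apply: ler_wpM2l h3; exact: powR_ge0.
Qed.

End StageLimit.

(** * Reaching the metric up to a small isotropic defect *)

Section Bounds.
Variable R : realType.
Local Notation E := 'rV[R]_2.
Local Notation U := (@open_disk R).
Implicit Types (f : E -> R) (n : nat) (A B w k W : R).

(** The content of [symb] for a single function, with its constant [B] made explicit. *)
Fixpoint deriv_bound n B A w k f : Prop :=
  (forall x, U x -> `|f x| <= B * A) /\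
  if n is m.+1 then (forall i x, U x -> derivable f x (delta_mx 0 i)) /\
    forall i, deriv_bound m B (A * w) k k (pd i f) else True.

Lemma deriv_bound_amp n B A A' w k f : 0 <= B -> 0 <= w -> 0 <= k -> A <= A' ->
  deriv_bound n B A w k f -> deriv_bound n B A' w k f.
Proof.
move=> B0; elim: n A A' w f => [|n IH] A A' w f w0 k0 AA /=.
  by move=> [h _]; split=> // x Ux; apply: le_trans (h x Ux) _; rewrite ler_wpM2l.
move=> [h [d hd]]; split; first by move=> x Ux; apply: le_trans (h x Ux) _; rewrite ler_wpM2l.
by split=> // i; apply: IH (hd i) => //; rewrite ler_wpM2r.
Qed.

Lemma deriv_bound_le m n B A w k f : (m <= n)%N -> deriv_bound n B A w k f -> deriv_bound m B A w k f.
Proof.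
elim: m n A w f => [|m IH] [|n] A w f //= mn.
  by move=> [b _]; split.
by move=> [b [d h]]; split=> //; split=> // i; exact: IH (h i).
Qed.

(** A large [W] absorbs all derivatives of a fixed function, even when the first one is charged
    [s W]. The constant [B] reflects the sup norm alone, so the constant of a step does not see the
    higher derivatives, which grow without control from step to step. *)
Lemma deriv_bound_ex n B A s f : 1 <= B -> 0 < s -> 0 < A -> ucn n f ->
  (forall x, U x -> `|f x| <= B * A) ->
  exists2 W0, 0 < W0 & forall W, W0 <= W -> deriv_bound n B A (s * W) W f.
Proof.
move=> B1; elim: n s A f => [|n IH] s A f s0 A0 uf bf; first by exists 1.
have b i : exists2 W0, 0 < W0 & forall W, W0 <= W -> deriv_bound n B (A * (s * W)) W W (pd i f).
  have [M hM] := ucn_bnd (ucn_pd i uf).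
  have M0 : 0 < `|M| + 1 by rewrite ltr_wpDl.
  have bM x : U x -> `|pd i f x| <= B * (`|M| + 1).
    move=> Ux; apply: le_trans (hM x Ux) _; have := ler_norm M; have := ler_wpM2r (ltW M0) B1; lra.
  have [W0 W00 hW] := IH 1 _ _ ltr01 M0 (ucn_pd i uf) bM.
  exists (Num.max W0 ((`|M| + 1) / (A * s))); first by rewrite lt_max W00.
  move=> W; rewrite ge_max => /andP[W1 W2]; have W3 : 0 <= W by apply: le_trans W1; exact: ltW.
  apply: (@deriv_bound_amp _ _ (`|M| + 1)) => //; first by lra.
    by move: W2; rewrite ler_pdivrMr ?mulr_gt0// => h; rewrite mulrA mulrC.
  by have := hW W W1; rewrite mul1r.
have [W0 W00 h0] := b 0; have [W1 W10 h1] := b 1.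
exists (Num.max W0 W1); first by rewrite lt_max W00.
move=> W; rewrite ge_max => /andP[a0 a1]; split=> //; split; first by move=> i x Ux; exact: ucn_der uf Ux.
by move=> i; case: (ord2_case i) => ->; [exact: h0|exact: h1].
Qed.

Lemma deriv_bound_symb (P : Type) (V : P -> Prop) n B (A w k : P -> R) (f : P -> E -> R) :
  (forall p, V p -> deriv_bound n B (A p) (w p) (k p) (f p)) -> symb (globally [set p | V p]) n A w k f.
Proof.
elim: n A w f => [|n IH] A w f h.
  by split=> //; exists B => p Vp x Ux; have [b _] := h p Vp; exact: b.
split; first by exists B => p Vp x Ux; have [b _] := h p Vp; exact: b.
split; first by move=> p Vp; have [_ [d _]] := h p Vp; exact: d.
by move=> i; apply: IH => p Vp; have [_ [_ hi]] := h p Vp; exact: hi.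
Qed.

Lemma ucn_symb n f : ucn n f -> exists2 W, 0 < W & symb (globally [set: unit]) n (fun=> 1) (fun=> W) (fun=> W) (fun=> f).
Proof.
move=> uf; have [M hM] := ucn_bnd uf.
have M1 : 1 <= `|M| + 1 by rewrite lerDr.
have bM x : U x -> `|f x| <= (`|M| + 1) * 1.
  by move=> Ux; rewrite mulr1; apply: le_trans (hM x Ux) _; have := ler_norm M; lra.
have [W W0 hW] := deriv_bound_ex M1 ltr01 ltr01 uf bM.
exists W => //; apply: (@deriv_bound_symb _ _ _ (`|M| + 1)) => _ _.
by have := hW W (lexx _); rewrite mul1r.
Qed.

(** The symbol calculus over a one-point parameter set; returning by [symb_ucn] costs one order. *)
Lemma ucn_inv n f (c : R) : 0 < c -> (forall x, U x -> c <= f x) -> ucn n.+1 f -> ucn n (fun x => (f x)^-1).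
Proof.
move=> c0 hc /ucn_symb[W W0 sf].
have hW : \forall p \near globally [set: unit], 0 <= W <= W by move=> p _; rewrite lexx ltW.
have hf : \forall p \near globally [set: unit], forall x, U x -> c <= f x by move=> p _; exact: hc.
have h := symb_ucn (symb_inv (FF := globally_filter _) c0 hW hf sf).
exact: (h (globally_filter _) tt I).
Qed.

Lemma ucn_sqrt n f (c : R) : 0 < c -> (forall x, U x -> c <= f x) -> ucn n.+1 f -> ucn n (fun x => Num.sqrt (f x)).
Proof.
move=> c0 hc /ucn_symb[W W0 sf].
have hW : \forall p \near globally [set: unit], 0 <= W <= W by move=> p _; rewrite lexx ltW.
have hf : \forall p \near globally [set: unit], forall x, U x -> c <= f x by move=> p _; exact: hc.
have h := symb_ucn (symb_sqrt (FF := globally_filter _) c0 hW hf sf).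
exact: (h (globally_filter _) tt I).
Qed.

End Bounds.

(** * Adding one primitive metric *)

Section PrimitiveStep.
Variable R : realType.
Local Notation E := 'rV[R]_2.
Local Notation U := (@open_disk R).
Implicit Types (x : E) (i j : 'I_2).
Variables (e f : E) (B c : R).
Hypothesis c0 : 0 < c.
Hypothesis B1 : 1 <= B.

Record primitive := Primitive { pr_s : R; pr_w : R; pr_mu : R; pr_u : 'I_3 -> E -> R; pr_b : E -> R }.

(** The estimates are taken over the set of all valid data instead of along a limit, so their
    constants depend only on [e], [f], [B], [c] and the order [n]. The data are smooth enough
    without mollification, hence a single slow frequency [pr_w]. *)
Definition primitive_ok n p := [/\ scales_ok pr_s pr_w pr_w pr_mu p,
  forall x, U x -> c <= gdet (pr_u p) x,
  forall l i x, U x -> derivable (pr_u p l) x (delta_mx 0 i),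
  forall i l, deriv_bound n.+2 B 1 (pr_s p * pr_w p) (pr_w p) (pd i (pr_u p l))
& deriv_bound n.+2 B (pr_s p) (pr_w p) (pr_w p) (pr_b p)].

Let F n := globally [set p | primitive_ok n p].

Let ok n : \forall p \near F n, scales_ok pr_s pr_w pr_w pr_mu p. Proof. by move=> p []. Qed.
Let hdet n : \forall p \near F n, forall x, U x -> c <= gdet (pr_u p) x. Proof. by move=> p []. Qed.
Let hder n : \forall p \near F n, forall l i x, U x -> derivable (pr_u p l) x (delta_mx 0 i).
Proof. by move=> p []. Qed.
Let hu n i l : symb (F n) n.+2 (fun=> 1) (fun p => pr_s p * pr_w p) pr_w (fun p => pd i (pr_u p l)).
Proof. by apply: (@deriv_bound_symb _ _ _ _ B) => p [_ _ _ h _]; exact: h. Qed.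
Let hb n : symb (F n) n.+2 pr_s pr_w pr_w pr_b.
Proof. by apply: (@deriv_bound_symb _ _ _ _ B) => p [_ _ _ _ h]; exact: h. Qed.

Local Notation cr p := (corr (pr_mu p) e f (pr_u p) (pr_b p)).

Lemma primitive_corr n l : symb (F n) n.+1 (fun p => pr_s p * (pr_mu p)^-1) pr_mu pr_mu
   (fun p x => cr p l x - pr_u p l x).
Proof. by have [_ h] := sy_corr e f (@ok n) c0 (@hdet n) (@hu n) (@hb n) l. Qed.

Lemma primitive_bounds : exists2 C, 1 <= C & forall p, primitive_ok 0 p ->
  [/\ forall l x, U x -> `|cr p l x - pr_u p l x| <= C * (pr_s p * (pr_mu p)^-1),
      forall i l x, U x -> `|pd i (fun y => cr p l y - pr_u p l y) x| <= C * pr_s p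
    & forall i j x, U x -> `|corr_defect (pr_mu p) e f (pr_u p) (pr_b p) i j x|
        <= C * (pr_s p ^+ 2 * (pr_w p * (pr_mu p)^-1) + pr_s p ^+ 4)].
Proof.
have b3 (T : 'I_3 -> R -> Prop) : (forall l C C', C <= C' -> T l C -> T l C') -> (forall l, exists C, T l C) -> exists C, forall l, T l C.
  move=> mon ex; have [C0 h0] := ex 0; have [C1 h1] := ex 1; have [C2 h2] := ex 2.
  exists (Num.max C0 (Num.max C1 C2)) => l; case: (ord3_case l) => ->.
  - by apply: mon h0; rewrite le_max lexx.
  - by apply: mon h1; rewrite !le_max lexx orbT.
  - by apply: mon h2; rewrite !le_max lexx !orbT.
have b2 (T : 'I_2 -> R -> Prop) : (forall l C C', C <= C' -> T l C -> T l C') -> (forall l, exists C, T l C) -> exists C, forall l, T l C.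
  move=> mon ex; have [C0 h0] := ex 0; have [C1 h1] := ex 1.
  exists (Num.max C0 C1) => l; case: (ord2_case l) => ->.
  - by apply: mon h0; rewrite le_max lexx.
  - by apply: mon h1; rewrite !le_max lexx orbT.
have nn p : primitive_ok 0 p -> [/\ 0 <= pr_s p * (pr_mu p)^-1, 0 <= pr_s p & 0 <= pr_s p ^+ 2 * (pr_w p * (pr_mu p)^-1) + pr_s p ^+ 4].
  move=> [[/andP[s0 s1] /andP[w0 _] wm m0] _ _ _ _].
  have m1 : 0 <= (pr_mu p)^-1 by rewrite invr_ge0 ltW.
  split=> //; first exact: mulr_ge0.
  by apply: addr_ge0; [apply: mulr_ge0; [exact: exprn_ge0|exact: mulr_ge0]|exact: exprn_ge0].
have mon (C C' z A : R) : C <= C' -> 0 <= A -> z <= C * A -> z <= C' * A.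
  by move=> CC A0 h; apply: le_trans h _; rewrite ler_wpM2r.
have [C0 h0] := b3 (fun l C => forall p, primitive_ok 0 p -> forall x, U x -> `|cr p l x - pr_u p l x| <= C * (pr_s p * (pr_mu p)^-1))
  (fun l C C' CC h p ip x Ux => mon _ _ _ _ CC (let: And3 a _ _ := nn p ip in a) (h p ip x Ux))
  (fun l => symb_sup (primitive_corr 0 l)).
have e1 i : exists C, forall l p, primitive_ok 0 p -> forall x, U x -> `|pd i (fun y => cr p l y - pr_u p l y) x| <= C * pr_s p.
  apply: b3 => [l C C' CC h p ip x Ux|l].
    by have [_ a _] := nn p ip; exact: mon CC a (h p ip x Ux).
  have [C hC] := symb_sup (symb_pd i (primitive_corr 0 l)); exists C => p ip x Ux.
  have [[_ _ _ m0] _ _ _ _] := ip.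
  by have := hC p ip x Ux; rewrite mulfVK ?gt_eqF.
have [C1 h1] := b2 (fun i C => forall l p, primitive_ok 0 p -> forall x, U x -> `|pd i (fun y => cr p l y - pr_u p l y) x| <= C * pr_s p)
  (fun i C C' CC h l p ip x Ux => mon _ _ _ _ CC (let: And3 _ a _ := nn p ip in a) (h l p ip x Ux)) e1.
have e2 i : exists C, forall j p, primitive_ok 0 p -> forall x, U x -> `|corr_defect (pr_mu p) e f (pr_u p) (pr_b p) i j x|
        <= C * (pr_s p ^+ 2 * (pr_w p * (pr_mu p)^-1) + pr_s p ^+ 4).
  apply: b2 => [l C C' CC h p ip x Ux|j].
    by have [_ _ a] := nn p ip; exact: mon CC a (h p ip x Ux).
  by have [_ s] := sy_corr_defect e f (@ok 0) c0 (@hdet 0) (@hder 0) (@hu 0) (@hb 0) i j; exact: symb_sup s.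
have [C2 h2] := b2 (fun i C => forall j p, primitive_ok 0 p -> forall x, U x -> `|corr_defect (pr_mu p) e f (pr_u p) (pr_b p) i j x|
        <= C * (pr_s p ^+ 2 * (pr_w p * (pr_mu p)^-1) + pr_s p ^+ 4))
  (fun i C C' CC h l p ip x Ux => mon _ _ _ _ CC (let: And3 _ _ a := nn p ip in a) (h l p ip x Ux)) e2.
exists (1 + `|C0| + `|C1| + `|C2|); first by rewrite -!addrA lerDl !addr_ge0.
have n0 := normr_ge0 C0; have n1 := normr_ge0 C1; have n2 := normr_ge0 C2.
have l0 := ler_norm C0; have l1 := ler_norm C1; have l2 := ler_norm C2.
move=> p ip; have [a0 a1 a2] := nn p ip; split.
- by move=> l x Ux; apply: (mon) a0 (h0 l p ip x Ux); lra.
- by move=> i l x Ux; apply: (mon) a1 (h1 i l p ip x Ux); lra.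
- by move=> i j x Ux; apply: (mon) a2 (h2 i j p ip x Ux); lra.
Qed.

(** All errors with a factor [mu^-1] can be made smaller than [eta]; the quartic one cannot, and it
    forces small increments. [C] is fixed before the map and the order, and each step consumes three
    derivatives. *)
Theorem primitive_step : exists2 C, 1 <= C & forall n s u b, 0 < s <= 1 ->
  (forall l, ucn n.+3 (u l)) -> (forall i l x, U x -> `|pd i (u l) x| <= B) ->
  (forall x, U x -> c <= gdet u x) -> ucn n.+2 b -> (forall x, U x -> `|b x| <= B * s) ->
  forall eta, 0 < eta -> exists v : 'I_3 -> E -> R, [/\
    forall l, ucn n (v l), forall l x, U x -> `|v l x - u l x| <= eta,
    forall i l x, U x -> `|pd i (fun y => v l y - u l y) x| <= C * s
  & forall i j x, U x -> `|gram v i j x - gram u i j x - 2^-1 * (b x * b x) * (e 0 i * e 0 j)| <= C * s ^+ 4 + eta].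
Proof.
have [C C1 hC] := primitive_bounds; exists C => // n s u b /andP[s0 s1] uu bu du ub bb eta eta0.
have ex i l : exists2 W0, 0 < W0 & forall W, W0 <= W -> deriv_bound n.+2 B 1 (s * W) W (pd i (u l)).
  have bl x : U x -> `|pd i (u l) x| <= B * 1 by move=> Ux; rewrite mulr1; exact: bu.
  exact: (deriv_bound_ex B1 s0 ltr01 (ucn_pd i (uu l)) bl).
have [Wb Wb0 hWb] := deriv_bound_ex B1 ltr01 s0 ub bb.
have ex2 : exists2 W, 0 < W & forall i l, deriv_bound n.+2 B 1 (s * W) W (pd i (u l)) /\ deriv_bound n.+2 B s W W b.
  have [W00 p00 h00] := ex 0 0; have [W01 p01 h01] := ex 0 1; have [W02 p02 h02] := ex 0 2.
  have [W10 p10 h10] := ex 1 0; have [W11 p11 h11] := ex 1 1; have [W12 p12 h12] := ex 1 2.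
  exists (Wb + W00 + W01 + W02 + W10 + W11 + W12); first by lra.
  move=> i l; split; last first.
    have := hWb (Wb + W00 + W01 + W02 + W10 + W11 + W12); rewrite mul1r; apply; lra.
  by case: (ord2_case i) => ->; case: (ord3_case l) => ->; [apply: h00|apply: h01|apply: h02|apply: h10|apply: h11|apply: h12]; lra.
have [W W0 hW] := ex2.
(* At this frequency both [C s / mu] and [C s^2 W / mu] are at most [eta], and [W <= mu]. *)
pose mu := W + C * (s + s ^+ 2 * W) / eta.
have T0 : 0 <= C * (s + s ^+ 2 * W).
  by apply: mulr_ge0; [lra|rewrite addr_ge0 ?(ltW s0)// mulr_ge0 ?sqr_ge0 ?(ltW W0)].
have m0 : 0 < mu by rewrite /mu ltr_pwDl// divr_ge0 ?(ltW eta0).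
have Wm : W <= mu by rewrite /mu lerDl divr_ge0 ?(ltW eta0).
have hmu : C * (s + s ^+ 2 * W) <= eta * mu.
  have : eta * (C * (s + s ^+ 2 * W) / eta) <= eta * mu by rewrite ler_wpM2l ?(ltW eta0)// /mu lerDr ltW.
  by rewrite mulrCA mulfV ?mulr1// gt_eqF.
pose p := Primitive s W mu u b.
have pn m : (m <= n)%N -> primitive_ok m p.
  move=> mn; split=> //.
  - by split=> //=; rewrite ?lexx ?(ltW s0) ?(ltW W0).
  - by move=> l i x Ux; exact: ucn_der (uu l) Ux.
  - move=> i l; have [a _] := hW i l; exact: deriv_bound_le (mn : (m.+2 <= n.+2)%N) a.
  - by have [_ a] := hW 0 0; exact: deriv_bound_le (mn : (m.+2 <= n.+2)%N) a.
have [b0 b1 b2] := hC p (pn 0%N (leq0n n)).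
have sm : C * (s * mu^-1) <= eta /\ C * (s ^+ 2 * (W * mu^-1)) <= eta.
  have x1 : C * s <= C * (s + s ^+ 2 * W) by rewrite ler_wpM2l ?lerDl ?mulr_ge0 ?sqr_ge0 ?(ltW W0)//; lra.
  have x2 : C * (s ^+ 2 * W) <= C * (s + s ^+ 2 * W) by rewrite ler_wpM2l ?lerDr ?(ltW s0)//; lra.
  split; first by rewrite mulrA ler_pdivrMr//; exact: le_trans x1 hmu.
  have -> : C * (s ^+ 2 * (W * mu^-1)) = C * (s ^+ 2 * W) / mu by rewrite !mulrA.
  by rewrite ler_pdivrMr//; exact: le_trans x2 hmu.
exists (corr mu e f u b); split.
- move=> l; have /(_ (globally_filter _) _ (pn n (leqnn n))) h := symb_ucn (primitive_corr n l).
  apply: ucn_ext (ucnD h (ucn_le _ (uu l))) => [x Ux|]; first by rewrite subrK.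
  by rewrite -addn3 leq_addr.
- by move=> l x Ux; apply: le_trans (b0 l x Ux) sm.1.
- by move=> i l x Ux; exact: b1.
- move=> i j x Ux; apply: le_trans (b2 i j x Ux) _.
  by rewrite mulrDr addrC lerD2l; exact: sm.2.
Qed.

End PrimitiveStep.

(** * Quantitative injectivity and its stability *)

Section Separation.
Variable R : realType.
Local Notation E := 'rV[R]_2.
Local Notation U := (@open_disk R).
Implicit Types (x y : E) (i j : 'I_2) (u v : 'I_3 -> E -> R).

(** The path turns at a corner of the rectangle, at one of the two that lies in the disk. If the
    path has to start at [y], the intermediate points are only within twice the distance from
    [x]. *)
Lemma disk_MVT (g : E -> R) x y : (forall i y, U y -> derivable g y (delta_mx 0 i)) -> U x -> U y ->
  exists z0 z1, [/\ U z0 /\ U z1, dist1 z0 x <= 2 * dist1 x y, dist1 z1 x <= 2 * dist1 x y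
  & g x - g y = (x 0 0 - y 0 0) * pd 0 g z0 + (x 0 1 - y 0 1) * pd 1 g z1].
Proof.
move=> dg.
have half x' y' : U x' -> U y' -> U ((y' 0 0 - x' 0 0) *: delta_mx 0 0 + x') -> 
    exists z0 z1, [/\ U z0 /\ U z1, dist1 z0 x' <= dist1 x' y', dist1 z1 x' <= dist1 x' y'
  & g x' - g y' = (x' 0 0 - y' 0 0) * pd 0 g z0 + (x' 0 1 - y' 0 1) * pd 1 g z1].
  move=> Ux Uy Uc; set z := (_ *: _ + x') in Uc.
  have ez : y' = (y' 0 1 - x' 0 1) *: delta_mx 0 1 + z.
    apply/rowP => j; rewrite !mxE; case: (ord2_case j) => -> /=.
      by rewrite mulr0 add0r mulr1 subrK.
    by rewrite mulr1 mulr0 add0r subrK.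
  have [s [/andP[s0 s1] Us es]] := axis_MVT (dg 0) Ux Uc.
  have [t [/andP[t0 t1] Ut et]] : exists th, [/\ 0 <= th <= 1,
     U ((th * (y' 0 1 - x' 0 1)) *: delta_mx 0 1 + z) & 
     g y' - g z = (y' 0 1 - x' 0 1) * pd 1 g ((th * (y' 0 1 - x' 0 1)) *: delta_mx 0 1 + z)].
    by have := axis_MVT (dg 1) Uc (t := y' 0 1 - x' 0 1); rewrite -ez; apply.
  exists ((s * (y' 0 0 - x' 0 0)) *: delta_mx 0 0 + x'), ((t * (y' 0 1 - x' 0 1)) *: delta_mx 0 1 + z).
  split=> //.
  - rewrite /dist1 !mxE /= !mulr1 !mulr0 add0r subrr normr0 addr0 addrK normrM (ger0_norm s0) [`|x' 0 0 - _|]distrC.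
    by apply: le_trans (ler_piMl _ s1) _; rewrite ?lerDl.
  - rewrite /dist1 !mxE /= !mulr1 !mulr0 !add0r subrK addrK normrM (ger0_norm t0).
    by rewrite [`|x' 0 0 - _|]distrC [`|x' 0 1 - _|]distrC lerD2l ler_piMl.
  - have -> : g x' - g y' = - (g z - g x') - (g y' - g z) by ring.
    by rewrite es et; move: (pd 0 g _) (pd 1 g _) => *; ring.
move=> Ux Uy.
have [c|c] := ltP (y 0 0 ^+ 2 + x 0 1 ^+ 2) 1.
  have [|z0 [z1 [Uz h0 h1 e]]] := half x y Ux Uy.
    by apply/in_disk; rewrite !mxE /= mulr1 mulr0 add0r subrK.
  by exists z0, z1; split=> //; have := dist1_ge0 x y; lra.
have [|z0 [z1 [Uz h0 h1 e]]] := half y x Uy Ux.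
  move/in_disk: Ux; move/in_disk: Uy => hy hx.
  by apply/in_disk; rewrite !mxE /= mulr1 mulr0 add0r subrK; lra.
exists z0, z1; split=> //.
- by apply: le_trans (dist1_triangle z0 y x) _; move: h0; rewrite [dist1 y x]dist1C; lra.
- by apply: le_trans (dist1_triangle z1 y x) _; move: h1; rewrite [dist1 y x]dist1C; lra.
- by rewrite -opprB e; move: (pd 0 g _) (pd 1 g _) => *; ring.
Qed.

Lemma sqr_sum_lower (p q r : R) (c a : R) : 0 <= c -> p * r - q ^+ 2 >= c -> 0 <= r ->
  forall b, c * a ^+ 2 <= r * (a ^+ 2 * p + 2 * a * b * q + b ^+ 2 * r).
Proof.
move=> c0 h r0 b; rewrite (_ : r * _ = (p * r - q ^+ 2) * a ^+ 2 + (a * q + b * r) ^+ 2); last by ring.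
by apply: (le_trans (ler_wpM2r (sqr_ge0 a) h)); rewrite lerDl sqr_ge0.
Qed.

Lemma vd_bound (p : 'I_3 -> R) (B : R) : 0 <= B -> (forall l, `|p l| <= B) -> vd p p <= 3 * B ^+ 2.
Proof.
move=> B0 h; have sq l : p l * p l <= B ^+ 2.
  by rewrite -expr2 -real_normK ?num_real// lerXn2r ?nnegrE.
by have := sq 0; have := sq 1; have := sq 2; rewrite /vd; lra.
Qed.

(** Completing the square gives [c a^2 <= |q|^2 |a p + b q|^2], and likewise for [b]. With [|p|^2]
    and [|q|^2] at most [3 B^2], if all three coordinates were below the bound the two inequalities
    would contradict each other; [36 B^2 k^2 = c] is the resulting balance. *)
Lemma immersion_lower (p q : 'I_3 -> R) (B c a b : R) : 0 < c -> 0 < B ->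
  (forall l, `|p l| <= B) -> (forall l, `|q l| <= B) -> c <= vd p p * vd q q - vd p q ^+ 2 ->
  exists l, Num.sqrt c / (6 * B) * (`|a| + `|b|) <= `|a * p l + b * q l|.
Proof.
move=> c0 B0 hp hq hc.
set k := Num.sqrt c / (6 * B); have k0 : 0 < k by rewrite /k divr_gt0 ?sqrtr_gt0// mulr_gt0.
have k2 : 36 * B ^+ 2 * k ^+ 2 = c.
  rewrite /k expr_div_n sqr_sqrtr ?(ltW c0)// exprMn; field; exact: lt0r_neq0.
set d := `|a| + `|b|; have d0 : 0 <= d by rewrite addr_ge0.
have [[l hl]|h] := pselect (exists l, k * d <= `|a * p l + b * q l|); first by exists l.
have {}h l : `|a * p l + b * q l| < k * d by rewrite ltNge; apply/negP => hl; apply: h; exists l.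
have kd : 0 < k * d by apply: le_lt_trans (h 0).
have {}d0 : 0 < d by move: kd; rewrite pmulr_rgt0.
pose V l := a * p l + b * q l.
have VV : vd V V < 3 * (k * d) ^+ 2.
  have sq l : V l * V l < (k * d) ^+ 2.
    by rewrite -expr2 -real_normK ?num_real// ltrXn2r ?nnegrE ?(ltW kd)//; exact: h.
  by have := sq 0; have := sq 1; have := sq 2; rewrite /vd; lra.
have Ve : vd V V = a ^+ 2 * vd p p + 2 * a * b * vd p q + b ^+ 2 * vd q q by rewrite /vd /V; ring.
have np : 0 <= vd p p by rewrite /vd -!expr2 !addr_ge0 ?sqr_ge0.
have nq : 0 <= vd q q by rewrite /vd -!expr2 !addr_ge0 ?sqr_ge0.
have nV : 0 <= vd V V by rewrite /vd -!expr2 !addr_ge0 ?sqr_ge0.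
have bp := vd_bound (ltW B0) hp; have bq := vd_bound (ltW B0) hq.
have ha : c * a ^+ 2 <= vd q q * vd V V by rewrite Ve; apply: sqr_sum_lower => //; exact: ltW.
have hb : c * b ^+ 2 <= vd p p * vd V V.
  rewrite Ve (_ : _ + _ = b ^+ 2 * vd q q + 2 * b * a * vd p q + a ^+ 2 * vd p p); last by ring.
  by apply: sqr_sum_lower => //; [exact: ltW|rewrite mulrC].
have ub z : z <= 3 * B ^+ 2 -> 0 <= z -> z * vd V V < c * d ^+ 2 / 4.
  move=> zB z0; apply: le_lt_trans (ler_wpM2r nV zB) _.
  have : 3 * B ^+ 2 * vd V V < 3 * B ^+ 2 * (3 * (k * d) ^+ 2) by rewrite ltr_pM2l// mulr_gt0 ?exprn_gt0.
  have -> : 3 * B ^+ 2 * (3 * (k * d) ^+ 2) = (36 * B ^+ 2 * k ^+ 2) * d ^+ 2 / 4 by field.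
  by rewrite k2.
have a2 := le_lt_trans ha (ub _ bq nq); have b2 := le_lt_trans hb (ub _ bp np).
have {a2 b2} : c * (a ^+ 2 + b ^+ 2) < c * (d ^+ 2 / 2) by rewrite mulrDr; lra.
rewrite ltr_pM2l// /d -(real_normK (num_real a)) -(real_normK (num_real b)).
have := sqr_ge0 (`|a| - `|b|); move: `|a| `|b| => A' B'; lra.
Qed.

(** Injectivity up to the boundary, stated in the open disk: for a map that extends continuously it
    says that the extension is injective on the closed disk. *)
Definition unif_injective u := forall rho, 0 < rho -> exists2 eta, 0 < eta &
  forall x y, U x -> U y -> rho <= dist1 x y -> exists l, eta <= `|u l x - u l y|.

(** Close points are separated by the gradient, with a constant depending on [B] and [c] alone;
    distant points by the uniform injectivity of [u]. The C^1 threshold [kap] is thus common to all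
    maps of a construction and is met by a small amplitude, while [eta] may depend on the map and is
    met by a high frequency. *)
Lemma unif_injective_perturb (B c : R) : 0 < c -> 0 < B -> exists2 kap, 0 < kap & forall u,
  (forall l, ucn 1 (u l)) -> (forall i l x, U x -> `|pd i (u l) x| <= B) ->
  (forall x, U x -> c <= gdet u x) -> unif_injective u ->
  exists2 eta, 0 < eta & forall v, (forall i l x, U x -> derivable (fun y => v l y - u l y) x (delta_mx 0 i)) ->
    (forall l x, U x -> `|v l x - u l x| <= eta) ->
    (forall i l x, U x -> `|pd i (fun y => v l y - u l y) x| <= kap) -> unif_injective v.
Proof.
move=> c0 B0; set k := Num.sqrt c / (6 * B); have k0 : 0 < k by rewrite /k divr_gt0 ?sqrtr_gt0// mulr_gt0.
have k8 : 0 < k / 8 by rewrite divr_gt0.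
exists (k / 8) => // u uu bu du su.
have [d d0 hd] : exists2 d, 0 < d & forall i l x y, U x -> U y -> dist1 x y < d -> `|pd i (u l) x - pd i (u l) y| < k / 8.
  have ex i l := ucn_uc (ucn_pd i (uu l)) k8.
  have [d00 p00 h00] := ex 0 0; have [d01 p01 h01] := ex 0 1; have [d02 p02 h02] := ex 0 2.
  have [d10 p10 h10] := ex 1 0; have [d11 p11 h11] := ex 1 1; have [d12 p12 h12] := ex 1 2.
  exists (Num.min (Num.min d00 (Num.min d01 d02)) (Num.min d10 (Num.min d11 d12))).
    by rewrite !lt_min p00 p01 p02 p10 p11 p12.
  move=> i l x y Ux Uy; rewrite !lt_min => /andP[/and3P[a00 a01 a02] /and3P[a10 a11 a12]].
  by case: (ord2_case i) => ->; case: (ord3_case l) => ->; [exact: h00|exact: h01|exact: h02|exact: h10|exact: h11|exact: h12].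
(* The points given by [disk_MVT] may be twice as far from [x] as [y] is, and must stay within
   [d]. *)
have d3 : 0 < d / 3 by rewrite divr_gt0.
have [eta0 eta00 heta] := su _ d3.
exists (eta0 / 4); first by rewrite divr_gt0.
move=> v dv bv pv rho rho0; exists (Num.min (k * rho / 2) (eta0 / 2)).
  by rewrite lt_min (divr_gt0 (mulr_gt0 k0 rho0) (ltr0n R 2)) (divr_gt0 eta00 (ltr0n R 2)).
move=> x y Ux Uy xy.
have [far|near] := leP (d / 3) (dist1 x y).
  have [l hl] := heta x y Ux Uy far; exists l; rewrite ge_min; apply/orP; right.
  have a := bv l x Ux; have b := bv l y Uy.
  have e : u l x - u l y = (v l x - v l y) - (v l x - u l x) + (v l y - u l y) by ring.
  have := le_trans (ler_normD (v l x - v l y - (v l x - u l x)) (v l y - u l y)) (lerD (ler_normB (v l x - v l y) (v l x - u l x)) (lexx _)).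
  by rewrite -e; lra.
have [l hl] := immersion_lower (x 0 0 - y 0 0) (x 0 1 - y 0 1) c0 B0 (fun l => bu 0 l x Ux) (fun l => bu 1 l x Ux) (du x Ux).
exists l; rewrite ge_min; apply/orP; left.
have [z0 [z1 [[U0 U1] n0 n1 e]]] := disk_MVT (fun i y Uy => ucn_der (uu l) Uy) Ux Uy.
have e0 : `|pd 0 (u l) z0 - pd 0 (u l) x| <= k / 8 by apply/ltW/hd => //; lra.
have e1 : `|pd 1 (u l) z1 - pd 1 (u l) x| <= k / 8 by apply/ltW/hd => //; lra.
have lip := disk_lip (dv ^~ l) (pv ^~ l) Ux Uy.
move: hl lip; rewrite -/k -/(dist1 x y) /= => hl lip.
set X := x 0 0 - y 0 0 in hl e *; set Y := x 0 1 - y 0 1 in hl e *.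
have dX : dist1 x y = `|X| + `|Y| by [].
have id : X * pd 0 (u l) x + Y * pd 1 (u l) x = (v l x - v l y) - (v l x - u l x - (v l y - u l y))
   - (X * (pd 0 (u l) z0 - pd 0 (u l) x) + Y * (pd 1 (u l) z1 - pd 1 (u l) x)).
  have -> : v l x - v l y - (v l x - u l x - (v l y - u l y)) = u l x - u l y by ring.
  by rewrite e; move: (pd 0 (u l) z0) (pd 1 (u l) z1) (pd 0 (u l) x) (pd 1 (u l) x) => *; ring.
have b1 : `|X * (pd 0 (u l) z0 - pd 0 (u l) x) + Y * (pd 1 (u l) z1 - pd 1 (u l) x)| <= k / 8 * dist1 x y.
  apply: le_trans (ler_normD _ _) _; rewrite !normrM dX mulrDr [k / 8 * _]mulrC [k / 8 * `|Y|]mulrC.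
  by apply: lerD; exact: ler_wpM2l.
have hl2 : k * dist1 x y <= `|v l x - v l y| + k / 8 * dist1 x y + k / 8 * dist1 x y.
  apply: le_trans hl _; rewrite id; apply: le_trans (ler_normB _ _) _; apply: lerD b1.
  by apply: le_trans (ler_normB _ _) _; exact: lerD.
have := ler_wpM2l (ltW k0) xy; have := mulr_ge0 (ltW k0) (ltW rho0); lra.
Qed.

End Separation.

(** * Adding many primitive metrics *)

Section ManySteps.
Variable R : realType.
Local Notation E := 'rV[R]_2.
Local Notation U := (@open_disk R).
Implicit Types (x e : E) (i j : 'I_2) (u v : 'I_3 -> E -> R) (G : 'I_2 -> 'I_2 -> E -> R) (b : E -> R).

Definition add_primitive G (eb : E * (E -> R)) : 'I_2 -> 'I_2 -> E -> R :=
  fun i j x => G i j x + 2^-1 * (eb.2 x * eb.2 x) * (eb.1 0 i * eb.1 0 j).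

Definition posmx (ga : R) G := forall x, U x ->
  [/\ G 1 0 x = G 0 1 x, 0 <= G 0 0 x, 0 <= G 1 1 x & ga <= G 0 0 x * G 1 1 x - G 0 1 x ^+ 2].

Definition trace_le (T : R) G := forall x, U x -> G 0 0 x + G 1 1 x <= T.

(** A primitive metric raises the determinant by the adjugate form evaluated at its direction, which
    is nonnegative. *)
Lemma posmx_add ga G eb : 0 < ga -> posmx ga G -> posmx ga (add_primitive G eb).
Proof.
move=> ga0 h x Ux; have [s a0 d0 det] := h x Ux; rewrite /add_primitive.
set t := 2^-1 * _; have t0 : 0 <= t by rewrite /t -expr2 mulr_ge0 ?sqr_ge0// invr_ge0.
move: (eb.1 0 0) (eb.1 0 1) => p q.
move: t0 a0 d0 det s; move: t (G 0 0 x) (G 0 1 x) (G 1 0 x) (G 1 1 x) => t a b b' d t0 a0 d0 det ->.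
have pp : 0 <= p * p by rewrite -expr2 sqr_ge0.
have qq : 0 <= q * q by rewrite -expr2 sqr_ge0.
split.
- ring.
- by rewrite addr_ge0// mulr_ge0.
- by rewrite addr_ge0// mulr_ge0.
have da : 0 < a.
  rewrite lt_neqAle eq_sym a0 andbT; apply/eqP => az; move: det; rewrite az mul0r sub0r.
  have := sqr_ge0 b; lra.
have Q : 0 <= q ^+ 2 * a - 2 * p * q * b + p ^+ 2 * d.
  rewrite -(pmulr_rge0 _ da) (_ : a * _ = (q * a - p * b) ^+ 2 + p ^+ 2 * (a * d - b ^+ 2)); last by ring.
  by rewrite addr_ge0 ?sqr_ge0// mulr_ge0 ?sqr_ge0//; lra.
rewrite (_ : _ - _ = (a * d - b ^+ 2) + t * (q ^+ 2 * a - 2 * p * q * b + p ^+ 2 * d)); last by ring.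
by have := mulr_ge0 t0 Q; lra.
Qed.

(** The trace only grows, so a bound for the final metric serves all the intermediate ones. *)
Lemma trace_foldl T L G : trace_le T (foldl add_primitive G L) -> trace_le T G.
Proof.
elim: L G => [//|eb L IH] G /= /IH h x Ux; apply: le_trans (h x Ux); rewrite /add_primitive.
set t := 2^-1 * _; have t0 : 0 <= t by rewrite /t -expr2 mulr_ge0 ?sqr_ge0// invr_ge0.
have a := mulr_ge0 t0 (sqr_ge0 (eb.1 0 0)); have b := mulr_ge0 t0 (sqr_ge0 (eb.1 0 1)).
rewrite -!expr2; lra.
Qed.

Lemma posmx_close (ga T : R) : 0 < ga -> 0 < T -> exists2 tau, 0 < tau <= 1 & forall u G,
  posmx ga G -> trace_le T G -> (forall i j x, U x -> `|gram u i j x - G i j x| <= tau) ->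
  (forall i l x, U x -> `|pd i (u l) x| <= T + 1) /\ (forall x, U x -> ga / 2 <= gdet u x).
Proof.
move=> ga0 T0; pose tau := Num.min 1 (ga / (8 * T + 4)).
have T4 : 0 < 8 * T + 4 by lra.
have tau0 : 0 < tau by rewrite lt_min ltr01 divr_gt0.
have tau1 : tau <= 1 by rewrite ge_min lexx.
have tauT : tau * (8 * T + 4) <= ga by rewrite -ler_pdivlMr// ge_min lexx orbT.
exists tau; first by rewrite tau0.
move=> u G pG tG h; split.
  move=> i l x Ux; have [_ a0 d0 _] := pG x Ux; have t := tG x Ux.
  have gi : gram u i i x <= T + 1.
    have := h i i x Ux; rewrite ler_norml => /andP[_ h1].
    have : G i i x <= T by case: (ord2_case i) => ->; lra.
    lra.
  have sq : pd i (u l) x ^+ 2 <= gram u i i x.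
    rewrite /gram /vd /du -!expr2; have s0 := sqr_ge0 (pd i (u 0) x); have s1 := sqr_ge0 (pd i (u 1) x).
    have s2 := sqr_ge0 (pd i (u 2) x); move: s0 s1 s2.
    case: (ord3_case l) => ->; move: (pd i (u 0) x ^+ 2) (pd i (u 1) x ^+ 2) (pd i (u 2) x ^+ 2) => a b c; lra.
  have T1 : 0 <= T + 1 by lra.
  rewrite -(@ler_sqr _ `|_|) ?nnegrE// real_normK ?num_real//; apply: (le_trans sq); apply: (le_trans gi).
  by rewrite expr2 ler_peMr//; lra.
move=> x Ux; have [_ a0 d0 det] := pG x Ux; have t := tG x Ux.
have h00 := h 0 0 x Ux; have h01 := h 0 1 x Ux; have h11 := h 1 1 x Ux; rewrite /gdet.
move: (gram u 0 0 x) (gram u 0 1 x) (gram u 1 1 x) h00 h01 h11.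
move: (G 0 0 x) (G 0 1 x) (G 1 1 x) a0 d0 det t => a b d a0 d0 det t a' b' d' h00 h01 h11.
have b2 : `|b| <= T.
  rewrite -(@ler_sqr _ `|_|) ?nnegrE ?(ltW T0)// real_normK ?num_real//.
  apply: (@le_trans _ _ (a * d)); first by lra.
  by rewrite expr2 ler_pM//; lra.
have aT : `|a| <= T by rewrite ger0_norm//; lra.
have dT : `|d| <= T by rewrite ger0_norm//; lra.
have t01 : 0 <= tau <= 1 by rewrite (ltW tau0).
have := det_close t01 aT b2 dT h00 h01 h11; apply: le_trans; lra.
Qed.

Definition step_const (B c C : R) e := forall n s u b, 0 < s <= 1 ->
  (forall l, ucn n.+3 (u l)) -> (forall i l x, U x -> `|pd i (u l) x| <= B) ->
  (forall x, U x -> c <= gdet u x) -> ucn n.+2 b -> (forall x, U x -> `|b x| <= B * s) ->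
  forall eta, 0 < eta -> exists v : 'I_3 -> E -> R, [/\
    forall l, ucn n (v l), forall l x, U x -> `|v l x - u l x| <= eta,
    forall i l x, U x -> `|pd i (fun y => v l y - u l y) x| <= C * s
  & forall i j x, U x -> `|gram v i j x - gram u i j x - 2^-1 * (b x * b x) * (e 0 i * e 0 j)| <= C * s ^+ 4 + eta].

Lemma step_const_le B c C C' e : C <= C' -> step_const B c C e -> step_const B c C' e.
Proof.
move=> CC h n s u b s01 uu bu du ub bb eta eta0; have [v [h1 h2 h3 h4]] := h n s u b s01 uu bu du ub bb eta eta0.
have /andP[s0 _] := s01; exists v; split=> //.
  by move=> i l x Ux; apply: le_trans (h3 i l x Ux) _; rewrite ler_wpM2r// ltW.
move=> i j x Ux; apply: le_trans (h4 i j x Ux) _.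
by rewrite lerD2r ler_wpM2r// exprn_ge0// ltW.
Qed.

Lemma step_const_ex B c (D : seq E) : 0 < c -> 1 <= B ->
  exists2 C, 1 <= C & forall e, e \in D -> step_const B c C e.
Proof.
move=> c0 B1; elim: D => [|e D [C C1 hC]]; first by exists 1.
have [C' C1' hC'] := primitive_step e 0 c0 B1.
exists (Num.max C C'); first by rewrite le_max C1.
have CC : C <= Num.max C C' /\ C' <= Num.max C C' by rewrite !le_max !lexx orbT.
move=> e'; rewrite inE => /orP[/eqP->|/hC h]; first exact: step_const_le CC.2 hC'.
exact: step_const_le CC.1 h.
Qed.

Fixpoint valid_steps (D : seq E) (n : nat) (A : R) (L : seq (E * (E -> R))) : Prop :=
  if L is eb :: L' then [/\ eb.1 \in D, ucn n eb.2, forall x, U x -> `|eb.2 x| <= A & valid_steps D n A L']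
  else True.

Lemma valid_steps_le D m n A L : (m <= n)%N -> valid_steps D n A L -> valid_steps D m A L.
Proof.
move=> mn; elim: L => [//|eb L IH] /= [h1 h2 h3 h4]; split; [exact: h1|exact: ucn_le mn h2|exact: h3|exact: IH].
Qed.

(** Determinant and trace of the prescribed intermediate metrics stay within [ga] and [T], so the
    same [C] serves every step, whatever their number. The list may therefore be chosen after [C].
    Each step uses three derivatives and at most [2 C s^4] of the error budget [tau]. *)
Theorem multi_step (ga T : R) (D : seq E) : 0 < ga -> 0 < T ->
  exists C s0 tau, [/\ 1 <= C, 0 < s0 <= 1, 0 < tau & forall s, 0 < s <= s0 -> forall L G u err,
    posmx ga G -> trace_le T (foldl add_primitive G L) ->
    valid_steps D (3 * size L + 2) ((T + 1) * s) L ->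
    (forall l, ucn (3 * size L + 2) (u l)) ->
    (forall i j x, U x -> `|gram u i j x - G i j x| <= err) ->
    err + (size L)%:R * (2 * C * s ^+ 4) <= tau ->
    forall eta, 0 < eta -> exists v : 'I_3 -> E -> R, [/\ forall l, ucn 2 (v l),
      forall l x, U x -> `|v l x - u l x| <= eta,
      forall i j x, U x -> `|gram v i j x - foldl add_primitive G L i j x| <= err + (size L)%:R * (2 * C * s ^+ 4)
    & unif_injective u -> unif_injective v]].
Proof.
move=> ga0 T0.
have B1 : 1 <= T + 1 by lra.
have B0 : 0 < T + 1 by lra.
have g2 : 0 < ga / 2 by rewrite divr_gt0.
have [tau /andP[tau0 _] htau] := posmx_close ga0 T0.
have [C C1 hC] := step_const_ex D g2 B1.
have [kap kap0 hk] := unif_injective_perturb g2 B0.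
have C0 : 0 < C by lra.
exists C, (Num.min 1 (kap / C)), tau; split=> //.
  by rewrite lt_min ltr01 divr_gt0//= ge_min lexx.
move=> s /andP[s0]; rewrite le_min => /andP[s1 sk].
have Cs : C * s <= kap by rewrite mulrC -ler_pdivlMr.
have s4 : 0 < C * s ^+ 4 by rewrite mulr_gt0 ?exprn_gt0.
elim=> [|[e b] L IH] G u err pG tG vL uu hu herr eta eta0.
  rewrite muln0 in uu; exists u; split=> //.
  - by move=> l x Ux; rewrite subrr normr0 ltW.
  - by move=> i j x Ux; rewrite mul0r addr0; exact: hu.
have [eD ub bb vL'] := vL.
have n0 : 0 <= (size L)%:R * (2 * C * s ^+ 4) by rewrite mulr_ge0// -mulrA mulr_ge0// ltW.
have er' : err + 2 * C * s ^+ 4 + (size L)%:R * (2 * C * s ^+ 4) <= tau.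
  by move: herr; rewrite /= -natr1 mulrDl mul1r; lra.
have errt : err <= tau by move: s4 n0 er'; rewrite -!mulrA; lra.
have [bu du] := htau u G pG (trace_foldl tG) (fun i j x Ux => le_trans (hu i j x Ux) errt).
have nE : (3 * size ((e, b) :: L) + 2 = (3 * size L + 2).+3)%N by rewrite /= mulnS -addnA addnC addn3 .
have uu3 l : ucn (3 * size L + 2).+3 (u l) by rewrite -nE; exact: uu.
have u1 l : ucn 1 (u l) by apply: ucn_le (uu l); rewrite nE.
have [eta1 eta10 heta1] : exists2 eta1, 0 < eta1 & unif_injective u ->
   forall v, (forall i l x, U x -> derivable (fun y => v l y - u l y) x (delta_mx 0 i)) ->
    (forall l x, U x -> `|v l x - u l x| <= eta1) ->
    (forall i l x, U x -> `|pd i (fun y => v l y - u l y) x| <= kap) -> unif_injective v.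
  have [su|nsu] := pselect (unif_injective u); last by exists 1.
  by have [eta1 e10 he1] := hk u u1 bu du su; exists eta1.
(* Half of the displacement is left to the remaining steps, [eta1] protects injectivity, and the
   last term turns the error [C s^4 + eta'] into at most [2 C s^4]. *)
pose eta' := Num.min (eta / 2) (Num.min eta1 (C * s ^+ 4)).
have eta'0 : 0 < eta' by rewrite !lt_min divr_gt0// eta10.
have [e1 e2 e3] : [/\ eta' <= eta / 2, eta' <= eta1 & eta' <= C * s ^+ 4].
  by split; rewrite /eta' !ge_min lexx ?orbT.
have s01 : 0 < s <= 1 by rewrite s0.
have lt3 : ((3 * size L + 2).+2 <= 3 * size ((e, b) :: L) + 2)%N by rewrite nE leqnSn.
have [v [v1 v2 v3 v4]] := hC e eD _ s u b s01 uu3 bu du (ucn_le lt3 ub) bb eta' eta'0.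
have nle : (3 * size L + 2 <= 3 * size ((e, b) :: L) + 2)%N by rewrite nE; do 3!apply: leqW.
have hu' i j x : U x -> `|gram v i j x - add_primitive G (e, b) i j x| <= err + 2 * C * s ^+ 4.
  move=> Ux; have a := v4 i j x Ux; have a' := hu i j x Ux; rewrite /add_primitive /=.
  have id (p q r t : R) : p - (q + t) = (p - r - t) + (r - q) by ring.
  rewrite (id _ _ (gram u i j x)); apply: le_trans (ler_normD _ _) _.
  by move: a a'; set X := `|_|; set Y := `|_|; move: s4 e3; rewrite -mulrA; move: (C * s ^+ 4) => z; lra.
have eta2 : 0 < eta / 2 by rewrite divr_gt0.
have [w [w1 w2 w3 w4]] := IH _ v _ (posmx_add (e, b) ga0 pG) tG (valid_steps_le nle vL') v1 hu' er' _ eta2.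
exists w; split=> //.
- move=> l x Ux; have a := v2 l x Ux; have a' := w2 l x Ux.
  rewrite (_ : w l x - u l x = (w l x - v l x) + (v l x - u l x)); last by ring.
  apply: le_trans (ler_normD _ _) _; lra.
- move=> i j x Ux; apply: le_trans (w3 i j x Ux) _; rewrite [size (_ :: _)]/= -natr1 mulrDl mul1r; lra.
- move=> su; apply: w4; apply: (heta1 su).
  + move=> i l x Ux; apply: (ucn_der (n := 0) _ Ux); apply: ucnB (ucn_le _ (u1 l)); last by [].
    by apply: ucn_le (v1 l); rewrite addn2.
  + by move=> l x Ux; apply: le_trans (v2 l x Ux) e2.
  + by move=> i l x Ux; apply: le_trans (v3 i l x Ux) Cs.
Qed.

End ManySteps.

(** * Moments of coin flips *)

Section Binomial.
Variable R : realType.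
Implicit Types (q al be ga : R) (F : nat -> R).

(* Numbers of heads and tails of all sequences of [n] flips: an enumeration of the
   binomial distribution that avoids binomial coefficients. *)
Fixpoint coin_flips (n : nat) : seq (nat * nat) :=
  if n is m.+1 then [seq (p.1, p.2.+1) | p <- coin_flips m] ++ [seq (p.1.+1, p.2) | p <- coin_flips m]
  else [:: (0%N, 0%N)].

Lemma coin_flips_sum n p : p \in coin_flips n -> (p.1 + p.2 = n)%N.
Proof.
elim: n p => [|n IH] p /=; first by rewrite inE => /eqP->.
by rewrite mem_cat => /orP[] /mapP[z /IH <- ->] /=; rewrite ?addnS ?addSn.
Qed.

Definition expect n q F : R := \sum_(p <- coin_flips n) q ^+ p.1 * (1 - q) ^+ p.2 * F p.1.

Lemma expectS n q F : expect n.+1 q F = (1 - q) * expect n q F + q * expect n q (F \o succn).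
Proof.
rewrite /expect /= big_cat !big_map /= !mulr_sumr; congr (_ + _); apply: eq_bigr => p _; rewrite exprS; ring.
Qed.

(** The first two moments of the binomial law; quadratic functions are stable under the shift of
    [expectS], so all three coefficients are carried through the induction. *)
Lemma expect_quadratic n q al be ga :
  expect n q (fun k => al + be * k%:R + ga * k%:R ^+ 2) =
  al + be * (n%:R * q) + ga * (n%:R * q * (1 - q) + n%:R ^+ 2 * q ^+ 2).
Proof.
elim: n al be ga => [|n IH] al be ga.
  by rewrite /expect big_seq1 /=; ring.
rewrite expectS IH [X in q * X](_ : _ = expect n q (fun k => (al + be + ga) + (be + 2 * ga) * k%:R + ga * k%:R ^+ 2)).
  by rewrite IH -natr1; ring.
by apply: eq_bigr => p _ /=; rewrite -natr1; ring.
Qed.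

End Binomial.

(** * Decomposition into primitive metrics with constant directions *)

Section Decomposition.
Variable R : realType.
Local Notation E := 'rV[R]_2.
Local Notation U := (@open_disk R).
Implicit Types (x e : E) (i j : 'I_2) (P G : 'I_2 -> 'I_2 -> E -> R) (L : seq (E * (E -> R))).

Definition primitive_sum L i j x : R := \sum_(eb <- L) 2^-1 * (eb.2 x * eb.2 x) * (eb.1 0 i * eb.1 0 j).

Lemma foldl_add_primitive L G i j x :
  foldl (@add_primitive R) G L i j x = G i j x + primitive_sum L i j x.
Proof.
rewrite /primitive_sum; elim: L G => [|eb L IH] G /=; first by rewrite big_nil addr0.
by rewrite IH big_cons addrA.
Qed.

Lemma primitive_sum_cat L L' i j x : primitive_sum (L ++ L') i j x = primitive_sum L i j x + primitive_sum L' i j x.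
Proof. by rewrite /primitive_sum big_cat. Qed.

Definition scale_steps (s : R) L : seq (E * (E -> R)) := [seq (eb.1, fun x => s * eb.2 x) | eb <- L].

Lemma primitive_sum_scale s L i j x : primitive_sum (scale_steps s L) i j x = s ^+ 2 * primitive_sum L i j x.
Proof.
rewrite /primitive_sum big_map mulr_sumr; apply: eq_bigr => eb _ /=.
move: (eb.2 x) (eb.1 0 i) (eb.1 0 j) => *; ring.
Qed.

Lemma valid_steps_cat D n (A : R) L L' : valid_steps D n A L -> valid_steps D n A L' -> valid_steps D n A (L ++ L').
Proof. by elim: L => [//|eb L IH] /= [h1 h2 h3 h4] h; split; [exact: h1|exact: h2|exact: h3|exact: IH]. Qed.

Lemma valid_steps_scale D n (A s : R) L : 0 <= s -> valid_steps D n A L -> valid_steps D n (A * s) (scale_steps s L).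
Proof.
move=> s0; elim: L => [//|eb L IH] /= [h1 h2 h3 h4]; split; [exact: h1|exact: ucnZ| |exact: IH].
by move=> x Ux; rewrite normrM (ger0_norm s0) mulrC ler_wpM2r//; exact: h3.
Qed.

Fixpoint repeat_steps (N : nat) L : seq (E * (E -> R)) := if N is N'.+1 then L ++ repeat_steps N' L else [::].

Lemma size_repeat N L : size (repeat_steps N L) = (N * size L)%N.
Proof. by elim: N => [|N IH] //=; rewrite size_cat IH mulSn. Qed.

Lemma primitive_sum_repeat N L i j x : primitive_sum (repeat_steps N L) i j x = N%:R * primitive_sum L i j x.
Proof.
elim: N => [|N IH] /=; first by rewrite /primitive_sum big_nil mul0r.
by rewrite primitive_sum_cat IH -natr1 mulrDl mul1r addrC.
Qed.

Lemma valid_steps_repeat D n (A : R) L N : valid_steps D n A L -> valid_steps D n A (repeat_steps N L).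
Proof. by move=> h; elim: N => [//|N IH]; exact: valid_steps_cat. Qed.

Lemma ucnX n (f : E -> R) k : ucn n f -> ucn n (fun x => f x ^+ k).
Proof.
move=> uf; elim: k => [|k IH]; first by apply: ucn_ext (ucn_cst n 1) => x _; rewrite expr0.
by apply: ucn_ext (ucnM uf IH) => x _; rewrite exprS.
Qed.

Lemma valid_map D n (A : R) (I : eqType) (r : seq I) (F : I -> E * (E -> R)) :
  (forall p, p \in r -> [/\ (F p).1 \in D, ucn n (F p).2 & forall x, U x -> `|(F p).2 x| <= A]) ->
  valid_steps D n A [seq F p | p <- r].
Proof.
elim: r => [//|p r IH] h /=; have [h1 h2 h3] := h p (mem_head _ _); split; [exact: h1|exact: h2|exact: h3|].
by apply: IH => z zr; apply: h; rewrite inE zr orbT.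
Qed.

Section Slopes.
Variables (c T : R).
Hypothesis c0 : 0 < c.
Hypothesis T0 : 0 < T.

(** As [|P_01 / P_00| <= T / c], the bias of the coin stays away from 0 and 1. The flip number [n]
    keeps the variance term, at most [T sl^2 / n], below [c / (2 T)], half of the lower bound
    [c / T] for the Schur complement of [P]. *)
Let sl : R := T / c + 1.
Let n : nat := (Num.bound (2 * T ^+ 2 * sl ^+ 2 / c)).+1.
Definition slope_dir (k : nat) : E := \row_(i < 2) (if i == 0 then 1 else - sl + 2 * sl * k%:R / n%:R).

Lemma slope_dirE k : slope_dir k 0 0 = 1 /\ slope_dir k 0 1 = - sl + 2 * sl * k%:R / n%:R.
Proof. by rewrite !mxE. Qed.

Definition slope_dirs : seq E := delta_mx 0 1 :: [seq slope_dir p.1 | p <- coin_flips n].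

Let sl1 : 1 <= sl. Proof. by rewrite /sl lerDr divr_ge0// ltW. Qed.
Let sl0 : 0 < sl. Proof. exact: lt_le_trans ltr01 sl1. Qed.
Let n0 : 0 < n%:R :> R. Proof. by rewrite ltr0n. Qed.

Variables (P : 'I_2 -> 'I_2 -> E -> R) (m : nat).
Hypothesis uP : forall i j, ucn m.+2 (P i j).
Hypothesis Ps : forall x, U x -> P 1 0 x = P 0 1 x.
Hypothesis Pc : forall x, U x -> c <= P 0 0 x.
Hypothesis PT : forall i j x, U x -> `|P i j x| <= T.
Hypothesis Pdet : forall x, U x -> c <= P 0 0 x * P 1 1 x - P 0 1 x ^+ 2.

(** With bias [q] the slopes [-sl] and [sl] have mean [P_01 / P_00]. [th] is [P_00] times the
    probability of one sequence of flips, and [rho] is the Schur complement [P_11 - P_01^2 / P_00]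
    minus the variance. *)
Let q x : R := (P 0 1 x * (P 0 0 x)^-1 + sl) * (2 * sl)^-1.
Let th (p : nat * nat) x : R := P 0 0 x * (q x ^+ p.1 * (1 - q x) ^+ p.2).
Let rho x : R := P 1 1 x - P 0 1 x * P 0 1 x * (P 0 0 x)^-1 - 4 * sl ^+ 2 / n%:R * (P 0 0 x * (q x * (1 - q x))).

(* [P = P_00 (1, t) (x) (1, t) + (..) e_2 (x) e_2] with [t = P_01 / P_00]. The slope [t] is
   replaced by the mean of [n] flips of a coin with values [-sl], [sl] and bias [q];
   the variance this adds to the coefficient of [e_2 (x) e_2] is [O(1 / n)]. *)
Definition slope_steps : seq (E * (E -> R)) :=
  (delta_mx 0 1, fun x => Num.sqrt (2 * rho x)) ::
  [seq (slope_dir p.1, fun x => Num.sqrt (2 * th p x)) | p <- coin_flips n].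

Let q_bounds x : U x -> (2 * sl)^-1 <= q x <= 1 - (2 * sl)^-1.
Proof.
move=> Ux; have a0 := lt_le_trans c0 (Pc Ux).
have h : `|P 0 1 x * (P 0 0 x)^-1| <= T / c.
  rewrite normrM ler_pM ?PT// ger0_norm ?invr_ge0 ?(ltW a0)// lef_pV2 ?posrE// Pc//.
have s2 : 0 < (2 * sl)^-1 by rewrite invr_gt0 mulr_gt0.
have e1 : 1 = 2 * sl * (2 * sl)^-1 by rewrite mulfV// gt_eqF// mulr_gt0.
rewrite /q; move: h; rewrite ler_norml => /andP[h1 h2]; apply/andP; split.
  by rewrite -[leLHS]mul1r ler_wpM2r ?(ltW s2)// /sl; lra.
rewrite lerBrDr -[X in _ + X]mul1r -mulrDl [leRHS]e1 ler_wpM2r ?(ltW s2)// /sl; lra.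
Qed.

Let th_bounds p x : p \in coin_flips n -> U x -> c * (2 * sl)^-1 ^+ n <= th p x <= T.
Proof.
move=> pn Ux; have /andP[q0 q1] := q_bounds Ux; have a0 := lt_le_trans c0 (Pc Ux).
have s2 : 0 < (2 * sl)^-1 by rewrite invr_gt0 mulr_gt0.
rewrite /th -(coin_flips_sum pn) exprD; apply/andP; split.
  apply: ler_pM; rewrite ?(ltW c0) ?mulr_ge0 ?exprn_ge0 ?(ltW s2) ?Pc//.
  by apply: ler_pM; rewrite ?exprn_ge0 ?(ltW s2)// lerXn2r ?nnegrE//; lra.
apply: le_trans (_ : P 0 0 x * 1 <= _).
  rewrite ler_wpM2l ?(ltW a0)// mulr_ile1 ?exprn_ge0 ?exprn_ile1//; lra.
by rewrite mulr1; apply: le_trans (ler_norm _) (PT 0 0 Ux).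
Qed.

Let rho_bounds x : U x -> c / (2 * T) <= rho x <= T.
Proof.
move=> Ux; have /andP[q0 q1] := q_bounds Ux; have a0 := lt_le_trans c0 (Pc Ux).
have s2 : 0 < (2 * sl)^-1 by rewrite invr_gt0 mulr_gt0.
have aT : P 0 0 x <= T by apply: le_trans (ler_norm _) (PT 0 0 Ux).
have dT : P 1 1 x <= T by apply: le_trans (ler_norm _) (PT 1 1 Ux).
have qq : 0 <= q x * (1 - q x) <= 4^-1.
  have q00 : 0 <= q x by lra.
  have q11 : 0 <= 1 - q x by lra.
  rewrite mulr_ge0//=; have := sqr_ge0 (q x - 2^-1); lra.
have sn : 0 <= 4 * sl ^+ 2 / n%:R by exact: divr_ge0 (mulr_ge0 (ler0n _ 4) (sqr_ge0 sl)) (ltW n0).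
case/andP: qq => qq0 qq1.
have v0 : 0 <= 4 * sl ^+ 2 / n%:R * (P 0 0 x * (q x * (1 - q x))) by rewrite mulr_ge0// mulr_ge0// ltW.
have v1 : 4 * sl ^+ 2 / n%:R * (P 0 0 x * (q x * (1 - q x))) <= c / (2 * T).
  apply: le_trans (_ : 4 * sl ^+ 2 / n%:R * (T * 4^-1) <= _).
    by rewrite ler_wpM2l// ler_pM ?(ltW a0).
  have h0 : 0 <= 2 * T ^+ 2 * sl ^+ 2 / c by exact: divr_ge0 (mulr_ge0 (mulr_ge0 (ler0n _ 2) (sqr_ge0 T)) (sqr_ge0 sl)) (ltW c0).
  have nb : 2 * T ^+ 2 * sl ^+ 2 / c <= n%:R.
    by apply: ltW; apply: lt_le_trans (archi_boundP h0) _; rewrite ler_nat.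
  rewrite (_ : _ * (T * 4^-1) = (T * sl ^+ 2) / n%:R); last by field; rewrite gt_eqF.
  rewrite ler_pdivrMr// -[leRHS]mulrAC ler_pdivlMr ?mulr_gt0//.
  move: nb; rewrite ler_pdivrMr// [n%:R * c]mulrC; apply: le_trans; rewrite [leRHS](_ : _ = T * sl ^+ 2 * (2 * T)) //; ring.
have w0 : c / T <= P 1 1 x - P 0 1 x * P 0 1 x * (P 0 0 x)^-1.
  have -> : P 1 1 x - P 0 1 x * P 0 1 x * (P 0 0 x)^-1 = (P 0 0 x * P 1 1 x - P 0 1 x ^+ 2) / P 0 0 x.
    by field; rewrite gt_eqF.
  by apply: ler_pM; rewrite ?invr_ge0 ?(ltW c0) ?(ltW T0)// ?Pdet// lef_pV2 ?posrE.
have w1 : 0 <= P 0 1 x * P 0 1 x * (P 0 0 x)^-1 by rewrite mulr_ge0 ?invr_ge0 ?(ltW a0)// -expr2 sqr_ge0.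
have e2 : c / T = c / (2 * T) + c / (2 * T) by field; rewrite gt_eqF.
by rewrite /rho; apply/andP; split; lra.
Qed.

Let uq : ucn m.+1 q.
Proof.
have ui := ucn_inv c0 Pc (uP 0 0).
apply: ucn_ext (ucnZ (2 * sl)^-1 (ucnD (ucnM (ucn_pred (uP 0 1)) ui) (ucn_cst m.+1 sl))) => x _.
by rewrite mulrC.
Qed.

Let uth p : ucn m.+1 (th p).
Proof. exact: (ucnM (ucn_pred (uP 0 0)) (ucnM (ucnX _ uq) (ucnX _ (ucnB (ucn_cst m.+1 1) uq)))). Qed.

Let urho : ucn m.+1 rho.
Proof.
have ui := ucn_inv c0 Pc (uP 0 0); have u1 := ucn_pred (uP 0 1).
exact: (ucnB (ucnB (ucn_pred (uP 1 1)) (ucnM (ucnM u1 u1) ui))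
  (ucnZ _ (ucnM (ucn_pred (uP 0 0)) (ucnM uq (ucnB (ucn_cst m.+1 1) uq))))).
Qed.

Lemma sqrt2_bound (z : R) : 0 <= z <= T -> `|Num.sqrt (2 * z)| <= T + 1.
Proof.
move=> /andP[z0 zT]; rewrite ger0_norm ?sqrtr_ge0// -(@ler_sqr _ _ (T + 1)) ?nnegrE ?sqrtr_ge0//; last by lra.
rewrite sqr_sqrtr ?mulr_ge0//; have := sqr_ge0 T; rewrite sqrrD; lra.
Qed.

Lemma slope_steps_valid : valid_steps slope_dirs m (T + 1) slope_steps.
Proof.
have cT : 0 < c / (2 * T) by rewrite divr_gt0// mulr_gt0.
have cs : 0 < c * (2 * sl)^-1 ^+ n by rewrite mulr_gt0// exprn_gt0// invr_gt0 mulr_gt0.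
rewrite /slope_steps /=; split.
- exact: mem_head.
- apply: (ucn_sqrt cT) (ucnZ 2 urho) => x Ux; have /andP[] := rho_bounds Ux; lra.
- by move=> x Ux; apply: sqrt2_bound; have /andP[a ->] := rho_bounds Ux; rewrite (le_trans (ltW cT)).
apply: valid_map => p pn; split.
- by rewrite inE; apply/orP; right; apply/mapP; exists p.
- apply: (ucn_sqrt cs) (ucnZ 2 (uth p)) => x Ux; have /andP[] := th_bounds pn Ux; lra.
- by move=> x Ux; apply: sqrt2_bound; have /andP[a ->] := th_bounds pn Ux; rewrite (le_trans (ltW cs)).
Qed.

Lemma slope_steps_sum i j x : U x -> primitive_sum slope_steps i j x = P i j x.
Proof.
move=> Ux; have a0 := lt_le_trans c0 (Pc Ux).
have cT : 0 < c / (2 * T) by rewrite divr_gt0// mulr_gt0.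
have cs : 0 < c * (2 * sl)^-1 ^+ n by rewrite mulr_gt0// exprn_gt0// invr_gt0 mulr_gt0.
have hs (z : R) : 0 <= z -> 2^-1 * (Num.sqrt (2 * z) * Num.sqrt (2 * z)) = z.
  by move=> z0; rewrite -expr2 sqr_sqrtr ?mulr_ge0// mulrA mulVf ?mul1r.
have r0 : 0 <= rho x by have /andP[a _] := rho_bounds Ux; apply: le_trans a; exact: ltW.
have sum : primitive_sum slope_steps i j x = rho x * ((delta_mx 0 1 : E) 0 i * (delta_mx 0 1 : E) 0 j)
   + P 0 0 x * expect n (q x) (fun k => slope_dir k 0 i * slope_dir k 0 j).
  rewrite /primitive_sum /slope_steps big_cons big_map (hs _ r0); congr (_ + _).
  rewrite /expect mulr_sumr !big_seq; apply: eq_bigr => p pn /=.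
  rewrite hs; last by have /andP[a _] := th_bounds pn Ux; apply: le_trans a; exact: ltW.
  by rewrite /th !mulrA.
have aq : P 0 0 x * q x = (P 0 1 x + sl * P 0 0 x) * (2 * sl)^-1.
  by rewrite /q; field; rewrite !gt_eqF.
have ex al be ga F : (forall k, F k = al + be * k%:R + ga * k%:R ^+ 2) -> expect n (q x) F =
  al + be * (n%:R * q x) + ga * (n%:R * q x * (1 - q x) + n%:R ^+ 2 * q x ^+ 2).
  by move=> hF; rewrite -expect_quadratic; apply: eq_bigr => p _; rewrite hF.
have e01 : P 0 0 x * (- sl + 2 * sl * q x) = P 0 1 x.
  rewrite /q; field; rewrite !gt_eqF//.
have d0 k : slope_dir k 0 0 = 1 by have [] := slope_dirE k.
have d1 k : slope_dir k 0 1 = - sl + 2 * sl * k%:R / n%:R by have [] := slope_dirE k.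
rewrite sum; case: (ord2_case i) => ->; case: (ord2_case j) => ->; rewrite !mxE /= ?mulr0 ?mul0r ?mulr1 ?add0r.
- rewrite (ex 1 0 0); last by move=> k; rewrite d0; ring.
  by ring.
- rewrite (ex (- sl) (2 * sl / n%:R) 0); last by move=> k; rewrite d0 d1; ring.
  rewrite -e01; field; rewrite gt_eqF//.
- rewrite (Ps Ux) (ex (- sl) (2 * sl / n%:R) 0); last by move=> k; rewrite d0 d1; ring.
  rewrite -e01; field; rewrite gt_eqF//.
- rewrite (ex (sl ^+ 2) (- 4 * sl ^+ 2 / n%:R) (4 * sl ^+ 2 / n%:R ^+ 2)); last first.
    by move=> k; rewrite d1; field; rewrite gt_eqF.
  rewrite /rho; have -> : P 0 1 x * P 0 1 x * (P 0 0 x)^-1 = P 0 0 x * (- sl + 2 * sl * q x) ^+ 2.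
    by rewrite -{1 2}e01; field; rewrite gt_eqF.
  by field; rewrite gt_eqF.
Qed.

End Slopes.
End Decomposition.

(** * Smooth approximation and the initial map *)

Section Approximation.
Variable R : realType.
Local Notation E := 'rV[R]_2.
Local Notation U := (@open_disk R).
Implicit Types (x : E) (i j : 'I_2) (u v : 'I_3 -> E -> R) (f : E -> R).

Lemma smooth_close f e : uc f -> 0 < e -> exists2 l0, 0 < l0 <= 1 & forall l, 0 < l < l0 ->
  forall x, U x -> `|smooth l f x - f x| <= e.
Proof.
move=> uf e0; have [d d0 hd] := uf e e0.
exists (Num.min 1 (d / 12)); first by rewrite lt_min ltr01 divr_gt0//= ge_min lexx.
move=> l /andP[l0]; rewrite lt_min => /andP[l1 ld] x Ux.
have hl : 0 < l < 1 by rewrite l0.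
have uc_c : uc (fun _ : E => - f x) := ucn_uc (ucn_cst 0 (- f x)).
rewrite -[- f x](smooth_cst (- f x) hl Ux) -(smoothD hl uf uc_c Ux).
apply: (smooth_bound hl (ucD uf uc_c) Ux) => y Uy yx; apply/ltW/hd => //; lra.
Qed.

Lemma sm_close m f e : ucn 0 f -> 0 < e -> exists2 l0, 0 < l0 <= 1 & forall l, 0 < l < l0 ->
  forall x, U x -> `|sm m l f x - f x| <= e.
Proof.
move=> uf; elim: m e => [|m IH] e e0.
  by exists 1; rewrite ?ltr01 ?lexx// => l _ x _; rewrite subrr normr0 ltW.
have e2 : 0 < e / 2 by rewrite divr_gt0.
have [l0 /andP[l00 l01] h0] := IH _ e2; have [l1 /andP[l10 l11] h1] := smooth_close (ucn_uc uf) e2.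
exists (Num.min l0 l1); first by rewrite lt_min l00 l10 ge_min l01.
move=> l /andP[lp]; rewrite lt_min => /andP[a0 a1] x Ux.
have hl : 0 < l < 1 by rewrite lp (lt_le_trans a0).
have us := ucn_sm m hl uf.
have lp0 : 0 < l < l0 by rewrite lp.
have lp1 : 0 < l < l1 by rewrite lp.
have -> : sm m.+1 l f x - f x = smooth l (fun y => sm m l f y - f y) x + (smooth l f x - f x).
  rewrite -[X in _ = smooth l X x + _]/(fun y => sm m l f y + - f y).
  rewrite (smoothD hl (ucn_uc us) (ucn_uc (ucnN uf)) Ux).
  have -> : smooth l (fun y => - f y) x = - smooth l f x.
    rewrite -mulN1r -(smoothZ (-1) hl (ucn_uc uf) Ux); apply: eq_smooth => //.
    - exact: ucn_uc (ucnN uf).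
    - exact: ucn_uc (ucnZ (-1) uf).
    - by move=> y _; rewrite mulN1r.
  by rewrite addrA subrK.
apply: le_trans (ler_normD _ _) _; rewrite [e]splitr; apply: lerD; last exact: h1.
by apply: (smooth_bound hl (ucn_uc (ucnB us uf)) Ux) => y Uy _; exact: h0.
Qed.

Lemma pd_sm_close m f i e : ucn 1 f -> 0 < e -> exists2 l0, 0 < l0 <= 1 & forall l, 0 < l < l0 ->
  forall x, U x -> `|pd i (sm m l f) x - pd i f x| <= e.
Proof.
move=> uf e0; have up := ucn_pd i uf; have [M hM] := ucn_bnd up.
have e2 : 0 < e / 2 by rewrite divr_gt0.
have [l0 /andP[l00 l01] h0] := sm_close m up e2.
pose B := (2 * m)%:R * (`|M| + 1) + 1; have B0 : 0 < B by rewrite /B ltr_wpDl// mulr_ge0// addr_ge0.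
exists (Num.min l0 (e / 2 / B)); first by rewrite lt_min l00 divr_gt0//= ge_min l01.
move=> l /andP[lp]; rewrite lt_min => /andP[a0 a1] x Ux.
have hl : 0 < l < 1 by rewrite lp (lt_le_trans a0).
have lp0 : 0 < l < l0 by rewrite lp.
rewrite (pd_sm m i hl uf Ux).
have bern k : 1 - k%:R * l <= (1 - l) ^+ k <= 1.
  have /andP[l0' l1'] := hl.
  elim: k => [|k /andP[IH1 IH2]]; first by rewrite mul0r subr0 expr0 lexx.
  have p1 : 0 <= 1 - l by lra.
  rewrite exprS; apply/andP; split; last by rewrite mulr_ile1 ?exprn_ge0//; lra.
  have := ler_wpM2l p1 IH1; have m0 : 0 <= k%:R * l * l by rewrite !mulr_ge0 ?(ltW l0').
  rewrite -natr1; lra.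
have /andP[b1 b2] := bern (2 * m)%N; set a := (1 - l) ^+ (2 * m) in b1 b2 *.
have a0' : 0 <= a by rewrite exprn_ge0//; case/andP: hl => *; lra.
have -> : a * sm m l (pd i f) x - pd i f x = a * (sm m l (pd i f) x - pd i f x) - (1 - a) * pd i f x.
  by move: (sm m l (pd i f) x) (pd i f x) => *; ring.
apply: le_trans (ler_normB _ _) _; rewrite !normrM (ger0_norm a0') [`|1 - a|]ger0_norm ?subr_ge0// [leRHS]splitr.
apply: lerD; first by apply: le_trans (ler_piMl _ b2) _ => //; exact: h0.
have fx : `|pd i f x| <= `|M| + 1 by apply: le_trans (hM x Ux) _; have := ler_norm M; lra.
apply: le_trans (_ : (2 * m)%:R * l * (`|M| + 1) <= _).
  by apply: ler_pM => //; rewrite ?subr_ge0//; lra.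
move: a1; rewrite ltr_pdivlMr// => h; apply: le_trans (ltW h).
by rewrite mulrAC [leLHS]mulrC ler_wpM2l ?(ltW lp)// /B lerDl.
Qed.

Lemma vd_close (p q p' q' : 'I_3 -> R) (B e : R) : 0 <= e <= 1 -> (forall l, `|p l| <= B) -> (forall l, `|q l| <= B) ->
  (forall l, `|p' l - p l| <= e) -> (forall l, `|q' l - q l| <= e) -> `|vd p' q' - vd p q| <= 3 * (2 * B + 1) * e.
Proof.
move=> /andP[e0 e1] hp hq hp' hq'.
have B0 : 0 <= B by apply: le_trans (hp 0).
have one l : `|p' l * q' l - p l * q l| <= (2 * B + 1) * e.
  have -> : p' l * q' l - p l * q l = (p' l - p l) * (q' l - q l) + (p' l - p l) * q l + p l * (q' l - q l) by ring.
  apply: le_trans (ler_normD _ _) _; apply: le_trans (lerD (ler_normD _ _) (lexx _)) _; rewrite !normrM.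
  have a := ler_pM (normr_ge0 _) (normr_ge0 _) (hp' l) (hq' l).
  have b := ler_pM (normr_ge0 _) (normr_ge0 _) (hp' l) (hq l).
  have c := ler_pM (normr_ge0 _) (normr_ge0 _) (hp l) (hq' l).
  have ee : e * e <= e by rewrite ler_piMr.
  lra.
have -> : vd p' q' - vd p q = (p' 0 * q' 0 - p 0 * q 0) + (p' 1 * q' 1 - p 1 * q 1) + (p' 2 * q' 2 - p 2 * q 2).
  by rewrite /vd; ring.
apply: le_trans (ler_normD _ _) _; apply: le_trans (lerD (ler_normD _ _) (lexx _)) _.
have := one 0; have := one 1; have := one 2; lra.
Qed.

Lemma all_small (I : finType) (Q : I -> R -> Prop) :
  (forall k, exists2 l0 : R, 0 < l0 <= 1 & forall l, 0 < l < l0 -> Q k l) ->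
  exists2 l0 : R, 0 < l0 <= 1 & forall l, 0 < l < l0 -> forall k, Q k l.
Proof.
move=> h; have /choice[F hF] (k : I) : exists l0 : R, 0 < l0 <= 1 /\ forall l, 0 < l < l0 -> Q k l.
  by have [a b c] := h k; exists a.
exists (\big[Num.min/1]_k F k).
  apply/andP; split; last by elim/big_rec: _ => // k x _ h1; rewrite ge_min h1 orbT.
  by elim/big_rec: _ => // k x _ x0; rewrite lt_min x0 andbT; have [/andP[]] := hF k.
move=> l /andP[l0 l1] k; apply: (hF k).2; rewrite l0 /=; apply: lt_le_trans l1 _.
by rewrite (bigD1 k)//= ge_min lexx.
Qed.

Lemma ucn_sm_gain n m f l : 0 < l < 1 -> ucn n f -> ucn (m + n) (sm m l f).
Proof. by move=> hl uf; elim: m => [//|m IH]; rewrite addSn; exact: ucn_smooth_gain. Qed.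

Lemma ucn_gram n u : (forall l, ucn n.+1 (u l)) -> forall i j, ucn n (gram u i j).
Proof.
by move=> uu i j; apply: ucnD; [apply: ucnD|]; apply: ucnM; exact: ucn_pd (uu _).
Qed.

End Approximation.

Lemma size_slope_steps (R : realType) (c T : R) P : size (slope_steps c T P) = size (slope_dirs c T).
Proof. by rewrite /= !size_map. Qed.

Lemma vd_ge0 (R : realType) (p : 'I_3 -> R) : 0 <= vd p p.
Proof. by rewrite /vd -!expr2 !addr_ge0 ?sqr_ge0. Qed.

Lemma all_bounded (R : realType) (I : finType) (h : I -> 'rV[R]_2 -> R) : (forall k, bounded_on_disk (h k)) ->
  exists2 B, 0 <= B & forall k x, @open_disk R x -> `|h k x| <= B.
Proof.
move=> /choice[F hF]; exists (\sum_k `|F k|); first exact: sumr_ge0.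
move=> k x Ux; apply: le_trans (hF k x Ux) _; rewrite (bigD1 k)//=.
by apply: le_trans (ler_norm _) _; rewrite lerDl; exact: sumr_ge0.
Qed.

Local Notation U := (@open_disk _).

(** After mollification of [g] and [ub], what is missing up to [sg^2 Id] is still uniformly positive
    definite and gets decomposed. The order of the quantifiers matters: [sg] is fixed before [tol],
    so the deviation can be made small relative to [sg^2]. *)
Theorem initial_approximation (R : realType) (g : 'I_2 -> 'I_2 -> 'rV[R]_2 -> R)
    (ub : 'I_3 -> 'rV[R]_2 -> R) (ga c : R) :
  (forall i j, ucn 2 (g i j)) -> (forall i j, g i j = g j i) -> (forall l, ucn 1 (ub l)) ->
  0 < ga -> 0 < c -> (forall x, U x -> ga <= gdet ub x) ->
  (forall x, U x -> c <= g 0 0 x - gram ub 0 0 x) ->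
  (forall x, U x -> c <= (g 0 0 x - gram ub 0 0 x) * (g 1 1 x - gram ub 1 1 x) - (g 0 1 x - gram ub 0 1 x) ^+ 2) ->
  exists2 s0, 0 < s0 & forall sg, 0 < sg <= s0 -> forall tol eta, 0 < tol -> 0 < eta ->
  exists v : 'I_3 -> 'rV[R]_2 -> R, [/\ forall l, ucn 2 (v l), forall l x, U x -> `|v l x - ub l x| <= eta,
    forall i j x, U x -> `|defect g v i j x - sg ^+ 2 * (i == j)%:R| <= tol
  & unif_injective ub -> unif_injective v].
Proof.
move=> gucn gsym uub ga0 c0 hga hc hdet.
have [Bu Bu0 hBu] := all_bounded (fun z : 'I_2 * 'I_3 => ucn_bnd (ucn_pd z.1 (uub z.2))).
have [Tg Tg0 hTg] := all_bounded (fun z : 'I_2 * 'I_2 => ucn_bnd (gucn z.1 z.2)).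
pose T := 2 * Tg + 3 * (2 * Bu + 1) * Bu + 4.
have BB : 0 <= 3 * (2 * Bu + 1) * Bu by rewrite mulr_ge0// mulr_ge0// addr_ge0// mulr_ge0.
have T0 : 0 < T by rewrite /T; lra.
have BT : 3 * (2 * Bu + 1) * Bu <= T by rewrite /T; lra.
have TgT : 2 * Tg + 4 <= T by rewrite /T; lra.
have gT i j x : U x -> `|gram ub i j x| <= 3 * (2 * Bu + 1) * Bu.
  move=> Ux; have b i' l : `|pd i' (ub l) x| <= Bu := hBu (i', l) x Ux.
  rewrite /gram /vd; apply: le_trans (ler_normD _ _) _; apply: le_trans (lerD (ler_normD _ _) (lexx _)) _.
  rewrite !normrM; have p l := ler_pM (normr_ge0 _) (normr_ge0 _) (b i l) (b j l).
  have B2 : 0 <= Bu * Bu by rewrite mulr_ge0.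
  have := p 0; have := p 1; have := p 2; rewrite /du.
  by move: (`|_| * `|_|) (`|_| * `|_|) (`|_| * `|_|) => *; lra.
pose h i j x := g i j x - gram ub i j x.
have hT i j x : U x -> `|h i j x| <= T - 1.
  move=> Ux; apply: le_trans (ler_normB _ _) _; have := hTg (i, j) x Ux; have := gT i j x Ux; rewrite /T /=; lra.
clearbody T.
(* The deviation of the entries at which [det_close] costs at most half of [ga] and of [c]. *)
pose e2 := Num.min 1 (Num.min (c / 2) (Num.min ga c / 2 / (4 * T + 2))).
have T4 : 0 < 4 * T + 2 by lra.
have m0 : 0 < Num.min ga c by rewrite lt_min ga0.
have e20 : 0 < e2 by rewrite !lt_min ltr01 !divr_gt0.
have e21 : e2 <= 1 by rewrite /e2 ge_min lexx.
have e2c : e2 <= c / 2 by rewrite /e2 !ge_min lexx orbT.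
have e2T : (4 * T + 2) * e2 <= Num.min ga c / 2 by rewrite mulrC -ler_pdivlMr// /e2 !ge_min lexx !orbT.
have [e2ga e2c'] : (4 * T + 2) * e2 <= ga / 2 /\ (4 * T + 2) * e2 <= c / 2.
  by split; apply: le_trans e2T _; rewrite ler_wpM2r ?invr_ge0// ge_min lexx ?orbT.
clearbody e2.
have c20 : 0 < c / 2 by rewrite divr_gt0.
have ga20 : 0 < ga / 2 by rewrite divr_gt0.
have [C [s0 [tau [C1 /andP[s00 s01] tau0 step]]]] := multi_step (slope_dirs (c / 2) T) ga20 T0.
exists (Num.min 1 (e2 / 2)); first by rewrite lt_min ltr01 divr_gt0.
move=> sg /andP[sg0]; rewrite le_min => /andP[sg1 sge] tol eta tol0 eta0.
have sg2 : 0 <= sg ^+ 2 <= e2 / 2.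
  by rewrite sqr_ge0/=; apply: le_trans sge; rewrite expr2 ler_piMr// ltW.
pose K := size (slope_dirs (c / 2) T).
pose tt := Num.min (tol / 2) tau; have tt0 : 0 < tt by rewrite lt_min divr_gt0.
have K0 : 0 <= K%:R * (2 * C) by rewrite mulr_ge0// mulr_ge0//; lra.
(* The first summand makes the amplitude [s = N^(-1/2)] admissible; the second makes the total error
   [N K * 2 C s^4 = 2 C K / N] at most [tt]. *)
pose X := (s0 ^+ 2)^-1 + K%:R * (2 * C) / tt.
have X0 : 0 <= X by rewrite addr_ge0 ?divr_ge0 ?invr_ge0 ?sqr_ge0 ?(ltW tt0).
pose N := (Num.bound X).+1.
have N0 : 0 < N%:R :> R by rewrite ltr0n.
have XN : X <= N%:R by apply: ltW; apply: lt_le_trans (archi_boundP X0) _; rewrite ler_nat.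
pose s : R := Num.sqrt N%:R^-1.
have s2 : s ^+ 2 = N%:R^-1 by rewrite sqr_sqrtr// invr_ge0 ltW.
have sp : 0 < s by rewrite sqrtr_gt0 invr_gt0.
have ss0 : s <= s0.
  rewrite -(@ler_sqr _ s) ?nnegrE ?(ltW sp) ?(ltW s00)// s2 -[leRHS]invrK lef_pV2 ?posrE ?invr_gt0 ?exprn_gt0//.
  by apply: le_trans XN; rewrite lerDl divr_ge0 ?(ltW tt0).
have err : (N * K)%:R * (2 * C * s ^+ 4) <= tt.
  have -> : (N * K)%:R * (2 * C * s ^+ 4) = K%:R * (2 * C) / N%:R.
    rewrite natrM (_ : s ^+ 4 = s ^+ 2 * s ^+ 2); last by rewrite -exprD.
    by rewrite s2; field; rewrite gt_eqF.
  rewrite ler_pdivrMr// [tt * _]mulrC -ler_pdivrMr//; apply: le_trans XN.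
  by rewrite lerDr invr_ge0 sqr_ge0.
(* Three derivatives for each of the [N K] steps, two that the final map must keep, and two that the
   square roots of the decomposition lose. Hence [N] is chosen before the number of smoothings. *)
pose m := (3 * (N * K) + 4)%N.
have Bu1 : 0 < Bu + 1 by lra.
have [kap kap0 hkap] := unif_injective_perturb ga0 Bu1.
have bub1 i l x : U x -> `|pd i (ub l) x| <= Bu + 1 by move=> Ux; have := hBu (i, l) x Ux; rewrite /=; lra.
have [eta1 eta10 heta1] : exists2 eta1, 0 < eta1 & unif_injective ub ->
   forall v, (forall i l x, U x -> derivable (fun y => v l y - ub l y) x (delta_mx 0 i)) ->
    (forall l x, U x -> `|v l x - ub l x| <= eta1) ->
    (forall i l x, U x -> `|pd i (fun y => v l y - ub l y) x| <= kap) -> unif_injective v.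
  have [su|nsu] := pselect (unif_injective ub); last by exists 1.
  by have [eta1 e10 he1] := hkap ub uub bub1 hga su; exists eta1.
pose e1 := Num.min (e2 / 2 / (3 * (2 * Bu + 1) + 1)) (Num.min (tol / 2) (Num.min (eta / 2) (Num.min eta1 kap))).
have B31 : 0 < 3 * (2 * Bu + 1) + 1 by lra.
have e10 : 0 < e1 by rewrite !lt_min !divr_gt0//= eta10.
have e1B : (3 * (2 * Bu + 1) + 1) * e1 <= e2 / 2 by rewrite mulrC -ler_pdivlMr// /e1 ge_min lexx.
have e1tol : e1 <= tol / 2 by rewrite /e1 !ge_min lexx ?orbT.
have e1eta : e1 <= eta / 2 by rewrite /e1 !ge_min lexx ?orbT.
have e1eta1 : e1 <= eta1 by rewrite /e1 !ge_min lexx ?orbT.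
have e1kap : e1 <= kap by rewrite /e1 !ge_min lexx ?orbT.
clearbody e1.
have e1e2 : e1 <= e2 / 2.
  by apply: le_trans e1B; rewrite mulrDl mul1r lerDr mulr_ge0 ?(ltW e10)//; clear - Bu0; lra.
have [l1 /andP[l10 l11] hl1] := all_small (fun z : 'I_2 * 'I_2 => sm_close m (ucn_le (leq0n 2) (gucn z.1 z.2)) e10).
have [l2 /andP[l20 l21] hl2] := all_small (fun z : 'I_3 => sm_close m (ucn_le (leq0n 1) (uub z)) e10).
have [l3 /andP[l30 l31] hl3] := all_small (fun z : 'I_2 * 'I_3 => pd_sm_close m z.1 (uub z.2) e10).
pose l := Num.min l1 (Num.min l2 l3) / 2.
have lm : 0 < Num.min l1 (Num.min l2 l3) by rewrite !lt_min l10 l20.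
have lt k : Num.min l1 (Num.min l2 l3) <= k -> 0 < l < k.
  by move=> hk; rewrite divr_gt0//=; apply: lt_le_trans hk; rewrite /l; clear - lm; lra.
have {}hl1 : forall i j x, U x -> `|sm m l (g i j) x - g i j x| <= e1.
  by move=> i j; apply: (hl1 l _ (i, j)); apply: lt; rewrite ge_min lexx.
have {}hl2 : forall l' x, U x -> `|sm m l (ub l') x - ub l' x| <= e1.
  by apply: (hl2 l); apply: lt; rewrite !ge_min lexx ?orbT.
have {}hl3 : forall i l' x, U x -> `|pd i (sm m l (ub l')) x - pd i (ub l') x| <= e1.
  by move=> i l'; apply: (hl3 l _ (i, l')); apply: lt; rewrite !ge_min lexx ?orbT.
have hl : 0 < l < 1 by apply: lt; rewrite ge_min l11.
pose w l' := sm m l (ub l').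
have uw l' : ucn m.+1 (w l') by have := ucn_sm_gain m hl (uub l'); rewrite addn1.
have e1_1 : 0 <= e1 <= 1 by rewrite (ltW e10)/=; clear - e1e2 e21 e20; lra.
have gw i j x : U x -> `|gram w i j x - gram ub i j x| <= 3 * (2 * Bu + 1) * e1.
  move=> Ux; apply: vd_close => // k; rewrite /du.
  - exact: hBu (i, k) x Ux.
  - exact: hBu (j, k) x Ux.
  - exact: hl3.
  - exact: hl3.
have gw2 i j x : U x -> `|gram w i j x - gram ub i j x| <= e2.
  by move=> Ux; apply: le_trans (gw i j x Ux) _; move: e1B; rewrite mulrDl mul1r; clear - e10 e20; lra.
pose P i j x := sm m l (g i j) x - gram w i j x - sg ^+ 2 * (i == j)%:R.
have Ph i j x : U x -> `|P i j x - h i j x| <= e2.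
  move=> Ux; have a1 := hl1 i j x Ux; have a2 := gw i j x Ux.
  have a3 : `|sg ^+ 2 * (i == j)%:R| <= e2 / 2.
    by case/andP: sg2 => q1 q2; case: (i == j); rewrite ?mulr1 ?mulr0 ?normr0 ?ger0_norm//; clear - q1 q2 e20; lra.
  have -> : P i j x - h i j x = (sm m l (g i j) x - g i j x) - (gram w i j x - gram ub i j x) - sg ^+ 2 * (i == j)%:R.
    by rewrite /P /h; move: (sm m l (g i j) x) (gram w i j x) (gram ub i j x) (g i j x) => *; ring.
  apply: le_trans (ler_normB _ _) _; apply: le_trans (lerD (ler_normB _ _) (lexx _)) _.
  move: e1B a1 a2 a3; rewrite mulrDl mul1r; set X1 := `|_|; set X2 := `|_|; set X3 := `|_|.
  by clear; lra.
have e2_1 : 0 <= e2 <= 1 by rewrite (ltW e20).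
have uP i j : ucn (3 * (N * K) + 2).+2 (P i j).
  have -> : (3 * (N * K) + 2).+2 = m by rewrite /m !addnS !addn0.
  apply: ucnB (ucn_cst m _); apply: ucnB; last exact: ucn_gram.
  by apply: ucn_le (ucn_sm_gain m hl (gucn i j)); exact: leq_addr.
have Ps x : U x -> P 1 0 x = P 0 1 x.
  by move=> Ux; rewrite /P gsym gramC.
have Pc x : U x -> c / 2 <= P 0 0 x.
  by move=> Ux; have := Ph 0 0 x Ux; have := hc x Ux; rewrite /h ler_norml => a /andP[b _]; clear - a b e2c; lra.
have PT i j x : U x -> `|P i j x| <= T.
  move=> Ux; have := Ph i j x Ux; have := hT i j x Ux; rewrite !ler_norml => /andP[a1 a2] /andP[b1 b2].
  by apply/andP; split; clear - a1 a2 b1 b2 e21; lra.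
have hT' i j x : U x -> `|h i j x| <= T by move=> Ux; apply: le_trans (hT i j x Ux) _; clear; lra.
have Pdet x : U x -> c / 2 <= P 0 0 x * P 1 1 x - P 0 1 x ^+ 2.
  move=> Ux; have := det_close e2_1 (hT' 0 0 x Ux) (hT' 0 1 x Ux) (hT' 1 1 x Ux) (Ph 0 0 x Ux) (Ph 0 1 x Ux) (Ph 1 1 x Ux).
  apply: le_trans; have : c <= h 0 0 x * h 1 1 x - h 0 1 x ^+ 2 := hdet x Ux.
  by move: (_ - _ ^+2) e2c' => z; move: (_ * e2) => y; clear; lra.
pose L := repeat_steps N (scale_steps s (slope_steps (c / 2) T P)).
have szL : size L = (N * K)%N by rewrite /L size_repeat size_map size_slope_steps.
have sumL i j x : U x -> primitive_sum L i j x = P i j x.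
  move=> Ux; rewrite /L primitive_sum_repeat primitive_sum_scale (slope_steps_sum c20 T0 Ps Pc PT Pdet i j Ux).
  by rewrite s2 mulrA mulfV ?mul1r// gt_eqF.
have foldE i j x : U x -> foldl (@add_primitive R) (gram w) L i j x = sm m l (g i j) x - sg ^+ 2 * (i == j)%:R.
  move=> Ux; rewrite foldl_add_primitive (sumL i j x Ux) /P.
  by move: (gram w i j x) (sm m l (g i j) x) => *; ring.
have pw : posmx (ga / 2) (gram w).
  move=> x Ux; split; first exact: gramC.
  - exact: vd_ge0.
  - exact: vd_ge0.
  have gT' i j : `|gram ub i j x| <= T := le_trans (gT i j x Ux) BT.
  have := det_close e2_1 (gT' 0 0) (gT' 0 1) (gT' 1 1) (gw2 0 0 x Ux) (gw2 0 1 x Ux) (gw2 1 1 x Ux).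
  apply: le_trans; have : ga <= gram ub 0 0 x * gram ub 1 1 x - gram ub 0 1 x ^+ 2 := hga x Ux.
  by move: (_ - _ ^+ 2) e2ga => z; move: (_ * e2) => y; clear; lra.
have tL : trace_le T (foldl (@add_primitive R) (gram w) L).
  move=> x Ux; rewrite !(foldE _ _ _ Ux) !eqxx !mulr1.
  have a0 := hl1 0 0 x Ux; have a1 := hl1 1 1 x Ux; have b0 := hTg (0, 0) x Ux; have b1 := hTg (1, 1) x Ux.
  move: a0 a1 b0 b1; rewrite /= !ler_norml => /andP[_ a0] /andP[_ a1] /andP[_ b0] /andP[_ b1].
  case/andP: sg2 => q1 q2; case/andP: e1_1 => _ q3; move: a0 a1 b0 b1.
  by move: (sm m l (g 0 0) x) (sm m l (g 1 1) x) (g 0 0 x) (g 1 1 x) (sg ^+ 2) q1 q3 TgT; clear => *; lra.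
have vL : valid_steps (slope_dirs (c / 2) T) (3 * size L + 2) ((T + 1) * s) L.
  rewrite szL; apply: valid_steps_repeat; apply: valid_steps_scale (ltW sp) _.
  exact: (slope_steps_valid c20 T0 uP Pc PT Pdet).
have uwL l' : ucn (3 * size L + 2) (w l').
  by rewrite szL; apply: ucn_le (uw l'); rewrite /m -addnS leq_add2l.
have e0 i j x : U x -> `|gram w i j x - gram w i j x| <= 0 by move=> _; rewrite subrr normr0.
have errL : 0 + (size L)%:R * (2 * C * s ^+ 4) <= tau.
  by rewrite add0r szL; apply: le_trans err _; rewrite ge_min lexx orbT.
have eta2 : 0 < eta / 2 by rewrite divr_gt0.
have sps : 0 < s <= s0 by rewrite sp.
have [v [v1 v2 v3 v4]] := step s sps L (gram w) w 0 pw tL vL uwL e0 errL _ eta2.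
exists v; split=> //.
- move=> l' x Ux; have a := v2 l' x Ux; have b := hl2 l' x Ux.
  rewrite (_ : v l' x - ub l' x = (v l' x - w l' x) + (w l' x - ub l' x)); last by ring.
  apply: le_trans (ler_normD _ _) _; rewrite /w; move: a b e1eta; clear; set X1 := `|_|; set X2 := `|_|; lra.
- move=> i j x Ux; have := v3 i j x Ux; rewrite (foldE i j x Ux) add0r szL => a.
  have a' := le_trans a err; have b := hl1 i j x Ux.
  have t2 : tt <= tol / 2 by rewrite ge_min lexx.
  have -> : defect g v i j x - sg ^+ 2 * (i == j)%:R =
    - (sm m l (g i j) x - g i j x) - (gram v i j x - (sm m l (g i j) x - sg ^+ 2 * (i == j)%:R)).
    by rewrite /defect; move: (sm m l (g i j) x) (gram v i j x) (g i j x) => *; ring.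
  by apply: le_trans (ler_normB _ _) _; rewrite normrN; move: a' b t2 e1tol; clear; set X1 := `|_|; set X2 := `|_|; lra.
- move=> su; apply: v4; apply: (heta1 su).
  + move=> i l' x Ux; apply: (ucn_der (n := 0) _ Ux); apply: ucnB (uub l').
    exact: ucn_le (uw l').
  + by move=> l' x Ux; apply: le_trans (hl2 l' x Ux) e1eta1.
  + move=> i l' x Ux; rewrite pdB.
    * exact: le_trans (hl3 i l' x Ux) e1kap.
    * exact: ucn_der (uw l') Ux.
    * exact: ucn_der (uub l') Ux.
Qed.

(** [M / (5 M + 5)] tends to [1 / 5]; [M >= 2] is what gives [r^2 <= K]. *)
Lemma holder_order (R : realType) (al : R) : al < 1 / 5 -> exists2 M, (2 <= M)%N & al * (5 * M + 5)%:R <= M%:R.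
Proof.
move=> al5; have d0 : 0 < 1 - 5 * al by lra.
have a0 : 0 <= 5 * `|al| / (1 - 5 * al) by rewrite divr_ge0 ?(ltW d0)// mulr_ge0.
exists (Num.bound (5 * `|al| / (1 - 5 * al))).+2 => //.
set M := (Num.bound _).+2; have : 5 * `|al| / (1 - 5 * al) <= M%:R.
  by apply: ltW; apply: lt_le_trans (archi_boundP a0) _; rewrite ler_nat; exact: leqW (leqnSn _).
rewrite ler_pdivrMr// natrD natrM => h; have := ler_norm al; lra.
Qed.

(** The constants are fixed in the order [M], [r], [sg], [tol], [v], [lam]. The invariant bounds the
    second derivatives of [v] and the gradient of its defect only from above, by quantities that
    grow with [lam], so [lam] can be chosen after [v]. *)
Theorem interior_solution (R : realType) (g : 'I_2 -> 'I_2 -> 'rV[R]_2 -> R)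
    (ub : 'I_3 -> 'rV[R]_2 -> R) (ga c al : R) :
  (forall i j, ucn 2 (g i j)) -> (forall i j, g i j = g j i) -> (forall l, ucn 1 (ub l)) ->
  0 < ga -> 0 < c -> (forall x, U x -> ga <= gdet ub x) ->
  (forall x, U x -> ga <= g 0 0 x * g 1 1 x - g 0 1 x ^+ 2) ->
  (forall x, U x -> c <= g 0 0 x - gram ub 0 0 x) ->
  (forall x, U x -> c <= g 1 1 x - gram ub 1 1 x) ->
  (forall x, U x -> c <= (g 0 0 x - gram ub 0 0 x) * (g 1 1 x - gram ub 1 1 x) - (g 0 1 x - gram ub 0 1 x) ^+ 2) ->
  0 < al < 1 / 5 -> forall eta, 0 < eta -> exists u : 'I_3 -> 'rV[R]_2 -> R, [/\
    forall l x, U x -> `|u l x - ub l x| <= eta,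
    forall i l x, U x -> derivable (u l) x (delta_mx 0 i),
    forall i j x, U x -> gram u i j x = g i j x,
    exists H, forall i l x y, U x -> U y -> `|pd i (u l) x - pd i (u l) y| <= H * enorm (x - y) `^ al
  & unif_injective ub -> unif_injective u].
Proof.
move=> gucn gsym uub ga0 c0 hga hg hc hc1 hdet /andP[al0 al5] eta eta0.
have [s0 s00 init] := initial_approximation gucn gsym uub ga0 c0 hga hc hdet.
have [M M2 alM] := holder_order al5.
have [C [r0 [C0 lim]]] := stage_limit gucn gsym ga0 hg (ltW al0) alM.
have [Tg Tg0 hTg] := all_bounded (fun z : 'I_2 * 'I_2 => ucn_bnd (gucn z.1 z.2)).
have T0 : 0 < 2 * Tg + 1 by lra.
have pg : posmx ga g.
  move=> x Ux; have g0 := vd_ge0 (du ub 0 x); have g1 := vd_ge0 (du ub 1 x).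
  have a0 : gram ub 0 0 x <= g 0 0 x by rewrite -subr_ge0 (le_trans (ltW c0) (hc x Ux)).
  have a1 : gram ub 1 1 x <= g 1 1 x by rewrite -subr_ge0 (le_trans (ltW c0) (hc1 x Ux)).
  split; first by rewrite gsym.
  - exact: le_trans g0 a0.
  - exact: le_trans g1 a1.
  - exact: hg.
have tg : trace_le (2 * Tg + 1) g.
  move=> x Ux; have a0 := le_trans (ler_norm _) (hTg (0, 0) x Ux).
  have a1 := le_trans (ler_norm _) (hTg (1, 1) x Ux); move: a0 a1 => /=; lra.
have [tau /andP[tau0 tau1] htau] := posmx_close ga0 T0.
have B0 : 0 < 2 * Tg + 1 + 1 by lra.
have ga2 : 0 < ga / 2 by rewrite divr_gt0.
have [kap kap0 hkap] := unif_injective_perturb ga2 B0.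
pose r := Num.max 2 r0; have r2 : 2 <= r by rewrite le_max lexx.
have rr0 : r0 <= r by rewrite le_max lexx orbT.
clearbody r; have rp : 0 < r by lra.
pose K := r ^+ M; have K0 : 0 < K by rewrite exprn_gt0.
have rK : r ^+ 2 <= K by rewrite /K ler_weXn2l//; lra.
pose h := (K ^+ 2 * r ^+ 2)^-1; have h0 : 0 < h by rewrite invr_gt0 mulr_gt0 ?exprn_gt0.
have C1 : 0 < C + 1 by lra.
(* In order: the range of [initial_approximation], the condition [s K^3 <= 1], the C^1 displacement
   [C sg] of the limit below the injectivity threshold, and closeness of the metric of [v] to
   [g]. *)
pose sg := Num.min 1 (Num.min s0 (Num.min (K ^+ 3)^-1 (Num.min (kap / (C + 1)) (tau / 2)))).
have sg0 : 0 < sg by rewrite !lt_min ltr01 s00 !divr_gt0// invr_gt0 exprn_gt0.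
have sg1 : sg <= 1 by rewrite /sg ge_min lexx.
have sgs : sg <= s0 by rewrite /sg !ge_min lexx ?orbT.
have sgK : sg * K ^+ 3 <= 1 by rewrite -ler_pdivlMr ?exprn_gt0// div1r /sg !ge_min lexx ?orbT.
have sgk : C * sg <= kap.
  apply: (@le_trans _ _ ((C + 1) * sg)); first by rewrite ler_wpM2r ?(ltW sg0)//; lra.
  by rewrite mulrC -ler_pdivlMr// /sg !ge_min lexx ?orbT.
have sgt : sg <= tau / 2 by rewrite /sg !ge_min lexx ?orbT.
clearbody sg.
have sq0 : 0 < sg ^+ 2 by rewrite exprn_gt0.
pose tol := Num.min (sg ^+ 2 / r) (Num.min (sg ^+ 2 * h) (tau / 2)).
have tol0 : 0 < tol by rewrite !lt_min (divr_gt0 sq0 rp) (mulr_gt0 sq0 h0) (divr_gt0 tau0 (ltr0n _ 2)).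
have tolr : tol <= sg ^+ 2 / r by rewrite /tol ge_min lexx.
have tolh : tol <= sg ^+ 2 * h by rewrite /tol !ge_min lexx ?orbT.
have tolt : tol <= tau / 2 by rewrite /tol !ge_min lexx ?orbT.
clearbody tol.
have eta2 : 0 < eta / 2 by rewrite divr_gt0.
have sgs0 : 0 < sg <= s0 by rewrite sg0.
have [v [v1 v2 v3 v4]] := init sg sgs0 tol _ tol0 eta2.
have vg i j x : U x -> `|gram v i j x - g i j x| <= tau.
  move=> Ux; have a := v3 i j x Ux.
  have ss : 0 <= sg ^+ 2 * (i == j)%:R <= tau / 2.
    have s2 : sg ^+ 2 <= tau / 2 by apply: le_trans sgt; rewrite expr2 ler_piMr// ltW.
    by case: (i == j); rewrite ?mulr1 ?mulr0 ?lexx ?(ltW sq0) ?divr_ge0 ?(ltW tau0).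
  rewrite distrC -/(defect g v i j x).
  move: a ss; move: (defect g v i j x) (sg ^+ 2 * _) => d z; rewrite !ler_norml => /andP[a1 a2] /andP[b1 b2].
  by apply/andP; split; clear - a1 a2 b1 b2 tolt; lra.
have [bv dv] := htau v g pg tg vg.
have uv1 l : ucn 1 (v l) := ucn_pred (v1 l).
have [eta1 eta10 heta1] : exists2 eta1, 0 < eta1 & unif_injective v ->
   forall u, (forall i l x, U x -> derivable (fun y => u l y - v l y) x (delta_mx 0 i)) ->
    (forall l x, U x -> `|u l x - v l x| <= eta1) ->
    (forall i l x, U x -> `|pd i (fun y => u l y - v l y) x| <= kap) -> unif_injective u.
  have [su|nsu] := pselect (unif_injective v); last by exists 1.
  by have [eta1 e10 he1] := hkap v uv1 bv dv su; exists eta1.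
have [B2 B20 hB2] := all_bounded (fun z : 'I_2 * 'I_2 * 'I_3 => ucn_bnd (ucn_pd z.1.2 (ucn_pd z.1.1 (v1 z.2)))).
have udef i j : ucn 1 (defect g v i j) := ucnB (ucn_pred (gucn i j)) (ucn_gram v1 i j).
have [B3 B30 hB3] := all_bounded (fun z : 'I_2 * 'I_2 * 'I_2 => ucn_bnd (ucn_pd z.2 (udef z.1.1 z.1.2))).
(* The summands serve the second derivatives of [v], the gradient of its defect together with
   [K^4 <= s^2 lam], the displacement [C / lam] below [eta / 2], and the same below [eta1]. *)
pose lam := B2 / (sg * K) + (B3 + K ^+ 4) / sg ^+ 2 + C / (eta / 2) + C / eta1 + 1.
have n1 : 0 <= B2 / (sg * K) by rewrite divr_ge0// mulr_ge0 ?(ltW sg0) ?(ltW K0).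
have n2 : 0 <= (B3 + K ^+ 4) / sg ^+ 2 by rewrite divr_ge0 ?(ltW sq0)// addr_ge0// exprn_ge0 ?(ltW K0).
have n3 : 0 <= C / (eta / 2) by rewrite divr_ge0 ?(ltW eta2).
have n4 : 0 <= C / eta1 by rewrite divr_ge0 ?(ltW eta10).
have [lam0 lam1 lam2 lam3 lam4] : [/\ 0 < lam, B2 / (sg * K) <= lam, (B3 + K ^+ 4) / sg ^+ 2 <= lam, C / (eta / 2) <= lam & C / eta1 <= lam].
  by rewrite /lam; clear - n1 n2 n3 n4; split; lra.
clearbody lam.
have lB2 : B2 <= sg * (K * lam) by rewrite mulrA mulrC -ler_pdivrMr ?mulr_gt0.
have lB3 : B3 + K ^+ 4 <= sg ^+ 2 * lam by rewrite mulrC -ler_pdivrMr.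
have K40 : 0 <= K ^+ 4 by rewrite exprn_ge0 ?(ltW K0).
have lC x : 0 < x -> C / x <= lam -> C / lam <= x.
  by move=> x0; rewrite !ler_pdivrMr// mulrC.
pose p := Stage sg lam r v.
have ip : stage_inv g M (delta_mx 0 0) (delta_mx 0 1) p.
  split.
  - by split=> //; split=> //; apply: le_trans lB3; rewrite lerDr.
  - exact: v1.
  - move=> i j l x Ux; have b : `|pd j (pd i (v l)) x| <= B2 := hB2 (i, j, l) x Ux.
    have b' := le_trans b lB2; exact: b'.
  - split; first by move=> i j x Ux; have b := le_trans (v3 i j x Ux) tolr; exact: b.
    move=> i j q x Ux; have b : `|pd q (defect g v i j) x| <= B3 := hB3 (i, j, q) x Ux.
    have b' : B3 <= sg ^+ 2 * lam by apply: le_trans lB3; rewrite lerDl.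
    have b'' := le_trans b b'; exact: b''.
  - move=> x Ux; rewrite bilE !mxE /= !mulr0 !mul0r !mulr1 !addr0 ?add0r ?mul1r ?mul0r ?add0r.
    by have := v3 0 1 x Ux; rewrite mulr0 subr0 => a; have b := le_trans a tolh; exact: b.
have [u [u1 u2 u3 u4]] := lim p ip rr0.
exists u; split=> //.
- move=> l x Ux; have a := le_trans (u1 l x Ux) (lC _ eta2 lam3); have b := v2 l x Ux.
  rewrite (_ : u l x - ub l x = (u l x - v l x) + (v l x - ub l x)); last by ring.
  by apply: le_trans (ler_normD _ _) _; rewrite [eta]splitr; exact: lerD.
- by move=> i l x Ux; have [] := u2 i l x Ux.
- move=> su; apply: (heta1 (v4 su)).
  + move=> i l x Ux; apply: derivableB; first by have [] := u2 i l x Ux.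
    exact: ucn_der (v1 l) Ux.
  + by move=> l x Ux; exact: le_trans (u1 l x Ux) (lC _ eta10 lam4).
  + move=> i l x Ux; have [du bu] := u2 i l x Ux; rewrite (pdB du (ucn_der (v1 l) Ux)).
    exact: le_trans bu sgk.
Qed.

(** * From the open to the closed disk *)

Section ClosedDisk.
Variable R : realType.
Local Notation E := 'rV[R]_2.
Local Notation U := (@open_disk R).
Local Notation D := (@disk R).
Implicit Types (x y : E) (f : E -> R).

Lemma open_disk_sub x : U x -> D x. Proof. exact: ltW. Qed.

Lemma diskE x : D x <-> x 0 0 ^+ 2 + x 0 1 ^+ 2 <= 1.
Proof. by rewrite /disk /= enorm_le1 dot2E !expr2. Qed.

Lemma disk_closed : closed D.
Proof.
rewrite (_ : D = (fun x : E => dot x x) @^-1` [set t | t <= 1]); last first.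
  by apply/seteqP; split=> x /=; rewrite /disk /= enorm_le1.
apply: closed_comp; last exact: closed_le.
by move=> x _; exact: continuous_dot.
Qed.

Lemma disk_coord x i : D x -> `|x 0 i| <= 1.
Proof. by move=> Dx; exact: le_trans (enorm_ge_coord x i) Dx. Qed.

Lemma disk_compact : compact D.
Proof.
apply: bounded_closed_compact disk_closed; exists 1; split=> // M M1 x Dx.
rewrite /Num.Def.normr/= mx_normrE bigmax_le//= => [|[i j] _].
  by apply: le_trans (ltW M1).
by rewrite ord1; apply: le_trans (disk_coord j Dx) (ltW M1).
Qed.

Lemma near_dist1 x (e : R) : 0 < e -> \forall y \near x, dist1 y x < e.
Proof.
move=> e0; have e2 : 0 < e / 2 by rewrite divr_gt0.
apply/nbhs_ballP; exists (e / 2) => //= y [_ xy].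
have := xy 0 0; have := xy 0 1; rewrite /ball /= /ball_ /dist1 => h1 h0.
rewrite distrC [`|y 0 1 - _|]distrC; lra.
Qed.

Lemma heine_cantor f : {within D, continuous f} -> forall e, 0 < e -> exists2 d, 0 < d &
  forall x y, D x -> D y -> dist1 x y < d -> `|f x - f y| < e.
Proof.
move=> /subspace_continuousP cf e e0.
have /compact_near_coveringP/near_covering_withinP cov := disk_compact.
have e2 : 0 < e / 2 by rewrite divr_gt0.
have : \forall d \near (0 : R)^'+, D `<=` (fun x => forall y, D y -> dist1 x y < d -> `|f x - f y| < e).
  apply: (cov R (0 : R)^'+ (fun d x => forall y, D y -> dist1 x y < d -> `|f x - f y| < e)) => x Dx.
  have /cvgrPdist_lt/(_ _ e2) := cf x Dx.
  rewrite near_withinE => /nbhs_ballP[r r0 hr].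
  have r2 : 0 < r / 2 by rewrite divr_gt0.
  have hz z : D z -> dist1 z x < r -> `|f x - f z| < e / 2.
    move=> Dz zx; apply: hr => //; split=> // i j; rewrite ord1 /ball /= /ball_ distrC.
    have n0 := normr_ge0 (z 0 0 - x 0 0); have n1 := normr_ge0 (z 0 1 - x 0 1).
    by move: zx; rewrite /dist1; case: (ord2_case j) => ->; lra.
  exists ([set z | dist1 z x < r / 2], [set d | d < r / 2]) => /=.
    split; first exact: near_dist1.
    by exists (r / 2) => //= d; rewrite /ball_ /= sub0r normrN => + d0; rewrite gtr0_norm.
  move=> [z d] /= [zx dr] Dz y Dy zy.
  have yx : dist1 y x < r.
    by apply: le_lt_trans (dist1_triangle y z x) _; rewrite dist1C; lra.
  have zr : dist1 z x < r by apply: lt_trans zx _; rewrite ltr_pdivrMr// ltr_pMr// ltr1n.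
  have a := hz z Dz zr; have b := hz y Dy yx.
  have -> : f z - f y = - (f x - f z) + (f x - f y) by ring.
  by apply: le_lt_trans (ler_normD _ _) _; rewrite normrN [e]splitr ltrD.
move=> [r r0 hr].
exists (r / 2); first by rewrite divr_gt0.
have r20 : 0 < r / 2 by rewrite divr_gt0.
move=> x y Dx Dy xy; apply: (hr (r / 2) _ r20 x Dx y Dy xy).
by rewrite /ball_ /= sub0r normrN gtr0_norm// ltr_pdivrMr// ltr_pMr// ltr1n.
Qed.

Lemma within_ucn0 f : {within D, continuous f} -> ucn 0 f.
Proof.
move=> cf; split=> //.
  move=> e e0; have [d d0 hd] := heine_cantor cf e0; exists d => // x y Ux Uy.
  by apply: hd; exact: open_disk_sub.
have D0 : D !=set0 by exists 0; apply/diskE; rewrite !mxE expr0n /= addr0.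
have [a _ ha] := compact_EVT_max D0 disk_compact cf.
have [b _ hb] := compact_EVT_min D0 disk_compact cf.
exists (`|f a| + `|f b|) => x /open_disk_sub Dx.
have h1 := ha x (mem_set Dx); have h2 := hb x (mem_set Dx).
have := ler_norm (f a); have := ler_norm (- f b); rewrite normrN ler_norml => a1 a2.
have := normr_ge0 (f a); have := normr_ge0 (f b) => a3 a4.
by apply/andP; split; lra.
Qed.

Lemma within_positive f : {within D, continuous f} -> (forall x, D x -> 0 < f x) ->
  exists2 c, 0 < c & forall x, U x -> c <= f x.
Proof.
move=> cf f0; have D0 : D !=set0 by exists 0; apply/diskE; rewrite !mxE expr0n /= addr0.
have [b bD hb] := compact_EVT_min D0 disk_compact cf.
exists (f b); first by apply: f0; exact: set_mem.
by move=> x /open_disk_sub Dx; apply: hb; exact: mem_set.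
Qed.

Lemma within_coord m n (f : E -> 'M[R]_(m, n)) i j :
  {within D, continuous f} -> {within D, continuous (fun x => f x i j)}.
Proof.
move=> /subspace_continuousP cf; apply/subspace_continuousP => x Dx.
exact: (@cvg_comp _ _ _ f (fun M : 'M[R]_(m, n) => M i j) _ _ _ (cf x Dx) (@coord_continuous R m n i j (f x))).
Qed.

Lemma partial_coord m n (f : E -> 'M[R]_(m, n)) i k k' x : U x -> derivable f x (delta_mx 0 i) ->
  derivable (fun y => f y k k') x (delta_mx 0 i) /\ pd i (fun y => f y k k') x = 'D_(delta_mx 0 i) f x k k'.
Proof.
move=> Ux df; split; first by move/derivable_mxP: df; apply.
by rewrite (derive_mx df) mxE.
Qed.

(** Compactness of the closed disk turns continuity of the extended derivatives into uniform
    continuity and boundedness inside. *)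
Lemma Ck_ucn m n k (f : E -> 'M[R]_(m.+1, n.+1)) i j : Ck k f -> ucn k (fun x => f x i j).
Proof.
elim: k f => [|k IH] f [cf h].
  exact: within_ucn0 (@within_coord _ _ f i j cf).
have [u0 b0 _] := within_ucn0 (@within_coord _ _ f i j cf).
split; [exact: u0|exact: b0|split].
  by move=> q x Ux; have [df _] := h q; have [] := @partial_coord _ _ f q i j x Ux (df x Ux).
move=> q; have [df ck] := h q.
apply: ucn_ext (IH _ ck) => x Ux.
by have [_ ->] := @partial_coord _ _ f q i j x Ux (df x Ux); rewrite /partial (mem_set Ux).
Qed.

End ClosedDisk.

(** * Boundary values of uniformly continuous maps *)

Section BoundaryExtension.
Variable R : realType.
Local Notation E := 'rV[R]_2.
Local Notation V := 'rV[R]_3.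
Local Notation U := (@open_disk R).
Local Notation D := (@disk R).
Implicit Types (x y : E) (f : E -> V).

Lemma radial_disk x (t : R) : D x -> 0 <= t < 1 -> U (t *: x).
Proof.
move=> /diskE Dx /andP[t0 t1]; apply/in_disk; rewrite !mxE !exprMn -mulrDr.
have t2 : t ^+ 2 < 1 by rewrite expr_lt1.
have n0 : 0 <= t ^+ 2 by rewrite sqr_ge0.
by apply: le_lt_trans (ler_wpM2l n0 Dx) _; rewrite mulr1.
Qed.

Lemma dist1_radial x y (t : R) : 0 <= t -> dist1 (t *: x) (t *: y) = t * dist1 x y.
Proof. by move=> t0; rewrite /dist1 !mxE -!mulrBr !normrM (ger0_norm t0) mulrDr. Qed.

Lemma dist1_radial_self x (t : R) : D x -> t <= 1 -> dist1 (t *: x) x <= 2 * (1 - t).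
Proof.
move=> Dx t1; rewrite /dist1 !mxE.
have e i : `|t * x 0 i - x 0 i| <= 1 - t.
  rewrite (_ : t * x 0 i - x 0 i = - ((1 - t) * x 0 i)); last by ring.
  rewrite normrN normrM ger0_norm ?subr_ge0// -[leRHS]mulr1 ler_wpM2l ?subr_ge0//.
  exact: disk_coord.
have := e 0; have := e 1; lra.
Qed.

Lemma closure_open_disk x : D x -> closure U x.
Proof.
move=> Dx B /nbhs_ballP[e /= e0 eB].
pose t := 1 - Num.min 1 (e / 4).
have e4 : 0 < Num.min 1 (e / 4) by rewrite lt_min ltr01 divr_gt0.
have m1 : Num.min 1 (e / 4) <= 1 by rewrite ge_min lexx.
have m4 : Num.min 1 (e / 4) <= e / 4 by rewrite ge_min lexx orbT.
have t01 : 0 <= t < 1 by rewrite /t; apply/andP; split; lra.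
have tm : 1 - t <= e / 4 by rewrite /t; lra.
have t1 : t <= 1 by rewrite /t; lra.
clearbody t; exists (t *: x); split; first exact: radial_disk.
have := dist1_radial_self Dx t1; rewrite /dist1 => h.
apply: eB; split=> // i j; rewrite ord1 /ball /= /ball_ distrC.
have n0 := normr_ge0 ((t *: x) 0 0 - x 0 0); have n1 := normr_ge0 ((t *: x) 0 1 - x 0 1).
by move: h; case: (ord2_case j) => ->; lra.
Qed.

(** Written in the shape of [partial], so that [partial i W] is by definition the extension of the
    interior derivative of [W]. *)
Definition boundary_ext f x : V := if x \in U then f x else lim (f y @[y --> within U (nbhs x)]).

Lemma boundary_ext_in f x : U x -> boundary_ext f x = f x.
Proof. by move=> Ux; rewrite /boundary_ext (mem_set Ux). Qed.

(** Uniform continuity makes the image of the filter Cauchy, and the target is complete. *)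
Lemma boundary_cvg f x : (forall l, uc (fun y => f y 0 l)) -> D x -> ~ U x ->
  f y @[y --> within U (nbhs x)] --> boundary_ext f x.
Proof.
move=> uf Dx nU; rewrite /boundary_ext memNset//.
have PF : ProperFilter (within U (nbhs x)) := within_nbhs_proper (closure_open_disk Dx).
have : cauchy (f y @[y --> within U (nbhs x)]).
  apply: cauchy_exP => e e0.
  have [d d0 hd] : exists2 d, 0 < d & forall l y z, U y -> U z -> dist1 y z < d -> `|f y 0 l - f z 0 l| < e.
    have [d0 p0 h0] := uf 0 e e0; have [d1 p1 h1] := uf 1 e e0; have [d2 p2 h2] := uf 2 e e0.
    exists (Num.min d0 (Num.min d1 d2)); first by rewrite !lt_min p0 p1.
    move=> l y z Uy Uz; rewrite !lt_min => /and3P[a0 a1 a2].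
    by case: (ord3_case l) => ->; [exact: h0|exact: h1|exact: h2].
  have d2 : 0 < d / 2 by rewrite divr_gt0.
  have [y0 [Uy0 yx0]] : exists y, U y /\ dist1 y x < d / 2.
    by have [y [Uy yx]] := closure_open_disk Dx (near_dist1 x d2); exists y.
  exists (f y0); apply: (filterS _ (@near_dist1 _ x _ d2)) => z zx Uz.
  split=> // i j; rewrite ord1; apply: hd => //.
  by apply: le_lt_trans (dist1_triangle y0 x z) _; rewrite [dist1 x z]dist1C; lra.
by move/cauchy_cvg.
Qed.

Lemma ext_radial f x e : (forall l, uc (fun y => f y 0 l)) -> D x -> 0 < e -> exists2 t0, 0 <= t0 < 1 &
  forall t, t0 < t < 1 -> forall l, `|f (t *: x) 0 l - boundary_ext f x 0 l| < e.
Proof.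
move=> uf Dx e0.
suff [d d0 hd] : exists2 d, 0 < d & forall y, U y -> dist1 y x < d -> forall l, `|f y 0 l - boundary_ext f x 0 l| < e.
  exists (1 - Num.min 1 (d / 2)).
    have m0 : 0 < Num.min 1 (d / 2) by rewrite lt_min ltr01 divr_gt0.
    have m1 : Num.min 1 (d / 2) <= 1 by rewrite ge_min lexx.
    by apply/andP; split; lra.
  move=> t /andP[t0 t1] l; have m4 : Num.min 1 (d / 2) <= d / 2 by rewrite ge_min lexx orbT.
  have m1 : Num.min 1 (d / 2) <= 1 by rewrite ge_min lexx.
  apply: hd; first by apply: radial_disk => //; apply/andP; split; lra.
  by apply: le_lt_trans (dist1_radial_self Dx (ltW t1)) _; lra.
have [Ux|nU] := pselect (U x).
  rewrite (boundary_ext_in f Ux).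
  have [d0 p0 h0] := uf 0 e e0; have [d1 p1 h1] := uf 1 e e0; have [d2 p2 h2] := uf 2 e e0.
  exists (Num.min d0 (Num.min d1 d2)); first by rewrite !lt_min p0 p1.
  move=> y Uy; rewrite !lt_min => /and3P[a0 a1 a2] l.
  by case: (ord3_case l) => ->; [exact: h0|exact: h1|exact: h2].
have /cvgrPdist_lt/(_ _ e0) := boundary_cvg uf Dx nU.
rewrite near_withinE => /nbhs_ballP[d /= d0 hd]; exists d => // y Uy yx l.
have yb : ball x d y.
  split=> // i j; rewrite ord1 /ball /= /ball_ distrC.
  have n0 := normr_ge0 (y 0 0 - x 0 0); have n1 := normr_ge0 (y 0 1 - x 0 1).
  by move: yx; rewrite /dist1; case: (ord2_case j) => ->; lra.
have := hd y yb Uy; rewrite distrC; apply: le_lt_trans.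
rewrite /Num.Def.normr/= mx_normrE; apply: le_trans; last exact: (le_bigmax _ _ (ord0, l)).
by rewrite !mxE.
Qed.

End BoundaryExtension.

(** * Passage to the boundary along radii *)

Section RadialLimits.
Variable R : realType.
Local Notation E := 'rV[R]_2.
Local Notation V := 'rV[R]_3.
Local Notation U := (@open_disk R).
Local Notation D := (@disk R).
Implicit Types (x y : E) (f h : E -> V).

(** Scaling by these factors sends the closed disk into the open one and does not increase
    distances, so inequalities valid inside pass to the limit at boundary points. *)
Definition inner_radius (n : nat) : R := 1 - n.+1%:R^-1.

Lemma inner_radius_itv n : 0 <= inner_radius n < 1.
Proof.
rewrite /inner_radius subr_ge0 invf_le1 ?ltr0n// ler1n/= ltrBlDr ltrDl invr_gt0 ltr0n //.
Qed.

Lemma inner_radius_large (t0 : R) : t0 < 1 -> \forall n \near \oo, t0 < inner_radius n.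
Proof.
move=> t1; have p : 0 < 1 - t0 by rewrite subr_gt0.
have b0 : 0 <= (1 - t0)^-1 by rewrite invr_ge0 ltW.
exists (Num.bound (1 - t0)^-1) => // n /= hn.
have h : (1 - t0)^-1 < n.+1%:R.
  by apply: lt_le_trans (archi_boundP b0) _; rewrite ler_nat ltnW.
have : n.+1%:R^-1 < 1 - t0 by rewrite -[ltRHS]invrK ltf_pV2 ?posrE ?ltr0n ?invr_gt0.
by rewrite /inner_radius !ltrBrDr addrC.
Qed.

Lemma ext_cvg f x l : (forall l, uc (fun y => f y 0 l)) -> D x ->
  (fun n => f (inner_radius n *: x) 0 l) @ \oo --> boundary_ext f x 0 l.
Proof.
move=> uf Dx; apply/cvgrPdist_le => e e0; have [t0 /andP[_ t1] ht] := ext_radial uf Dx e0.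
apply: filterS (inner_radius_large t1) => n tn; rewrite distrC; apply/ltW/ht; rewrite tn /=.
by have /andP[] := inner_radius_itv n.
Qed.

Lemma within_cvg (G : E -> R) x : {within D, continuous G} -> D x -> (fun n => G (inner_radius n *: x)) @ \oo --> G x.
Proof.
move=> cG Dx; apply/cvgrPdist_le => e e0; have [d d0 hd] := heine_cantor cG e0.
have t1 : 1 - d / 2 < 1 by rewrite ltrBlDr ltrDl divr_gt0.
apply: filterS (inner_radius_large t1) => n tn; have /andP[r0 r1] := inner_radius_itv n.
have Ur : U (inner_radius n *: x) by apply: radial_disk; rewrite ?r0.
rewrite distrC; apply/ltW/hd => //; first exact: open_disk_sub.
by apply: le_lt_trans (dist1_radial_self Dx (ltW r1)) _; lra.
Qed.

Lemma seq_norm_le (a : nat -> R) L c : a @ \oo --> L -> (forall n, `|a n| <= c) -> `|L| <= c.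
Proof.
move=> /cvgrPdist_le aL ac; apply/ler_addgt0Pr => e e0; have [n _ hn] := aL e e0.
have := hn n (leqnn n) => /= h; rewrite (_ : L = (L - a n) + a n); last by rewrite subrK.
by apply: le_trans (ler_normD _ _) _; rewrite addrC lerD.
Qed.

Lemma dot3E (u v : V) : dot u v = vd (u 0) (v 0).
Proof.
rewrite /dot !big_ord_recl big_ord0 addr0 addrA /vd.
by congr (_ + _ * _ + _ * _); congr (_ _ _); apply/val_inj.
Qed.

Lemma cvg_vd (a b : nat -> 'I_3 -> R) (A B : 'I_3 -> R) :
  (forall l, a ^~ l @ \oo --> A l) -> (forall l, b ^~ l @ \oo --> B l) ->
  (fun n => vd (a n) (b n)) @ \oo --> vd A B.
Proof. by move=> ha hb; apply: cvgD; [apply: cvgD|]; apply: cvgM; rewrite ?ha ?hb. Qed.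

(** Both sides are limits along the radius through [x]; this carries the isometry relation to the
    boundary. *)
Lemma ext_dot f h (G : E -> R) x : (forall l, uc (fun y => f y 0 l)) -> (forall l, uc (fun y => h y 0 l)) ->
  {within D, continuous G} -> (forall y, U y -> dot (f y) (h y) = G y) -> D x ->
  dot (boundary_ext f x) (boundary_ext h x) = G x.
Proof.
move=> uf uh cG fh Dx; rewrite dot3E.
have c1 := cvg_vd (fun l => ext_cvg (l:=l) uf Dx) (fun l => ext_cvg (l:=l) uh Dx).
have c2 := within_cvg cG Dx.
apply: (cvg_unique (@norm_hausdorff _ _) c1).
rewrite (_ : (fun n => _) = (fun n => G (inner_radius n *: x))) //; apply/funext => n.
by rewrite -fh ?dot3E//; apply: radial_disk => //; exact: inner_radius_itv.
Qed.

(** The scaled points are no farther apart than the original ones, so the interior modulus of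
    continuity holds along the whole sequence and survives in the limit. *)
Lemma ext_within f : (forall l, uc (fun y => f y 0 l)) -> {within D, continuous (boundary_ext f)}.
Proof.
move=> uf; apply/subspace_continuousP => x Dx; apply/cvgrPdist_le => e e0.
have [d0 p0 h0] := uf 0 e e0; have [d1 p1 h1] := uf 1 e e0; have [d2 p2 h2] := uf 2 e e0.
pose d := Num.min d0 (Num.min d1 d2); have dp : 0 < d by rewrite !lt_min p0 p1.
have hd l y z : U y -> U z -> dist1 y z < d -> `|f y 0 l - f z 0 l| < e.
  move=> Uy Uz; rewrite !lt_min => /and3P[a0 a1 a2].
  by case: (ord3_case l) => ->; [exact: h0|exact: h1|exact: h2].
rewrite near_withinE; apply: filterS (near_dist1 x dp) => y yx Dy.
rewrite /Num.Def.normr/= mx_normrE bigmax_le ?(ltW e0)//= => -[i l] _.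
rewrite ord1 !mxE distrC.
apply: (seq_norm_le (cvgB (ext_cvg (l:=l) uf Dy) (ext_cvg (l:=l) uf Dx))) => n.
have /andP[r0 r1] := inner_radius_itv n; apply/ltW/hd; try by apply: radial_disk; rewrite ?r0.
by rewrite dist1_radial//; apply: le_lt_trans yx; rewrite ler_piMl ?dist1_ge0// ltW.
Qed.

Lemma enorm_radial n x y : enorm (inner_radius n *: x - inner_radius n *: y) <= enorm (x - y).
Proof.
have /andP[r0 r1] := inner_radius_itv n; rewrite -scalerBr /enorm.
have dd (z : E) : 0 <= dot z z by rewrite dot2E -!expr2 addr_ge0 ?sqr_ge0.
rewrite ler_sqrt// (_ : dot (inner_radius n *: (x - y)) _ = inner_radius n ^+ 2 * dot (x - y) (x - y)).
  by rewrite ler_piMl// expr_le1// ltW.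
rewrite !dot2E !mxE; ring.
Qed.

Lemma enorm3_le (v : V) (c : R) : (forall l, `|v 0 l| <= c) -> enorm v <= 2 * c.
Proof.
move=> h; have c0 : 0 <= c by apply: le_trans (h 0).
have c2 : 0 <= 2 * c by rewrite mulr_ge0.
rewrite /enorm dot3E -[leRHS]ger0_norm// -sqrtr_sqr ler_sqrt ?sqr_ge0//.
apply: le_trans (vd_bound c0 h) _; rewrite exprMn ler_wpM2r ?sqr_ge0//.
by rewrite -natrX ler_nat.
Qed.

Lemma ext_holder f (H al : R) : 0 <= al -> (forall l, uc (fun y => f y 0 l)) ->
  (forall l x y, U x -> U y -> `|f x 0 l - f y 0 l| <= H * enorm (x - y) `^ al) ->
  forall x y, D x -> D y -> enorm (boundary_ext f x - boundary_ext f y) <= 2 * `|H| * enorm (x - y) `^ al.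
Proof.
move=> al0 uf hf x y Dx Dy; rewrite -mulrA; apply: enorm3_le => l; rewrite !mxE.
apply: (seq_norm_le (cvgB (ext_cvg (l:=l) uf Dx) (ext_cvg (l:=l) uf Dy))) => n.
have /andP[r0 r1] := inner_radius_itv n.
apply: le_trans (hf l _ _ _ _) _; try by apply: radial_disk; rewrite ?r0.
apply: le_trans (ler_wpM2r (powR_ge0 _ _) (ler_norm H)) _; apply: ler_wpM2l; first exact: normr_ge0.
have en (z : E) : 0 <= enorm z by exact: sqrtr_ge0.
by apply: ge0_ler_powR; rewrite ?nnegrE ?en//; exact: enorm_radial.
Qed.

End RadialLimits.

(** * Injectivity on the closed disk *)

Section Injectivity.
Variable R : realType.
Local Notation E := 'rV[R]_2.
Local Notation V := 'rV[R]_3.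
Local Notation U := (@open_disk R).
Local Notation D := (@disk R).
Implicit Types (x y : E) (f : E -> V).

Lemma dist1_eq0 x y : dist1 x y = 0 -> x = y.
Proof.
move=> h; have := normr_ge0 (x 0 0 - y 0 0); have := normr_ge0 (x 0 1 - y 0 1) => a b.
have [h0 h1] : `|x 0 0 - y 0 0| <= 0 /\ `|x 0 1 - y 0 1| <= 0 by move: h; rewrite /dist1; split; lra.
move: h0 h1; rewrite !normr_le0 !subr_eq0 => /eqP h0 /eqP h1.
by apply/rowP => k; case: (ord2_case k) => ->.
Qed.

Lemma dist1_diff (x y x' y' : E) : `|dist1 x y - dist1 x' y'| <= dist1 x x' + dist1 y y'.
Proof.
have a := dist1_triangle x x' y; have b := dist1_triangle x' y' y.
have c := dist1_triangle x' x y'; have d := dist1_triangle x y y'.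
rewrite (dist1C y' y) in b; rewrite (dist1C x' x) in c.
by rewrite ler_norml; apply/andP; split; lra.
Qed.

Lemma far_pairs_compact (rho : R) : compact ((D `*` D) `&` [set z : E * E | rho <= dist1 z.1 z.2]).
Proof.
apply: compact_closedI; first by apply: compact_setX; exact: disk_compact.
apply: (@closed_comp _ _ (fun z : E * E => dist1 z.1 z.2) [set t | rho <= t]); last exact: closed_ge.
move=> z _; apply/cvgrPdist_le => e e0; have e2 : 0 < e / 2 by rewrite divr_gt0.
exists ([set y | dist1 y z.1 < e / 2], [set y | dist1 y z.2 < e / 2]).
  by split; exact: near_dist1.
move=> [y1 y2] /= [h1 h2]; apply: le_trans (dist1_diff _ _ _ _) _.
by rewrite dist1C [dist1 z.2 _]dist1C; lra.
Qed.

(** The l1 distance of the images attains a positive minimum on the compact set of distant pairs,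
    and some coordinate accounts for a third of it. *)
Lemma unif_injective_compact f : {within D, continuous f} -> set_inj D f ->
  unif_injective (fun l x => f x 0 l).
Proof.
move=> cf inj rho rho0.
pose K := (D `*` D) `&` [set z : E * E | rho <= dist1 z.1 z.2].
pose G (z : E * E) : R := `|f z.1 0 0 - f z.2 0 0| + `|f z.1 0 1 - f z.2 0 1| + `|f z.1 0 2 - f z.2 0 2|.
have cG : {within K, continuous G}.
  apply/subspace_continuousP => z [[D1 D2] _]; apply/cvgrPdist_le => e e0.
  have e6 : 0 < e / 6 by rewrite divr_gt0.
  have hc l := heine_cantor (@within_coord _ _ _ f 0 l cf) e6.
  have [d0 p0 h0] := hc 0; have [d1 p1 h1] := hc 1; have [d2 p2 h2] := hc 2.
  pose d := Num.min d0 (Num.min d1 d2); have dp : 0 < d by rewrite !lt_min p0 p1.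
  have hd l x y : D x -> D y -> dist1 x y < d -> `|f x 0 l - f y 0 l| <= e / 6.
    move=> Dx Dy; rewrite !lt_min => /and3P[a0 a1 a2]; apply: ltW.
    by case: (ord3_case l) => ->; [exact: h0|exact: h1|exact: h2].
  rewrite near_withinE; exists ([set y | dist1 y z.1 < d], [set y | dist1 y z.2 < d]).
    by split; exact: near_dist1.
  move=> [y1 y2] /= [b1 b2] [[Dy1 Dy2] _]; rewrite /= in Dy1 Dy2.
  have one l : `| `|f z.1 0 l - f z.2 0 l| - `|f y1 0 l - f y2 0 l| | <= e / 3.
    apply: le_trans (ler_dist_dist _ _) _.
    rewrite (_ : _ - _ = - (f y1 0 l - f z.1 0 l) + (f y2 0 l - f z.2 0 l)); last by ring.
    apply: le_trans (ler_normD _ _) _; rewrite normrN.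
    by have := hd l _ _ Dy1 D1 b1; have := hd l _ _ Dy2 D2 b2; lra.
  have add3 (u0 u1 u2 w0 w1 w2 : R) : `|u0 - w0| <= e / 3 -> `|u1 - w1| <= e / 3 -> `|u2 - w2| <= e / 3 ->
      `|u0 + u1 + u2 - (w0 + w1 + w2)| <= e.
    rewrite !ler_norml => /andP[l0 l0'] /andP[l1 l1'] /andP[l2 l2'].
    by apply/andP; split; lra.
  exact: add3 (one 0) (one 1) (one 2).
have [K0|nK] := pselect (K !=set0); last first.
  by exists 1 => // x y Ux Uy xy; exfalso; apply: nK; exists (x, y); split; [split; exact: open_disk_sub|].
have [z zK hz] := compact_EVT_min K0 (@far_pairs_compact rho) cG.
have [[D1 D2] zr] := set_mem zK; rewrite /= in zr.
have Gz : 0 < G z.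
  have n0 := normr_ge0 (f z.1 0 0 - f z.2 0 0); have n1 := normr_ge0 (f z.1 0 1 - f z.2 0 1).
  have n2 := normr_ge0 (f z.1 0 2 - f z.2 0 2).
  rewrite lt_neqAle /G !addr_ge0// andbT; apply/eqP => Ge.
  have [g0 [g1 g2]] : `|f z.1 0 0 - f z.2 0 0| <= 0 /\ `|f z.1 0 1 - f z.2 0 1| <= 0 /\ `|f z.1 0 2 - f z.2 0 2| <= 0.
    by split; [|split]; lra.
  have ff : f z.1 = f z.2.
    move: g0 g1 g2; rewrite !normr_le0 !subr_eq0 => /eqP g0 /eqP g1 /eqP g2.
    by apply/rowP => l; case: (ord3_case l) => ->.
  have zz := inj _ _ (mem_set D1) (mem_set D2) ff.
  by move: zr; rewrite zz /dist1 !subrr !normr0 addr0 leNgt rho0.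
exists (G z / 3); first by rewrite divr_gt0.
move=> x y Ux Uy xy; have xyK : K (x, y) by split; [split; exact: open_disk_sub|].
have := hz (x, y) (mem_set xyK); rewrite {2}/G /= => h.
have [c0|c0] := leP (G z / 3) `|f x 0 0 - f y 0 0|; first by exists 0.
have [c1|c1] := leP (G z / 3) `|f x 0 1 - f y 0 1|; first by exists 1.
by exists 2; move: h c0 c1; move: (G z) `|_| `|_| `|_| => *; lra.
Qed.

(** Two distinct points are approached along their radii: the scaled points stay apart, hence so do
    their images, uniformly. *)
Lemma ext_injective f : (forall l, uc (fun y => f y 0 l)) -> unif_injective (fun l x => f x 0 l) ->
  set_inj D (boundary_ext f).
Proof.
move=> uf inj x y /set_mem Dx /set_mem Dy exy.
have [//|xy] := eqVneq x y.
have d0 : 0 < dist1 x y.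
  by rewrite lt_neqAle dist1_ge0 andbT eq_sym; apply: contra_neq xy; exact: dist1_eq0.
have r0 : 0 < dist1 x y / 2 by rewrite divr_gt0.
have [eta eta0 heta] := inj _ r0.
have e3 : 0 < eta / 3 by rewrite divr_gt0.
have [t1 /andP[_ a1] h1] := ext_radial uf Dx e3; have [t2 /andP[_ a2] h2] := ext_radial uf Dy e3.
have half1 : (2^-1 : R) < 1 by rewrite invf_lt1// ltr1n.
(* A factor above 1/2 keeps half of the distance; beyond [t1] and [t2] the images are within
   [eta / 3] of the boundary values. *)
have m1 : Num.max 2^-1 (Num.max t1 t2) < 1 by rewrite !gt_max half1 a1.
have [n _ hn] := inner_radius_large m1.
have := hn n (leqnn n) => /=; rewrite !gt_max => /and3P[b0 b1 b2]; have /andP[rn0 rn1] := inner_radius_itv R n.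
have far : dist1 x y / 2 <= dist1 (inner_radius R n *: x) (inner_radius R n *: y).
  by rewrite dist1_radial// mulrC ler_wpM2r ?(ltW d0)// ltW.
have Ux : U (inner_radius R n *: x) by apply: radial_disk; rewrite ?rn0.
have Uy : U (inner_radius R n *: y) by apply: radial_disk; rewrite ?rn0.
have [l hl] := heta _ _ Ux Uy far.
have c1 := h1 (inner_radius R n); rewrite b1 rn1 in c1; have {}c1 := c1 isT l.
have c2 := h2 (inner_radius R n); rewrite b2 rn1 in c2; have {}c2 := c2 isT l.
exfalso; move: hl c1 c2; rewrite exy; move: (f _ 0 l) (f _ 0 l) (boundary_ext f y 0 l) => p q w.
rewrite !ltr_norml leNgt => + /andP[u1 u2] /andP[v1 v2] => /negP; apply.
by rewrite ltr_norml; apply/andP; split; lra.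
Qed.

End Injectivity.

(** * Positive definite matrices of size two *)

Section QuadraticForms.
Variable R : realType.

Lemma quadratic_form2 (M : 'M[R]_2) (v : 'rV[R]_2) : (v *m M *m v^T) 0 0 =
  v 0 0 ^+ 2 * M 0 0 + v 0 0 * v 0 1 * (M 0 1 + M 1 0) + v 0 1 ^+ 2 * M 1 1.
Proof.
have o1 : lift ord0 ord0 = 1 :> 'I_2 by apply/val_inj.
rewrite mxE !big_ord_recl big_ord0 !mxE !big_ord_recl !big_ord0 !o1.
move: (v ord0 ord0) (v 0 1) (M ord0 ord0) (M ord0 1) (M 1 ord0) (M 1 1) => *; ring.
Qed.

Lemma posdef2 (M : 'M[R]_2) : M 1 0 = M 0 1 -> posdef M ->
  [/\ 0 < M 0 0, 0 < M 1 1 & 0 < M 0 0 * M 1 1 - M 0 1 ^+ 2].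
Proof.
move=> sM pM.
have p0 : 0 < M 0 0.
  have := pM (delta_mx 0 0); rewrite quadratic_form2 !mxE /=.
  rewrite expr1n expr0n /= !mul0r !mulr0 mul0r mul1r !addr0; apply.
  by apply/eqP => /rowP/(_ 0); rewrite !mxE /= => /eqP; rewrite oner_eq0.
have p1 : 0 < M 1 1.
  have := pM (delta_mx 0 1); rewrite quadratic_form2 !mxE /=.
  rewrite expr1n expr0n /= !mul0r mul1r !add0r; apply.
  by apply/eqP => /rowP/(_ 1); rewrite !mxE /= => /eqP; rewrite oner_eq0.
split=> //.
(* The form takes the value [M 0 0] times the determinant at this vector. *)
have := pM (\row_(i < 2) (if i == 0 then - M 0 1 else M 0 0)); rewrite quadratic_form2 !mxE /= sM.
rewrite (_ : _ + _ = M 0 0 * (M 0 0 * M 1 1 - M 0 1 ^+ 2)); last by ring.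
rewrite pmulr_rgt0//; apply; apply/eqP => /rowP/(_ 1); rewrite !mxE /= => /eqP; rewrite gt_eqF//.
Qed.

(** A vector killing [A] is isotropic for its Gram matrix. With the Gram matrix equal to [g], an
    isometric map is an immersion, on the boundary as well. *)
Lemma row_free_gram (A : 'M[R]_(2, 3)) : posdef (A *m A^T) -> row_free A.
Proof.
move=> pA; rewrite -kermx_eq0; apply/rowV0P => v /sub_kermxP vA; apply/eqP; apply: contraT => v0.
by have := pA v v0; rewrite mulmxA vA !mul0mx mxE ltxx.
Qed.

End QuadraticForms.

Local Notation D := (@disk _).

(** * Assembly on the closed disk *)

Section Closure.
Variable R : realType.
Local Notation E := 'rV[R]_2.
Local Notation V := 'rV[R]_3.
Implicit Types (x y : E).

Lemma holder_uc (f : E -> R) (H al : R) : 0 < al ->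
  (forall x y, U x -> U y -> `|f x - f y| <= H * enorm (x - y) `^ al) -> uc f.
Proof.
move=> al0 hf e e0; have H0 : 0 < `|H| + 1 by rewrite ltr_wpDl.
pose z := e / (2 * (`|H| + 1)); have z0 : 0 < z by rewrite divr_gt0// mulr_gt0.
exists (z `^ al^-1); first exact: powR_gt0.
move=> x y Ux Uy xy; apply: le_lt_trans (hf x y Ux Uy) _.
have en : 0 <= enorm (x - y) by exact: sqrtr_ge0.
have p : enorm (x - y) `^ al <= z.
  rewrite -[leRHS](powRr1 (ltW z0)) -(mulVf (lt0r_neq0 al0)) powRrM.
  by apply: ge0_ler_powR; rewrite ?nnegrE ?powR_ge0 ?(ltW al0)//; apply: ltW; apply: le_lt_trans (enorm_dist1 x y) xy.
apply: le_lt_trans (ler_wpM2r (powR_ge0 _ _) (ler_norm H)) _.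
apply: le_lt_trans (ler_wpM2l (normr_ge0 _) p) _.
rewrite /z mulrA ltr_pdivrMr ?mulr_gt0//.
by have := normr_ge0 H; have := mulr_ge0 (normr_ge0 H) (ltW e0); lra.
Qed.

Lemma holder_bounded (f : E -> R) (H al : R) : 0 <= al ->
  (forall x y, U x -> U y -> `|f x - f y| <= H * enorm (x - y) `^ al) -> exists2 B, 0 <= B & forall x, U x -> `|f x| <= B.
Proof.
move=> al0 hf; exists (`|f 0| + `|H| * 4 `^ al); first by rewrite addr_ge0// mulr_ge0// powR_ge0.
have U0 : U (0 : E) by apply/in_disk; rewrite !mxE expr0n /= addr0.
move=> x Ux; rewrite (_ : f x = f 0 + (f x - f 0)); last by rewrite addrC subrK.
apply: le_trans (ler_normD _ _) _; rewrite lerD2l.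
apply: le_trans (hf x 0 Ux U0) _; apply: le_trans (ler_wpM2r (powR_ge0 _ _) (ler_norm H)) _.
apply: ler_wpM2l => //; apply: ge0_ler_powR; rewrite ?nnegrE ?sqrtr_ge0//.
exact: le_trans (enorm_dist1 x 0) (dist1_le4 Ux U0).
Qed.

Lemma bounded_pd_uc (f : E -> R) : (forall i x, U x -> derivable f x (delta_mx 0 i)) ->
  (forall i, exists2 B, 0 <= B & forall x, U x -> `|pd i f x| <= B) -> uc f.
Proof.
move=> df bf; have [B0 p0 h0] := bf 0; have [B1 p1 h1] := bf 1.
apply: (lip_uc (M := B0 + B1)) => x y Ux Uy; apply: disk_lip => // i z Uz.
case: (ord2_case i) => ->; first by apply: le_trans (h0 z Uz) _; rewrite lerDl.
by apply: le_trans (h1 z Uz) _; rewrite lerDr.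
Qed.

Lemma boundary_ext_derivable (u : 'I_3 -> E -> R) i x :
  let f := fun y => \row_(l < 3) u l y in
  (forall l y, U y -> derivable (u l) y (delta_mx 0 i)) -> U x ->
  derivable (boundary_ext f) x (delta_mx 0 i) /\ 'D_(delta_mx 0 i) (boundary_ext f) x = \row_(l < 3) pd i (u l) x.
Proof.
move=> f du Ux.
have ne : {near x, f =1 boundary_ext f}.
  by apply: filterS (near_disk Ux) => y Uy; rewrite boundary_ext_in.
have ce (l : 'I_3) k : (fun y => f y k l) = u l by apply/funext => y; rewrite mxE.
have df : derivable f x (delta_mx 0 i).
  by apply/derivable_mxP => k l; rewrite ce; exact: du.
split; first exact: near_eq_derivable ne df.
rewrite -(near_eq_derive (delta_mx 0 i) ne) (derive_mx df).
by apply/matrixP => k l; rewrite !mxE ce.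
Qed.

Lemma induced_metric_within (ub : E -> V) i j : Ck 1 ub -> {within D, continuous (fun x => induced_metric ub x i j)}.
Proof.
move=> [_ h]; have [_ [ci _]] := h i; have [_ [cj _]] := h j.
have e : (fun x => induced_metric ub x i j) = (fun x => vd (partial i ub x 0) (partial j ub x 0)).
  by apply/funext => x; rewrite mxE dot3E.
rewrite e; apply/subspace_continuousP => x Dx.
have c q l : {within D, continuous (partial q ub)} -> partial q ub y 0 l @[y --> within D (nbhs x)] --> partial q ub x 0 l.
  by move=> cq; have /subspace_continuousP := @within_coord _ _ _ _ 0 l cq; apply.
by rewrite /vd; apply: cvgD; [apply: cvgD|]; apply: cvgM; exact: c.
Qed.

End Closure.

(** One map serves both assertions of the theorem: injectivity is transmitted as an implication
    about the same [u]. *)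
Theorem isometric_approximation (R : realType)
    (g : 'rV[R]_2 -> 'M[R]_2) (ubar : 'rV[R]_2 -> 'rV[R]_3) (delta eps : R) :
  Ck 2 g -> riemannian_metric g ->
  immersion ubar -> short g ubar ->
  0 < delta -> delta < 1 / 5%:R -> 0 < eps ->
  exists u : 'rV[R]_2 -> 'rV[R]_3,
     [/\ C1holder (1 / 5%:R - delta) u, immersion u, isometric g u,
       C0norm (fun x => ubar x - u x) < eps & set_inj D ubar -> set_inj D u].
Proof.
move=> cg rg [cub _] sh d0 d5 eps0.
(* The symmetry of [g] is given on the disk only; this symmetrization agrees with [g] there and is
   symmetric as a family of functions. *)
pose gs i j x := 2^-1 * (g x i j + g x j i).
have gsE i j x : D x -> gs i j x = g x i j.
  move=> Dx; have [gt _] := rg x Dx; rewrite /gs -{2}gt mxE; lra.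
have gucn i j : ucn 2 (gs i j) by apply: ucnZ; apply: ucnD; exact: Ck_ucn.
have gsym i j : gs i j = gs j i by apply/funext => x; rewrite /gs addrC.
pose ub l x := ubar x 0 l.
have uub l : ucn 1 (ub l) by exact: Ck_ucn.
have grE i j x : U x -> gram ub i j x = induced_metric ubar x i j.
  move=> Ux; rewrite mxE dot3E /gram /du; have [_ h] := cub.
  have e q : (fun l => pd q (ub l) x) = partial q ubar x 0.
    apply/funext => l; have [dq _] := h q; have [_ ->] := @partial_coord _ _ _ ubar q 0 l x Ux (dq x Ux).
    by rewrite /partial (mem_set Ux).
  by rewrite !e.
have cgc i j : {within D, continuous (fun x => g x i j)} by apply: within_coord; case: cg.
have cac i j : {within D, continuous (fun x => induced_metric ubar x i j)} := @induced_metric_within R ubar i j cub.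
pose A x := induced_metric ubar x.
have As x : A x 1 0 = A x 0 1.
  by rewrite !mxE /dot; apply: eq_bigr => k _; exact: mulrC.
have gsy x : D x -> g x 1 0 = g x 0 1 by move=> Dx; have [gt _] := rg x Dx; rewrite -{1}gt mxE.
have wD (f h : 'rV[R]_2 -> R) : {within D, continuous f} -> {within D, continuous h} -> {within D, continuous (fun x => f x - h x)}.
  by move=> cf ch; exact: within_continuousB.
have wM (f h : 'rV[R]_2 -> R) : {within D, continuous f} -> {within D, continuous h} -> {within D, continuous (fun x => f x * h x)}.
  move=> /subspace_continuousP cf /subspace_continuousP ch; apply/subspace_continuousP => x Dx.
  by apply: cvgM; [exact: cf|exact: ch].
have wdet (M : 'rV[R]_2 -> 'M[R]_2) : (forall i j, {within D, continuous (fun x => M x i j)}) ->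
    {within D, continuous (fun x => M x 0 0 * M x 1 1 - M x 0 1 ^+ 2)}.
  by move=> cM; apply: (wD _ (fun x => M x 0 1 * M x 0 1)); apply: wM.
have cH i j : {within D, continuous (fun x => (g x - A x) i j)}.
  rewrite (_ : (fun x => _) = (fun x => g x i j - A x i j)); first exact: wD.
  by apply/funext => x; rewrite !mxE.
have pA x : D x -> 0 < A x 0 0 * A x 1 1 - A x 0 1 ^+ 2.
  by move=> Dx; have [p _] := sh x Dx; have [] := posdef2 (As x) p.
have pg x : D x -> 0 < g x 0 0 * g x 1 1 - g x 0 1 ^+ 2.
  by move=> Dx; have [_ p] := rg x Dx; have [] := posdef2 (gsy x Dx) p.
have pH x : D x -> [/\ 0 < (g x - A x) 0 0, 0 < (g x - A x) 1 1 & 0 < (g x - A x) 0 0 * (g x - A x) 1 1 - (g x - A x) 0 1 ^+ 2].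
  move=> Dx; have [_ p] := sh x Dx; apply: posdef2 p.
  have e i j : (g x - A x) i j = g x i j - A x i j by rewrite !mxE.
  by rewrite !e gsy// As.
have [a1 a10 ha1] := within_positive (wdet A cac) pA.
have [a2 a20 ha2] := within_positive (wdet g cgc) pg.
have [c1 c10 hc1] := within_positive (cH 0 0) (fun x Dx => let: And3 a _ _ := pH x Dx in a).
have [c2 c20 hc2] := within_positive (cH 1 1) (fun x Dx => let: And3 _ a _ := pH x Dx in a).
have [c3 c30 hc3] := within_positive (wdet (fun x => g x - A x) cH) (fun x Dx => let: And3 _ _ a := pH x Dx in a).
pose ga := Num.min a1 a2; have ga0 : 0 < ga by rewrite lt_min a10.
pose c := Num.min c1 (Num.min c2 c3); have c0 : 0 < c by rewrite !lt_min c10 c20.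
have hE i j x : U x -> gs i j x - gram ub i j x = (g x - A x) i j.
  by move=> Ux; rewrite (gsE _ _ _ (open_disk_sub Ux)) (grE _ _ _ Ux) !mxE.
have h1 x : U x -> ga <= gdet ub x.
  move=> Ux; rewrite /gdet !(grE _ _ _ Ux); apply: le_trans (ha1 x Ux); by rewrite ge_min lexx.
have h2 x : U x -> ga <= gs 0 0 x * gs 1 1 x - gs 0 1 x ^+ 2.
  move=> Ux; rewrite !(gsE _ _ _ (open_disk_sub Ux)); apply: le_trans (ha2 x Ux); by rewrite ge_min lexx orbT.
have h3 x : U x -> c <= gs 0 0 x - gram ub 0 0 x.
  by move=> Ux; rewrite hE//; apply: le_trans (hc1 x Ux); rewrite ge_min lexx.
have h4 x : U x -> c <= gs 1 1 x - gram ub 1 1 x.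
  by move=> Ux; rewrite hE//; apply: le_trans (hc2 x Ux); rewrite !ge_min lexx orbT.
have h5 x : U x -> c <= (gs 0 0 x - gram ub 0 0 x) * (gs 1 1 x - gram ub 1 1 x) - (gs 0 1 x - gram ub 0 1 x) ^+ 2.
  by move=> Ux; rewrite !hE//; apply: le_trans (hc3 x Ux); rewrite !ge_min lexx !orbT.
set al := 1 / 5%:R - delta.
have al0 : 0 < al by rewrite /al subr_gt0.
have al5 : 0 < al < 1 / 5 by rewrite al0 /al ltrBlDr ltrDl.
(* Passing from coordinates to the Euclidean norm costs a factor 2, and taking the supremum loses
   strictness; [eps / 4] leaves room for both. *)
have eta0 : 0 < eps / 4 by rewrite divr_gt0.
have [u [u1 u2 u3 [H u4] u5]] := interior_solution gucn gsym uub ga0 c0 h1 h2 h3 h4 h5 al5 eta0.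
clearbody al.
pose f y := \row_(l < 3) u l y; pose W := boundary_ext f.
have fE l : (fun y => f y 0 l) = u l by apply/funext => y; rewrite mxE.
have ul l : uc (u l).
  by apply: bounded_pd_uc => i; [exact: u2|exact: holder_bounded (ltW al0) (u4 i l)].
have uf l : uc (fun y => f y 0 l) by rewrite fE.
have dW i x : U x -> derivable W x (delta_mx 0 i) /\ 'D_(delta_mx 0 i) W x = \row_(l < 3) pd i (u l) x.
  exact: boundary_ext_derivable (u2 i).
pose p i y := 'D_(delta_mx 0 i) W y.
(* Holds by conversion, since [boundary_ext] has the form of [partial]. The extension results
   therefore apply to the boundary values of the derivatives. *)
have pW i : partial i W = boundary_ext (p i) by [].
have pE i l y : U y -> p i y 0 l = pd i (u l) y by move=> Uy; rewrite /p (dW i y Uy).2 mxE.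
clearbody p.
have ph i l x y : U x -> U y -> `|p i x 0 l - p i y 0 l| <= H * enorm (x - y) `^ al.
  by move=> Ux Uy; rewrite (pE i l x Ux) (pE i l y Uy); exact: u4.
have up i l : uc (fun y => p i y 0 l) by exact: (@holder_uc R (fun y => p i y 0 l) H al al0 (ph i l)).
have isoW x : D x -> induced_metric W x = g x.
  move=> Dx; apply/matrixP => i j; rewrite mxE !pW.
  apply: (ext_dot (G := fun x => g x i j) (up i) (up j) (cgc i j) _ Dx) => y Uy.
  rewrite dot3E -(gsE i j y (open_disk_sub Uy)) -(u3 i j y Uy) /gram /du.
  by congr (vd _ _); apply/funext => l; exact: pE.
have ckW : Ck 1 W.
  split; first exact: ext_within.
  move=> i; split; first by move=> x /(dW i x)[].
  by split=> //; rewrite pW; exact: ext_within (up i).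
exists W; split.
- split=> //; exists (2 * `|H|) => i x y Dx Dy; rewrite !pW.
  exact: (ext_holder (ltW al0) (up i) (ph i) Dx Dy).
- split=> // x Dx; apply: row_free_gram.
  have -> : (\matrix_(i < 2) partial i W x) *m (\matrix_(i < 2) partial i W x)^T = g x.
    rewrite -(isoW x Dx); apply/matrixP => i j; rewrite !mxE /dot.
    by apply: eq_bigr => k _; rewrite !mxE.
  by have [] := rg x Dx.
- exact: isoW.
- have le x : D x -> enorm (ubar x - W x) <= 2 * (eps / 4).
    move=> Dx; apply: enorm3_le => l; rewrite !mxE.
    have cu : {within D, continuous (fun y => ubar y 0 l)} by apply: within_coord; case: cub.
    apply: (seq_norm_le (cvgB (within_cvg cu Dx) (ext_cvg (l:=l) uf Dx))) => n.
    have Ur : U (inner_radius R n *: x) by apply: radial_disk => //; exact: inner_radius_itv.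
    have := u1 l _ Ur; rewrite distrC -(fE l); exact.
  have D0 : D (0 : 'rV[R]_2) by apply/diskE; rewrite !mxE expr0n /= addr0.
  apply: (@le_lt_trans _ _ (2 * (eps / 4))); last by lra.
  apply: ge_sup; first by exists (enorm (ubar 0 - W 0)), 0.
  by move=> _ [x Dx <-]; exact: le.
- move=> inj; apply: ext_injective uf _.
  have := u5 (unif_injective_compact (proj1 cub) inj).
  by rewrite (_ : (fun l x => f x 0 l) = u)//; apply/funext => l; rewrite fE.
Qed.

Theorem theorem1p2 (R : realType)
    (g : 'rV[R]_2 -> 'M[R]_2) (ubar : 'rV[R]_2 -> 'rV[R]_3) (delta eps : R) :
  Ck 2 g -> riemannian_metric g ->
  immersion ubar -> short g ubar ->
  0 < delta -> delta < 1 / 5%:R -> 0 < eps ->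
  (exists u : 'rV[R]_2 -> 'rV[R]_3,
     [/\ C1holder (1 / 5%:R - delta) u, immersion u, isometric g u
       & C0norm (fun x => ubar x - u x) < eps]) /\
  (embedding ubar ->
   exists u : 'rV[R]_2 -> 'rV[R]_3,
     [/\ C1holder (1 / 5%:R - delta) u, embedding u, isometric g u
       & C0norm (fun x => ubar x - u x) < eps]).
Proof.
move=> cg rg iub sh d0 d5 eps0.
have [u [h1 h2 h3 h4 h5]] := isometric_approximation cg rg iub sh d0 d5 eps0.
by split; [exists u|case=> _ inj; exists u; split=> //; split=> //; exact: h5].
Qed.
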